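(* Let $\theta>0$ and assume that for every $\varepsilon>0$ we have $I_N(T,2T)\ll_\varepsilon T^{1+\varepsilon}$ for all integers $N$ in the range $2\leq N\leq T^{\theta}$; that is, for every $\varepsilon>0$ there is a constant $C_\varepsilon>0$ (for the given $\theta$) such that $I_N(T,2T)\leq C_\varepsilon T^{1+\varepsilon}$ for all $T\geq 2$ and all integers $N$ with $2\leq N\leq T^\theta$. Then the Riemann zeta-function $\zeta(s)$ has no zeros in the half-plane $\Re\, s>\frac12+\frac{2}{\theta}$. In particular, if this assumption ($I_N(T,2T)\ll_\varepsilon T^{1+\varepsilon}$ for $2\leq N\leq T^{\theta}$, for every $\varepsilon>0$) holds for arbitrarily large $\theta$, then the Riemann hypothesis is true.
   Context: For an integer $N\geq 2$ and $s\in\mathbb{C}$ define $$M_N(s):=\sum_{n\leq N}\frac{\mu(n)}{n^{s}}\Big(1-\frac{\log n}{\log N}\Big),$$ where $\mu$ is the Möbius function. For real $T_1\leq T_2$ define the mollified second moment $$I_N(T_1,T_2):=\int_{T_1}^{T_2}|M_N(\tfrac12+it)|^2\,|\zeta(\tfrac12+it)|^2\,dt,$$ where $\zeta$ is the Riemann zeta-function. The Riemann hypothesis is the statement that all non-trivial zeros of $\zeta(s)$ satisfy $\Re\, s=\frac12$. *)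

(* Defs.v *)
From Stdlib Require Import ZArith Reals ClassicalEpsilon.
From Coquelicot Require Import Coquelicot.
From mathcomp Require Import ssreflect ssrbool eqtype ssrnat seq prime.

Open Scope R_scope.

Definition Cexp (z : C) : C :=
  (exp (Re z) * cos (Im z), exp (Re z) * sin (Im z)).

(* [n ^ s] for an integer [n >= 1] and complex [s]; the value at [n = 0] is
   never used. *)
Definition nat_cpow (n : nat) (s : C) : C := Cexp (s * RtoC (ln (INR n)))%C.

Definition moebius (n : nat) : Z :=
  if (0 < n)%N && all (fun p => logn p n == 1%N) (primes n)
  then Z.pow (-1) (Z.of_nat (size (primes n)))
  else 0%Z.

(* Analytic continuation of the Dirichlet series to the complex plane minus 1.
   By the identity theorem such an [f] is unique away from 1, and [f 1] is
   unconstrained. *)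
Definition is_riemann_zeta (f : C -> C) : Prop :=
  (forall s : C, 1 < Re s ->
     @is_series C_AbsRing C_NormedModule
       (fun k : nat => (RtoC 1 / nat_cpow (S k) s)%C) (f s)) /\
  (forall s : C, s <> RtoC 1 -> @ex_derive C_AbsRing C_NormedModule f s).

(* Since [zeta 1] is arbitrary, statements about zeros must exclude the pole
   at 1. *)
Definition zeta : C -> C :=
  epsilon (inhabits (fun _ : C => RtoC 0)) is_riemann_zeta.

Definition mollifier (N : nat) (s : C) : C :=
  @sum_n_m C_AbelianMonoid
    (fun n : nat =>
       (RtoC (IZR (moebius n)) / nat_cpow n s
        * RtoC (1 - ln (INR n) / ln (INR N)))%C)
    1 N.

Definition critical_point (t : R) : C := (1 / 2, t).

Definition mollified_moment (N : nat) (T1 T2 : R) : R :=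
  RInt (fun t : R =>
          (Cmod (mollifier N (critical_point t))) ^ 2
          * (Cmod (zeta (critical_point t))) ^ 2) T1 T2.

Definition moment_bound (theta : R) : Prop :=
  forall eps : R, 0 < eps ->
  exists K : R, 0 < K /\
    forall (T : R) (N : nat), 2 <= T -> (2 <= N)%N ->
      INR N <= Rpower T theta ->
      mollified_moment N T (2 * T) <= K * Rpower T (1 + eps).

Definition trivial_zero (s : C) : Prop :=
  exists n : nat, s = RtoC (- 2 * INR (S n)).

Definition riemann_hypothesis : Prop :=
  forall s : C, s <> RtoC 1 -> zeta s = RtoC 0 -> ~ trivial_zero s ->
    Re s = 1 / 2.

(* Main.v *)
(** Let [F_n(s)] be the sum over [k <= n] of [mu(k) k^-s log(n/k)], so that
    [F_n = log n * M_n].  By AM-GM, [|F_n zeta| <= log n (1 + |M_n zeta|^2)], so the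
    hypothesis bounds the integral of [|F_n zeta|] over [1/2 + i[T, 2T]].
    Multiplying [mu(k) k^(-1/2-it)] by the smooth weight [k^(it)] and summing by
    parts twice bounds [F_n(1/2)] by [T^2] times a harmonic average of the
    [|F_k(1/2 + it)|], [k <= n], for every [t] in [[T, 2T]].  Integrating this
    against [|zeta(1/2 + it)|], whose integral is at least of order [T], and
    choosing [T = n^(1/theta)] gives [F_n(1/2) << n^(2/theta + eps)].  Another double
    summation by parts then turns the Dirichlet series of [1/zeta(1/2 + w)] into a
    series which converges locally uniformly for [Re w > 2/theta], and the
    identity theorem shows that zeta has no zeros there.

    With [theta] arbitrarily large there are no zeros with [Re s > 1/2], and the
    functional equation, derived from that of the theta function, reflects
    nontrivial zeros with [Re s < 1/2] to zeros with [Re s > 1/2]. *)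

Require Import Defs.
From Stdlib Require Import ZArith Reals Lra Lia Classical ClassicalEpsilon.
From Coquelicot Require Import Coquelicot.
From HB Require Import structures.
From mathcomp Require ssreflect ssrfun ssrbool eqtype ssrnat seq div prime bigop fintype binomial.
Open Scope R_scope.

(** The hypothesis controls only the product of the mollifier with zeta, so zeta has to be divided
    out on average. The left side of the transfer inequality is the sum at the real point [1/2],
    which does not depend on [t]; a lower bound for the mean of [|zeta|] therefore suffices, where a
    pointwise one would fail at zeros. The price is the oscillation of [k^(it)]: its second
    derivative in [log k] has size [T^2], and this square is the 2 in [2 / theta]. The logarithmic
    weight vanishes at [k = n], which removes the boundary term containing the unweighted partial
    sum at height [T]. One [T] serves each [n], since all lengths up to [n] are admissible for it.

    Zeta is given by choice from its characterisation, so a continuation to the whole plane has to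
    be constructed: Euler-Maclaurin covers [Re s > -1], and the completed function divided by the
    gamma factor covers the rest. This needs a gamma factor without zeros, which is obtained from
    its Mellin integral and its recursion. *)

Notation cderiv f z d := (@is_derive C_AbsRing C_NormedModule f z d).
Notation holo f z := (@ex_derive C_AbsRing C_NormedModule f z).
Notation CInt := (@RInt C_R_CompleteNormedModule).
Notation is_CInt := (@is_RInt C_R_NormedModule).
Notation pcont f t := (@continuous R_UniformSpace C_UniformSpace f t).
Notation pderiv f t d := (@is_derive R_AbsRing C_R_NormedModule f t d).

(** * Complex differentiation *)

(** Continuity measured by [Cmod]. The uniform structure behind [pcont] is that of a product of two
    real lines; [pcont_eps] and [pcont_eps_inv] translate between the two. *)
Definition ccont (f : C -> C) (z : C) : Prop :=
  forall eps : R, 0 < eps -> exists delta : R, 0 < delta /\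
    forall w : C, Cmod (w - z) < delta -> Cmod (f w - f z) < eps.

Lemma cderiv_eps (f : C -> C) (z d : C) :
  cderiv f z d <->
  forall eps : R, 0 < eps -> exists delta : R, 0 < delta /\
    forall w : C, Cmod (w - z) < delta ->
      Cmod (f w - f z - (w - z) * d)%C <= eps * Cmod (w - z).
Proof.
  split.
  - intros [_ H] eps Heps.
    destruct (H z (fun P H => H) (mkposreal eps Heps)) as [delta Hd].
    exists delta; split; [apply cond_pos|].
    intros w Hw. exact (Hd w Hw).
  - intros H; split; [apply is_linear_scal_l|].
    intros x Hx.
    apply (is_filter_lim_locally_unique (K := C_AbsRing) (V := AbsRing_NormedModule C_AbsRing)) in Hx; subst x.
    intros eps. destruct (H eps (cond_pos eps)) as [delta [Hd H']].
    exists (mkposreal delta Hd). intros w Hw. exact (H' w Hw).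
Qed.

Lemma Cmod_minus_sym (a b : C) : Cmod (a - b) = Cmod (b - a).
Proof. rewrite <- Cmod_opp. f_equal. ring. Qed.

Lemma Cmod_triangle_inv (a b : C) : Cmod a - Cmod b <= Cmod (a - b).
Proof.
  assert (H := Cmod_triangle (a - b) b).
  replace (a - b + b)%C with a in H by ring. lra.
Qed.

Lemma Cmod_minus_triangle (a b c : C) :
  Cmod (a - c) <= Cmod (a - b) + Cmod (b - c).
Proof.
  replace (a - c)%C with ((a - b) + (b - c))%C by ring. apply Cmod_triangle.
Qed.

Lemma Cmod_le_add (x y : R) : Cmod (x, y) <= Rabs x + Rabs y.
Proof.
  replace (x, y) with (RtoC x + Ci * RtoC y)%C
    by (unfold RtoC, Ci, Cplus, Cmult; simpl; f_equal; ring).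
  eapply Rle_trans; [apply Cmod_triangle|].
  rewrite Cmod_mult, Cmod_Ci, !Cmod_R. lra.
Qed.

Lemma im_le_Cmod (c : C) : Rabs (Im c) <= Cmod c.
Proof.
  eapply Rle_trans; [|apply Rmax_Cmod]. apply Rmax_r.
Qed.

Lemma holo_ccont (f : C -> C) (z : C) : holo f z -> ccont f z.
Proof.
  intros [d Hd] eps Heps.
  destruct (proj1 (cderiv_eps f z d) Hd 1 Rlt_0_1) as [delta [Hdelta H]].
  assert (Hd0 := Cmod_ge_0 d).
  assert (0 < eps / (2 + Cmod d)) by (apply Rdiv_lt_0_compat; lra).
  exists (Rmin delta (eps / (2 + Cmod d))). split; [now apply Rmin_pos|].
  intros w Hw.
  assert (H1 := H w (Rlt_le_trans _ _ _ Hw (Rmin_l _ _))).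
  assert (H2 := Rlt_le_trans _ _ _ Hw (Rmin_r _ _)).
  replace (f w - f z)%C with ((f w - f z - (w - z) * d) + (w - z) * d)%C by ring.
  eapply Rle_lt_trans; [apply Cmod_triangle|]. rewrite Cmod_mult.
  assert (H3 : (2 + Cmod d) * Cmod (w - z) < eps).
  { apply Rmult_lt_reg_l with (/ (2 + Cmod d)).
    - apply Rinv_0_lt_compat; lra.
    - rewrite <- Rmult_assoc, Rinv_l by lra. unfold Rdiv in H2. lra. }
  assert (H4 := Cmod_ge_0 (w - z)). nra.
Qed.

Lemma pcont_eps (f : R -> C) (t : R) :
  (forall eps, 0 < eps -> exists delta, 0 < delta /\
     forall u, Rabs (u - t) < delta -> Cmod (f u - f t) < eps) -> pcont f t.
Proof.
  intros H P [eps HP].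
  destruct (H eps (cond_pos eps)) as [delta [Hd Hu]].
  exists (mkposreal delta Hd). intros u Hut. apply HP.
  assert (H1 := Hu u Hut).
  split.
  - change (Rabs (Re (f u) + - Re (f t)) < eps).
    rewrite <- re_opp, <- re_plus. eapply Rle_lt_trans; [apply re_le_Cmod|]. exact H1.
  - change (Rabs (Im (f u) + - Im (f t)) < eps).
    rewrite <- im_opp, <- im_plus. eapply Rle_lt_trans; [apply im_le_Cmod|]. exact H1.
Qed.

Lemma pcont_eps_inv (f : R -> C) (t : R) : pcont f t ->
  (forall eps, 0 < eps -> exists delta, 0 < delta /\
     forall u, Rabs (u - t) < delta -> Cmod (f u - f t) < eps).
Proof.
  intros H eps Heps.
  assert (He : 0 < eps / 2) by lra.
  destruct (H (ball (M := C_UniformSpace) (f t) (mkposreal _ He))) as [delta Hd].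
  { now exists (mkposreal _ He). }
  exists delta; split; [apply cond_pos|]. intros u Hu.
  destruct (Hd u Hu) as [H1 H2].
  change (Rabs (fst (f u) - fst (f t)) < eps / 2) in H1.
  change (Rabs (snd (f u) - snd (f t)) < eps / 2) in H2.
  change (f u - f t)%C with (fst (f u) - fst (f t), snd (f u) - snd (f t)).
  eapply Rle_lt_trans; [apply Cmod_le_add|]. lra.
Qed.

(* Lipschitz paths only, which covers all line segments. *)
Lemma pcont_comp_path (f : C -> C) (g : R -> C) (K t : R) :
  (forall u, Cmod (g u - g t) <= K * Rabs (u - t)) -> ccont f (g t) ->
  pcont (fun u => f (g u)) t.
Proof.
  intros Hg Hf. apply pcont_eps. intros eps Heps.
  destruct (Hf eps Heps) as [delta [Hd H]].
  assert (HK : 0 < Rmax K 1) by (eapply Rlt_le_trans; [apply Rlt_0_1|apply Rmax_r]).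
  exists (delta / Rmax K 1); split; [now apply Rdiv_lt_0_compat|].
  intros u Hu. apply H. eapply Rle_lt_trans; [apply Hg|].
  apply Rle_lt_trans with (Rmax K 1 * Rabs (u - t)).
  - apply Rmult_le_compat_r; [apply Rabs_pos|apply Rmax_l].
  - apply Rmult_lt_reg_l with (/ Rmax K 1); [now apply Rinv_0_lt_compat|].
    rewrite <- Rmult_assoc, Rinv_l by lra. unfold Rdiv in Hu. lra.
Qed.

Lemma Cmod_horizontal (x x' y : R) : Cmod ((x, y) - (x', y)) = Rabs (x - x').
Proof.
  rewrite <- Cmod_R. f_equal. unfold Cminus, Cplus, Copp, RtoC; simpl. f_equal; ring.
Qed.

Lemma Cmod_vertical (x y y' : R) : Cmod ((x, y) - (x, y')) = Rabs (y - y').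
Proof.
  replace ((x, y) - (x, y'))%C with (Ci * RtoC (y - y'))%C.
  - rewrite Cmod_mult, Cmod_Ci, Cmod_R. ring.
  - unfold Ci, Cmult, Cminus, Cplus, Copp, RtoC; simpl. f_equal; ring.
Qed.

Lemma pcont_horizontal (f : C -> C) (x y : R) :
  ccont f (x, y) -> pcont (fun u => f (u, y)) x.
Proof.
  intros H. apply pcont_comp_path with (K := 1) (g := fun u => (u, y)); [|exact H].
  intros u. rewrite Cmod_horizontal. lra.
Qed.

Lemma pcont_vertical (f : C -> C) (x y : R) :
  ccont f (x, y) -> pcont (fun u => f (x, u)) y.
Proof.
  intros H. apply pcont_comp_path with (K := 1) (g := fun u => (x, u)); [|exact H].
  intros u. rewrite Cmod_vertical. lra.
Qed.

Lemma pderiv_eps (f : R -> C) (t : R) (d : C) :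
  pderiv f t d <->
  forall eps : R, 0 < eps -> exists delta : R, 0 < delta /\
    forall u : R, Rabs (u - t) < delta ->
      Cmod (f u - f t - RtoC (u - t) * d)%C <= eps * Rabs (u - t).
Proof.
  split.
  - intros [_ H] eps Heps.
    destruct (H t (fun P H => H) (mkposreal eps Heps)) as [delta Hd].
    exists delta; split; [apply cond_pos|].
    intros u Hu. assert (H1 := Hd u Hu). clear Hd H. simpl in H1.
    rewrite <- scal_R_Cmult, Cmod_norm. exact H1.
  - intros H; split; [apply (is_linear_scal_l (K := R_AbsRing) (V := C_R_NormedModule))|].
    intros x Hx.
    apply (is_filter_lim_locally_unique (K := R_AbsRing) (V := R_NormedModule)) in Hx; subst x.
    intros eps. destruct (H eps (cond_pos eps)) as [delta [Hd H']].
    exists (mkposreal delta Hd). intros u Hu.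
    assert (H1 := H' u Hu). rewrite <- scal_R_Cmult, Cmod_norm in H1. exact H1.
Qed.

(** A chain rule from complex to real differentiation, for affine paths only: these cover the sides
    of rectangles and the rays [u * z]. *)
Lemma pderiv_comp_line (F : C -> C) (g : R -> C) (t : R) (v d : C) :
  (forall u, (g u - g t)%C = (RtoC (u - t) * v)%C) -> cderiv F (g t) d ->
  pderiv (fun u => F (g u)) t (v * d)%C.
Proof.
  intros Hg HF. apply pderiv_eps. intros eps Heps.
  assert (Hv := Cmod_ge_0 v).
  assert (He : 0 < eps / (1 + Cmod v)) by (apply Rdiv_lt_0_compat; lra).
  destruct (proj1 (cderiv_eps F (g t) d) HF _ He) as [delta [Hd H]].
  exists (delta / (1 + Cmod v)); split; [apply Rdiv_lt_0_compat; lra|].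
  intros u Hu.
  assert (Hm : Cmod (g u - g t) = Rabs (u - t) * Cmod v)
    by (rewrite Hg, Cmod_mult, Cmod_R; reflexivity).
  assert (Hu0 := Rabs_pos (u - t)).
  assert (Hu' : Rabs (u - t) * (1 + Cmod v) < delta).
  { apply Rmult_lt_reg_r with (/ (1 + Cmod v)); [apply Rinv_0_lt_compat; lra|].
    rewrite Rmult_assoc, Rinv_r by lra. unfold Rdiv in Hu. lra. }
  assert (H1 := H (g u) ltac:(rewrite Hm; nra)).
  rewrite Hg in H1.
  replace (F (g u) - F (g t) - RtoC (u - t) * (v * d))%C
    with (F (g u) - F (g t) - RtoC (u - t) * v * d)%C by ring.
  eapply Rle_trans; [exact H1|].
  rewrite Cmod_mult, Cmod_R.
  replace (eps / (1 + Cmod v) * (Rabs (u - t) * Cmod v))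
    with (eps * Rabs (u - t) * (Cmod v / (1 + Cmod v))) by (field; lra).
  rewrite <- (Rmult_1_r (eps * Rabs (u - t))) at 2.
  apply Rmult_le_compat_l; [nra|].
  apply Rmult_le_reg_r with (1 + Cmod v); [lra|].
  unfold Rdiv. rewrite Rmult_assoc, Rinv_l by lra. lra.
Qed.

Lemma cderiv_const (c z : C) : cderiv (fun _ => c) z (RtoC 0).
Proof. exact (is_derive_const (K := C_AbsRing) (V := C_NormedModule) c z). Qed.

Lemma cderiv_id (z : C) : cderiv (fun w => w) z (RtoC 1).
Proof.
  apply cderiv_eps. intros eps Heps. exists 1; split; [lra|]. intros w _.
  replace (w - z - (w - z) * 1)%C with (RtoC 0) by ring. rewrite Cmod_0.
  apply Rmult_le_pos; [lra|apply Cmod_ge_0].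
Qed.

Lemma cderiv_plus (f g : C -> C) (z df dg : C) :
  cderiv f z df -> cderiv g z dg ->
  cderiv (fun w => f w + g w)%C z (df + dg)%C.
Proof. exact (is_derive_plus (K := C_AbsRing) (V := C_NormedModule) f g z df dg). Qed.

Lemma cderiv_minus (f g : C -> C) (z df dg : C) :
  cderiv f z df -> cderiv g z dg ->
  cderiv (fun w => f w - g w)%C z (df - dg)%C.
Proof. exact (is_derive_minus (K := C_AbsRing) (V := C_NormedModule) f g z df dg). Qed.

Lemma cderiv_opp (f : C -> C) (z df : C) :
  cderiv f z df -> cderiv (fun w => - f w)%C z (- df)%C.
Proof. exact (is_derive_opp (K := C_AbsRing) (V := C_NormedModule) f z df). Qed.

(** [C] is a normed module over itself in two ways, with the same norm but different uniform
    structures. The product rule, and the chain rule for its inner function, use the structure of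
    the absolute ring; in epsilon form both derivatives coincide. *)
Lemma cderiv_absring (f : C -> C) (z d : C) :
  cderiv f z d <->
  @is_derive C_AbsRing (AbsRing_NormedModule C_AbsRing) f z d.
Proof.
  rewrite cderiv_eps. split.
  - intros H; split; [apply is_linear_scal_l|].
    intros x Hx.
    apply (is_filter_lim_locally_unique (K := C_AbsRing) (V := AbsRing_NormedModule C_AbsRing)) in Hx; subst x.
    intros eps. destruct (H eps (cond_pos eps)) as [delta [Hd H']].
    exists (mkposreal delta Hd). intros w Hw. exact (H' w Hw).
  - intros [_ H] eps Heps.
    destruct (H z (fun P H => H) (mkposreal eps Heps)) as [delta Hd].
    exists delta; split; [apply cond_pos|].
    intros w Hw. exact (Hd w Hw).
Qed.

Lemma cderiv_mult (f g : C -> C) (z df dg : C) :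
  cderiv f z df -> cderiv g z dg ->
  cderiv (fun w => f w * g w)%C z (df * g z + f z * dg)%C.
Proof.
  rewrite !cderiv_absring. intros Hf Hg.
  exact (is_derive_mult (K := C_AbsRing) f g z df dg Hf Hg Cmult_comm).
Qed.

Lemma cderiv_comp (f g : C -> C) (z df dg : C) :
  cderiv f (g z) df -> cderiv g z dg ->
  cderiv (fun w => f (g w)) z (dg * df)%C.
Proof.
  rewrite (cderiv_absring g). intros Hf Hg.
  exact (is_derive_comp (K := C_AbsRing) (V := C_NormedModule) f g z df dg Hf Hg).
Qed.

Lemma cderiv_inv_id (z : C) : z <> 0 -> cderiv (fun w => / w)%C z (- / (z * z))%C.
Proof.
  intros Hz. apply cderiv_eps. intros eps Heps.
  assert (Hm : 0 < Cmod z) by now apply Cmod_gt_0.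
  assert (Hm3 : 0 < Cmod z * Cmod z * Cmod z) by (repeat apply Rmult_lt_0_compat; lra).
  exists (Rmin (Cmod z / 2) (eps * (Cmod z * Cmod z * Cmod z) / 2)). split.
  { apply Rmin_pos; [lra|]. apply Rdiv_lt_0_compat; [nra|lra]. }
  intros w Hw.
  assert (H1 := Rlt_le_trans _ _ _ Hw (Rmin_l _ _)).
  assert (H2 := Rlt_le_trans _ _ _ Hw (Rmin_r _ _)).
  assert (Hwm : Cmod z / 2 < Cmod w).
  { rewrite Cmod_minus_sym in H1. assert (H3 := Cmod_triangle_inv z w). lra. }
  assert (Hw0 : w <> 0) by (apply Cmod_gt_0; lra).
  replace (/ w - / z - (w - z) * - / (z * z))%C
    with ((w - z) * ((w - z) / (w * (z * z))))%C by (field; now split).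
  rewrite Cmod_mult, Cmod_div by now repeat apply Cmult_neq_0.
  rewrite !Cmod_mult, Rmult_comm.
  apply Rmult_le_compat_r; [apply Cmod_ge_0|].
  apply Rmult_le_reg_r with (Cmod w * (Cmod z * Cmod z)); [nra|].
  unfold Rdiv. rewrite Rmult_assoc, Rinv_l, Rmult_1_r by nra.
  apply Rle_trans with (eps * (Cmod z / 2 * (Cmod z * Cmod z))); [lra|].
  apply Rmult_le_compat_l; [lra|]. apply Rmult_le_compat_r; nra.
Qed.

Lemma holo_const (c z : C) : holo (fun _ => c) z.
Proof. eexists; apply cderiv_const. Qed.

Lemma holo_id (z : C) : holo (fun w => w) z.
Proof. eexists; apply cderiv_id. Qed.

Lemma holo_plus (f g : C -> C) (z : C) :
  holo f z -> holo g z -> holo (fun w => f w + g w)%C z.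
Proof. intros [df Hf] [dg Hg]; eexists; now apply cderiv_plus; eauto. Qed.

Lemma holo_minus (f g : C -> C) (z : C) :
  holo f z -> holo g z -> holo (fun w => f w - g w)%C z.
Proof. intros [df Hf] [dg Hg]; eexists; now apply cderiv_minus; eauto. Qed.

Lemma holo_opp (f : C -> C) (z : C) : holo f z -> holo (fun w => - f w)%C z.
Proof. intros [df Hf]; eexists; now apply cderiv_opp; eauto. Qed.

Lemma holo_mult (f g : C -> C) (z : C) :
  holo f z -> holo g z -> holo (fun w => f w * g w)%C z.
Proof. intros [df Hf] [dg Hg]; eexists; now apply cderiv_mult; eauto. Qed.

Lemma holo_comp (f g : C -> C) (z : C) :
  holo f (g z) -> holo g z -> holo (fun w => f (g w)) z.
Proof. intros [df Hf] [dg Hg]; eexists; now apply cderiv_comp; eauto. Qed.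

Lemma holo_inv (f : C -> C) (z : C) :
  f z <> 0 -> holo f z -> holo (fun w => / f w)%C z.
Proof.
  intros Hz Hf. apply (holo_comp (fun w => / w)%C f); [|exact Hf].
  eexists; now apply cderiv_inv_id.
Qed.

Lemma holo_div (f g : C -> C) (z : C) :
  g z <> 0 -> holo f z -> holo g z -> holo (fun w => f w / g w)%C z.
Proof. intros Hz Hf Hg. apply holo_mult; [exact Hf|now apply holo_inv]. Qed.

Lemma holo_ext_loc (f g : C -> C) (z : C) :
  (exists r, 0 < r /\ forall w, Cmod (w - z) < r -> f w = g w) ->
  holo f z -> holo g z.
Proof.
  intros [r [Hr H]] [d Hd]. exists d.
  apply cderiv_eps. intros eps Heps.
  destruct (proj1 (cderiv_eps f z d) Hd eps Heps) as [delta [Hdelta H1]].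
  exists (Rmin delta r); split; [now apply Rmin_pos|]. intros w Hw.
  rewrite <- (H w) by (eapply Rlt_le_trans; [exact Hw|apply Rmin_r]).
  rewrite <- (H z).
  - apply H1. eapply Rlt_le_trans; [exact Hw|apply Rmin_l].
  - replace (z - z)%C with (RtoC 0) by ring. now rewrite Cmod_0.
Qed.

Lemma holo_ext (f g : C -> C) (z : C) :
  (forall w, f w = g w) -> holo f z -> holo g z.
Proof. intros H. apply holo_ext_loc. exists 1; split; [lra|auto]. Qed.

Lemma holo_pow (f : C -> C) (n : nat) (z : C) :
  holo f z -> holo (fun w => f w ^ n)%C z.
Proof.
  intros Hf. induction n as [|n IH]; [exact (holo_const 1 z)|].
  exact (holo_mult f (fun w => f w ^ n)%C z Hf IH).
Qed.

Lemma ccont_lim_zero (f : C -> C) (z : C) :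
  ccont f z ->
  (forall r, 0 < r -> exists w, Cmod (w - z) < r /\ f w = RtoC 0) -> f z = RtoC 0.
Proof.
  intros Hc H. apply Cmod_eq_0, Rle_antisym; [|apply Cmod_ge_0].
  apply Rnot_lt_le. intros Hlt.
  destruct (Hc _ Hlt) as [d [Hd H1]]. destruct (H d Hd) as [w [Hw Hw0]].
  specialize (H1 w Hw). rewrite Hw0 in H1.
  replace (0 - f z)%C with (- f z)%C in H1 by ring. rewrite Cmod_opp in H1. lra.
Qed.

(** * Calculus of complex-valued functions of a real variable *)

Lemma pderiv_pair (f : R -> C) (t a b : R) :
  is_derive (fun u => Re (f u)) t a -> is_derive (fun u => Im (f u)) t b ->
  pderiv f t (a, b).
Proof.
  intros Ha Hb. apply pderiv_eps. intros eps Heps.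
  destruct (proj2 Ha t (fun P H => H) (mkposreal (eps / 2) ltac:(lra))) as [d1 H1].
  destruct (proj2 Hb t (fun P H => H) (mkposreal (eps / 2) ltac:(lra))) as [d2 H2].
  exists (Rmin d1 d2); split; [apply Rmin_pos; apply cond_pos|].
  intros u Hu.
  specialize (H1 u (Rlt_le_trans _ _ _ Hu (Rmin_l _ _))).
  specialize (H2 u (Rlt_le_trans _ _ _ Hu (Rmin_r _ _))).
  change (Rabs (Re (f u) - Re (f t) - (u - t) * a) <= eps / 2 * Rabs (u - t)) in H1.
  change (Rabs (Im (f u) - Im (f t) - (u - t) * b) <= eps / 2 * Rabs (u - t)) in H2.
  replace (f u - f t - RtoC (u - t) * (a, b))%C
    with (Re (f u) - Re (f t) - (u - t) * a, Im (f u) - Im (f t) - (u - t) * b)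
    by (unfold Cminus, Cplus, Copp, Cmult, RtoC, Re, Im; simpl; f_equal; ring).
  eapply Rle_trans; [apply Cmod_le_add|]. lra.
Qed.

Lemma pderiv_continuous (f : R -> C) (t : R) (d : C) : pderiv f t d -> pcont f t.
Proof.
  intros H. apply (ex_derive_continuous (K := R_AbsRing) (V := C_R_NormedModule)).
  now exists d.
Qed.

Lemma pderiv_Re_mult (f : R -> C) (t : R) (c d : C) :
  pderiv f t d -> is_derive (fun u => Re (c * f u)) t (Re (c * d)).
Proof.
  intros H. split; [apply is_linear_scal_l|].
  intros x Hx. apply (is_filter_lim_locally_unique (K := R_AbsRing) (V := R_NormedModule)) in Hx; subst x.
  intros eps. assert (Hc := Cmod_ge_0 c).
  destruct (proj1 (pderiv_eps f t d) H (eps / (1 + Cmod c))) as [delta [Hd H1]].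
  { apply Rdiv_lt_0_compat; [apply cond_pos|lra]. }
  exists (mkposreal delta Hd). intros u Hu. specialize (H1 u Hu).
  change (Rabs (Re (c * f u) - Re (c * f t) - (u - t) * Re (c * d)) <= eps * Rabs (u - t)).
  replace (Re (c * f u) - Re (c * f t) - (u - t) * Re (c * d))
    with (Re (c * (f u - f t - RtoC (u - t) * d)))
    by (unfold Re, Cmult, Cminus, Cplus, Copp, RtoC; simpl; ring).
  eapply Rle_trans; [apply re_le_Cmod|]. rewrite Cmod_mult.
  eapply Rle_trans; [apply Rmult_le_compat_l; [exact Hc|exact H1]|].
  replace (Cmod c * (eps / (1 + Cmod c) * Rabs (u - t)))
    with (eps * Rabs (u - t) * (Cmod c / (1 + Cmod c))) by (field; lra).
  rewrite <- (Rmult_1_r (eps * Rabs (u - t))) at 2.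
  apply Rmult_le_compat_l.
  - apply Rmult_le_pos; [left; apply cond_pos|apply Rabs_pos].
  - apply Rmult_le_reg_r with (1 + Cmod c); [lra|].
    unfold Rdiv. rewrite Rmult_assoc, Rinv_l by lra. lra.
Qed.

(** The real mean value theorem is applied to [Re (c * f)] with [c] the conjugate of [f b - f a];
    the increment of this function is the squared modulus of [f b - f a], and one factor cancels. *)
Lemma mean_value_ineq (f df : R -> C) (a b M : R) :
  a <= b ->
  (forall t, a <= t <= b -> pderiv f t (df t)) ->
  (forall t, a <= t <= b -> Cmod (df t) <= M) ->
  Cmod (f b - f a) <= M * (b - a).
Proof.
  intros Hab Hd HM.
  set (c := Cconj (f b - f a)).
  destruct (MVT_gen (fun u => Re (c * f u)) a b (fun u => Re (c * df u))) as [x [Hx Heq]].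
  - rewrite Rmin_left, Rmax_right by lra. intros t Ht. apply pderiv_Re_mult, Hd; lra.
  - rewrite Rmin_left, Rmax_right by lra. intros t Ht.
    apply continuity_pt_filterlim.
    apply (ex_derive_continuous (K := R_AbsRing) (V := R_NormedModule)).
    eexists; apply pderiv_Re_mult, Hd; lra.
  - rewrite Rmin_left, Rmax_right in Hx by lra.
    assert (H1 : Cmod (f b - f a) ^ 2 = Re (c * f b) - Re (c * f a)).
    { replace (Re (c * f b) - Re (c * f a)) with (Re ((f b - f a) * c))
        by (unfold Re, Cmult, Cminus, Cplus, Copp; simpl; ring).
      unfold c. rewrite <- Cmod2_conj. reflexivity. }
    rewrite Heq in H1.
    assert (H2 := Rle_trans _ _ _ (Rle_abs _) (re_le_Cmod (c * df x))).
    rewrite Cmod_mult in H2. unfold c in H2 at 2. rewrite Cmod_conj in H2.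
    assert (H3 := HM x Hx). assert (H4 := Cmod_ge_0 (f b - f a)).
    destruct (Req_dec (Cmod (f b - f a)) 0) as [H0|H0].
    + rewrite H0. assert (H5 := Cmod_ge_0 (df x)). nra.
    + apply Rmult_le_reg_l with (Cmod (f b - f a)); [lra|].
      replace (Cmod (f b - f a) * Cmod (f b - f a)) with (Cmod (f b - f a) ^ 2) by ring.
      rewrite H1.
      apply Rle_trans with (Cmod (f b - f a) * Cmod (df x) * (b - a)).
      * apply Rmult_le_compat_r; lra.
      * rewrite Rmult_assoc. apply Rmult_le_compat_l; [lra|]. apply Rmult_le_compat_r; lra.
Qed.

(** * The complex exponential *)

Lemma Cexp_plus (z w : C) : Cexp (z + w) = (Cexp z * Cexp w)%C.
Proof.
  unfold Cexp. rewrite re_plus, im_plus, exp_plus, cos_plus, sin_plus.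
  unfold Cmult; simpl. f_equal; ring.
Qed.

Lemma Cexp_R (x : R) : Cexp (RtoC x) = RtoC (exp x).
Proof. unfold Cexp, RtoC, Re, Im; simpl. rewrite cos_0, sin_0. f_equal; ring. Qed.

Lemma Cexp_0 : Cexp 0 = RtoC 1.
Proof. now rewrite Cexp_R, exp_0. Qed.

Lemma Cmod_Cexp (z : C) : Cmod (Cexp z) = exp (Re z).
Proof.
  unfold Cmod, Cexp; simpl.
  replace (_ + _) with (exp (Re z) * exp (Re z) * (Rsqr (sin (Im z)) + Rsqr (cos (Im z))))
    by (unfold Rsqr; ring).
  rewrite sin2_cos2, Rmult_1_r. apply sqrt_square. left; apply exp_pos.
Qed.

Lemma Cexp_neq_0 (z : C) : Cexp z <> 0.
Proof. apply Cmod_gt_0. rewrite Cmod_Cexp. apply exp_pos. Qed.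

Lemma Cexp_opp (z : C) : Cexp (- z) = (/ Cexp z)%C.
Proof.
  assert (H := Cexp_neq_0 z).
  assert (E : (Cexp (- z) * Cexp z)%C = 1).
  { rewrite <- Cexp_plus. replace (- z + z)%C with (RtoC 0) by ring. apply Cexp_0. }
  replace (Cexp (- z)) with (Cexp (- z) * Cexp z / Cexp z)%C by (field; exact H).
  rewrite E. field; exact H.
Qed.

Lemma pderiv_Cexp_line (z : C) (t : R) :
  pderiv (fun u => Cexp (RtoC u * z)) t (z * Cexp (RtoC t * z))%C.
Proof.
  destruct z as [a b].
  replace ((a, b) * Cexp (RtoC t * (a, b)))%C with
    (exp (t * a) * (a * cos (t * b) - b * sin (t * b)),
     exp (t * a) * (a * sin (t * b) + b * cos (t * b))).
  - apply pderiv_pair.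
    + apply is_derive_ext with (fun u => exp (u * a) * cos (u * b)).
      * intros u. unfold Cexp, Re, Im, Cmult, RtoC; simpl. f_equal; f_equal; ring.
      * auto_derive; [trivial|ring].
    + apply is_derive_ext with (fun u => exp (u * a) * sin (u * b)).
      * intros u. unfold Cexp, Re, Im, Cmult, RtoC; simpl. f_equal; f_equal; ring.
      * auto_derive; [trivial|ring].
  - unfold Cexp, Re, Im, Cmult, RtoC; simpl.
    replace (t * a - 0 * b) with (t * a) by ring.
    replace (t * b + 0 * a) with (t * b) by ring. f_equal; ring.
Qed.

Lemma Re_scal_le_Cmod (t : R) (z : C) : 0 <= t <= 1 -> Re (RtoC t * z) <= Cmod z.
Proof.
  intros Ht. rewrite re_scal_l.
  assert (H := re_le_Cmod z). assert (H1 := Rle_abs (Re z)).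
  assert (H2 := Cmod_ge_0 z). nra.
Qed.

(** This and [Cexp_sub_1_sub_id] are Taylor remainders of orders one and two, from the mean value
    inequality on the segment from 0 to [z]. The factor [exp (Cmod z)] is crude but bounded on
    bounded sets. *)
Lemma Cexp_sub_1 (z : C) : Cmod (Cexp z - 1) <= Cmod z * exp (Cmod z).
Proof.
  assert (H := mean_value_ineq (fun u => Cexp (RtoC u * z))
    (fun t => z * Cexp (RtoC t * z))%C 0 1 (Cmod z * exp (Cmod z)) ltac:(lra)
    (fun t _ => pderiv_Cexp_line z t)).
  cbv beta in H. rewrite Cmult_1_l, Cmult_0_l, Cexp_0 in H.
  eapply Rle_trans; [apply H|lra].
  intros t Ht. rewrite Cmod_mult, Cmod_Cexp.
  apply Rmult_le_compat_l; [apply Cmod_ge_0|].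
  destruct (Re_scal_le_Cmod t z Ht) as [H1|H1]; [left; now apply exp_increasing|rewrite H1; lra].
Qed.

Lemma exp_le (x y : R) : x <= y -> exp x <= exp y.
Proof. intros [H|H]; [left; now apply exp_increasing|rewrite H; lra]. Qed.

Lemma pderiv_minus (f g : R -> C) (t : R) (df dg : C) :
  pderiv f t df -> pderiv g t dg -> pderiv (fun u => f u - g u)%C t (df - dg)%C.
Proof. exact (is_derive_minus (K := R_AbsRing) (V := C_R_NormedModule) f g t df dg). Qed.

Lemma Cexp_sub_1_sub_id (z : C) :
  Cmod (Cexp z - 1 - z) <= Cmod z ^ 2 * exp (Cmod z).
Proof.
  assert (H := mean_value_ineq (fun u => Cexp (RtoC u * z) - RtoC u * z)%C
    (fun t => z * Cexp (RtoC t * z) - z)%C 0 1 (Cmod z ^ 2 * exp (Cmod z)) ltac:(lra)).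
  cbv beta in H. rewrite Cmult_1_l, Cmult_0_l, Cexp_0 in H.
  replace (Cexp z - 1 - z)%C with (Cexp z - z - (1 - 0))%C by ring.
  eapply Rle_trans; [apply H|lra].
  - intros t Ht. apply pderiv_minus; [apply pderiv_Cexp_line|].
    assert (Hl : pderiv (fun u => (RtoC u * z)%C) t (z * 1)%C).
    { apply (pderiv_comp_line (fun w => w) (fun u => RtoC u * z)%C t z 1).
      - intros u. rewrite RtoC_minus. ring.
      - apply cderiv_id. }
    rewrite Cmult_1_r in Hl. exact Hl.
  - intros t Ht. replace (z * Cexp (RtoC t * z) - z)%C with (z * (Cexp (RtoC t * z) - 1))%C by ring.
    rewrite Cmod_mult. simpl. rewrite Rmult_1_r, Rmult_assoc.
    apply Rmult_le_compat_l; [apply Cmod_ge_0|].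
    eapply Rle_trans; [apply Cexp_sub_1|].
    assert (Hm : Cmod (RtoC t * z) <= Cmod z).
    { rewrite Cmod_mult, Cmod_R, Rabs_pos_eq by lra. assert (H1 := Cmod_ge_0 z). nra. }
    apply Rmult_le_compat; [apply Cmod_ge_0|left; apply exp_pos|exact Hm|now apply exp_le].
Qed.

Lemma cderiv_Cexp (z : C) : cderiv Cexp z (Cexp z).
Proof.
  apply cderiv_eps. intros eps Heps.
  assert (Hp := exp_pos (Re z)). assert (He := exp_pos 1).
  assert (HK : 0 < exp (Re z) * exp 1) by nra.
  exists (Rmin 1 (eps / (exp (Re z) * exp 1))). split.
  { apply Rmin_pos; [lra|now apply Rdiv_lt_0_compat]. }
  intros w Hw.
  assert (H1 := Rlt_le_trans _ _ _ Hw (Rmin_l _ _)).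
  assert (H2 := Rlt_le_trans _ _ _ Hw (Rmin_r _ _)).
  replace (Cexp w - Cexp z - (w - z) * Cexp z)%C
    with (Cexp z * (Cexp (w - z) - 1 - (w - z)))%C.
  2:{ replace w with (z + (w - z))%C at 3 by ring. rewrite Cexp_plus. ring. }
  rewrite Cmod_mult, Cmod_Cexp.
  eapply Rle_trans; [apply Rmult_le_compat_l; [lra|apply Cexp_sub_1_sub_id]|].
  assert (H3 := Cmod_ge_0 (w - z)).
  assert (H4 : exp (Cmod (w - z)) <= exp 1) by (apply exp_le; lra).
  apply Rle_trans with (exp (Re z) * exp 1 * Cmod (w - z) * Cmod (w - z)).
  - simpl. rewrite Rmult_1_r.
    assert (0 <= exp (Re z) * (Cmod (w - z) * Cmod (w - z))) by nra. nra.
  - apply Rmult_le_compat_r; [lra|].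
    apply Rlt_le, Rmult_lt_reg_l with (/ (exp (Re z) * exp 1)); [now apply Rinv_0_lt_compat|].
    rewrite <- Rmult_assoc, Rinv_l by lra. unfold Rdiv in H2. lra.
Qed.

Lemma holo_Cexp (f : C -> C) (z : C) : holo f z -> holo (fun w => Cexp (f w)) z.
Proof. intros H. apply (holo_comp Cexp f); [eexists; apply cderiv_Cexp|exact H]. Qed.

(** * Integrals of complex-valued functions over real intervals *)

Definition pcont_on (f : R -> C) (a b : R) : Prop :=
  forall t, a <= t <= b -> pcont f t.

Lemma ex_CInt (f : R -> C) (a b : R) :
  a <= b -> pcont_on f a b -> @ex_RInt C_R_NormedModule f a b.
Proof.
  intros Hab H. apply (ex_RInt_continuous (V := C_R_CompleteNormedModule)).
  rewrite Rmin_left, Rmax_right by lra. exact H.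
Qed.

Lemma CInt_correct (f : R -> C) (a b : R) :
  a <= b -> pcont_on f a b -> is_CInt f a b (CInt f a b).
Proof. intros Hab H. apply (RInt_correct (V := C_R_CompleteNormedModule)). now apply ex_CInt. Qed.

Lemma CInt_unique (f : R -> C) (a b : R) (l : C) : is_CInt f a b l -> CInt f a b = l.
Proof. apply (is_RInt_unique (V := C_R_CompleteNormedModule)). Qed.

Lemma CInt_plus (f g : R -> C) (a b : R) :
  a <= b -> pcont_on f a b -> pcont_on g a b ->
  CInt (fun t => f t + g t)%C a b = (CInt f a b + CInt g a b)%C.
Proof.
  intros Hab Hf Hg.
  apply (RInt_plus (V := C_R_CompleteNormedModule)); now apply ex_CInt.
Qed.

Lemma CInt_minus (f g : R -> C) (a b : R) :
  a <= b -> pcont_on f a b -> pcont_on g a b ->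
  CInt (fun t => f t - g t)%C a b = (CInt f a b - CInt g a b)%C.
Proof.
  intros Hab Hf Hg.
  apply (RInt_minus (V := C_R_CompleteNormedModule)); now apply ex_CInt.
Qed.

Lemma is_CInt_pair (f : R -> C) (a b x y : R) :
  is_RInt (fun t => Re (f t)) a b x -> is_RInt (fun t => Im (f t)) a b y ->
  is_CInt f a b (x, y).
Proof. apply (is_RInt_fct_extend_pair (U := R_NormedModule) (V := R_NormedModule)). Qed.

Lemma is_CInt_Re (f : R -> C) (a b : R) (l : C) :
  is_CInt f a b l -> is_RInt (fun t => Re (f t)) a b (Re l).
Proof. apply (is_RInt_fct_extend_fst (U := R_NormedModule) (V := R_NormedModule)). Qed.

Lemma is_CInt_Im (f : R -> C) (a b : R) (l : C) :
  is_CInt f a b l -> is_RInt (fun t => Im (f t)) a b (Im l).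
Proof. apply (is_RInt_fct_extend_snd (U := R_NormedModule) (V := R_NormedModule)). Qed.

(** The integral regards [C] as a real vector space, so a complex factor is moved out through the
    real and imaginary parts. *)
Lemma is_CInt_scal (f : R -> C) (a b : R) (c l : C) :
  is_CInt f a b l -> is_CInt (fun t => c * f t)%C a b (c * l)%C.
Proof.
  intros H.
  assert (HR := is_CInt_Re _ _ _ _ H). assert (HI := is_CInt_Im _ _ _ _ H).
  rewrite (surjective_pairing (c * l)%C).
  apply is_CInt_pair.
  - apply (is_RInt_minus (V := R_NormedModule)
      (fun t => Re c * Re (f t)) (fun t => Im c * Im (f t)));
    now apply (is_RInt_scal (V := R_NormedModule)).
  - apply (is_RInt_plus (V := R_NormedModule)
      (fun t => Re c * Im (f t)) (fun t => Im c * Re (f t)));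
    now apply (is_RInt_scal (V := R_NormedModule)).
Qed.

Lemma CInt_scal (f : R -> C) (a b : R) (c : C) :
  a <= b -> pcont_on f a b -> CInt (fun t => c * f t)%C a b = (c * CInt f a b)%C.
Proof. intros Hab Hf. apply CInt_unique, is_CInt_scal. now apply CInt_correct. Qed.

Lemma CInt_Chasles (f : R -> C) (a b c : R) :
  a <= b <= c -> pcont_on f a c -> (CInt f a b + CInt f b c)%C = CInt f a c.
Proof.
  intros H Hf. apply (RInt_Chasles (V := C_R_CompleteNormedModule));
  apply ex_CInt; try lra; intros t Ht; apply Hf; lra.
Qed.

Lemma CInt_ext (f g : R -> C) (a b : R) :
  a <= b -> (forall t, a < t < b -> f t = g t) -> CInt f a b = CInt g a b.
Proof.
  intros Hab H. apply (RInt_ext (V := C_R_CompleteNormedModule)).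
  rewrite Rmin_left, Rmax_right by lra. exact H.
Qed.

Lemma CInt_norm_le (f : R -> C) (a b M : R) :
  a <= b -> pcont_on f a b -> (forall t, a <= t <= b -> Cmod (f t) <= M) ->
  Cmod (CInt f a b) <= (b - a) * M.
Proof.
  intros Hab Hf HM. rewrite Cmod_norm.
  apply (norm_RInt_le_const (V := C_R_NormedModule) f a b (CInt f a b) M Hab).
  - intros t Ht. rewrite <- Cmod_norm. now apply HM.
  - now apply CInt_correct.
Qed.

Lemma CInt_norm_le_RInt (f : R -> C) (g : R -> R) (a b : R) :
  a <= b -> pcont_on f a b -> ex_RInt g a b -> (forall t, a <= t <= b -> Cmod (f t) <= g t) ->
  Cmod (CInt f a b) <= RInt g a b.
Proof.
  intros Hab Hf Hg HM. rewrite Cmod_norm.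
  apply (norm_RInt_le (V := C_R_NormedModule) f g a b (CInt f a b) _ Hab).
  - intros t Ht. rewrite <- Cmod_norm. now apply HM.
  - now apply CInt_correct.
  - now apply (RInt_correct (V := R_CompleteNormedModule)).
Qed.

Lemma CInt_primitive (F f : R -> C) (a b : R) :
  a <= b -> (forall t, a <= t <= b -> pderiv F t (f t)) -> pcont_on f a b ->
  CInt f a b = (F b - F a)%C.
Proof.
  intros Hab HF Hf. apply CInt_unique.
  apply (is_RInt_derive (V := C_R_CompleteNormedModule));
  rewrite Rmin_left, Rmax_right by lra; auto.
Qed.

(** * Cauchy's theorem on rectangles *)

(** The contour integral around [[a, b] x [c, d]], counterclockwise: bottom, right, top, left. The
    factor [Ci] is the velocity on the vertical sides. *)
Definition rect_int (f : C -> C) (a b c d : R) : C :=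
  (CInt (fun x => f (x, c)) a b + Ci * CInt (fun y => f (b, y)) c d
   - CInt (fun x => f (x, d)) a b - Ci * CInt (fun y => f (a, y)) c d)%C.

Definition ccont_rect (f : C -> C) (a b c d : R) : Prop :=
  forall x y, a <= x <= b -> c <= y <= d -> ccont f (x, y).

Definition in_rect (z : C) (a b c d : R) : Prop :=
  a <= Re z <= b /\ c <= Im z <= d.

Definition on_boundary (z : C) (a b c d : R) : Prop :=
  in_rect z a b c d /\ (Re z = a \/ Re z = b \/ Im z = c \/ Im z = d).

Definition ccont_boundary (f : C -> C) (a b c d : R) : Prop :=
  forall z, on_boundary z a b c d -> ccont f z.

Ltac solve_bd := split; [split; unfold Re, Im; simpl; lra|unfold Re, Im; simpl; auto].

Lemma boundary_pcont (f : C -> C) (a b c d : R) :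
  a <= b -> c <= d -> ccont_boundary f a b c d ->
  pcont_on (fun x => f (x, c)) a b /\ pcont_on (fun y => f (b, y)) c d /\
  pcont_on (fun x => f (x, d)) a b /\ pcont_on (fun y => f (a, y)) c d.
Proof.
  intros Hab Hcd H. repeat split; intros t Ht.
  - apply pcont_horizontal, H; solve_bd.
  - apply pcont_vertical, H; solve_bd.
  - apply pcont_horizontal, H; solve_bd.
  - apply pcont_vertical, H; solve_bd.
Qed.

Lemma ccont_rect_boundary (f : C -> C) (a b c d : R) :
  ccont_rect f a b c d -> ccont_boundary f a b c d.
Proof. intros H [x y] [[H1 H2] _]. now apply H. Qed.

Lemma rect_int_norm_le (f : C -> C) (a b c d M : R) :
  a <= b -> c <= d -> ccont_boundary f a b c d ->
  (forall z, on_boundary z a b c d -> Cmod (f z) <= M) ->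
  Cmod (rect_int f a b c d) <= 2 * ((b - a) + (d - c)) * M.
Proof.
  intros Hab Hcd Hc HM.
  destruct (boundary_pcont f a b c d Hab Hcd Hc) as [C1 [C2 [C3 C4]]].
  unfold rect_int, Cminus.
  assert (H1 := CInt_norm_le _ a b M Hab C1 (fun t Ht => HM (t, c) ltac:(solve_bd))).
  assert (H2 := CInt_norm_le _ c d M Hcd C2 (fun t Ht => HM (b, t) ltac:(solve_bd))).
  assert (H3 := CInt_norm_le _ a b M Hab C3 (fun t Ht => HM (t, d) ltac:(solve_bd))).
  assert (H4 := CInt_norm_le _ c d M Hcd C4 (fun t Ht => HM (a, t) ltac:(solve_bd))).
  eapply Rle_trans; [apply Cmod_triangle|].
  eapply Rle_trans; [apply Rplus_le_compat_r, Cmod_triangle|].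
  eapply Rle_trans; [apply Rplus_le_compat_r, Rplus_le_compat_r, Cmod_triangle|].
  rewrite !Cmod_opp, !Cmod_mult, Cmod_Ci. lra.
Qed.

Lemma rect_int_plus (f g : C -> C) (a b c d : R) :
  a <= b -> c <= d -> ccont_boundary f a b c d -> ccont_boundary g a b c d ->
  rect_int (fun z => f z + g z)%C a b c d = (rect_int f a b c d + rect_int g a b c d)%C.
Proof.
  intros Hab Hcd Hf Hg.
  destruct (boundary_pcont f a b c d Hab Hcd Hf) as [C1 [C2 [C3 C4]]].
  destruct (boundary_pcont g a b c d Hab Hcd Hg) as [D1 [D2 [D3 D4]]].
  unfold rect_int.
  rewrite (CInt_plus (fun x => f (x, c)) (fun x => g (x, c))) by auto.
  rewrite (CInt_plus (fun x => f (b, x)) (fun x => g (b, x))) by auto.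
  rewrite (CInt_plus (fun x => f (x, d)) (fun x => g (x, d))) by auto.
  rewrite (CInt_plus (fun x => f (a, x)) (fun x => g (a, x))) by auto.
  ring.
Qed.

Lemma rect_int_scal (f : C -> C) (k : C) (a b c d : R) :
  a <= b -> c <= d -> ccont_boundary f a b c d ->
  rect_int (fun z => k * f z)%C a b c d = (k * rect_int f a b c d)%C.
Proof.
  intros Hab Hcd Hf.
  destruct (boundary_pcont f a b c d Hab Hcd Hf) as [C1 [C2 [C3 C4]]].
  unfold rect_int.
  rewrite (CInt_scal (fun x => f (x, c))) by auto.
  rewrite (CInt_scal (fun x => f (b, x))) by auto.
  rewrite (CInt_scal (fun x => f (x, d))) by auto.
  rewrite (CInt_scal (fun x => f (a, x))) by auto.
  ring.
Qed.

Lemma rect_int_ext (f g : C -> C) (a b c d : R) :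
  a <= b -> c <= d -> (forall z, on_boundary z a b c d -> f z = g z) ->
  rect_int f a b c d = rect_int g a b c d.
Proof.
  intros Hab Hcd H. unfold rect_int.
  rewrite (CInt_ext (fun x => f (x, c)) (fun x => g (x, c))) by (auto; intros; apply H; solve_bd).
  rewrite (CInt_ext (fun x => f (b, x)) (fun x => g (b, x))) by (auto; intros; apply H; solve_bd).
  rewrite (CInt_ext (fun x => f (x, d)) (fun x => g (x, d))) by (auto; intros; apply H; solve_bd).
  rewrite (CInt_ext (fun x => f (a, x)) (fun x => g (a, x))) by (auto; intros; apply H; solve_bd).
  reflexivity.
Qed.

Lemma ccont_plus (f g : C -> C) (z : C) :
  ccont f z -> ccont g z -> ccont (fun w => f w + g w)%C z.
Proof.
  intros Hf Hg eps Heps.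
  destruct (Hf (eps / 2) ltac:(lra)) as [d1 [Hd1 H1]].
  destruct (Hg (eps / 2) ltac:(lra)) as [d2 [Hd2 H2]].
  exists (Rmin d1 d2); split; [now apply Rmin_pos|]. intros w Hw.
  specialize (H1 w (Rlt_le_trans _ _ _ Hw (Rmin_l _ _))).
  specialize (H2 w (Rlt_le_trans _ _ _ Hw (Rmin_r _ _))).
  replace (f w + g w - (f z + g z))%C with ((f w - f z) + (g w - g z))%C by ring.
  eapply Rle_lt_trans; [apply Cmod_triangle|]. lra.
Qed.

Lemma ccont_mult (f g : C -> C) (z : C) :
  ccont f z -> ccont g z -> ccont (fun w => f w * g w)%C z.
Proof.
  intros Hf Hg eps Heps.
  assert (Hf0 := Cmod_ge_0 (f z)). assert (Hg0 := Cmod_ge_0 (g z)).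
  set (e := Rmin 1 (eps / (2 + Cmod (f z) + Cmod (g z)))).
  assert (He : 0 < e) by (apply Rmin_pos; [lra|apply Rdiv_lt_0_compat; lra]).
  assert (He1 : e <= 1) by apply Rmin_l.
  assert (He2 : e * (2 + Cmod (f z) + Cmod (g z)) <= eps).
  { apply Rle_trans with (eps / (2 + Cmod (f z) + Cmod (g z)) * (2 + Cmod (f z) + Cmod (g z))).
    - apply Rmult_le_compat_r; [lra|apply Rmin_r].
    - right; field; lra. }
  destruct (Hf e He) as [d1 [Hd1 H1]].
  destruct (Hg e He) as [d2 [Hd2 H2]].
  exists (Rmin d1 d2); split; [now apply Rmin_pos|]. intros w Hw.
  specialize (H1 w (Rlt_le_trans _ _ _ Hw (Rmin_l _ _))).
  specialize (H2 w (Rlt_le_trans _ _ _ Hw (Rmin_r _ _))).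
  replace (f w * g w - f z * g z)%C
    with ((f w - f z) * (g w - g z) + ((f w - f z) * g z + f z * (g w - g z)))%C by ring.
  eapply Rle_lt_trans; [apply Cmod_triangle|].
  eapply Rle_lt_trans; [apply Rplus_le_compat_l, Cmod_triangle|].
  rewrite !Cmod_mult.
  assert (H3 := Cmod_ge_0 (f w - f z)). assert (H4 := Cmod_ge_0 (g w - g z)). nra.
Qed.

Lemma ccont_const (k z : C) : ccont (fun _ => k) z.
Proof. apply holo_ccont, holo_const. Qed.

Lemma rect_int_split_x (f : C -> C) (a m b c d : R) :
  a <= m <= b -> c <= d -> ccont_rect f a b c d ->
  rect_int f a b c d = (rect_int f a m c d + rect_int f m b c d)%C.
Proof.
  intros Hm Hcd Hf. unfold rect_int.
  rewrite <- (CInt_Chasles (fun x => f (x, c)) a m b) by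
    (auto; intros t Ht; apply pcont_horizontal, Hf; lra).
  rewrite <- (CInt_Chasles (fun x => f (x, d)) a m b) by
    (auto; intros t Ht; apply pcont_horizontal, Hf; lra).
  ring.
Qed.

Lemma rect_int_split_y (f : C -> C) (a b c m d : R) :
  a <= b -> c <= m <= d -> ccont_rect f a b c d ->
  rect_int f a b c d = (rect_int f a b c m + rect_int f a b m d)%C.
Proof.
  intros Hab Hm Hf. unfold rect_int.
  rewrite <- (CInt_Chasles (fun x => f (a, x)) c m d) by
    (auto; intros t Ht; apply pcont_vertical, Hf; lra).
  rewrite <- (CInt_Chasles (fun x => f (b, x)) c m d) by
    (auto; intros t Ht; apply pcont_vertical, Hf; lra).
  ring.
Qed.

Lemma pderiv_horizontal (F : C -> C) (x y : R) (d : C) :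
  cderiv F (x, y) d -> pderiv (fun u => F (u, y)) x d.
Proof.
  intros H. replace d with (1 * d)%C by ring.
  apply (pderiv_comp_line F (fun u => (u, y))); [|exact H].
  intros u. unfold RtoC, Cminus, Cplus, Copp, Cmult; simpl. f_equal; ring.
Qed.

Lemma pderiv_vertical (F : C -> C) (x y : R) (d : C) :
  cderiv F (x, y) d -> pderiv (fun u => F (x, u)) y (Ci * d)%C.
Proof.
  intros H.
  apply (pderiv_comp_line F (fun u => (x, u))); [|exact H].
  intros u. unfold Ci, RtoC, Cminus, Cplus, Copp, Cmult; simpl. f_equal; ring.
Qed.

Lemma rect_int_primitive (F f : C -> C) (a b c d : R) :
  a <= b -> c <= d -> (forall z, cderiv F z (f z)) -> (forall z, ccont f z) ->
  rect_int f a b c d = RtoC 0.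
Proof.
  intros Hab Hcd HF Hf. unfold rect_int.
  assert (HV : forall x, (Ci * CInt (fun y => f (x, y)) c d = F (x, d) - F (x, c))%C).
  { intros x. rewrite <- CInt_scal by (auto; intros t _; now apply pcont_vertical).
    apply (CInt_primitive (fun y => F (x, y))); auto.
    - intros t _. now apply pderiv_vertical.
    - intros t _. apply (pcont_vertical (fun z => Ci * f z)%C).
      apply ccont_mult; [apply ccont_const|apply Hf]. }
  assert (HH : forall y, (CInt (fun x => f (x, y)) a b = F (b, y) - F (a, y))%C).
  { intros y. apply (CInt_primitive (fun x => F (x, y))); auto.
    - intros t _. now apply pderiv_horizontal.
    - intros t _. now apply pcont_horizontal. }
  rewrite !HV, !HH. ring.
Qed.

Lemma rect_int_affine (p q : C) (a b c d : R) :
  a <= b -> c <= d -> rect_int (fun z => p + q * z)%C a b c d = RtoC 0.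
Proof.
  intros Hab Hcd.
  apply rect_int_primitive with (F := fun z => (p * z + q * (/ 2 * (z * z)))%C); auto.
  - intros z.
    replace (p + q * z)%C with
      ((0 * z + p * 1) + (0 * (/ 2 * (z * z)) + q * (0 * (z * z) + / 2 * (1 * z + z * 1))))%C
      by field.
    apply (cderiv_plus (fun z => p * z)%C (fun z => q * (/ 2 * (z * z)))%C).
    + apply (cderiv_mult (fun _ => p) (fun z => z)); [apply cderiv_const|apply cderiv_id].
    + apply (cderiv_mult (fun _ => q) (fun z => / 2 * (z * z))%C); [apply cderiv_const|].
      apply (cderiv_mult (fun _ => / 2)%C (fun z => z * z)%C); [apply cderiv_const|].
      apply (cderiv_mult (fun z => z) (fun z => z)); apply cderiv_id.
  - intros z. apply holo_ccont.
    apply (holo_plus (fun _ => p) (fun z => q * z)%C); [apply holo_const|].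
    apply (holo_mult (fun _ => q) (fun z => z)); [apply holo_const|apply holo_id].
Qed.

Lemma rect_quarter (f : C -> C) (x y w h e : R) :
  0 <= w -> 0 <= h -> ccont_rect f x (x + w) y (y + h) ->
  e <= Cmod (rect_int f x (x + w) y (y + h)) ->
  exists x' y', (x' = x \/ x' = x + w / 2) /\ (y' = y \/ y' = y + h / 2) /\
    e / 4 <= Cmod (rect_int f x' (x' + w / 2) y' (y' + h / 2)).
Proof.
  intros Hw Hh Hc He.
  apply NNPP. intros Hn.
  assert (HQ : forall x' y', (x' = x \/ x' = x + w / 2) -> (y' = y \/ y' = y + h / 2) ->
    Cmod (rect_int f x' (x' + w / 2) y' (y' + h / 2)) < e / 4).
  { intros x' y' Hx Hy. apply Rnot_le_lt. intros H. apply Hn. exists x', y'. auto. }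
  rewrite (rect_int_split_x f x (x + w / 2) (x + w)) in He by (auto; lra).
  rewrite (rect_int_split_y f x (x + w / 2) y (y + h / 2) (y + h)) in He
    by (try lra; intros u v Hu Hv; apply Hc; lra).
  rewrite (rect_int_split_y f (x + w / 2) (x + w) y (y + h / 2) (y + h)) in He
    by (try lra; intros u v Hu Hv; apply Hc; lra).
  assert (H1 := HQ x y ltac:(auto) ltac:(auto)).
  assert (H2 := HQ x (y + h / 2) ltac:(auto) ltac:(auto)).
  assert (H3 := HQ (x + w / 2) y ltac:(auto) ltac:(auto)).
  assert (H4 := HQ (x + w / 2) (y + h / 2) ltac:(auto) ltac:(auto)).
  replace (x + w / 2 + w / 2) with (x + w) in * by field.
  replace (y + h / 2 + h / 2) with (y + h) in * by field.
  assert (H5 := Rle_trans _ _ _ He (Cmod_triangle _ _)).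
  assert (H6 := Cmod_triangle (rect_int f x (x + w / 2) y (y + h / 2))
                  (rect_int f x (x + w / 2) (y + h / 2) (y + h))).
  assert (H7 := Cmod_triangle (rect_int f (x + w / 2) (x + w) y (y + h / 2))
                  (rect_int f (x + w / 2) (x + w) (y + h / 2) (y + h))).
  lra.
Qed.

Lemma nested_limit (x : nat -> R) (w : R) :
  0 <= w -> (forall n, x n <= x (S n) /\ x (S n) + w / 2 ^ S n <= x n + w / 2 ^ n) ->
  exists l, forall n, x n <= l <= x n + w / 2 ^ n.
Proof.
  intros Hw H.
  assert (Hp : forall n, 0 <= w / 2 ^ n).
  { intros n. apply Rmult_le_pos; [exact Hw|]. left. apply Rinv_0_lt_compat, pow_lt. lra. }
  assert (Hinc : forall n k, x n <= x (n + k)%nat).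
  { intros n k. induction k as [|k IH]; [rewrite Nat.add_0_r; lra|].
    rewrite Nat.add_succ_r. destruct (H (n + k)%nat). lra. }
  assert (Hdec : forall n k, x (n + k)%nat + w / 2 ^ (n + k) <= x n + w / 2 ^ n).
  { intros n k. induction k as [|k IH]; [rewrite Nat.add_0_r; lra|].
    rewrite Nat.add_succ_r. destruct (H (n + k)%nat). lra. }
  assert (Hle : forall n m, x m <= x n + w / 2 ^ n).
  { intros n m. destruct (Nat.le_ge_cases n m) as [Hnm|Hnm].
    - replace m with (n + (m - n))%nat by lia.
      assert (H1 := Hdec n (m - n)%nat). assert (H2 := Hp (n + (m - n))%nat). lra.
    - replace n with (m + (n - m))%nat by lia.
      assert (H1 := Hinc m (n - m)%nat). assert (H2 := Hp (m + (n - m))%nat). lra. }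
  destruct (completeness (fun r => exists n, r = x n)) as [l [Hub Hlub]].
  - exists (x O + w / 2 ^ 0). intros r [n ->]. apply Hle.
  - exists (x O). now exists O.
  - exists l. intros n. split.
    + apply Hub. now exists n.
    + apply Hlub. intros r [m ->]. apply Hle.
Qed.

Theorem goursat (f : C -> C) (a b c d : R) :
  a <= b -> c <= d -> (forall z, in_rect z a b c d -> holo f z) ->
  rect_int f a b c d = RtoC 0.
Proof.
  intros Hab Hcd Hf. apply Cmod_eq_0, Rle_antisym; [|apply Cmod_ge_0].
  apply Rnot_lt_le. intros Heta. set (eta := Cmod (rect_int f a b c d)) in *.
  set (w := b - a). set (h := d - c).
  assert (Hw : 0 <= w) by (unfold w; lra). assert (Hh : 0 <= h) by (unfold h; lra).
  assert (Hpow : forall n, 0 < 2 ^ n) by (intros n; apply pow_lt; lra).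
  assert (Hwn : forall n, 0 <= w / 2 ^ n)
    by (intros n; apply Rmult_le_pos; [exact Hw|left; apply Rinv_0_lt_compat, Hpow]).
  assert (Hhn : forall n, 0 <= h / 2 ^ n)
    by (intros n; apply Rmult_le_pos; [exact Hh|left; apply Rinv_0_lt_compat, Hpow]).
  assert (Hcont : ccont_rect f a b c d).
  { intros x y Hx Hy. apply holo_ccont, Hf. now split. }
  set (q := fun (n : nat) (p : R * R) =>
    (a <= fst p /\ fst p + w / 2 ^ n <= b /\ c <= snd p /\ snd p + h / 2 ^ n <= d) /\
    eta / 4 ^ n <= Cmod (rect_int f (fst p) (fst p + w / 2 ^ n) (snd p) (snd p + h / 2 ^ n))).
  set (nxt := fun (n : nat) (p p' : R * R) =>
    (fst p <= fst p' /\ fst p' + w / 2 ^ S n <= fst p + w / 2 ^ n) /\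
    (snd p <= snd p' /\ snd p' + h / 2 ^ S n <= snd p + h / 2 ^ n)).
  assert (Hstep : forall n p, q n p -> exists p', q (S n) p' /\ nxt n p p').
  { intros n [x y] [[H1 [H2 [H3 H4]]] H5]; simpl in H1, H2, H3, H4, H5.
    destruct (rect_quarter f x y (w / 2 ^ n) (h / 2 ^ n) (eta / 4 ^ n))
      as [x' [y' [Hx [Hy He]]]]; auto.
    { intros u v Hu Hv. apply Hcont; lra. }
    exists (x', y'). unfold q, nxt; simpl fst; simpl snd.
    assert (Ew : w / 2 ^ S n = w / 2 ^ n / 2) by (simpl; field; apply Rgt_not_eq, Hpow).
    assert (Eh : h / 2 ^ S n = h / 2 ^ n / 2) by (simpl; field; apply Rgt_not_eq, Hpow).
    assert (Ee : eta / 4 ^ S n = eta / 4 ^ n / 4).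
    { simpl; field. apply pow_nonzero. lra. }
    rewrite Ew, Eh, Ee. assert (H6 := Hwn n). assert (H7 := Hhn n).
    split; [split; [|exact He]|]; destruct Hx as [-> | ->]; destruct Hy as [-> | ->]; lra. }
  assert (Hq0 : q O (a, c)).
  { unfold q; simpl.
    replace (a + w / 1) with b by (unfold w; field).
    replace (c + h / 1) with d by (unfold h; field).
    split; [lra|]. fold eta. lra. }
  (* The nested rectangles are selected one after another by choice; the subset type carries the
     invariant [q], on which the next choice depends. *)
  set (sq := fix sq (n : nat) : {p | q n p} :=
    match n with
    | O => exist _ (a, c) Hq0
    | S m => let (p, Hp) := sq m in
             let (p', Hp') := constructive_indefinite_description _ (Hstep m p Hp) in
             exist _ p' (proj1 Hp')
    end).
  set (p := fun n => proj1_sig (sq n)).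
  assert (Hq : forall n, q n (p n)) by (intros n; exact (proj2_sig (sq n))).
  assert (Hn : forall n, nxt n (p n) (p (S n))).
  { intros n. unfold p. simpl. destruct (sq n) as [pn Hpn]. simpl.
    destruct (constructive_indefinite_description _ (Hstep n pn Hpn)) as [p' [H1 H2]].
    exact H2. }
  destruct (nested_limit (fun n => fst (p n)) w Hw (fun n => proj1 (Hn n))) as [lx Hlx].
  destruct (nested_limit (fun n => snd (p n)) h Hh (fun n => proj2 (Hn n))) as [ly Hly].
  destruct (Hf (lx, ly)) as [df Hdf].
  { destruct (Hq O) as [[H1 [H2 [H3 H4]]] _]. assert (H5 := Hlx O). assert (H6 := Hly O).
    unfold in_rect, Re, Im; simpl fst; simpl snd. lra. }
  (* [L / 2^n] bounds half the perimeter of the n-th rectangle and its distance to the limit point;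
     the summand 1 keeps [L] positive for degenerate rectangles. With tolerance [eta / (4 L^2)] the
     integral is at most perimeter times remainder, which is half of [eta / 4^n]. *)
  set (L := w + h + 1). assert (HL : 0 < L) by (unfold L; lra).
  assert (HeL : 0 < eta / (4 * (L * L))).
  { apply Rdiv_lt_0_compat; [exact Heta|]. nra. }
  destruct (proj1 (cderiv_eps f (lx, ly) df) Hdf _ HeL) as [delta [Hdelta H]].
  destruct (pow_lt_1_zero (/ 2) ltac:(rewrite Rabs_pos_eq; lra) (delta / L)
    ltac:(now apply Rdiv_lt_0_compat)) as [n Hn2].
  specialize (Hn2 n (Nat.le_refl n)). rewrite pow_inv, Rabs_pos_eq in Hn2
    by (left; apply Rinv_0_lt_compat, Hpow).
  assert (HLn : L / 2 ^ n < delta).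
  { apply Rmult_lt_reg_l with (/ L); [now apply Rinv_0_lt_compat|].
    unfold Rdiv in *. rewrite <- Rmult_assoc, Rinv_l by lra. lra. }
  destruct (Hq n) as [[H1 [H2 [H3 H4]]] H5].
  specialize (Hlx n). specialize (Hly n). specialize (Hwn n). specialize (Hhn n).
  destruct (p n) as [x y]. simpl fst in *. simpl snd in *.
  assert (HwL : w / 2 ^ n + h / 2 ^ n <= L / 2 ^ n).
  { unfold Rdiv. rewrite <- Rmult_plus_distr_r. apply Rmult_le_compat_r.
    - left; apply Rinv_0_lt_compat, Hpow.
    - unfold L; lra. }
  assert (Hin : forall z, on_boundary z x (x + w / 2 ^ n) y (y + h / 2 ^ n) ->
     Cmod (z - (lx, ly)) <= L / 2 ^ n).
  { intros [u v] [[Hu Hv] _]. unfold Re, Im in Hu, Hv; simpl in Hu, Hv.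
    eapply Rle_trans; [apply Cmod_le_add|].
    simpl. change (Rabs (u - lx) + Rabs (v - ly) <= L / 2 ^ n).
    assert (Rabs (u - lx) <= w / 2 ^ n) by (apply Rabs_le; lra).
    assert (Rabs (v - ly) <= h / 2 ^ n) by (apply Rabs_le; lra). lra. }
  (* The tangent polynomial at the limit point has integral zero, so [f] may be replaced by its
     remainder of first order. *)
  set (pp := (f (lx, ly) - (lx, ly) * df)%C).
  assert (Hcb : ccont_boundary f x (x + w / 2 ^ n) y (y + h / 2 ^ n)).
  { apply ccont_rect_boundary. intros u v Hu Hv. apply Hcont; lra. }
  assert (Hca : ccont_boundary (fun z => -1 * (pp + df * z))%C x (x + w / 2 ^ n) y (y + h / 2 ^ n)).
  { intros z _. apply ccont_mult; [apply ccont_const|].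
    apply ccont_plus; [apply ccont_const|].
    apply ccont_mult; [apply ccont_const|apply holo_ccont, holo_id]. }
  assert (Hca' : ccont_boundary (fun z => (pp + df * z))%C x (x + w / 2 ^ n) y (y + h / 2 ^ n)).
  { intros z _. apply ccont_plus; [apply ccont_const|].
    apply ccont_mult; [apply ccont_const|apply holo_ccont, holo_id]. }
  assert (Hr : rect_int f x (x + w / 2 ^ n) y (y + h / 2 ^ n)
    = rect_int (fun z => f z + -1 * (pp + df * z))%C x (x + w / 2 ^ n) y (y + h / 2 ^ n)).
  { rewrite rect_int_plus by (auto; lra).
    rewrite (rect_int_scal (fun z => pp + df * z)%C) by (auto; lra).
    rewrite rect_int_affine by lra. ring. }
  rewrite Hr in H5.
  assert (H6 := rect_int_norm_le (fun z => f z + -1 * (pp + df * z))%C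
    x (x + w / 2 ^ n) y (y + h / 2 ^ n) (eta / (4 * (L * L)) * (L / 2 ^ n))
    ltac:(lra) ltac:(lra)
    (fun z Hz => ccont_plus _ _ z (Hcb z Hz) (Hca z Hz))).
  assert (H7 : forall z, on_boundary z x (x + w / 2 ^ n) y (y + h / 2 ^ n) ->
    Cmod (f z + -1 * (pp + df * z))%C <= eta / (4 * (L * L)) * (L / 2 ^ n)).
  { intros z Hz.
    replace (f z + -1 * (pp + df * z))%C with (f z - f (lx, ly) - (z - (lx, ly)) * df)%C
      by (unfold pp; ring).
    eapply Rle_trans; [apply H; eapply Rle_lt_trans; [now apply Hin|exact HLn]|].
    apply Rmult_le_compat_l; [lra|now apply Hin]. }
  specialize (H6 H7).
  assert (H8 : 2 * (x + w / 2 ^ n - x + (y + h / 2 ^ n - y)) * (eta / (4 * (L * L)) * (L / 2 ^ n))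
     <= 2 * (L / 2 ^ n) * (eta / (4 * (L * L)) * (L / 2 ^ n))).
  { apply Rmult_le_compat_r; [|lra].
    apply Rmult_le_pos; [lra|]. lra. }
  assert (H9 : 2 * (L / 2 ^ n) * (eta / (4 * (L * L)) * (L / 2 ^ n)) = eta / 4 ^ n / 2).
  { replace (4 ^ n) with (2 ^ n * 2 ^ n) by (rewrite <- Rpow_mult_distr; f_equal; lra).
    field. split; [apply Rgt_not_eq, Hpow|lra]. }
  assert (H10 : 0 < eta / 4 ^ n) by (apply Rdiv_lt_0_compat; [exact Heta|apply pow_lt; lra]).
  lra.
Qed.

(** * Cauchy's formula and the identity theorem *)

(** All of the rectangle except a small square around [z0] is cut into rectangles to which Goursat
    applies; over the small square the integral is small because [f] is bounded near [z0]. *)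
Lemma goursat_punctured (f : C -> C) (z0 : C) (a b c d : R) :
  a < Re z0 < b -> c < Im z0 < d -> ccont_rect f a b c d ->
  (forall z, in_rect z a b c d -> z <> z0 -> holo f z) ->
  rect_int f a b c d = RtoC 0.
Proof.
  destruct z0 as [x0 y0]. unfold Re, Im; simpl. intros Hx Hy Hc Hf.
  apply Cmod_eq_0, Rle_antisym; [|apply Cmod_ge_0].
  apply Rnot_lt_le. intros Heta.
  destruct (Hc x0 y0 ltac:(lra) ltac:(lra) 1 ltac:(lra)) as [r [Hr Hbd]].
  set (M := Cmod (f (x0, y0)) + 1).
  assert (HM : 0 < M) by (unfold M; assert (H := Cmod_ge_0 (f (x0, y0))); lra).
  set (eta := Cmod (rect_int f a b c d)) in *.
  (* The side of the square. The first four bounds keep the square inside the rectangle, [r / 4]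
     keeps it where [Cmod (f z) <= M], and the last makes perimeter times [M], that is [4 e M], at
     most [eta / 4]. *)
  set (e := Rmin (Rmin (Rmin (x0 - a) (b - x0)) (Rmin (y0 - c) (d - y0)))
              (Rmin (r / 4) (eta / (16 * M)))).
  assert (He : 0 < e).
  { unfold e. repeat apply Rmin_pos; try lra. apply Rdiv_lt_0_compat; lra. }
  assert (Hel : e <= x0 - a /\ e <= b - x0 /\ e <= y0 - c /\ e <= d - y0
     /\ e <= r / 4 /\ e <= eta / (16 * M)).
  { unfold e. repeat split; repeat first [apply Rle_refl | apply Rmin_l | apply Rmin_r |
      eapply Rle_trans; [apply Rmin_l|]; first [apply Rmin_l | apply Rmin_r |
        eapply Rle_trans; [apply Rmin_l|]; first [apply Rmin_l | apply Rmin_r] |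
        eapply Rle_trans; [apply Rmin_r|]; first [apply Rmin_l | apply Rmin_r]] |
      eapply Rle_trans; [apply Rmin_r|]; first [apply Rmin_l | apply Rmin_r]]. }
  destruct Hel as [H1 [H2 [H3 [H4 [H5 H6]]]]].
  assert (G1 : rect_int f a (x0 - e / 2) c d = RtoC 0).
  { apply goursat; try lra. intros [u v] [Hu Hv]; unfold Re, Im in *; simpl in *.
    apply Hf; [split; unfold Re, Im; simpl; lra|]. intros [= Eu Ev]; lra. }
  assert (G2 : rect_int f (x0 + e / 2) b c d = RtoC 0).
  { apply goursat; try lra. intros [u v] [Hu Hv]; unfold Re, Im in *; simpl in *.
    apply Hf; [split; unfold Re, Im; simpl; lra|]. intros [= Eu Ev]; lra. }
  assert (G3 : rect_int f (x0 - e / 2) (x0 + e / 2) c (y0 - e / 2) = RtoC 0).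
  { apply goursat; try lra. intros [u v] [Hu Hv]; unfold Re, Im in *; simpl in *.
    apply Hf; [split; unfold Re, Im; simpl; lra|]. intros [= Eu Ev]; lra. }
  assert (G4 : rect_int f (x0 - e / 2) (x0 + e / 2) (y0 + e / 2) d = RtoC 0).
  { apply goursat; try lra. intros [u v] [Hu Hv]; unfold Re, Im in *; simpl in *.
    apply Hf; [split; unfold Re, Im; simpl; lra|]. intros [= Eu Ev]; lra. }
  assert (E : rect_int f a b c d =
    rect_int f (x0 - e / 2) (x0 + e / 2) (y0 - e / 2) (y0 + e / 2)).
  { rewrite (rect_int_split_x f a (x0 - e / 2) b) by (auto; lra).
    rewrite (rect_int_split_x f (x0 - e / 2) (x0 + e / 2) b)
      by (try lra; intros u v Hu Hv; apply Hc; lra).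
    rewrite (rect_int_split_y f (x0 - e / 2) (x0 + e / 2) c (y0 - e / 2) d)
      by (try lra; intros u v Hu Hv; apply Hc; lra).
    rewrite (rect_int_split_y f (x0 - e / 2) (x0 + e / 2) (y0 - e / 2) (y0 + e / 2) d)
      by (try lra; intros u v Hu Hv; apply Hc; lra).
    rewrite G1, G2, G3, G4. ring. }
  assert (H7 : Cmod (rect_int f (x0 - e / 2) (x0 + e / 2) (y0 - e / 2) (y0 + e / 2))
    <= 2 * ((x0 + e / 2 - (x0 - e / 2)) + (y0 + e / 2 - (y0 - e / 2))) * M).
  { apply rect_int_norm_le; try lra.
    - apply ccont_rect_boundary. intros u v Hu Hv. apply Hc; lra.
    - intros [u v] [[Hu Hv] _]; unfold Re, Im in *; simpl in Hu, Hv.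
      assert (Hd : Cmod ((u, v) - (x0, y0)) < r).
      { eapply Rle_lt_trans; [apply Cmod_le_add|]. simpl.
        assert (Rabs (u + - x0) <= e) by (apply Rabs_le; lra).
        assert (Rabs (v + - y0) <= e) by (apply Rabs_le; lra). lra. }
      assert (H8 := Hbd _ Hd). assert (H9 := Cmod_triangle_inv (f (u, v)) (f (x0, y0))).
      unfold M. lra. }
  rewrite <- E in H7. fold eta in H7.
  assert (H8 : e * (16 * M) <= eta).
  { apply Rle_trans with (eta / (16 * M) * (16 * M)).
    - apply Rmult_le_compat_r; lra.
    - right; field; lra. }
  lra.
Qed.

(** The difference quotient extends continuously to [z0] by the derivative, so the singularity is
    removable. Its value by totalised division at [z0] is harmless, as [z0] is off the boundary. *)
Lemma rect_int_quotient (f : C -> C) (z0 : C) (a b c d : R) :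
  a < Re z0 < b -> c < Im z0 < d ->
  (forall z, in_rect z a b c d -> holo f z) ->
  rect_int (fun z => (f z - f z0) / (z - z0))%C a b c d = RtoC 0.
Proof.
  intros Hx Hy Hf.
  assert (Hz0 : in_rect z0 a b c d) by (split; lra).
  destruct (Hf z0 Hz0) as [df Hdf].
  set (h := fun z => if Ceq_dec z z0 then df else ((f z - f z0) / (z - z0))%C).
  rewrite (rect_int_ext _ h); try lra.
  2:{ intros z [_ Hbz]. unfold h. destruct (Ceq_dec z z0) as [->|_]; [|reflexivity]. lra. }
  assert (Hh : forall z, in_rect z a b c d -> z <> z0 -> holo h z).
  { intros z Hz Hne.
    assert (Hpos : 0 < Cmod (z - z0)) by now apply Cmod_gt_0, Cminus_eq_contra.
    apply holo_ext_loc with (fun z => (f z - f z0) / (z - z0))%C.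
    - exists (Cmod (z - z0)). split; [exact Hpos|]. intros w Hw. unfold h.
      destruct (Ceq_dec w z0) as [->|_]; [|reflexivity].
      rewrite Cmod_minus_sym in Hw. lra.
    - apply holo_div; [now apply Cminus_eq_contra| |].
      + apply holo_minus; [now apply Hf|apply holo_const].
      + apply holo_minus; [apply holo_id|apply holo_const]. }
  apply goursat_punctured with (z0 := z0); auto.
  intros x y Hxr Hyr.
  destruct (Ceq_dec (x, y) z0) as [E|Hne].
  - rewrite E. intros eps Heps.
    destruct (proj1 (cderiv_eps f z0 df) Hdf (eps / 2) ltac:(lra)) as [delta [Hd H]].
    exists delta; split; [exact Hd|]. intros w Hw. unfold h.
    destruct (Ceq_dec z0 z0) as [_|Hn]; [|now contradict Hn].
    destruct (Ceq_dec w z0) as [_|Hwn].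
    + replace (df - df)%C with (RtoC 0) by ring. rewrite Cmod_0. exact Heps.
    + specialize (H w Hw).
      assert (Hn : (w - z0)%C <> 0) by now apply Cminus_eq_contra.
      assert (Hp : 0 < Cmod (w - z0)) by now apply Cmod_gt_0.
      replace ((f w - f z0) / (w - z0) - df)%C
        with ((f w - f z0 - (w - z0) * df) / (w - z0))%C by (field; exact Hn).
      rewrite Cmod_div by exact Hn.
      apply Rle_lt_trans with (eps / 2); [|lra].
      apply Rmult_le_reg_r with (Cmod (w - z0)); [exact Hp|].
      unfold Rdiv at 1. rewrite Rmult_assoc, Rinv_l by lra. lra.
  - apply holo_ccont, Hh; [now split|exact Hne].
Qed.

(** For [z0] inside the rectangle this is 2 pi i; the arguments below divide by it and ask only that
    it is nonzero. *)
Definition winding (z0 : C) (a b c d : R) : C :=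
  rect_int (fun z => / (z - z0))%C a b c d.

Lemma off_boundary (z0 z : C) (a b c d : R) :
  a < Re z0 < b -> c < Im z0 < d -> on_boundary z a b c d -> z <> z0.
Proof. intros Hx Hy [_ Hb] ->. lra. Qed.

Lemma ccont_inv_sub (z0 z : C) : z <> z0 -> ccont (fun w => / (w - z0))%C z.
Proof.
  intros H. apply holo_ccont, holo_inv; [now apply Cminus_eq_contra|].
  apply holo_minus; [apply holo_id|apply holo_const].
Qed.

Lemma cauchy_formula (f : C -> C) (z0 : C) (a b c d : R) :
  a < Re z0 < b -> c < Im z0 < d ->
  (forall z, in_rect z a b c d -> holo f z) ->
  (f z0 * winding z0 a b c d = rect_int (fun z => f z * / (z - z0)) a b c d)%C.
Proof.
  intros Hx Hy Hf. unfold winding.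
  assert (Hc1 : ccont_boundary (fun z => / (z - z0))%C a b c d).
  { intros z Hz. apply ccont_inv_sub. now apply (off_boundary z0 z a b c d). }
  assert (Hc2 : ccont_boundary (fun z => (f z - f z0) / (z - z0))%C a b c d).
  { intros z Hz. apply ccont_mult; [|now apply Hc1].
    apply holo_ccont, holo_minus; [now apply Hf, Hz|apply holo_const]. }
  rewrite <- rect_int_scal by (auto; lra).
  rewrite (rect_int_ext (fun z => f z * / (z - z0))%C
    (fun z => (f z - f z0) / (z - z0) + f z0 * / (z - z0))%C).
  - rewrite rect_int_plus; try lra; [|exact Hc2|].
    + rewrite rect_int_quotient by auto. ring.
    + intros z Hz. apply ccont_mult; [apply ccont_const|now apply Hc1].
  - lra.
  - lra.
  - intros z Hz. field. apply Cminus_eq_contra. now apply (off_boundary z0 z a b c d).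
Qed.

Lemma RInt_pos_lt (g : R -> R) (a b m : R) :
  a < b -> 0 < m -> ex_RInt g a b -> (forall t, a < t < b -> m <= g t) -> 0 < RInt g a b.
Proof.
  intros Hab Hm Hg H. apply Rlt_le_trans with (RInt (fun _ => m) a b).
  - rewrite RInt_const. apply Rmult_lt_0_compat; lra.
  - apply RInt_le; auto; [lra|apply ex_RInt_const].
Qed.

Lemma Re_inv_sub (x y x0 y0 : R) :
  Re (/ ((x, y) - (x0, y0))) = (x - x0) / ((x - x0) ^ 2 + (y - y0) ^ 2).
Proof. reflexivity. Qed.

Lemma Im_inv_sub (x y x0 y0 : R) :
  Im (/ ((x, y) - (x0, y0))) = (y0 - y) / ((x - x0) ^ 2 + (y - y0) ^ 2).
Proof.
  replace (y0 - y) with (- (y - y0)) by ring. reflexivity.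
Qed.

(** Each of the four sides contributes a positive amount to the imaginary part: the integrand on a
    side is bounded below in modulus by the distance of [z0] to that side over [D], the square of
    the diagonal. *)
Lemma winding_neq_0 (z0 : C) (a b c d : R) :
  a < Re z0 < b -> c < Im z0 < d -> winding z0 a b c d <> 0.
Proof.
  destruct z0 as [x0 y0]. unfold Re, Im; simpl. intros Hx Hy.
  assert (Hc : ccont_boundary (fun z => / (z - (x0, y0)))%C a b c d).
  { intros z Hz. apply ccont_inv_sub. apply (off_boundary (x0, y0) z a b c d); auto. }
  destruct (boundary_pcont _ a b c d ltac:(lra) ltac:(lra) Hc) as [C1 [C2 [C3 C4]]].
  set (D := (b - a) ^ 2 + (d - c) ^ 2).
  assert (Himpos : forall (u v : R), a <= u <= b -> c <= v <= d -> v <> y0 \/ u <> x0 ->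
     (0 < (u - x0) ^ 2 + (v - y0) ^ 2 <= D)).
  { intros u v Hu Hv Hne. split.
    - assert (H1 := pow2_ge_0 (u - x0)). assert (H2 := pow2_ge_0 (v - y0)).
      destruct Hne as [Hne|Hne].
      + assert (0 < (v - y0) ^ 2) by (apply pow2_gt_0; lra). lra.
      + assert (0 < (u - x0) ^ 2) by (apply pow2_gt_0; lra). lra.
    - unfold D. apply Rplus_le_compat; nra. }
  assert (HD : 0 < D) by (unfold D; nra).
  assert (Hfrac : forall k n, 0 < k -> 0 < n <= D -> k / D <= k / n).
  { intros k n Hk Hn. apply Rmult_le_compat_l; [lra|]. apply Rinv_le_contravar; lra. }
  assert (I1 : 0 < Im (CInt (fun x => / ((x, c) - (x0, y0)))%C a b)).
  { assert (H := is_CInt_Im _ _ _ _ (CInt_correct _ a b ltac:(lra) C1)).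
    rewrite <- (is_RInt_unique _ _ _ _ H).
    apply RInt_pos_lt with ((y0 - c) / D); [lra|apply Rdiv_lt_0_compat; lra|eexists; exact H|].
    intros t Ht. rewrite Im_inv_sub. apply Hfrac; [lra|apply Himpos; lra]. }
  assert (I3 : Im (CInt (fun x => / ((x, d) - (x0, y0)))%C a b) < 0).
  { assert (H := is_CInt_Im _ _ _ _ (CInt_correct _ a b ltac:(lra) C3)).
    rewrite <- (is_RInt_unique _ _ _ _ H).
    assert (H' := is_RInt_opp (V := R_NormedModule) _ _ _ _ H).
    enough (0 < RInt (fun x => - Im (/ ((x, d) - (x0, y0)))%C) a b).
    { assert (E : RInt (fun x => - Im (/ ((x, d) - (x0, y0)))%C) a b
        = - Im (CInt (fun x => / ((x, d) - (x0, y0)))%C a b)) by exact (is_RInt_unique _ _ _ _ H').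
      rewrite (is_RInt_unique _ _ _ _ H). lra. }
    apply RInt_pos_lt with ((d - y0) / D); [lra|apply Rdiv_lt_0_compat; lra|eexists; exact H'|].
    intros t Ht. rewrite Im_inv_sub.
    replace (- ((y0 - d) / _)) with ((d - y0) / ((t - x0) ^ 2 + (d - y0) ^ 2))
      by (unfold Rdiv; ring).
    apply Hfrac; [lra|apply Himpos; lra]. }
  assert (I2 : 0 < Re (CInt (fun y => / ((b, y) - (x0, y0)))%C c d)).
  { assert (H := is_CInt_Re _ _ _ _ (CInt_correct _ c d ltac:(lra) C2)).
    rewrite <- (is_RInt_unique _ _ _ _ H).
    apply RInt_pos_lt with ((b - x0) / D); [lra|apply Rdiv_lt_0_compat; lra|eexists; exact H|].
    intros t Ht. rewrite Re_inv_sub. apply Hfrac; [lra|apply Himpos; lra]. }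
  assert (I4 : Re (CInt (fun y => / ((a, y) - (x0, y0)))%C c d) < 0).
  { assert (H := is_CInt_Re _ _ _ _ (CInt_correct _ c d ltac:(lra) C4)).
    rewrite <- (is_RInt_unique _ _ _ _ H).
    assert (H' := is_RInt_opp (V := R_NormedModule) _ _ _ _ H).
    enough (0 < RInt (fun y => - Re (/ ((a, y) - (x0, y0)))%C) c d).
    { assert (E : RInt (fun y => - Re (/ ((a, y) - (x0, y0)))%C) c d
        = - Re (CInt (fun y => / ((a, y) - (x0, y0)))%C c d)) by exact (is_RInt_unique _ _ _ _ H').
      rewrite (is_RInt_unique _ _ _ _ H). lra. }
    apply RInt_pos_lt with ((x0 - a) / D); [lra|apply Rdiv_lt_0_compat; lra|eexists; exact H'|].
    intros t Ht. rewrite Re_inv_sub.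
    replace (- ((a - x0) / _)) with ((x0 - a) / ((a - x0) ^ 2 + (t - y0) ^ 2))
      by (unfold Rdiv; ring).
    apply Hfrac; [lra|apply Himpos; lra]. }
  intros H. apply (f_equal Im) in H. unfold winding, rect_int in H.
  unfold Cminus in H. rewrite !im_plus, !im_opp, !im_mult in H.
  change (Re Ci) with 0 in H. change (Im Ci) with 1 in H. change (Im 0) with 0 in H.
  unfold Cminus in *. lra.
Qed.

Lemma pcont_on_bounded (f : R -> C) (a b : R) :
  pcont_on f a b -> exists M, forall t, a <= t <= b -> Cmod (f t) <= M.
Proof.
  intros H.
  destruct (bounded_continuity (V := C_R_NormedModule) f a b H) as [M HM].
  exists M. intros t Ht. left. rewrite Cmod_norm. now apply HM.
Qed.

Lemma boundary_bounded (f : C -> C) (a b c d : R) :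
  a <= b -> c <= d -> ccont_boundary f a b c d ->
  exists M, 0 < M /\ forall z, on_boundary z a b c d -> Cmod (f z) <= M.
Proof.
  intros Hab Hcd Hc.
  destruct (boundary_pcont f a b c d Hab Hcd Hc) as [C1 [C2 [C3 C4]]].
  destruct (pcont_on_bounded _ _ _ C1) as [M1 H1].
  destruct (pcont_on_bounded _ _ _ C2) as [M2 H2].
  destruct (pcont_on_bounded _ _ _ C3) as [M3 H3].
  destruct (pcont_on_bounded _ _ _ C4) as [M4 H4].
  exists (Rabs M1 + Rabs M2 + Rabs M3 + Rabs M4 + 1).
  assert (A1 := Rle_abs M1). assert (A2 := Rle_abs M2).
  assert (A3 := Rle_abs M3). assert (A4 := Rle_abs M4).
  assert (B1 := Rabs_pos M1). assert (B2 := Rabs_pos M2).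
  assert (B3 := Rabs_pos M3). assert (B4 := Rabs_pos M4).
  split; [lra|].
  intros [x y] [[Hx Hy] Hb]. unfold Re, Im in *; simpl in *.
  destruct Hb as [-> | [-> | [-> | ->]]].
  - specialize (H4 y Hy). simpl in H4. lra.
  - specialize (H2 y Hy). simpl in H2. lra.
  - specialize (H1 x Hx). simpl in H1. lra.
  - specialize (H3 x Hx). simpl in H3. lra.
Qed.

Lemma boundary_far (z : C) (a : C) (r : R) :
  on_boundary z (Re a - r) (Re a + r) (Im a - r) (Im a + r) -> r <= Cmod (z - a).
Proof.
  intros [_ H].
  assert (HR := re_le_Cmod (z - a)). assert (HI := im_le_Cmod (z - a)).
  unfold Cminus in HR, HI. rewrite re_plus, re_opp in HR. rewrite im_plus, im_opp in HI.
  destruct H as [E | [E | [E | E]]]; rewrite E in *.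
  - replace (Re a - r + - Re a) with (- r) in HR by ring.
    rewrite Rabs_Ropp in HR. assert (H := Rle_abs r). unfold Cminus in *. lra.
  - replace (Re a + r + - Re a) with r in HR by ring.
    assert (H := Rle_abs r). unfold Cminus in *. lra.
  - replace (Im a - r + - Im a) with (- r) in HI by ring.
    rewrite Rabs_Ropp in HI. assert (H := Rle_abs r). unfold Cminus in *. lra.
  - replace (Im a + r + - Im a) with r in HI by ring.
    assert (H := Rle_abs r). unfold Cminus in *. lra.
Qed.

Lemma interior_square (z a : C) (r : R) : Cmod (z - a) < r ->
  Re a - r < Re z < Re a + r /\ Im a - r < Im z < Im a + r.
Proof.
  intros H.
  assert (HR := re_le_Cmod (z - a)). assert (HI := im_le_Cmod (z - a)).
  unfold Cminus in HR, HI, H. rewrite re_plus, re_opp in HR. rewrite im_plus, im_opp in HI.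
  assert (H1 := Rle_lt_trans _ _ _ HR H). assert (H2 := Rle_lt_trans _ _ _ HI H).
  apply Rabs_def2 in H1. apply Rabs_def2 in H2. lra.
Qed.

Lemma geom_small (q K e : R) : 0 <= q < 1 -> 0 <= K -> 0 < e -> exists n, K * q ^ n < e.
Proof.
  intros Hq HK He.
  destruct (pow_lt_1_zero q ltac:(rewrite Rabs_pos_eq; lra) (e / (K + 1))
    ltac:(apply Rdiv_lt_0_compat; lra)) as [n Hn].
  exists n. specialize (Hn n (Nat.le_refl n)).
  assert (Hp : 0 <= q ^ n) by (apply pow_le; lra). rewrite Rabs_pos_eq in Hn by lra.
  apply Rle_lt_trans with ((K + 1) * q ^ n); [nra|].
  apply Rmult_lt_reg_l with (/ (K + 1)); [apply Rinv_0_lt_compat; lra|].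
  rewrite <- Rmult_assoc, Rinv_l by lra. unfold Rdiv in Hn. lra.
Qed.

(* Cauchy's formula for [f(z) ((z0 - a) / (z - a))^n], which is holomorphic since
   [f] vanishes near [a]; let [n] tend to infinity. *)
Lemma identity_disc (f : C -> C) (a z0 : C) (r rho : R) :
  0 < r -> (forall w, Cmod (w - a) < r -> f w = RtoC 0) ->
  (forall z, in_rect z (Re a - rho) (Re a + rho) (Im a - rho) (Im a + rho) -> holo f z) ->
  Cmod (z0 - a) < rho -> f z0 = RtoC 0.
Proof.
  intros Hr Hz Hf Hz0.
  destruct (Ceq_dec z0 a) as [->|Hne].
  { apply Hz. replace (a - a)%C with (RtoC 0) by ring. now rewrite Cmod_0. }
  assert (Hza : (z0 - a)%C <> 0) by now apply Cminus_eq_contra.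
  assert (Hq0 := Cmod_ge_0 (z0 - a)). set (q := Cmod (z0 - a)) in *.
  destruct (interior_square _ _ _ Hz0) as [Hx Hy].
  set (x1 := Re a - rho) in *. set (x2 := Re a + rho) in *.
  set (y1 := Im a - rho) in *. set (y2 := Im a + rho) in *.
  assert (Hcf : ccont_boundary f x1 x2 y1 y2) by (intros z [H _]; now apply holo_ccont, Hf).
  destruct (boundary_bounded f x1 x2 y1 y2 ltac:(lra) ltac:(lra) Hcf) as [M [HM HfM]].
  set (W := winding z0 x1 x2 y1 y2).
  assert (HW : W <> 0) by (apply winding_neq_0; lra).
  apply NNPP. intros Hfz.
  assert (Hpos : 0 < Cmod (f z0 * W)) by now apply Cmod_gt_0, Cmult_neq_0.
  (* On the boundary [(z0 - a) / (z - a)] has modulus at most [q / rho < 1] and [1 / (z - z0)] at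
     most [1 / (rho - q)]; [n] makes the resulting bound for the integral smaller than the value it
     should equal. *)
  destruct (geom_small (q / rho) (2 * (x2 - x1 + (y2 - y1)) * (M / (rho - q)))
    (Cmod (f z0 * W))) as [n Hn]; [split| |exact Hpos|].
  { apply Rmult_le_pos; [exact Hq0|left; apply Rinv_0_lt_compat; lra]. }
  { apply Rmult_lt_reg_r with rho; [lra|]. unfold Rdiv. rewrite Rmult_assoc, Rinv_l by lra. lra. }
  { apply Rmult_le_pos; [lra|]. left; apply Rdiv_lt_0_compat; lra. }
  set (g := fun z => (f z * ((z0 - a) / (z - a)) ^ n)%C).
  assert (Hg : forall z, in_rect z x1 x2 y1 y2 -> holo g z).
  { intros z Hzr. destruct (Ceq_dec z a) as [->|Hza'].
    - apply holo_ext_loc with (fun _ => RtoC 0); [|apply holo_const].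
      exists r. split; [exact Hr|]. intros w Hw. unfold g. rewrite Hz by exact Hw. ring.
    - apply holo_mult; [now apply Hf|].
      apply holo_pow, holo_div; [now apply Cminus_eq_contra|apply holo_const|].
      apply holo_minus; [apply holo_id|apply holo_const]. }
  assert (HC := cauchy_formula g z0 x1 x2 y1 y2 Hx Hy Hg). fold W in HC.
  replace (g z0) with (f z0) in HC.
  2:{ unfold g. replace ((z0 - a) / (z0 - a))%C with (RtoC 1) by (field; exact Hza).
      rewrite Cpow_1_l. ring. }
  rewrite HC in Hn.
  assert (Hb := rect_int_norm_le (fun z => g z * / (z - z0))%C x1 x2 y1 y2
     (M / (rho - q) * (q / rho) ^ n) ltac:(lra) ltac:(lra)).
  apply Rlt_not_le in Hn. apply Hn. rewrite Rmult_assoc. apply Hb.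
  - intros z Hzb. apply ccont_mult; [apply holo_ccont, Hg, Hzb|].
    apply ccont_inv_sub. apply (off_boundary z0 z x1 x2 y1 y2); auto.
  - intros z Hzb. unfold g.
    assert (Hfar := boundary_far z a rho Hzb).
    assert (Hne1 : z <> z0) by (apply (off_boundary z0 z x1 x2 y1 y2); auto).
    assert (Hne1' : (z - z0)%C <> 0) by now apply Cminus_eq_contra.
    assert (Hne2 : (z - a)%C <> 0) by (apply Cmod_gt_0; lra).
    assert (Hd : rho - q <= Cmod (z - z0)).
    { assert (H := Cmod_minus_triangle z z0 a). unfold q. lra. }
    rewrite !Cmod_mult, Cmod_inv, Cmod_pow, Cmod_div by assumption. fold q.
    assert (Hr1 : (q / Cmod (z - a)) ^ n <= (q / rho) ^ n).
    { apply pow_incr. split.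
      - apply Rmult_le_pos; [exact Hq0|left; apply Rinv_0_lt_compat; lra].
      - apply Rmult_le_compat_l; [exact Hq0|]. apply Rinv_le_contravar; lra. }
    assert (Hr2 : / Cmod (z - z0) <= / (rho - q)) by (apply Rinv_le_contravar; lra).
    assert (Hr3 : 0 <= (q / Cmod (z - a)) ^ n).
    { apply pow_le, Rmult_le_pos; [exact Hq0|left; apply Rinv_0_lt_compat; lra]. }
    assert (Hr4 : 0 < / Cmod (z - z0)) by (apply Rinv_0_lt_compat; lra).
    unfold Rdiv at 2.
    replace (M * / (rho - q) * (q / rho) ^ n) with (M * (q / rho) ^ n * / (rho - q)) by ring.
    apply Rmult_le_compat; [|lra| |exact Hr2].
    + apply Rmult_le_pos; [apply Cmod_ge_0|exact Hr3].
    + apply Rmult_le_compat; [apply Cmod_ge_0|exact Hr3|now apply HfM|exact Hr1].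
Qed.

(** Vanishing spreads leftwards along horizontal lines off the real axis, where the possible
    singularity at 1 is out of the way. The real axis is reached by continuity from above. *)
Theorem identity_half_plane (f : C -> C) (c A : R) :
  (forall s, c < Re s -> s <> RtoC 1 -> holo f s) ->
  (forall s, A < Re s -> f s = RtoC 0) ->
  forall s, c < Re s -> s <> RtoC 1 -> f s = RtoC 0.
Proof.
  intros Hf HA.
  assert (Hline : forall x0 y, c < x0 -> y <> 0 -> f (x0, y) = RtoC 0).
  { intros x0 y Hx0 Hy.
    assert (Hy' := Rabs_pos_lt y Hy).
    (* The first bound keeps the squares off the real axis, the second keeps them in the half-plane.
       Successive centres differ by [rho / 2], so each square contains a neighbourhood of the next
       point to the left. *)
    set (rho := Rmin (Rabs y / 2) (x0 - c)).
    assert (Hrho : 0 < rho) by (apply Rmin_pos; lra).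
    assert (Hrho1 : rho <= Rabs y / 2) by apply Rmin_l.
    assert (Hrho2 : rho <= x0 - c) by apply Rmin_r.
    assert (Hk : forall k : nat, forall x, x0 <= x -> A + 1 - INR k * (rho / 2) < x ->
      exists r, 0 < r /\ forall w, Cmod (w - (x, y)) < r -> f w = RtoC 0).
    { induction k as [|k IH]; intros x Hx1 Hx2.
      - exists 1. split; [lra|]. intros w Hw. apply HA.
        simpl in Hx2. apply interior_square in Hw. unfold Re at 1 3 in Hw. simpl in Hw. lra.
      - destruct (IH (x + rho / 2)) as [r [Hr Hz]]; [lra| |].
        { rewrite S_INR in Hx2. lra. }
        exists (rho / 2). split; [lra|]. intros w Hw.
        apply (identity_disc f (x + rho / 2, y) w r rho Hr Hz).
        + intros [u v] [Hu Hv]. unfold Re, Im in Hu, Hv. simpl in Hu, Hv.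
          apply Hf.
          * unfold Re; simpl. lra.
          * intros [= _ Ev]. subst v.
            destruct (Rcase_abs y) as [Hn|Hn];
            [rewrite Rabs_left in * by lra|rewrite Rabs_right in * by lra]; lra.
        + eapply Rle_lt_trans; [apply (Cmod_minus_triangle w (x, y))|].
          rewrite Cmod_horizontal.
          replace (x - (x + rho / 2)) with (- (rho / 2)) by ring.
          rewrite Rabs_Ropp, Rabs_pos_eq by lra. lra. }
    destruct (Rle_or_lt (A + 1 - x0) 0) as [H0|H0].
    - apply HA. unfold Re; simpl. lra.
    - destruct (nfloor_ex ((A + 1 - x0) / (rho / 2))) as [k Hk2].
      { apply Rmult_le_pos; [lra|left; apply Rinv_0_lt_compat; lra]. }
      destruct (Hk (S k) x0) as [r [Hr Hz]]; [lra| |].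
      + rewrite S_INR. destruct Hk2 as [_ Hk2].
        assert (H1 : (A + 1 - x0) / (rho / 2) * (rho / 2) < (INR k + 1) * (rho / 2))
          by (apply Rmult_lt_compat_r; lra).
        replace ((A + 1 - x0) / (rho / 2) * (rho / 2)) with (A + 1 - x0) in H1 by (field; lra).
        lra.
      + apply Hz. rewrite Cmod_horizontal. replace (x0 - x0) with 0 by ring. now rewrite Rabs_R0. }
  intros [x y] Hx Hne. unfold Re in Hx; simpl in Hx.
  destruct (Req_dec y 0) as [->|Hy]; [|now apply Hline].
  apply ccont_lim_zero; [now apply holo_ccont, Hf|].
  intros r Hr. exists (x, r / 2). split.
  - rewrite Cmod_vertical. rewrite Rabs_pos_eq; lra.
  - apply Hline; lra.
Qed.

(** * Locally uniform limits of holomorphic functions *)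

(** Differentiation under the integral sign at the centre: the second order remainder of the kernel
    is [(z - z0)^2 / ((w - z) (w - z0)^2)]. Only continuity of [phi] on the boundary enters. *)
Lemma holo_cauchy_integral (phi : C -> C) (z0 : C) (r : R) :
  0 < r ->
  ccont_boundary phi (Re z0 - r) (Re z0 + r) (Im z0 - r) (Im z0 + r) ->
  holo (fun z => rect_int (fun w => phi w * / (w - z))%C
          (Re z0 - r) (Re z0 + r) (Im z0 - r) (Im z0 + r)) z0.
Proof.
  intros Hr Hc.
  set (x1 := Re z0 - r) in *. set (x2 := Re z0 + r) in *.
  set (y1 := Im z0 - r) in *. set (y2 := Im z0 + r) in *.
  assert (Hx12 : x1 <= x2) by (unfold x1, x2; lra).
  assert (Hy12 : y1 <= y2) by (unfold y1, y2; lra).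
  destruct (boundary_bounded phi x1 x2 y1 y2 Hx12 Hy12 Hc) as [M [HM HpM]].
  assert (Hinv : forall z, Cmod (z - z0) < r ->
    ccont_boundary (fun w => / (w - z))%C x1 x2 y1 y2).
  { intros z Hz w Hw. apply ccont_inv_sub. apply (off_boundary z w x1 x2 y1 y2); auto;
    apply interior_square in Hz; unfold x1, x2, y1, y2; lra. }
  assert (Hz00 : Cmod (z0 - z0) < r).
  { replace (z0 - z0)%C with (RtoC 0) by ring. now rewrite Cmod_0. }
  exists (rect_int (fun w => phi w * (/ (w - z0) * / (w - z0)))%C x1 x2 y1 y2).
  apply cderiv_eps. intros eps Heps.
  (* Perimeter times the bound of the remainder: [Cmod (w - z0) >= r] and, for [z] within [r / 2] of
     the centre, [Cmod (w - z) >= r / 2], whence [2 / r^3]. *)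
  set (K := 2 * (x2 - x1 + (y2 - y1)) * (M * (2 / (r * r * r)))).
  assert (HK : 0 < K).
  { unfold K, x1, x2, y1, y2. apply Rmult_lt_0_compat; [lra|].
    apply Rmult_lt_0_compat; [lra|]. apply Rdiv_lt_0_compat; [lra|].
    repeat apply Rmult_lt_0_compat; lra. }
  exists (Rmin (r / 2) (eps / K)). split; [apply Rmin_pos; [lra|now apply Rdiv_lt_0_compat]|].
  intros z Hz.
  assert (Hz1 := Rlt_le_trans _ _ _ Hz (Rmin_l _ _)).
  assert (Hz2 := Rlt_le_trans _ _ _ Hz (Rmin_r _ _)).
  assert (Hzr : Cmod (z - z0) < r) by lra.
  assert (Hc0 := Hinv z0 Hz00). assert (Hcz := Hinv z Hzr).
  assert (HB0 : ccont_boundary (fun w => phi w * / (w - z0))%C x1 x2 y1 y2)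
    by (intros w Hw; apply ccont_mult; auto).
  assert (HB1 : ccont_boundary (fun w => phi w * / (w - z))%C x1 x2 y1 y2)
    by (intros w Hw; apply ccont_mult; auto).
  assert (HB2 : ccont_boundary (fun w => phi w * (/ (w - z0) * / (w - z0)))%C x1 x2 y1 y2).
  { intros w Hw. apply ccont_mult; auto.
    apply (ccont_mult (fun w => / (w - z0))%C (fun w => / (w - z0))%C); auto. }
  assert (HB3 : ccont_boundary (fun w => -1 * (phi w * / (w - z0)))%C x1 x2 y1 y2)
    by (intros w Hw; apply ccont_mult; [apply ccont_const|auto]).
  assert (HB4 : ccont_boundary (fun w => - (z - z0) * (phi w * (/ (w - z0) * / (w - z0))))%C x1 x2 y1 y2)
    by (intros w Hw; apply ccont_mult; [apply ccont_const|auto]).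
  assert (HB5 : ccont_boundary (fun w => phi w * / (w - z) + -1 * (phi w * / (w - z0)))%C x1 x2 y1 y2)
    by (intros w Hw; apply ccont_plus; auto).
  assert (E : (rect_int (fun w => phi w * / (w - z)) x1 x2 y1 y2
     - rect_int (fun w => phi w * / (w - z0)) x1 x2 y1 y2
     - (z - z0) * rect_int (fun w => phi w * (/ (w - z0) * / (w - z0))) x1 x2 y1 y2)%C
    = rect_int (fun w => (phi w * / (w - z) + -1 * (phi w * / (w - z0)))
         + - (z - z0) * (phi w * (/ (w - z0) * / (w - z0))))%C x1 x2 y1 y2).
  { rewrite (rect_int_plus (fun w => phi w * / (w - z) + -1 * (phi w * / (w - z0)))%C
      (fun w => - (z - z0) * (phi w * (/ (w - z0) * / (w - z0))))%C); auto.
    rewrite (rect_int_plus (fun w => phi w * / (w - z))%C (fun w => -1 * (phi w * / (w - z0)))%C); auto.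
    rewrite (rect_int_scal (fun w => phi w * / (w - z0))%C); auto.
    rewrite (rect_int_scal (fun w => phi w * (/ (w - z0) * / (w - z0)))%C); auto.
    ring. }
  rewrite E.
  apply Rle_trans with (2 * (x2 - x1 + (y2 - y1)) *
     (M * (2 / (r * r * r)) * (Cmod (z - z0) * Cmod (z - z0)))).
  - apply rect_int_norm_le; auto.
    + intros w Hw; apply ccont_plus; auto.
    + intros w Hw.
      assert (Hfar := boundary_far w z0 r Hw).
      assert (Hn0 : (w - z0)%C <> 0) by (apply Cmod_gt_0; lra).
      assert (Hfz : r / 2 <= Cmod (w - z)).
      { assert (H := Cmod_minus_triangle w z z0). lra. }
      assert (Hnz : (w - z)%C <> 0) by (apply Cmod_gt_0; lra).
      replace (phi w * / (w - z) + -1 * (phi w * / (w - z0)) +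
        - (z - z0) * (phi w * (/ (w - z0) * / (w - z0))))%C
        with (phi w * (/ ((w - z) * (w - z0) * (w - z0))) * ((z - z0) * (z - z0)))%C
        by (field; auto).
      rewrite !Cmod_mult, Cmod_inv by (repeat apply Cmult_neq_0; auto).
      rewrite !Cmod_mult.
      assert (H0 := Cmod_ge_0 (z - z0)).
      apply Rmult_le_compat_r; [nra|].
      apply Rmult_le_compat; [apply Cmod_ge_0| |now apply HpM|].
      * left; apply Rinv_0_lt_compat. repeat apply Rmult_lt_0_compat; lra.
      * replace (2 / (r * r * r)) with (/ (r / 2 * r * r)) by (field; lra).
        apply Rinv_le_contravar; [repeat apply Rmult_lt_0_compat; lra|].
        apply Rmult_le_compat; [nra|lra| |lra].
        apply Rmult_le_compat; lra.
  - replace (2 * (x2 - x1 + (y2 - y1)) *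
     (M * (2 / (r * r * r)) * (Cmod (z - z0) * Cmod (z - z0))))
     with (K * Cmod (z - z0) * Cmod (z - z0)) by (unfold K; ring).
    apply Rmult_le_compat_r; [apply Cmod_ge_0|].
    apply Rlt_le, Rmult_lt_reg_l with (/ K); [now apply Rinv_0_lt_compat|].
    rewrite <- Rmult_assoc, Rinv_l by lra. unfold Rdiv in Hz2. lra.
Qed.

Definition holo_approx (F : C -> C) (z0 : C) (r : R) : Prop :=
  forall eps, 0 < eps -> exists G : C -> C,
    (forall z, Cmod (z - z0) < r -> holo G z) /\
    (forall z, Cmod (z - z0) < r -> Cmod (G z - F z) <= eps).

Lemma holo_approx_ccont (F : C -> C) (z0 z : C) (r : R) :
  holo_approx F z0 r -> Cmod (z - z0) < r -> ccont F z.
Proof.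
  intros H Hz eps Heps.
  destruct (H (eps / 3) ltac:(lra)) as [G [HG HGF]].
  destruct (holo_ccont G z (HG z Hz) (eps / 3) ltac:(lra)) as [delta [Hd Hc]].
  exists (Rmin delta (r - Cmod (z - z0))). split; [apply Rmin_pos; lra|].
  intros w Hw.
  assert (Hw1 := Rlt_le_trans _ _ _ Hw (Rmin_l _ _)).
  assert (Hw2 := Rlt_le_trans _ _ _ Hw (Rmin_r _ _)).
  assert (Hw3 : Cmod (w - z0) < r).
  { assert (H1 := Cmod_minus_triangle w z z0). lra. }
  assert (H1 := HGF w Hw3). assert (H2 := HGF z Hz). assert (H3 := Hc w Hw1).
  assert (H4 := Cmod_minus_triangle (F w) (G w) (F z)).
  assert (H5 := Cmod_minus_triangle (G w) (G z) (F z)).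
  rewrite Cmod_minus_sym in H1. lra.
Qed.

(** Cauchy's formula passes to uniform limits. Hence near [z0] the function [F] is the quotient of
    its own Cauchy integral by that of the constant 1, and both are holomorphic for merely
    continuous data. *)
Theorem weierstrass (F : C -> C) (z0 : C) (r : R) :
  0 < r -> holo_approx F z0 r -> holo F z0.
Proof.
  intros Hr HF.
  (* The square of half-side [r / 3] lies in the disc of radius [r], as the sum of the two
     coordinate distances is at most [2 r / 3]. *)
  set (e := r / 3). assert (He : 0 < e) by (unfold e; lra).
  set (x1 := Re z0 - e). set (x2 := Re z0 + e).
  set (y1 := Im z0 - e). set (y2 := Im z0 + e).
  assert (Hx12 : x1 <= x2) by (unfold x1, x2; lra).
  assert (Hy12 : y1 <= y2) by (unfold y1, y2; lra).
  assert (Hin : forall z, in_rect z x1 x2 y1 y2 -> Cmod (z - z0) < r).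
  { intros [u v] [Hu Hv]. destruct z0 as [u0 v0]. unfold x1, x2, y1, y2, Re, Im in *; simpl in *.
    eapply Rle_lt_trans; [apply Cmod_le_add|]. simpl.
    assert (Rabs (u + - u0) <= e) by (apply Rabs_le; lra).
    assert (Rabs (v + - v0) <= e) by (apply Rabs_le; lra). unfold e in *. lra. }
  assert (HcF : ccont_boundary F x1 x2 y1 y2).
  { intros z [Hz _]. apply (holo_approx_ccont F z0 z r HF). now apply Hin. }
  assert (Hc1 : ccont_boundary (fun _ => RtoC 1) x1 x2 y1 y2) by (intros z _; apply ccont_const).
  assert (HJ := holo_cauchy_integral F z0 e He HcF).
  assert (HW := holo_cauchy_integral (fun _ => RtoC 1) z0 e He Hc1).
  fold x1 x2 y1 y2 in HJ, HW.
  assert (HWeq : forall z, rect_int (fun w => 1 * / (w - z))%C x1 x2 y1 y2 = winding z x1 x2 y1 y2).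
  { intros z. apply rect_int_ext; auto. intros w _. ring. }
  assert (HWne : forall z, Cmod (z - z0) < e -> winding z x1 x2 y1 y2 <> 0).
  { intros z Hz. apply interior_square in Hz. apply winding_neq_0; unfold x1, x2, y1, y2; lra. }
  refine (holo_ext_loc (fun z => rect_int (fun w => F w * / (w - z)) x1 x2 y1 y2 /
    rect_int (fun w => 1 * / (w - z)) x1 x2 y1 y2)%C F z0 _ _).
  2:{ apply holo_div; [|exact HJ|exact HW]. rewrite HWeq. apply HWne.
      replace (z0 - z0)%C with (RtoC 0) by ring. now rewrite Cmod_0. }
  exists e. split; [exact He|]. intros z Hz. rewrite HWeq.
  assert (HWz := HWne z Hz).
  enough (E : (F z * winding z x1 x2 y1 y2 = rect_int (fun w => F w * / (w - z)) x1 x2 y1 y2)%C).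
  { rewrite <- E. field. exact HWz. }
  assert (Hzsq : x1 < Re z < x2 /\ y1 < Im z < y2) by now apply interior_square.
  destruct Hzsq as [Hzx Hzy].
  set (dist := e - Cmod (z - z0)).
  assert (Hdist : 0 < dist) by (unfold dist; lra).
  assert (Hinv : ccont_boundary (fun w => / (w - z))%C x1 x2 y1 y2).
  { intros w Hw. apply ccont_inv_sub. now apply (off_boundary z w x1 x2 y1 y2). }
  apply Ceq_minus, Cmod_eq_0, Rle_antisym; [|apply Cmod_ge_0].
  apply Rnot_lt_le. intros Hlt.
  set (eta := Cmod (F z * winding z x1 x2 y1 y2 - rect_int (fun w => F w * / (w - z)) x1 x2 y1 y2)%C) in *.
  (* [K] collects the two effects of replacing [F] by [G], at the point [z] and in the boundary
     integral; an approximation to within [eta / (2 K)] leaves a discrepancy of at most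
     [eta / 2]. *)
  set (K := Cmod (winding z x1 x2 y1 y2) + 2 * (x2 - x1 + (y2 - y1)) * / dist).
  assert (HK : 0 < K).
  { unfold K. assert (H := proj1 (Cmod_gt_0 _) HWz).
    assert (0 < / dist) by now apply Rinv_0_lt_compat. nra. }
  destruct (HF (eta / (2 * K)) ltac:(apply Rdiv_lt_0_compat; lra)) as [G [HG HGF]].
  assert (HCG := cauchy_formula G z x1 x2 y1 y2 Hzx Hzy (fun w Hw => HG w (Hin w Hw))).
  assert (HcG : ccont_boundary G x1 x2 y1 y2) by (intros w [Hw _]; apply holo_ccont, HG, Hin, Hw).
  assert (Hdiff : (rect_int (fun w => G w * / (w - z)) x1 x2 y1 y2
     - rect_int (fun w => F w * / (w - z)) x1 x2 y1 y2)%C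
     = rect_int (fun w => (G w * / (w - z)) + -1 * (F w * / (w - z)))%C x1 x2 y1 y2).
  { rewrite (rect_int_plus (fun w => G w * / (w - z))%C (fun w => -1 * (F w * / (w - z)))%C); auto.
    - rewrite (rect_int_scal (fun w => F w * / (w - z))%C); auto; [ring|].
      intros w Hw. apply ccont_mult; auto.
    - intros w Hw. apply ccont_mult; auto.
    - intros w Hw. apply ccont_mult; [apply ccont_const|apply ccont_mult; auto]. }
  assert (Hbd : Cmod (rect_int (fun w => (G w * / (w - z)) + -1 * (F w * / (w - z)))%C x1 x2 y1 y2)
     <= 2 * (x2 - x1 + (y2 - y1)) * (eta / (2 * K) * / dist)).
  { apply rect_int_norm_le; auto.
    - intros w Hw. apply ccont_plus; [apply ccont_mult; auto|].
      apply ccont_mult; [apply ccont_const|apply ccont_mult; auto].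
    - intros w Hw.
      assert (Hfar := boundary_far w z0 e Hw).
      assert (Hd : dist <= Cmod (w - z)).
      { assert (H := Cmod_minus_triangle w z z0). unfold dist. lra. }
      assert (Hnz : (w - z)%C <> 0) by (apply Cmod_gt_0; lra).
      replace (G w * / (w - z) + -1 * (F w * / (w - z)))%C with ((G w - F w) * / (w - z))%C by ring.
      rewrite Cmod_mult, Cmod_inv by exact Hnz.
      apply Rmult_le_compat; [apply Cmod_ge_0|left; apply Rinv_0_lt_compat; lra| |].
      + apply HGF, Hin, Hw.
      + apply Rinv_le_contravar; lra. }
  assert (Hlast : eta <= eta / (2 * K) * K).
  { unfold eta at 1.
    replace (F z * winding z x1 x2 y1 y2 - rect_int (fun w => F w * / (w - z)) x1 x2 y1 y2)%C
      with (- (G z - F z) * winding z x1 x2 y1 y2 +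
        (rect_int (fun w => G w * / (w - z)) x1 x2 y1 y2
          - rect_int (fun w => F w * / (w - z)) x1 x2 y1 y2))%C by (rewrite <- HCG; ring).
    eapply Rle_trans; [apply Cmod_triangle|]. rewrite Hdiff, Cmod_mult, Cmod_opp.
    assert (H1 := HGF z ltac:(unfold e in *; lra)).
    assert (H2 := Cmod_ge_0 (winding z x1 x2 y1 y2)).
    unfold K at 2. nra. }
  replace (eta / (2 * K) * K) with (eta / 2) in Hlast by (field; lra).
  lra.
Qed.

(** * Series of complex numbers and of holomorphic functions *)

Notation csum a n := (@sum_n C_AbelianMonoid a n).
Notation is_cseries a l := (@is_series C_AbsRing C_NormedModule a l).

Lemma is_cseries_eps (a : nat -> C) (l : C) :
  is_cseries a l <->
  forall eps, 0 < eps -> exists N, forall n, (N <= n)%nat -> Cmod (csum a n - l) < eps.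
Proof.
  split.
  - intros H eps Heps.
    assert (He : 0 < eps / 2) by lra.
    destruct (H (ball (M := C_UniformSpace) l (mkposreal _ He))) as [N HN].
    { now exists (mkposreal _ He). }
    exists N. intros n Hn. destruct (HN n Hn) as [H1 H2].
    change (Rabs (fst (csum a n) - fst l) < eps / 2) in H1.
    change (Rabs (snd (csum a n) - snd l) < eps / 2) in H2.
    change (csum a n - l)%C with (fst (csum a n) - fst l, snd (csum a n) - snd l).
    eapply Rle_lt_trans; [apply Cmod_le_add|]. lra.
  - intros H P [eps HP].
    destruct (H eps (cond_pos eps)) as [N HN].
    exists N. intros n Hn. apply HP. specialize (HN n Hn).
    split.
    + change (Rabs (Re (csum a n) + - Re l) < eps).
      rewrite <- re_opp, <- re_plus. eapply Rle_lt_trans; [apply re_le_Cmod|exact HN].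
    + change (Rabs (Im (csum a n) + - Im l) < eps).
      rewrite <- im_opp, <- im_plus. eapply Rle_lt_trans; [apply im_le_Cmod|exact HN].
Qed.

Lemma is_cseries_unique (a : nat -> C) (l1 l2 : C) :
  is_cseries a l1 -> is_cseries a l2 -> l1 = l2.
Proof.
  rewrite !is_cseries_eps. intros H1 H2.
  apply Ceq_minus, Cmod_eq_0, Rle_antisym; [|apply Cmod_ge_0].
  apply Rnot_lt_le. intros Hlt.
  destruct (H1 _ (Rdiv_lt_0_compat _ 2 Hlt ltac:(lra))) as [N1 HN1].
  destruct (H2 _ (Rdiv_lt_0_compat _ 2 Hlt ltac:(lra))) as [N2 HN2].
  specialize (HN1 (N1 + N2)%nat ltac:(lia)). specialize (HN2 (N1 + N2)%nat ltac:(lia)).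
  rewrite Cmod_minus_sym in HN1.
  assert (H := Cmod_minus_triangle l1 (csum a (N1 + N2)) l2). lra.
Qed.

Lemma csum_S (a : nat -> C) (n : nat) : csum a (S n) = (csum a n + a (S n))%C.
Proof. apply (sum_Sn (G := C_AbelianMonoid)). Qed.

Lemma csum_0 (a : nat -> C) : csum a 0 = a O.
Proof. apply (sum_O (G := C_AbelianMonoid)). Qed.

Lemma csum_ext (a b : nat -> C) (n : nat) :
  (forall k, (k <= n)%nat -> a k = b k) -> csum a n = csum b n.
Proof.
  induction n as [|n IH]; intros H; [rewrite !csum_0; now apply H|].
  rewrite !csum_S, IH, H by (intros; try apply H; lia). reflexivity.
Qed.

Lemma csum_holo (u : nat -> C -> C) (z : C) (n : nat) :
  (forall k, holo (u k) z) -> holo (fun w => csum (fun k => u k w) n) z.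
Proof.
  intros H. induction n as [|n IH].
  - apply holo_ext with (u O); [intros w; now rewrite csum_0|apply H].
  - apply holo_ext with (fun w => csum (fun k => u k w) n + u (S n) w)%C;
      [intros w; now rewrite csum_S|]. now apply holo_plus.
Qed.

(** A total sum, arbitrary for divergent series. This makes a function of [z] out of a series before
    its convergence is discussed. *)
Definition cseries (a : nat -> C) : C := epsilon (inhabits (RtoC 0)) (fun l => is_cseries a l).

Lemma cseries_unique (a : nat -> C) (l : C) : is_cseries a l -> cseries a = l.
Proof.
  intros H. apply (is_cseries_unique a); [|exact H].
  unfold cseries. apply epsilon_spec. now exists l.
Qed.

Lemma csum_diff_le (a : nat -> C) (g : nat -> R) (n k : nat) :
  (forall j, (n < j)%nat -> Cmod (a j) <= g j - g (S j)) ->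
  Cmod (csum a (n + k) - csum a n) <= g (S n) - g (S (n + k)).
Proof.
  intros H. induction k as [|k IH].
  - rewrite Nat.add_0_r. replace (csum a n - csum a n)%C with (RtoC 0) by ring. rewrite Cmod_0. lra.
  - rewrite Nat.add_succ_r, csum_S.
    replace (csum a (n + k) + a (S (n + k)) - csum a n)%C
      with ((csum a (n + k) - csum a n) + a (S (n + k)))%C by ring.
    eapply Rle_trans; [apply Cmod_triangle|].
    specialize (H (S (n + k)) ltac:(lia)). lra.
Qed.

(** Comparison with a telescoping series of sum [g 0]. The bounds force [g] to decrease, and as it
    tends to 0 it is nonnegative. *)
Lemma cseries_correct (a : nat -> C) (g : nat -> R) :
  (forall j, Cmod (a j) <= g j - g (S j)) -> is_lim_seq g 0 ->
  is_cseries a (cseries a).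
Proof.
  intros H Hg. unfold cseries. apply epsilon_spec.
  assert (Hpos : forall n, 0 <= g n).
  { intros n. apply (is_lim_seq_le (fun k => g (n + k)%nat) (fun _ => g n) 0 (g n)).
    - intros k. induction k as [|k IH]; [rewrite Nat.add_0_r; lra|].
      rewrite Nat.add_succ_r. assert (H1 := H (n + k)%nat).
      assert (H2 := Cmod_ge_0 (a (n + k)%nat)). lra.
    - apply is_lim_seq_ext with (fun k => g (k + n)%nat); [intros k; f_equal; lia|].
      now apply (is_lim_seq_incr_n g n).
    - apply is_lim_seq_const. }
  assert (Hex : @ex_series C_AbsRing C_CompleteNormedModule a).
  { apply (ex_series_le (K := C_AbsRing) (V := C_CompleteNormedModule) a (fun j => g j - g (S j))).
    - intros n. exact (H n).
    - exists (g O). change (is_lim_seq (sum_n (fun j => g j - g (S j))) (g O)).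
      apply is_lim_seq_spec. intros eps.
      apply is_lim_seq_spec in Hg. destruct (Hg eps) as [N HN].
      exists N. intros n Hn.
      assert (E : forall m, sum_n (fun j => g j - g (S j)) m = g O - g (S m)).
      { induction m as [|m IH]; [now rewrite sum_O|]. rewrite sum_Sn, IH. unfold plus; simpl. ring. }
      rewrite E. specialize (HN (S n) ltac:(lia)).
      replace (g O - g (S n) - g O) with (- (g (S n) - 0)) by ring. now rewrite Rabs_Ropp. }
  destruct Hex as [l Hl]. exists l. exact Hl.
Qed.

Lemma is_cseries_tail (a : nat -> C) (l : C) (g : nat -> R) (n : nat) :
  is_cseries a l -> (forall j, 0 <= g j) ->
  (forall j, (n < j)%nat -> Cmod (a j) <= g j - g (S j)) ->
  Cmod (csum a n - l) <= g (S n).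
Proof.
  rewrite is_cseries_eps. intros Hl Hg H.
  apply Rnot_lt_le. intros Hlt.
  destruct (Hl (Cmod (csum a n - l) - g (S n)) ltac:(lra)) as [N HN].
  specialize (HN (n + N)%nat ltac:(lia)).
  assert (H1 := csum_diff_le a g n N H). assert (H2 := Hg (S (n + N))).
  assert (H3 := Cmod_minus_triangle (csum a n) (csum a (n + N)) l).
  rewrite Cmod_minus_sym in H1. lra.
Qed.

(* The bounds on the terms are telescoping differences, so that tails are
   bounded by a single value of [g]. *)
Theorem holo_cseries (u : nat -> C -> C) (z0 : C) (r : R) (g : nat -> R) :
  0 < r -> is_lim_seq g 0 ->
  (forall j z, Cmod (z - z0) < r -> Cmod (u j z) <= g j - g (S j)) ->
  (forall j z, Cmod (z - z0) < r -> holo (u j) z) ->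
  holo (fun z => cseries (fun j => u j z)) z0.
Proof.
  intros Hr Hg Hb Hh. apply (weierstrass _ z0 r Hr). intros eps Heps.
  assert (Hpos : forall n, 0 <= g n).
  { assert (Hz0 : Cmod (z0 - z0) < r).
    { replace (z0 - z0)%C with (RtoC 0) by ring. now rewrite Cmod_0. }
    intros n. apply (is_lim_seq_le (fun k => g (n + k)%nat) (fun _ => g n) 0 (g n)).
    - intros k. induction k as [|k IH]; [rewrite Nat.add_0_r; lra|].
      rewrite Nat.add_succ_r. assert (H1 := Hb (n + k)%nat z0 Hz0).
      assert (H2 := Cmod_ge_0 (u (n + k)%nat z0)). lra.
    - apply is_lim_seq_ext with (fun k => g (k + n)%nat); [intros k; f_equal; lia|].
      now apply (is_lim_seq_incr_n g n).
    - apply is_lim_seq_const. }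
  assert (Hg' := Hg). apply is_lim_seq_spec in Hg'. destruct (Hg' (mkposreal eps Heps)) as [N HN].
  exists (fun z => csum (fun j => u j z) N). split.
  - intros z Hz. apply csum_holo. intros k. now apply Hh.
  - intros z Hz. apply Rle_trans with (g (S N)).
    + apply is_cseries_tail; auto.
      apply cseries_correct with g; auto.
    + specialize (HN (S N) ltac:(lia)). simpl in HN. rewrite Rminus_0_r in HN.
      apply Rabs_def2 in HN. lra.
Qed.

(** * Powers [n^-s] *)

(** The power [x^(-s)] for real [x], so that it can also be differentiated in [x], as the
    trapezoidal rule requires. *)
Definition ncp (x : R) (s : C) : C := Cexp (- s * RtoC (ln x)).

Lemma nat_cpow_inv (n : nat) (s : C) : (/ nat_cpow n s)%C = ncp (INR n) s.
Proof.
  unfold nat_cpow, ncp. rewrite <- Cexp_opp. f_equal. ring.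
Qed.

Lemma Cmod_ncp (x : R) (s : C) : Cmod (ncp x s) = exp (- Re s * ln x).
Proof. unfold ncp. rewrite Cmod_Cexp. f_equal. rewrite re_scal_r, re_opp. reflexivity. Qed.

Lemma ncp_plus (x : R) (s w : C) : ncp x (s + w) = (ncp x s * ncp x w)%C.
Proof. unfold ncp. rewrite <- Cexp_plus. f_equal. ring. Qed.

Lemma ncp_1 (s : C) : ncp 1 s = RtoC 1.
Proof. unfold ncp. rewrite ln_1. replace (- s * 0)%C with (RtoC 0) by ring. apply Cexp_0. Qed.

Lemma ncp_mult (x y : R) (s : C) : 0 < x -> 0 < y -> ncp (x * y) s = (ncp x s * ncp y s)%C.
Proof.
  intros Hx Hy. unfold ncp. rewrite <- Cexp_plus. f_equal.
  rewrite ln_mult, RtoC_plus by assumption. ring.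
Qed.

Lemma ncp_one (x : R) : 0 < x -> ncp x 1 = RtoC (/ x).
Proof.
  intros Hx. unfold ncp. replace (- (1) * ln x)%C with (RtoC (ln (/ x))).
  - rewrite Cexp_R, exp_ln; auto. now apply Rinv_0_lt_compat.
  - rewrite ln_Rinv by exact Hx. rewrite RtoC_opp. ring.
Qed.

Lemma holo_ncp (x : R) (s : C) : holo (fun w => ncp x w) s.
Proof.
  apply (holo_Cexp (fun w => - w * RtoC (ln x))%C).
  apply (holo_mult (fun w => - w)%C (fun _ => RtoC (ln x))); [|apply holo_const].
  apply (holo_opp (fun w => w)), holo_id.
Qed.

Lemma pderiv_ncp (s : C) (x : R) : 0 < x ->
  pderiv (fun u => ncp u s) x (- s * ncp x (s + 1))%C.
Proof.
  intros Hx.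
  assert (E : (- s * ncp x (s + 1))%C = (RtoC (/ x) * (- s * Cexp (RtoC (ln x) * - s)))%C).
  { rewrite ncp_plus, ncp_one by exact Hx.
    unfold ncp. replace (ln x * - s)%C with (- s * ln x)%C by ring. ring. }
  rewrite E, <- scal_R_Cmult.
  apply (is_derive_ext (fun u => Cexp (RtoC (ln u) * - s)%C)).
  { intros u. unfold ncp. f_equal. ring. }
  apply (is_derive_comp (K := R_AbsRing) (V := C_R_NormedModule) (fun v => Cexp (RtoC v * - s)%C) ln).
  - apply pderiv_Cexp_line.
  - apply is_derive_Reals, derivable_pt_lim_ln, Hx.
Qed.

Lemma ln_le_le (x y : R) : 0 < x -> x <= y -> ln x <= ln y.
Proof. intros Hx [H|H]; [left; now apply ln_increasing|rewrite H; lra]. Qed.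

Lemma exp_neg_ln_decr (a x y : R) : 0 <= a -> 0 < x -> x <= y -> exp (- a * ln y) <= exp (- a * ln x).
Proof. intros Ha Hx Hxy. apply exp_le. assert (H := ln_le_le x y Hx Hxy). nra. Qed.

(** The bracket is [a] times the integral of [u^(-a-1)] over [[x, x + 1]]. By the mean value theorem
    it is [a y^(-a-1)] with [y <= 2 x], which costs the factor [2^(a+1)]. *)
Lemma telescope_power (a x : R) : 0 < a -> 1 <= x ->
  exp (- (a + 1) * ln x) <=
  exp ((a + 1) * ln 2) / a * (exp (- a * ln x) - exp (- a * ln (x + 1))).
Proof.
  intros Ha Hx.
  destruct (MVT_gen (fun u => exp (- a * ln u)) x (x + 1) (fun u => - a * / u * exp (- a * ln u)))
    as [y [Hy E]].
  - rewrite Rmin_left, Rmax_right by lra. intros y Hy. auto_derive; [lra|ring].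
  - rewrite Rmin_left, Rmax_right by lra. intros y Hy.
    apply continuity_pt_filterlim.
    apply (ex_derive_continuous (K := R_AbsRing) (V := R_NormedModule) (fun u => exp (- a * ln u))).
    auto_derive. lra.
  - rewrite Rmin_left, Rmax_right in Hy by lra.
    replace (exp (- a * ln x) - exp (- a * ln (x + 1))) with (a * (/ y * exp (- a * ln y))) by lra.
    replace (/ y * exp (- a * ln y)) with (exp (- (a + 1) * ln y)).
    2:{ replace (- (a + 1) * ln y) with (- a * ln y + - ln y) by ring.
        rewrite exp_plus, exp_Ropp, exp_ln by lra. ring. }
    replace (exp ((a + 1) * ln 2) / a * (a * exp (- (a + 1) * ln y)))
      with (exp ((a + 1) * ln 2) * exp (- (a + 1) * ln y)) by (field; lra).
    rewrite <- exp_plus. apply exp_le.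
    assert (Hl : ln y <= ln 2 + ln x).
    { rewrite <- ln_mult by lra. apply ln_le_le; lra. }
    nra.
Qed.

Lemma is_lim_exp_neg_ln (a : R) : 0 < a ->
  is_lim_seq (fun n => exp (- a * ln (INR (S n)))) 0.
Proof.
  intros Ha. apply is_lim_seq_spec. intros eps.
  assert (He := cond_pos eps).
  destruct (nfloor_ex (exp (- ln eps / a))) as [N [_ HN]]; [left; apply exp_pos|].
  exists N. intros n Hn. rewrite Rminus_0_r, Rabs_pos_eq by (left; apply exp_pos).
  rewrite <- (exp_ln eps) by exact He. apply exp_increasing.
  assert (H : - ln eps / a < ln (INR (S n))).
  { rewrite <- (ln_exp (- ln eps / a)). apply ln_increasing; [apply exp_pos|].
    eapply Rlt_le_trans; [exact HN|]. rewrite S_INR. apply Rplus_le_compat_r.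
    now apply le_INR. }
  apply (Rmult_lt_compat_l a) in H; [|exact Ha].
  replace (a * (- ln eps / a)) with (- ln eps) in H by (field; lra). lra.
Qed.

(* [ring] does not recognise an equation typed at the carrier of a Coquelicot structure. *)
Ltac to_C := match goal with |- @eq _ ?x ?y => change (@eq C x y) end.

(** * Rules of differentiation in a real variable *)

Lemma RtoC_neq_0 (x : R) : x <> 0 -> RtoC x <> RtoC 0.
Proof. intros H E. now apply H, RtoC_inj. Qed.

Lemma pderiv_const (c : C) (t : R) : pderiv (fun _ => c) t (RtoC 0).
Proof. exact (is_derive_const (K := R_AbsRing) (V := C_R_NormedModule) c t). Qed.

Lemma pderiv_plus (f g : R -> C) (t : R) (df dg : C) :
  pderiv f t df -> pderiv g t dg -> pderiv (fun u => f u + g u)%C t (df + dg)%C.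
Proof. exact (is_derive_plus (K := R_AbsRing) (V := C_R_NormedModule) f g t df dg). Qed.

Lemma pderiv_mult (f g : R -> C) (t : R) (df dg : C) :
  pderiv f t df -> pderiv g t dg ->
  pderiv (fun u => f u * g u)%C t (df * g t + f t * dg)%C.
Proof.
  intros Hf Hg. apply pderiv_eps. intros eps Heps.
  assert (Pf := Cmod_ge_0 (f t)). assert (Pg := Cmod_ge_0 (g t)). assert (Pd := Cmod_ge_0 df).
  set (e := eps / (3 + Cmod (f t) + Cmod (g t) + Cmod df)).
  assert (He : 0 < e) by (apply Rdiv_lt_0_compat; lra).
  assert (HeE : e * (3 + Cmod (f t) + Cmod (g t) + Cmod df) = eps) by (unfold e; field; lra).
  destruct (proj1 (pderiv_eps f t df) Hf e He) as [d1 [Hd1 H1]].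
  destruct (proj1 (pderiv_eps f t df) Hf 1 Rlt_0_1) as [d2 [Hd2 H2]].
  destruct (proj1 (pderiv_eps g t dg) Hg e He) as [d3 [Hd3 H3]].
  destruct (pcont_eps_inv g t (pderiv_continuous g t dg Hg) e He) as [d4 [Hd4 H4]].
  exists (Rmin (Rmin d1 d2) (Rmin d3 d4)). split; [repeat apply Rmin_pos; assumption|].
  intros u Hu.
  assert (Hu1 := Rlt_le_trans _ _ _ Hu (Rmin_l _ _)).
  assert (Hu2 := Rlt_le_trans _ _ _ Hu (Rmin_r _ _)).
  specialize (H1 u (Rlt_le_trans _ _ _ Hu1 (Rmin_l _ _))).
  specialize (H2 u (Rlt_le_trans _ _ _ Hu1 (Rmin_r _ _))).
  specialize (H3 u (Rlt_le_trans _ _ _ Hu2 (Rmin_l _ _))).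
  specialize (H4 u (Rlt_le_trans _ _ _ Hu2 (Rmin_r _ _))).
  replace (f u * g u - f t * g t - RtoC (u - t) * (df * g t + f t * dg))%C
    with ((f u - f t - RtoC (u - t) * df) * g t + (f t * (g u - g t - RtoC (u - t) * dg)
      + (f u - f t) * (g u - g t)))%C by ring.
  assert (H5 : Cmod (f u - f t) <= (1 + Cmod df) * Rabs (u - t)).
  { replace (f u - f t)%C with ((f u - f t - RtoC (u - t) * df) + RtoC (u - t) * df)%C by ring.
    eapply Rle_trans; [apply Cmod_triangle|]. rewrite Cmod_mult, Cmod_R. lra. }
  eapply Rle_trans; [apply Cmod_triangle|].
  eapply Rle_trans; [apply Rplus_le_compat_l, Cmod_triangle|].
  rewrite !Cmod_mult.
  assert (H6 := Cmod_ge_0 (f u - f t)). assert (H7 := Cmod_ge_0 (g u - g t)).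
  assert (H8 := Rabs_pos (u - t)).
  assert (H9 : Cmod (f u - f t) * Cmod (g u - g t) <= (1 + Cmod df) * Rabs (u - t) * e)
    by (apply Rmult_le_compat; lra).
  apply Rle_trans with (e * Rabs (u - t) * Cmod (g t) + (Cmod (f t) * (e * Rabs (u - t)) +
    (1 + Cmod df) * Rabs (u - t) * e)).
  - apply Rplus_le_compat; [apply Rmult_le_compat_r; assumption|].
    apply Rplus_le_compat; [apply Rmult_le_compat_l; assumption|exact H9].
  - rewrite <- HeE. assert (0 <= e * Rabs (u - t)) by nra. nra.
Qed.

Lemma pderiv_RtoC (f : R -> R) (t d : R) :
  is_derive f t d -> pderiv (fun u => RtoC (f u)) t (RtoC d).
Proof. intros H. apply pderiv_pair; [exact H|]. apply (is_derive_const 0). Qed.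

Lemma pderiv_val (f : R -> C) (t : R) (d d' : C) : d = d' -> pderiv f t d -> pderiv f t d'.
Proof. now intros ->. Qed.

(** * Euler-Maclaurin continuation of zeta to [Re s > -1] *)

(* The error of the trapezoidal rule for [u^-s] on [[x, x + 1]]. *)
Definition trap (x : R) (s : C) : C :=
  ((ncp x s + ncp (x + 1) s) / 2 - (ncp x (s - 1) - ncp (x + 1) (s - 1)) / (s - 1))%C.

(** Let [h u] be the error of the rule on [[x, u]] for [phi u = u^(-s)]. Then [h' = k / 2], where
    [k u = phi x - phi u + (u - x) phi' u] satisfies [k' = (u - x) phi'']; the mean value inequality
    is applied to [k] and then to [h]. *)
Lemma trap_bound (x : R) (s : C) : 1 <= x -> s <> RtoC 1 -> 0 <= Re s + 2 ->
  Cmod (trap x s) <= Cmod (s * (s + 1)) / 2 * exp (- (Re s + 2) * ln x).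
Proof.
  intros Hx Hs Hre.
  assert (Hs1 : (s - 1)%C <> 0) by now apply Cminus_eq_contra.
  set (B := Cmod (s * (s + 1)) * exp (- (Re s + 2) * ln x)).
  assert (HB : 0 <= B) by (apply Rmult_le_pos; [apply Cmod_ge_0|left; apply exp_pos]).
  set (dphi := fun u => (- s * ncp u (s + 1))%C).
  set (ddphi := fun u => (- s * (- (s + 1) * ncp u (s + 1 + 1)))%C).
  assert (Hphi : forall u, x <= u -> pderiv (fun v => ncp v s) u (dphi u))
    by (intros u Hu; apply pderiv_ncp; lra).
  assert (Hdphi : forall u, x <= u -> pderiv dphi u (ddphi u)).
  { intros u Hu. apply (pderiv_val _ _ (0 * ncp u (s + 1) + - s * (- (s + 1) * ncp u (s + 1 + 1)))%C).
    - unfold ddphi. ring.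
    - apply (pderiv_mult (fun _ => (- s)%C) (fun v => ncp v (s + 1)%C)); [apply pderiv_const|].
      apply pderiv_ncp; lra. }
  assert (Hlin : forall u, pderiv (fun v => RtoC (v - x)) u (RtoC 1)).
  { intros u. apply pderiv_RtoC. auto_derive; [trivial|ring]. }
  assert (Hdd : forall u, x <= u -> Cmod (ddphi u) <= B).
  { intros u Hu. unfold ddphi, B.
    replace (- s * (- (s + 1) * ncp u (s + 1 + 1)))%C with (s * (s + 1) * ncp u (s + 1 + 1))%C by ring.
    rewrite Cmod_mult, Cmod_ncp. apply Rmult_le_compat_l; [apply Cmod_ge_0|].
    rewrite !re_plus, re_RtoC. replace (Re s + 1 + 1) with (Re s + 2) by ring.
    apply exp_neg_ln_decr; lra. }
  set (k := fun u => (ncp x s - ncp u s + RtoC (u - x) * dphi u)%C).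
  assert (Hk : forall u, x <= u <= x + 1 -> Cmod (k u) <= B).
  { intros u Hu.
    replace (k u) with (k u - k x)%C.
    2:{ unfold k. replace (x - x) with 0 by ring. ring. }
    apply Rle_trans with (B * (u - x)); [|nra].
    apply mean_value_ineq with (df := fun v => (RtoC (v - x) * ddphi v)%C); [lra| |].
    - intros v Hv.
      apply (pderiv_val _ _ ((0 - dphi v) + (1 * dphi v + RtoC (v - x) * ddphi v))%C); [ring|].
      apply (pderiv_plus (fun u => ncp x s - ncp u s)%C (fun u => RtoC (u - x) * dphi u)%C).
      + apply (pderiv_minus (fun _ => ncp x s)); [apply pderiv_const|apply Hphi; lra].
      + apply (pderiv_mult (fun u => RtoC (u - x)) dphi); [apply Hlin|apply Hdphi; lra].
    - intros v Hv. rewrite Cmod_mult, Cmod_R, Rabs_pos_eq by lra.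
      assert (H1 := Hdd v ltac:(lra)). assert (H2 := Cmod_ge_0 (ddphi v)). nra. }
  set (h := fun u => (RtoC (u - x) * ((ncp x s + ncp u s) * / 2)
     - (ncp u (s - 1) * / (1 - s) - ncp x (s - 1) * / (1 - s)))%C).
  assert (Hs1' : (1 - s)%C <> 0).
  { intros E. apply Hs1. replace (s - 1)%C with (- (1 - s))%C by ring. rewrite E. ring. }
  assert (Hh : Cmod (h (x + 1) - h x) <= B / 2 * (x + 1 - x)).
  { apply mean_value_ineq with (df := fun u => (k u * / 2)%C); [lra| |].
    - intros u Hu.
      apply (pderiv_val _ _ ((1 * ((ncp x s + ncp u s) * / 2) + RtoC (u - x) *
         ((0 + dphi u) * / 2 + (ncp x s + ncp u s) * 0)) -
         ((- (s - 1) * ncp u (s - 1 + 1)) * / (1 - s) + ncp u (s - 1) * 0 - 0))%C).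
      { unfold k. replace (s - 1 + 1)%C with s by ring. field. exact Hs1'. }
      apply (pderiv_minus (fun u => RtoC (u - x) * ((ncp x s + ncp u s) * / 2))%C
        (fun u => ncp u (s - 1) * / (1 - s) - ncp x (s - 1) * / (1 - s))%C).
      + apply (pderiv_mult (fun u => RtoC (u - x)) (fun u => (ncp x s + ncp u s) * / 2)%C); [apply Hlin|].
        apply (pderiv_mult (fun u => ncp x s + ncp u s)%C (fun _ => / 2)%C); [|apply pderiv_const].
        apply (pderiv_plus (fun _ => ncp x s) (fun u => ncp u s)); [apply pderiv_const|apply Hphi; lra].
      + apply (pderiv_minus (fun u => ncp u (s - 1) * / (1 - s))%C
          (fun _ => ncp x (s - 1) * / (1 - s))%C); [|apply pderiv_const].
        apply (pderiv_mult (fun u => ncp u (s - 1)%C) (fun _ => / (1 - s))%C); [|apply pderiv_const].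
        apply pderiv_ncp; lra.
    - intros u Hu. rewrite Cmod_mult, Cmod_inv by (apply RtoC_neq_0; lra).
      rewrite Cmod_R, Rabs_pos_eq by lra. assert (H1 := Hk u Hu). lra. }
  replace (trap x s) with (h (x + 1)%R - h x)%C.
  - unfold B in Hh. lra.
  - unfold h, trap. replace (x - x) with 0 by ring. replace (x + 1 - x) with 1 by ring.
    field. auto.
Qed.

(** The trapezoidal errors are of size [k^(-Re s - 2)], so the series converges for [Re s > -1], and
    the pole at 1 stands apart. *)
Definition zeta_em (s : C) : C :=
  (1 / (s - 1) + 1 / 2 + cseries (fun k => trap (INR (S k)) s))%C.

(** [a] and [B] are kept apart from [s] so that one majorant serves all points of a disc. *)
Lemma trap_telescope (s : C) (a B : R) (n : nat) :
  s <> RtoC 1 -> 0 < a -> a <= Re s + 1 -> Cmod (s * (s + 1)) <= B ->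
  let g := fun j => B / 2 * (exp ((a + 1) * ln 2) / a) * exp (- a * ln (INR (S j))) in
  Cmod (trap (INR (S n)) s) <= g n - g (S n).
Proof.
  intros Hs Ha Has HB g.
  assert (H0 := Cmod_ge_0 (s * (s + 1))).
  assert (H1 : 1 <= INR (S n)) by (rewrite S_INR; assert (H := pos_INR n); lra).
  assert (Hln : 0 <= ln (INR (S n))) by (rewrite <- ln_1; apply ln_le_le; lra).
  eapply Rle_trans; [apply trap_bound; auto; lra|].
  apply Rle_trans with (B / 2 * exp (- (a + 1) * ln (INR (S n)))).
  - apply Rmult_le_compat; [lra|left; apply exp_pos|lra|]. apply exp_le. nra.
  - unfold g. rewrite (S_INR (S n)).
    assert (H2 := telescope_power a (INR (S n)) Ha H1).
    apply (Rmult_le_compat_l (B / 2)) in H2; lra.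
Qed.

Lemma zeta_em_series (s : C) : s <> RtoC 1 -> -1 < Re s ->
  is_cseries (fun k => trap (INR (S k)) s) (cseries (fun k => trap (INR (S k)) s)).
Proof.
  intros Hs Hre.
  apply cseries_correct with
    (fun j => Cmod (s * (s + 1)) / 2 * (exp ((Re s + 1 + 1) * ln 2) / (Re s + 1)) *
        exp (- (Re s + 1) * ln (INR (S j)))).
  - intros j. apply trap_telescope; auto; lra.
  - rewrite <- (Rmult_0_r (Cmod (s * (s + 1)) / 2 * (exp ((Re s + 1 + 1) * ln 2) / (Re s + 1)))).
    apply (is_lim_seq_scal_l _ _ (Finite 0)). apply is_lim_exp_neg_ln. lra.
Qed.

Lemma holo_trap (x : R) (s : C) : s <> RtoC 1 -> holo (trap x) s.
Proof.
  intros Hs. unfold trap.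
  assert (Hs1 : (s - 1)%C <> 0) by now apply Cminus_eq_contra.
  assert (Hsub : holo (fun w => w - 1)%C s) by (apply holo_minus; [apply holo_id|apply holo_const]).
  apply (holo_minus (fun s => (ncp x s + ncp (x + 1) s) / 2)%C
    (fun s => (ncp x (s - 1) - ncp (x + 1) (s - 1)) / (s - 1))%C).
  - apply (holo_mult (fun s => ncp x s + ncp (x + 1) s)%C (fun _ => / 2)%C); [|apply holo_const].
    apply holo_plus; apply holo_ncp.
  - apply (holo_div (fun s => ncp x (s - 1) - ncp (x + 1) (s - 1))%C (fun s => s - 1)%C); auto.
    apply (holo_minus (fun s => ncp x (s - 1)%C) (fun s => ncp (x + 1) (s - 1)%C)).
    + apply (holo_comp (ncp x) (fun w => w - 1)%C); [apply holo_ncp|exact Hsub].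
    + apply (holo_comp (ncp (x + 1)) (fun w => w - 1)%C); [apply holo_ncp|exact Hsub].
Qed.

Lemma Cmod_near (z z0 : C) (r : R) : Cmod (z - z0) < r -> Cmod z < Cmod z0 + r.
Proof. intros H. assert (H1 := Cmod_triangle_inv z z0). lra. Qed.

Lemma Re_near (z z0 : C) (r : R) : Cmod (z - z0) < r -> Re z0 - r < Re z < Re z0 + r.
Proof. intros H. apply interior_square in H. tauto. Qed.

Lemma zeta_em_holo (s : C) : s <> RtoC 1 -> -1 < Re s -> holo zeta_em s.
Proof.
  intros Hs Hre. unfold zeta_em.
  assert (Hs1 : (s - 1)%C <> 0) by now apply Cminus_eq_contra.
  assert (Hs1' : 0 < Cmod (s - 1)) by now apply Cmod_gt_0.
  apply (holo_plus (fun s => 1 / (s - 1) + 1 / 2)%C (fun s => cseries (fun k => trap (INR (S k)) s))).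
  - apply (holo_plus (fun s => 1 / (s - 1))%C (fun _ => 1 / 2)%C); [|apply holo_const].
    apply holo_div; auto; [apply holo_const|]. apply holo_minus; [apply holo_id|apply holo_const].
  - set (a := (Re s + 1) / 2). set (B := (Cmod s + a) * (Cmod s + a + 1)).
    set (r := Rmin a (Cmod (s - 1))).
    assert (Hr : 0 < r) by (apply Rmin_pos; unfold a; lra).
    assert (Hra : r <= a) by apply Rmin_l. assert (Hr1 : r <= Cmod (s - 1)) by apply Rmin_r.
    apply (holo_cseries (fun k => trap (INR (S k))) s r
      (fun j => B / 2 * (exp ((a + 1) * ln 2) / a) * exp (- a * ln (INR (S j))))); auto.
    + rewrite <- (Rmult_0_r (B / 2 * (exp ((a + 1) * ln 2) / a))).
      apply (is_lim_seq_scal_l _ _ (Finite 0)). apply is_lim_exp_neg_ln. unfold a; lra.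
    + intros j z Hz. apply trap_telescope.
      * intros ->. rewrite Cmod_minus_sym in Hz. lra.
      * unfold a; lra.
      * apply Re_near in Hz. unfold a in *. lra.
      * apply Cmod_near in Hz. unfold B. rewrite Cmod_mult.
        assert (H1 := Cmod_triangle z 1). rewrite Cmod_1 in H1.
        apply Rmult_le_compat; try apply Cmod_ge_0; lra.
    + intros j z Hz. apply holo_trap. intros ->. rewrite Cmod_minus_sym in Hz. lra.
Qed.

(** The index [k] stands for the integer [k + 1]: the sum on the left ends at [N + 1], whereas the
    last trapezoid ends at [N + 2]. Hence the correction terms are powers of [N + 2]. *)
Lemma zeta_em_partial (s : C) (N : nat) : s <> RtoC 1 ->
  (csum (fun k => ncp (INR (S k)) s) N =
   csum (fun k => trap (INR (S k)) s) N + 1 / 2 + 1 / (s - 1)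
   - ncp (INR (S (S N))) s / 2 - ncp (INR (S (S N))) (s - 1) / (s - 1))%C.
Proof.
  intros Hs. assert (Hs1 : (s - 1)%C <> 0) by now apply Cminus_eq_contra.
  induction N as [|N IH].
  - rewrite !csum_0. unfold trap. replace (INR 2) with (INR 1 + 1) by reflexivity.
    change (INR 1) with 1. rewrite !ncp_1. to_C. field. auto.
  - rewrite !csum_S, IH. unfold trap. rewrite (S_INR (S (S N))). to_C. field. auto.
Qed.

Lemma is_cseries_shift (a b : nat -> C) (l c : C) (e : nat -> R) :
  is_cseries a l -> (forall n, Cmod (csum b n - (csum a n + c)) <= e n) -> is_lim_seq e 0 ->
  is_cseries b (l + c)%C.
Proof.
  rewrite !is_cseries_eps. intros Ha Hab He eps Heps.
  apply is_lim_seq_spec in He.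
  destruct (He (mkposreal (eps / 2) ltac:(lra))) as [N1 HN1].
  destruct (Ha (eps / 2) ltac:(lra)) as [N2 HN2].
  exists (N1 + N2)%nat. intros n Hn.
  specialize (HN1 n ltac:(lia)). specialize (HN2 n ltac:(lia)). simpl in HN1.
  rewrite Rminus_0_r in HN1. apply Rabs_def2 in HN1.
  assert (H := Cmod_minus_triangle (csum b n) (csum a n + c) (l + c)). specialize (Hab n).
  replace (csum a n + c - (l + c))%C with (csum a n - l)%C in H by ring. lra.
Qed.

Lemma zeta_em_dirichlet (s : C) : 1 < Re s ->
  is_cseries (fun k => ncp (INR (S k)) s) (zeta_em s).
Proof.
  intros Hre.
  assert (Hs : s <> RtoC 1) by (intros ->; rewrite re_RtoC in Hre; lra).
  assert (Hs1 : (s - 1)%C <> 0) by now apply Cminus_eq_contra.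
  unfold zeta_em. rewrite Cplus_comm.
  set (e := fun N => / 2 * exp (- Re s * ln (INR (S (S N)))) +
     / Cmod (s - 1) * exp (- (Re s - 1) * ln (INR (S (S N))))).
  apply (is_cseries_shift _ _ _ _ e (zeta_em_series s Hs ltac:(lra))).
  - intros n. rewrite zeta_em_partial by exact Hs.
    replace (_ - _)%C with (- (ncp (INR (S (S n))) s / 2) + - (ncp (INR (S (S n))) (s - 1) / (s - 1)))%C
      by ring.
    eapply Rle_trans; [apply Cmod_triangle|]. rewrite !Cmod_opp.
    rewrite !Cmod_div by (auto; apply RtoC_neq_0; lra).
    rewrite !Cmod_ncp, Cmod_R, Rabs_pos_eq by lra.
    unfold e, Cminus. rewrite re_plus, re_opp, re_RtoC. right. unfold Rdiv, Rminus. ring.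
  - replace (Finite 0) with (Finite (/ 2 * 0 + / Cmod (s - 1) * 0)) by (f_equal; ring).
    apply is_lim_seq_plus'.
    + apply (is_lim_seq_scal_l _ _ (Finite 0)).
      apply (is_lim_seq_incr_1 (fun n => exp (- Re s * ln (INR (S n))))).
      apply is_lim_exp_neg_ln. lra.
    + apply (is_lim_seq_scal_l _ _ (Finite 0)).
      apply (is_lim_seq_incr_1 (fun n => exp (- (Re s - 1) * ln (INR (S n))))).
      apply is_lim_exp_neg_ln. lra.
Qed.

(** * First moment of zeta on the critical line *)

Lemma cderiv_ncp (x : R) (s : C) : cderiv (ncp x) s (- RtoC (ln x) * ncp x s)%C.
Proof.
  unfold ncp.
  assert (H : cderiv (fun w => (- w * RtoC (ln x))%C) s (- (1) * RtoC (ln x) + - s * 0)%C).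
  { apply (cderiv_mult (fun w => - w)%C (fun _ => RtoC (ln x))).
    - apply (cderiv_opp (fun w => w)), cderiv_id.
    - apply cderiv_const. }
  assert (H1 := cderiv_comp Cexp (fun w => (- w * RtoC (ln x))%C) s _ _ (cderiv_Cexp _) H).
  replace (- RtoC (ln x) * Cexp (- s * RtoC (ln x)))%C
    with ((- (1) * RtoC (ln x) + - s * 0) * Cexp (- s * RtoC (ln x)))%C by ring.
  exact H1.
Qed.

Lemma pcont_critical (f : C -> C) (t : R) : ccont f (critical_point t) ->
  pcont (fun u => f (critical_point u)) t.
Proof. apply pcont_vertical. Qed.

(** The integrand oscillates with frequency [ln x]: a primitive is [Ci / ln x] times the integrand,
    so the bound is independent of the length of the interval. *)
Lemma CInt_ncp_critical (x T1 T2 : R) : 1 < x -> T1 <= T2 ->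
  Cmod (CInt (fun t => ncp x (critical_point t)) T1 T2) <= 2 / ln x * exp (- (1 / 2) * ln x).
Proof.
  intros Hx HT.
  assert (Hln : 0 < ln x) by (rewrite <- ln_1; apply ln_increasing; lra).
  set (c := (Ci / RtoC (ln x))%C).
  assert (Hlc : RtoC (ln x) <> 0) by (apply RtoC_neq_0; lra).
  rewrite (CInt_primitive (fun t => c * ncp x (critical_point t))%C); auto.
  - replace (c * ncp x (critical_point T2) - c * ncp x (critical_point T1))%C
      with (c * (ncp x (critical_point T2) + - ncp x (critical_point T1)))%C by ring.
    rewrite Cmod_mult. unfold c. rewrite Cmod_div by exact Hlc.
    rewrite Cmod_Ci, Cmod_R, Rabs_pos_eq by lra.
    assert (H1 := Cmod_triangle (ncp x (critical_point T2)) (- ncp x (critical_point T1))).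
    rewrite Cmod_opp, !Cmod_ncp in H1. unfold Re at 1 2 in H1; simpl in H1.
    replace (2 / ln x * exp (- (1 / 2) * ln x))
      with (1 / ln x * (exp (- (1 / 2) * ln x) + exp (- (1 / 2) * ln x))) by (field; lra).
    apply Rmult_le_compat_l; [left; apply Rdiv_lt_0_compat; lra|]. exact H1.
  - intros t _.
    apply (pderiv_val _ _ (Ci * (0 * ncp x (critical_point t) +
       c * (- RtoC (ln x) * ncp x (critical_point t))))%C).
    { unfold c. replace (Ci * (0 * ncp x (critical_point t) +
        Ci / RtoC (ln x) * (- RtoC (ln x) * ncp x (critical_point t))))%C
        with (- (Ci * Ci) * ncp x (critical_point t))%C by (field; exact Hlc).
      replace (Ci * Ci)%C with (- (1))%C; [ring|].
      unfold Ci, Cmult, Copp, RtoC; simpl. f_equal; ring. }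
    apply (pderiv_vertical (fun w => c * ncp x w)%C).
    apply (cderiv_mult (fun _ => c) (ncp x)); [apply cderiv_const|apply cderiv_ncp].
  - intros t _. apply pcont_critical, holo_ccont, holo_ncp.
Qed.

Lemma exp_half_ln (x : R) : 0 < x -> exp (- (1 / 2) * ln x) = / sqrt x.
Proof.
  intros Hx. replace (- (1 / 2) * ln x) with (- (/ 2 * ln x)) by field.
  rewrite exp_Ropp. f_equal. rewrite <- Rpower_sqrt by exact Hx. reflexivity.
Qed.

Lemma CInt_csum (u : nat -> R -> C) (a b : R) (n : nat) : a <= b ->
  (forall k, pcont_on (u k) a b) ->
  pcont_on (fun t => csum (fun k => u k t) n) a b /\
  CInt (fun t => csum (fun k => u k t) n) a b = csum (fun k => CInt (u k) a b) n.
Proof.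
  intros Hab Hu. induction n as [|n [IH1 IH2]].
  - split.
    + intros t Ht. apply (continuous_ext (u O)); [|now apply Hu].
      intros v. now rewrite csum_0.
    + rewrite csum_0. apply CInt_ext; auto. intros t _. now rewrite csum_0.
  - split.
    + intros t Ht.
      apply (continuous_ext (fun v => plus (csum (fun k => u k v) n : C_R_NormedModule) (u (S n) v))).
      { intros v. now rewrite csum_S. }
      apply (continuous_plus (K := R_AbsRing) (V := C_R_NormedModule) (fun t => csum (fun k => u k t) n));
      [now apply IH1|now apply Hu].
    + rewrite csum_S, <- IH2, <- CInt_plus by auto.
      apply CInt_ext; auto. intros t _. now rewrite csum_S.
Qed.

(** The term of the integer 1 contributes [T]. That of [m >= 2] contributes at most [4 / sqrt m],
    since [ln m >= 1 / 2], and these bounds add up to at most [8 sqrt (N + 1)]. *)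
Lemma CInt_dirichlet_poly (T : R) (N : nat) : 0 <= T ->
  Cmod (CInt (fun t => csum (fun k => ncp (INR (S k)) (critical_point t)) N) T (2 * T) - T)
   <= 8 * sqrt (INR (S N)).
Proof.
  intros HT.
  assert (Hc : forall k, pcont_on (fun t => ncp (INR (S k)) (critical_point t)) T (2 * T)).
  { intros k t _. apply pcont_critical, holo_ccont, holo_ncp. }
  rewrite (proj2 (CInt_csum _ T (2 * T) N ltac:(lra) Hc)).
  induction N as [|N IH].
  - rewrite csum_0.
    assert (E : CInt (fun t => ncp (INR 1) (critical_point t)) T (2 * T) = RtoC T).
    { apply CInt_unique.
      replace (RtoC T) with (scal (2 * T - T) (RtoC 1) : C_R_NormedModule).
      - apply (is_RInt_ext (V := C_R_NormedModule) (fun _ => RtoC 1)).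
        + intros t _. change (INR 1) with 1. now rewrite ncp_1.
        + apply (is_RInt_const (V := C_R_NormedModule)).
      - rewrite scal_R_Cmult. to_C. replace (2 * T - T) with T by ring. ring. }
    rewrite E. replace (T - T)%C with (RtoC 0) by ring. rewrite Cmod_0.
    apply Rmult_le_pos; [lra|apply sqrt_pos].
  - rewrite csum_S.
    set (S0 := csum _ N) in *. set (a := CInt _ T (2 * T)) in *.
    replace (S0 + a - T)%C with ((S0 - T) + a)%C by ring.
    eapply Rle_trans; [apply Cmod_triangle|].
    assert (H1 : 1 < INR (S (S N))) by (rewrite !S_INR; assert (H := pos_INR N); lra).
    assert (Ha : Cmod a <= 2 / ln (INR (S (S N))) * exp (- (1 / 2) * ln (INR (S (S N)))))
      by (apply CInt_ncp_critical; lra).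
    rewrite exp_half_ln in Ha by lra.
    assert (Hln : / 2 <= ln (INR (S (S N)))).
    { apply Rle_trans with (ln 2); [left; apply ln_lt_2|]. apply ln_le_le; [lra|].
      rewrite !S_INR. assert (H := pos_INR N). lra. }
    assert (Hsq : 0 < sqrt (INR (S (S N)))) by (apply sqrt_lt_R0; lra).
    assert (Ha' : Cmod a <= 4 * / sqrt (INR (S (S N)))).
    { eapply Rle_trans; [exact Ha|]. apply Rmult_le_compat_r.
      - left; now apply Rinv_0_lt_compat.
      - unfold Rdiv. replace 4 with (2 * / / 2) by field.
        apply Rmult_le_compat_l; [lra|]. apply Rinv_le_contravar; lra. }
    (* With [m = N + 2], [1 / sqrt m] is compared with the increment of [2 sqrt] from [m - 1] to
       [m]; this is what the induction needs. *)
    assert (Hd : / sqrt (INR (S (S N))) <= 2 * (sqrt (INR (S (S N))) - sqrt (INR (S N)))).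
    { assert (H2 : sqrt (INR (S N)) <= sqrt (INR (S (S N)))).
      { apply sqrt_le_1_alt. rewrite (S_INR (S N)). lra. }
      assert (H3 := sqrt_pos (INR (S N))).
      assert (H4 : (sqrt (INR (S (S N))) - sqrt (INR (S N))) * (sqrt (INR (S (S N))) + sqrt (INR (S N))) = 1).
      { replace ((sqrt (INR (S (S N))) - sqrt (INR (S N))) * (sqrt (INR (S (S N))) + sqrt (INR (S N))))
          with (sqrt (INR (S (S N))) * sqrt (INR (S (S N))) - sqrt (INR (S N)) * sqrt (INR (S N))) by ring.
        rewrite !sqrt_sqrt by apply pos_INR. rewrite (S_INR (S N)). ring. }
      apply Rmult_le_reg_l with (sqrt (INR (S (S N)))); [exact Hsq|].
      rewrite Rinv_r by lra. nra. }
    lra.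
Qed.

Lemma zeta_em_tail (s : C) (N : nat) : s <> RtoC 1 -> -1 < Re s ->
  Cmod (zeta_em s - (csum (fun k => ncp (INR (S k)) s) N + ncp (INR (S (S N))) s / 2
     + ncp (INR (S (S N))) (s - 1) / (s - 1)))
  <= Cmod (s * (s + 1)) / 2 * (exp ((Re s + 2) * ln 2) / (Re s + 1))
      * exp (- (Re s + 1) * ln (INR (S (S N)))).
Proof.
  intros Hs Hre. rewrite zeta_em_partial by exact Hs. unfold zeta_em.
  replace (_ - _)%C with (- (csum (fun k => trap (INR (S k)) s) N - cseries (fun k => trap (INR (S k)) s)))%C
    by ring.
  rewrite Cmod_opp.
  set (g := fun j => Cmod (s * (s + 1)) / 2 * (exp ((Re s + 1 + 1) * ln 2) / (Re s + 1)) *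
        exp (- (Re s + 1) * ln (INR (S j)))).
  replace (Re s + 2) with (Re s + 1 + 1) by ring.
  apply (is_cseries_tail _ _ g).
  - now apply zeta_em_series.
  - intros j. unfold g. apply Rmult_le_pos; [apply Rmult_le_pos|].
    + assert (H := Cmod_ge_0 (s * (s + 1))). lra.
    + left; apply Rdiv_lt_0_compat; [apply exp_pos|lra].
    + left; apply exp_pos.
  - intros j _. apply trap_telescope; auto; lra.
Qed.

(** The summands bound half of the end term, the end term of the integral, and the tail of the
    trapezoidal errors. The constant 24 is [9 / 2] from [Cmod (s * (s + 1)) / 2] times [8 / (3 / 2)]
    from the telescoping majorant. *)
Lemma zeta_em_critical_approx (t T M : R) (N : nat) :
  2 <= T -> T <= t <= 2 * T -> INR (S (S N)) = M ->
  Cmod (zeta_em (critical_point t) - csum (fun k => ncp (INR (S k)) (critical_point t)) N)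
  <= / sqrt M + sqrt M / T + 24 * T ^ 2 * (/ sqrt M * / sqrt M * / sqrt M).
Proof.
  intros HT Ht HM.
  assert (HM1 : 1 <= M) by (rewrite <- HM, !S_INR; assert (H := pos_INR N); lra).
  set (s := critical_point t).
  assert (Hre : Re s = 1 / 2) by reflexivity.
  assert (Him : Im s = t) by reflexivity.
  assert (Hs : s <> RtoC 1) by (intros E; rewrite E, re_RtoC in Hre; lra).
  assert (Hs1 : (s - 1)%C <> 0) by now apply Cminus_eq_contra.
  assert (H := zeta_em_tail s N Hs ltac:(lra)). rewrite HM in H.
  set (P := csum _ N) in *.
  replace (zeta_em s - P)%C with ((zeta_em s - (P + ncp M s / 2 + ncp M (s - 1) / (s - 1)))
     + (ncp M s / 2 + ncp M (s - 1) / (s - 1)))%C by ring.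
  eapply Rle_trans; [apply Cmod_triangle|].
  assert (HsM : 0 < sqrt M) by (apply sqrt_lt_R0; lra).
  assert (E0 : exp (- (1 / 2) * ln M) = / sqrt M) by (apply exp_half_ln; lra).
  assert (E1 : Cmod (ncp M s) = / sqrt M) by (rewrite Cmod_ncp, Hre; exact E0).
  assert (E2 : Cmod (ncp M (s - 1)) = sqrt M).
  { rewrite Cmod_ncp. unfold Cminus. rewrite re_plus, re_opp, re_RtoC, Hre.
    replace (- (1 / 2 + - (1)) * ln M) with (- (- (1 / 2) * ln M)) by field.
    rewrite exp_Ropp, E0, Rinv_inv. reflexivity. }
  assert (E3 : exp (- (Re s + 1) * ln M) = / sqrt M * / sqrt M * / sqrt M).
  { rewrite <- E0, <- !exp_plus, Hre. f_equal. field. }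
  assert (Hs1T : T <= Cmod (s - 1)).
  { assert (H1 := im_le_Cmod (s - 1)). unfold Cminus in *. rewrite im_plus, im_opp, im_RtoC, Him in H1.
    rewrite Rabs_pos_eq in H1 by lra. lra. }
  assert (Hb1 : Cmod (ncp M s / 2 + ncp M (s - 1) / (s - 1)) <= / sqrt M + sqrt M / T).
  { eapply Rle_trans; [apply Cmod_triangle|].
    rewrite !Cmod_div by (auto; apply RtoC_neq_0; lra). rewrite E1, E2, Cmod_R, Rabs_pos_eq by lra.
    assert (H2 : 0 < / sqrt M) by now apply Rinv_0_lt_compat.
    assert (H3 : sqrt M / Cmod (s - 1) <= sqrt M / T).
    { apply Rmult_le_compat_l; [lra|]. apply Rinv_le_contravar; lra. }
    lra. }
  assert (Hb2 : Cmod (s * (s + 1)) <= 3 * T * (3 * T)).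
  { rewrite Cmod_mult. unfold s, critical_point.
    apply Rmult_le_compat; try apply Cmod_ge_0.
    - eapply Rle_trans; [apply Cmod_le_add|]. rewrite !Rabs_pos_eq by lra. lra.
    - replace (((1 / 2)%R, t) + 1)%C with ((3 / 2)%R, t)
        by (unfold Cplus, RtoC; simpl; f_equal; field).
      eapply Rle_trans; [apply Cmod_le_add|]. rewrite !Rabs_pos_eq by lra. lra. }
  assert (Hb3 : exp ((Re s + 2) * ln 2) <= 8).
  { rewrite Hre. apply Rle_trans with (exp (3 * ln 2)).
    - apply exp_le. assert (H1 := ln_lt_2). lra.
    - replace (3 * ln 2) with (ln 2 + ln 2 + ln 2) by ring. rewrite !exp_plus, exp_ln; lra. }
  rewrite E3 in H.
  set (q := / sqrt M * / sqrt M * / sqrt M) in *.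
  assert (Hq : 0 <= q).
  { assert (H2 : 0 < / sqrt M) by now apply Rinv_0_lt_compat. unfold q. nra. }
  assert (H4 : Cmod (s * (s + 1)) / 2 * (exp ((Re s + 2) * ln 2) / (Re s + 1)) <= 24 * T ^ 2).
  { rewrite Hre in *. apply Rle_trans with (3 * T * (3 * T) / 2 * (8 / (1 / 2 + 1))).
    - apply Rmult_le_compat.
      + assert (H1 := Cmod_ge_0 (s * (s + 1))). lra.
      + left; apply Rdiv_lt_0_compat; [apply exp_pos|lra].
      + lra.
      + apply Rmult_le_compat_r; [lra|exact Hb3].
    - right; field. }
  apply (Rmult_le_compat_r q) in H4; [|exact Hq]. lra.
Qed.

Lemma zeta_em_critical_ccont (t : R) : pcont (fun u => zeta_em (critical_point u)) t.
Proof.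
  apply pcont_critical, holo_ccont, zeta_em_holo.
  - intros E. apply (f_equal Re) in E. rewrite re_RtoC in E. unfold critical_point, Re in E; simpl in E. lra.
  - unfold critical_point, Re; simpl; lra.
Qed.

Lemma continuous_Cmod (f : R -> C) (t : R) : pcont f t ->
  continuous (fun u => Cmod (f u)) t.
Proof.
  intros H. apply continuity_pt_filterlim. intros eps Heps.
  destruct (pcont_eps_inv f t H eps Heps) as [d [Hd H1]].
  exists d. split; [exact Hd|]. intros x [_ Hx].
  assert (H2 := H1 x Hx). unfold dist; simpl; unfold R_dist.
  assert (H3 := Cmod_triangle_inv (f x) (f t)).
  assert (H4 := Cmod_triangle_inv (f t) (f x)). rewrite Cmod_minus_sym in H4.
  apply Rabs_def1; lra.
Qed.

(** The sum has about [y^6 = T^(3/2)] terms, which makes [sqrt M / T] and [T^2 M^(-3/2)] both of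
    order [1 / y]; the pointwise error is at most [(1 + 2 + 24) / y]. Integrated it is [27 y^3], the
    Dirichlet polynomial adds [16 y^3], and for [y >= 100] the total is below half of [T = y * y^3].
    The fourth power keeps all exponents integral. *)
Lemma zeta_em_first_moment (y : R) : 100 <= y ->
  y ^ 4 / 2 <= RInt (fun t => Cmod (zeta_em (critical_point t))) (y ^ 4) (2 * y ^ 4).
Proof.
  intros Hy. set (T := y ^ 4).
  assert (HT : 2 <= T).
  { unfold T. assert (H := Rle_pow y 1 4 ltac:(lra) ltac:(lia)). lra. }
  assert (Hy6 : 1 <= y ^ 6) by (apply pow_R1_Rle; lra).
  destruct (nfloor_ex (y ^ 6)) as [N [HN1 HN2]]; [lra|].
  set (M := INR (S (S N))).
  assert (HM1 : y ^ 6 <= M) by (unfold M; rewrite !S_INR; lra).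
  assert (HM2 : M <= 4 * y ^ 6) by (unfold M; rewrite !S_INR; lra).
  assert (Hs1 : y ^ 3 <= sqrt M).
  { rewrite <- (sqrt_square (y ^ 3)) by (apply pow_le; lra).
    apply sqrt_le_1_alt. replace (y ^ 3 * y ^ 3) with (y ^ 6) by ring. exact HM1. }
  assert (Hs2 : sqrt M <= 2 * y ^ 3).
  { rewrite <- (sqrt_square (2 * y ^ 3)) by (assert (0 <= y ^ 3) by (apply pow_le; lra); lra).
    apply sqrt_le_1_alt. replace (2 * y ^ 3 * (2 * y ^ 3)) with (4 * y ^ 6) by ring. exact HM2. }
  assert (Hy3 : 1 <= y ^ 3) by (apply pow_R1_Rle; lra).
  assert (Hcz : pcont_on (fun t => zeta_em (critical_point t)) T (2 * T))
    by (intros t _; apply zeta_em_critical_ccont).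
  assert (Hcp : pcont_on (fun t => csum (fun k => ncp (INR (S k)) (critical_point t)) N) T (2 * T)).
  { apply CInt_csum; [lra|]. intros k t _. apply pcont_critical, holo_ccont, holo_ncp. }
  assert (Hi : / sqrt M <= / y ^ 3) by (apply Rinv_le_contravar; lra).
  assert (Hi0 : 0 < / sqrt M) by (apply Rinv_0_lt_compat; lra).
  assert (HA : forall t, T <= t <= 2 * T ->
    Cmod (zeta_em (critical_point t) - csum (fun k => ncp (INR (S k)) (critical_point t)) N) <= 27 / y).
  { intros t Ht. eapply Rle_trans; [apply (zeta_em_critical_approx t T M N); auto|].
    assert (H1 : / sqrt M <= / y).
    { eapply Rle_trans; [exact Hi|]. apply Rinv_le_contravar; [lra|]. simpl. nra. }
    assert (H2 : sqrt M / T <= 2 / y).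
    { unfold T. apply Rle_trans with (2 * y ^ 3 / y ^ 4).
      - apply Rmult_le_compat_r; [left; apply Rinv_0_lt_compat; fold T; lra|exact Hs2].
      - right; field; lra. }
    assert (H3 : T ^ 2 * (/ sqrt M * / sqrt M * / sqrt M) <= / y).
    { apply Rle_trans with (T ^ 2 * (/ y ^ 3 * / y ^ 3 * / y ^ 3)).
      - apply Rmult_le_compat_l; [apply pow2_ge_0|].
        assert (Hp := pow_incr (/ sqrt M) (/ y ^ 3) 3 ltac:(lra)).
        simpl in Hp |- *. rewrite !Rmult_1_r, <- !Rmult_assoc in *. exact Hp.
      - right. unfold T. field; lra. }
    unfold Rdiv in *. lra. }
  assert (Hd := CInt_norm_le (fun t => zeta_em (critical_point t) -
      csum (fun k => ncp (INR (S k)) (critical_point t)) N)%C T (2 * T) (27 / y) ltac:(lra)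
    (fun t Ht => continuous_minus (K := R_AbsRing) (V := C_R_NormedModule) _ _ t (Hcz t Ht) (Hcp t Ht)) HA).
  rewrite CInt_minus in Hd by (auto; lra).
  assert (HP := CInt_dirichlet_poly T N ltac:(lra)).
  set (Z := CInt (fun t => zeta_em (critical_point t)) T (2 * T)) in *.
  set (P := CInt (fun t => csum (fun k => ncp (INR (S k)) (critical_point t)) N) T (2 * T)) in *.
  assert (HZ : Cmod Z <= RInt (fun t => Cmod (zeta_em (critical_point t))) T (2 * T)).
  { apply CInt_norm_le_RInt; auto; [lra| |intros; lra].
    apply (ex_RInt_continuous (V := R_CompleteNormedModule)).
    intros t _. apply continuous_Cmod, zeta_em_critical_ccont. }
  assert (HTZ : T <= Cmod Z + Cmod (Z - P) + Cmod (P - T)).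
  { assert (H1 := Cmod_triangle Z (P - Z)). assert (H2 := Cmod_triangle (Z + (P - Z)) (T - P)).
    replace (Z + (P - Z) + (T - P))%C with (RtoC T) in H2 by ring.
    rewrite Cmod_R, Rabs_pos_eq in H2 by lra.
    rewrite (Cmod_minus_sym P Z) in H1. rewrite (Cmod_minus_sym (RtoC T) P) in H2. lra. }
  assert (Hsn : sqrt (INR (S N)) <= sqrt M).
  { apply sqrt_le_1_alt. unfold M. rewrite (S_INR (S N)). lra. }
  assert (Hlast : (2 * T - T) * (27 / y) = 27 * y ^ 3) by (unfold T; field; lra).
  rewrite Hlast in Hd.
  assert (HT4 : T = y * y ^ 3) by (unfold T; ring).
  assert (100 * y ^ 3 <= T) by (rewrite HT4; nra). lra.
Qed.

(** * Moebius inversion *)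

Module MoebiusInversion.
Import ssreflect ssrfun ssrbool eqtype ssrnat seq div prime bigop fintype.

HB.instance Definition _ := Monoid.isComLaw.Build Z 0%Z Z.add Z.add_assoc Z.add_comm Z.add_0_l.

Lemma moebius1 : moebius 1 = 1%Z.
Proof. by []. Qed.

Lemma moebius_mul_dvd p e : prime p -> (0 < e)%N -> (p %| e)%N -> moebius (p * e)%N = 0%Z.
Proof.
move=> pp e0 pe; rewrite /moebius.
case: ifP => // /andP[_ /allP H].
have p0 : (0 < p)%N by rewrite prime_gt0.
have pin : p \in primes (p * e) by rewrite primesM // mem_primes pp p0 dvdnn.
have := H _ pin.
rewrite lognM // logn_prime // eqxx.
have : (0 < logn p e)%N by rewrite logn_gt0 mem_primes pp e0 pe.
by case: (logn p e).
Qed.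

Lemma moebius_mul_coprime p e : prime p -> (0 < e)%N -> ~~ (p %| e)%N ->
  moebius (p * e)%N = (- moebius e)%Z.
Proof.
move=> pp e0 npe; have p0 : (0 < p)%N by rewrite prime_gt0.
have pnin : p \notin primes e by rewrite mem_primes pp e0.
have perm : perm_eq (primes (p * e)) (p :: primes e).
  apply: uniq_perm; rewrite ?primes_uniq //= ?pnin ?primes_uniq // => q.
  by rewrite primesM // primes_prime // !inE.
have lp : logn p e = 0%N by apply/eqP; rewrite -leqn0 leqNgt logn_gt0.
rewrite /moebius muln_gt0 p0 e0 /= (perm_size perm) /=.
have -> : all (fun q => logn q (p * e) == 1%N) (primes (p * e)) =
          all (fun q => logn q e == 1%N) (primes e).
  rewrite (perm_all _ perm) /= lognM // logn_prime // eqxx lp /=.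
  apply: eq_in_all => q qe; rewrite lognM // logn_prime //.
  case: (q =P p) => [qp|_] //; by move: qe; rewrite qp (negbTE pnin).
case: ifP => // _.
have powS k : (Z.pow (-1) (Z.of_nat k.+1) = - Z.pow (-1) (Z.of_nat k))%Z.
  by rewrite Nat2Z.inj_succ Z.pow_succ_r; [lia|exact: Nat2Z.is_nonneg].
exact: powS.
Qed.

Lemma big_Zopp (I : Type) (r : seq I) (P : pred I) (F : I -> Z) :
  \big[Z.add/0%Z]_(i <- r | P i) (- F i)%Z = (- \big[Z.add/0%Z]_(i <- r | P i) F i)%Z.
Proof.
elim: r => [|i r IH]; first by rewrite !big_nil.
by rewrite !big_cons; case: (P i) => //; rewrite IH; lia.
Qed.

(** Let [p] be the least prime factor. Among the divisors [p * e], those with [p] dividing [e]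
    contribute 0, and the others contribute [- moebius e] for exactly those [e] that divide [n] and
    are prime to [p]; this cancels the divisors not divisible by [p]. *)
Lemma sum_moebius_dvd n : (1 < n)%N ->
  \big[Z.add/0%Z]_(d < n.+1 | (d %| n)%N) moebius d = 0%Z.
Proof.
move=> n1; have n0 : (0 < n)%N by apply: ltnW.
set p := pdiv n; have pp : prime p by apply: pdiv_prime.
have p0 : (0 < p)%N by rewrite prime_gt0.
have pn : (p %| n)%N by apply: pdiv_dvd.
rewrite (bigID (fun d : 'I_n.+1 => (p %| d)%N)) /=.
have dle (d : nat) : (d %| n)%N -> (d < n.+1)%N by move=> /dvdn_leq; rewrite ltnS; apply.
(* [inord] sends an index out of range to 0. Such an [e] satisfies neither condition: 0 does not
   divide [n > 0], and [p * e > n] does not either. *)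
rewrite (reindex_onto (fun e : 'I_n.+1 => inord (p * e)) (fun d : 'I_n.+1 => inord (d %/ p))) /=;
  last first.
  move=> d /andP[dn pd].
  have dp : (d %/ p < n.+1)%N by apply: leq_ltn_trans (leq_div _ _) (ltn_ord d).
  by rewrite (inordK dp) mulnC divnK // inord_val.
have bridge : \big[Z.add/0%Z]_(e < n.+1 | ((inord (p * e) : 'I_n.+1) %| n)%N &&
     (p %| (inord (p * e) : 'I_n.+1))%N && (inord ((inord (p * e) : 'I_n.+1) %/ p) == e))
     moebius (inord (p * e) : 'I_n.+1) =
  \big[Z.add/0%Z]_(e < n.+1 | (p * e %| n)%N) moebius (p * e)%N.
  apply: eq_big => [e|e].
  - case: (boolP (p * e %| n)%N) => [pen|pen].
    + rewrite inordK ?dle // pen dvdn_mulr //= mulKn //.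
      by apply/eqP; rewrite inord_val.
    + apply/negbTE; apply/negP => /andP[/andP[H1 H2] /eqP H3].
      case: (ltnP (p * e) n.+1) => [lt|ge].
        by move: H1; rewrite inordK // (negbTE pen).
      have := H3; move: H1 H2.
      have geF : (p * e < n.+1)%N = false by apply/negbTE; rewrite -leqNgt.
      rewrite /inord /insubd (@insubF nat (fun m => (m < n.+1)%N) _ (p * e)%N geF) /= => H1 _.
      by move: H1; rewrite dvd0n eqn0Ngt n0.
  - move=> /andP[/andP[H1 H2] /eqP H3].
    case: (ltnP (p * e) n.+1) => [lt|ge]; first by rewrite inordK.
    have geF : (p * e < n.+1)%N = false by apply/negbTE; rewrite -leqNgt.
    move: H1; rewrite /inord /insubd (@insubF nat (fun m => (m < n.+1)%N) _ (p * e)%N geF) /= dvd0n.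
    by rewrite eqn0Ngt n0.
rewrite bridge (bigID (fun e : 'I_n.+1 => (p %| e)%N)) /=.
rewrite big1 => [|e /andP[pen pe]]; last first.
  apply: moebius_mul_dvd => //; rewrite lt0n; apply/negP => /eqP e0.
  by move: pen; rewrite e0 muln0 dvd0n eqn0Ngt n0.
rewrite Z.add_0_l.
rewrite (eq_big (fun d : 'I_n.+1 => (d %| n)%N && ~~ (p %| d)%N) (fun d : 'I_n.+1 => (- moebius d)%Z)).
- by rewrite big_Zopp Z.add_opp_diag_l.
- move=> e; case: (boolP (p %| e)%N) => pe; rewrite ?andbF ?andbT //=.
  have cop : coprime e p by rewrite coprime_sym prime_coprime.
  move: (nat_of_ord e) cop => k cop.
  have -> : (k %| n)%N = (k %| n %/ p)%N by rewrite -{1}(divnK pn) Gauss_dvdl.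
  by rewrite -{1}(divnK pn) mulnC dvdn_pmul2r.
- move=> e /andP[pen pe]; apply: moebius_mul_coprime => //.
  rewrite lt0n; apply/negP => /eqP e0.
  by move: pen; rewrite e0 muln0 dvd0n eqn0Ngt n0.
Qed.

Lemma moebius_abs n : (Z.abs (moebius n) <= 1)%Z.
Proof.
rewrite /moebius; case: ifP => // _.
rewrite Z.abs_pow [Z.abs (-1)]/=.
by rewrite Z.pow_1_l //; exact: Nat2Z.is_nonneg.
Qed.

Notation muC n := (RtoC (IZR (moebius n))).

Lemma csum_moebius_dvd (m n : nat) : (0 < m)%N ->
  csum (fun k => if (S k %| m)%N then muC (S k) else RtoC 0) n =
  RtoC (IZR (\big[Z.add/0%Z]_(d < n.+2 | (d %| m)%N) moebius d)).
Proof.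
move=> m0; elim: n => [|n IH].
  rewrite csum_0 big_mkcond !big_ord_recr big_ord0 /=.
  rewrite dvd0n eqn0Ngt m0 /=.
  by case: ifP => _; f_equal; f_equal; lia.
have -> : \big[Z.add/0%Z]_(d < n.+3 | (d %| m)%N) moebius d =
  (\big[Z.add/0%Z]_(d < n.+2 | (d %| m)%N) moebius d
    + (if (n.+2 %| m)%N then moebius n.+2 else 0))%Z.
  by rewrite big_mkcond big_ord_recr -big_mkcond.
rewrite csum_S IH plus_IZR RtoC_plus; congr Cplus.
by case: ifP.
Qed.

Definition zeta_partial (s : C) (j : nat) : C :=
  match j with O => RtoC 0 | S i => csum (fun k => ncp (INR (S k)) s) i end.

Lemma zeta_partial_S (s : C) (j : nat) :
  zeta_partial s (S j) = (zeta_partial s j + ncp (INR (S j)) s)%C.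
Proof.
case: j => [|j]; last exact: csum_S.
rewrite /zeta_partial csum_0; by to_C; ring.
Qed.

Lemma csum_plus (a b : nat -> C) (n : nat) :
  csum (fun k => a k + b k)%C n = (csum a n + csum b n)%C.
Proof. elim: n => [|n IH]; [by rewrite !csum_0|rewrite !csum_S IH; by to_C; ring]. Qed.

Lemma csum_scal (a : nat -> C) (c : C) (n : nat) :
  csum (fun k => c * a k)%C n = (c * csum a n)%C.
Proof. elim: n => [|n IH]; [by rewrite !csum_0|rewrite !csum_S IH; by to_C; ring]. Qed.

Lemma csum_norm_le (a : nat -> C) (g : nat -> R) (n : nat) :
  (forall k, (k <= n)%coq_nat -> Cmod (a k) <= g k) -> Cmod (csum a n) <= sum_n g n.
Proof.
elim: n => [|n IH] H; first by rewrite csum_0 sum_O; apply: H.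
rewrite csum_S sum_Sn; apply: Rle_trans; first exact: Cmod_triangle.
apply: Rplus_le_compat; [apply: IH => k hk|]; apply: H; lia.
Qed.

(* The sum over [n k <= N + 1] of [mu(n) (n k)^-s]. *)
Lemma moebius_convolution (s : C) (N : nat) :
  csum (fun n => muC (S n) * ncp (INR (S n)) s * zeta_partial s (S N %/ S n))%C N = RtoC 1.
Proof.
elim: N => [|N IH].
  rewrite csum_0 divn1 /zeta_partial csum_0 /= ncp_1 moebius1.
  by to_C; ring.
have E : csum (fun n => muC (S n) * ncp (INR (S n)) s * zeta_partial s (S (S N) %/ S n))%C (S N) =
  (csum (fun n => muC (S n) * ncp (INR (S n)) s * zeta_partial s (S N %/ S n))%C (S N)
   + csum (fun n => ncp (INR (S (S N))) s * (if (S n %| S (S N))%N then muC (S n) else RtoC 0))%C (S N))%C.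
  rewrite -csum_plus; apply: csum_ext => n _.
  (* Passing from [N + 1] to [N + 2], the quotient by [n + 1] grows by one exactly when [n + 1]
     divides [N + 2]; the new terms all carry the power of [N + 2], and their coefficients sum to
     zero. *)
  rewrite divnS //; case: ifP => dv; last by rewrite add0n; ring.
  rewrite add1n zeta_partial_S.
  have -> : ncp (INR N.+2) s = (ncp (INR n.+1) s * ncp (INR (N.+1 %/ n.+1).+1) s)%C.
    rewrite -ncp_mult; last 2 first.
    - by apply: lt_0_INR; lia.
    - by apply: lt_0_INR; lia.
    rewrite -mult_INR; congr (ncp (INR _) s).
    have := divnS N.+1 (ltn0Sn n); rewrite dv add1n => <-.
    by rewrite multE mulnC divnK.
  ring.
rewrite E csum_scal csum_moebius_dvd // sum_moebius_dvd // csum_S IH.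
rewrite (divn_small (ltnSn N.+1)) /=. by to_C; ring.
Qed.

Lemma zeta_partial_tail (s : C) (j : nat) : 1 < Re s ->
  Cmod (zeta_em s - zeta_partial s (S j)) <=
  exp (Re s * ln 2) / (Re s - 1) * exp (- (Re s - 1) * ln (INR (S (S j)))).
Proof.
move=> hs; rewrite Cmod_minus_sym /zeta_partial.
pose c := exp (Re s * ln 2) / (Re s - 1).
have c0 : 0 < c by apply: Rdiv_lt_0_compat; [exact: exp_pos|lra].
apply: (is_cseries_tail _ _ (fun j => c * exp (- (Re s - 1) * ln (INR (S j))))).
- exact: zeta_em_dirichlet.
- by move=> k; apply: Rmult_le_pos; [lra|left; exact: exp_pos].
- move=> k _; rewrite Cmod_ncp.
  have h1 : 1 <= INR (S k) by rewrite S_INR; have := pos_INR k; lra.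
  have := telescope_power (Re s - 1) (INR (S k)) ltac:(lra) h1.
  rewrite -S_INR /c.
  have -> : Re s - 1 + 1 = Re s by ring.
  lra.
Qed.

Lemma muC_le1 n : Cmod (muC n) <= 1.
Proof. rewrite Cmod_R -abs_IZR. apply: (IZR_le _ 1). exact: moebius_abs. Qed.

(** Against the exact convolution identity, each truncated zeta sum is replaced by zeta itself.
    Every one of the [N + 1] errors is at most [c (N + 1)^(1 - Re s)], so their sum tends to 0 for
    [Re s > 2]; smaller real parts are left to the identity theorem. *)
Lemma moebius_dirichlet_inverse (s : C) : 2 < Re s ->
  forall eps, 0 < eps -> exists N0, forall N, (N0 <= N)%coq_nat ->
  Cmod (csum (fun n => muC (S n) * ncp (INR (S n)) s)%C N * zeta_em s - 1) < eps.
Proof.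
move=> hs eps heps.
pose c := exp (Re s * ln 2) / (Re s - 1).
have c0 : 0 < c by apply: Rdiv_lt_0_compat; [exact: exp_pos|lra].
have bd N : Cmod (csum (fun n => muC (S n) * ncp (INR (S n)) s)%C N * zeta_em s - 1) <=
    c * exp (- (Re s - 2) * ln (INR (S N))).
  rewrite -(moebius_convolution s N).
  have -> : (csum (fun n => muC (S n) * ncp (INR (S n)) s)%C N * zeta_em s -
     csum (fun n => muC (S n) * ncp (INR (S n)) s * zeta_partial s (S N %/ S n))%C N)%C =
     csum (fun n => muC (S n) * ncp (INR (S n)) s * (zeta_em s - zeta_partial s (S N %/ S n)))%C N.
    have -> : csum (fun n => muC (S n) * ncp (INR (S n)) s * (zeta_em s - zeta_partial s (S N %/ S n)))%C N
      = csum (fun n => zeta_em s * (muC (S n) * ncp (INR (S n)) s) +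
           (-1) * (muC (S n) * ncp (INR (S n)) s * zeta_partial s (S N %/ S n)))%C N.
      by apply: csum_ext => n _; ring.
    by rewrite csum_plus !csum_scal; to_C; ring.
  apply: (Rle_trans _ (sum_n (fun _ => c * exp (- (Re s - 1) * ln (INR (S N)))) N)).
    apply: csum_norm_le => n hn.
    have [j jE] : exists j, (S N %/ S n)%N = S j.
      exists (S N %/ S n).-1; rewrite prednK // divn_gt0 //.
      by apply/ltP; lia.
    rewrite jE !Cmod_mult.
    have h1 := muC_le1 (S n). have h2 := zeta_partial_tail s j ltac:(lra).
    rewrite -/c in h2. rewrite Cmod_ncp.
    have hn0 : 1 <= INR (S n) by rewrite S_INR; have := pos_INR n; lra.
    have hN0 : 0 < INR (S N) by apply: lt_0_INR; lia.
    have hlt : INR (S N) <= INR (S n) * INR (S (S j)).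
      rewrite -mult_INR; apply: le_INR; apply/leP; rewrite multE mulnC -jE.
      by apply: ltnW; exact: ltn_ceil.
    have hln : ln (INR (S N)) <= ln (INR (S n)) + ln (INR (S (S j))).
      rewrite -ln_mult; [apply: ln_le_le|lra|apply: lt_0_INR; lia]; lra.
    have hl0 : 0 <= ln (INR (S n)) by rewrite -ln_1; apply: ln_le_le; lra.
    apply: (Rle_trans _ (1 * exp (- Re s * ln (INR (S n))) *
       (c * exp (- (Re s - 1) * ln (INR (S (S j))))))).
      apply: Rmult_le_compat; [|exact: Cmod_ge_0| |exact: h2].
        by apply: Rmult_le_pos; [exact: Cmod_ge_0|left; exact: exp_pos].
      by apply: Rmult_le_compat_r; [left; exact: exp_pos|].
    have -> : 1 * exp (- Re s * ln (INR (S n))) * (c * exp (- (Re s - 1) * ln (INR (S (S j)))))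
      = c * exp (- Re s * ln (INR (S n)) + - (Re s - 1) * ln (INR (S (S j)))) by rewrite exp_plus; ring.
    apply: Rmult_le_compat_l; [lra|]. apply: exp_le. nra.
  rewrite sum_n_const.
  right.
  have -> : c * exp (- (Re s - 2) * ln (INR (S N))) =
    INR (S N) * (c * exp (- (Re s - 1) * ln (INR (S N)))).
    have hN0 : 0 < INR (S N) by apply: lt_0_INR; lia.
    have -> : - (Re s - 2) * ln (INR (S N)) = ln (INR (S N)) + - (Re s - 1) * ln (INR (S N)) by ring.
    by rewrite exp_plus exp_ln //; ring.
  by [].
have hl : is_lim_seq (fun N => c * exp (- (Re s - 2) * ln (INR (S N)))) 0.
  rewrite -(Rmult_0_r c).
  by apply: (is_lim_seq_scal_l _ _ (Rbar.Finite 0)); apply: is_lim_exp_neg_ln; lra.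
move/is_lim_seq_spec: hl => /(_ (mkposreal eps heps)) [N0 hN0].
exists N0 => N hN; move: (hN0 N hN) => /= h.
rewrite Rminus_0_r in h. apply: Rle_lt_trans (bd N) _.
exact: Rle_lt_trans (Rle_abs _) h.
Qed.

End MoebiusInversion.
Import MoebiusInversion.

(** * The functional equation of the theta function *)

Fixpoint sum1 (f : nat -> R) (n : nat) : R :=
  match n with O => 0 | S k => sum1 f k + f (S k) end.

Lemma sum1_S (f : nat -> R) (n : nat) : sum1 f (S n) = sum1 f n + f (S n).
Proof. reflexivity. Qed.

Lemma sum1_ext (f g : nat -> R) (n : nat) :
  (forall k, (1 <= k <= n)%nat -> f k = g k) -> sum1 f n = sum1 g n.
Proof.
  induction n as [|n IH]; intros H; [reflexivity|]. simpl.
  rewrite IH, H; auto; [lia|]. intros k Hk. apply H. lia.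
Qed.

Lemma sum1_plus (f g : nat -> R) (n : nat) : sum1 (fun k => f k + g k) n = sum1 f n + sum1 g n.
Proof. induction n as [|n IH]; simpl; [ring|]. rewrite IH. ring. Qed.

Lemma sum1_scal (c : R) (f : nat -> R) (n : nat) : sum1 (fun k => c * f k) n = c * sum1 f n.
Proof. induction n as [|n IH]; simpl; [ring|]. rewrite IH. ring. Qed.

Lemma sum1_const (c : R) (n : nat) : sum1 (fun _ => c) n = INR n * c.
Proof. induction n as [|n IH]; [simpl; ring|]. rewrite sum1_S. rewrite IH, S_INR. ring. Qed.

Lemma sum1_exchange (f : nat -> nat -> R) (n m : nat) :
  sum1 (fun i => sum1 (f i) m) n = sum1 (fun j => sum1 (fun i => f i j) n) m.
Proof.
  induction n as [|n IH]; simpl.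
  - induction m as [|m IHm]; simpl; [reflexivity|]. rewrite <- IHm. ring.
  - rewrite IH, <- sum1_plus. reflexivity.
Qed.

(** The coefficient of [cos a ^ (2 m)] at frequency [2 r]; equally the probability that a symmetric
    walk of [2 m] steps ends at [2 r]. *)
Definition cbin (m r : nat) : R := INR (binomial.binomial (2 * m) (m + r)) / 4 ^ m.

Lemma binS_nat (n k : nat) :
  binomial.binomial (S n) (S k) = (binomial.binomial n (S k) + binomial.binomial n k)%nat.
Proof. exact (binomial.binS n k). Qed.

Lemma cbin_ratio (m r : nat) : (r <= m)%nat ->
  INR (m + r + 1) * cbin m (S r) = INR (m - r) * cbin m r.
Proof.
  intros H. unfold cbin.
  assert (E : (S (m + r) * binomial.binomial (2 * m) (S (m + r)) =
    (2 * m - (m + r)) * binomial.binomial (2 * m) (m + r))%nat) by exact (binomial.mul_bin_left (2 * m) (m + r)).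
  assert (E' : ((m + r + 1) * binomial.binomial (2 * m) (m + S r) = (m - r) * binomial.binomial (2 * m) (m + r))%nat).
  { replace (m + S r)%nat with (S (m + r)) by lia.
    replace (m + r + 1)%nat with (S (m + r)) by lia.
    rewrite E. f_equal. lia. }
  apply (f_equal INR) in E'. rewrite !mult_INR in E'.
  unfold Rdiv. rewrite <- !Rmult_assoc, E'. reflexivity.
Qed.

Lemma cbin_large (m r : nat) : (m < r)%nat -> cbin m r = 0.
Proof.
  intros H. unfold cbin.
  rewrite binomial.bin_small; [simpl; unfold Rdiv; ring|].
  apply (ssrbool.introT ssrnat.ltP).
  change (2 * m < m + r)%nat. lia.
Qed.

Lemma cbin_rec (m r : nat) : cbin (S m) (S r) = / 4 * (cbin m r + 2 * cbin m (S r) + cbin m (S (S r))).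
Proof.
  unfold cbin.
  assert (E : (binomial.binomial (2 * S m) (S m + S r) =
    binomial.binomial (2 * m) (m + r) + 2 * binomial.binomial (2 * m) (m + S r) + binomial.binomial (2 * m) (m + S (S r)))%nat).
  { replace (2 * S m)%nat with (S (S (2 * m))) by lia.
    replace (S m + S r)%nat with (S (S (m + r))) by lia.
    replace (m + S r)%nat with (S (m + r)) by lia.
    replace (m + S (S r))%nat with (S (S (m + r))) by lia.
    rewrite !binS_nat. lia. }
  rewrite E, !plus_INR, mult_INR. simpl (INR 2). simpl pow. field. apply pow_nonzero. lra.
Qed.

Lemma cbin_rec0 (m : nat) : cbin (S m) 0 = / 2 * (cbin m 0 + cbin m 1).
Proof.
  unfold cbin.
  assert (E : (binomial.binomial (2 * S m) (S m + 0) =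
    2 * binomial.binomial (2 * m) (m + 0) + 2 * binomial.binomial (2 * m) (m + 1))%nat).
  { destruct m as [|m]; [reflexivity|].
    replace (2 * S (S m))%nat with (S (S (2 * S m))) by lia.
    replace (S (S m) + 0)%nat with (S (S m)) by lia.
    replace (S m + 0)%nat with (S m) by lia.
    replace (S m + 1)%nat with (S (S m)) by lia.
    rewrite !(binS_nat (S (2 * S m))), !(binS_nat (2 * S m)).
    assert (Es : binomial.binomial (2 * S m) m = binomial.binomial (2 * S m) (S (S m))).
    { rewrite <- (binomial.bin_sub (n := 2 * S m) (m := m)).
      - f_equal. change (2 * S m - m = S (S m))%nat. lia.
      - apply (ssrbool.introT ssrnat.leP). change (m <= 2 * S m)%nat. lia. }
    rewrite Es. lia. }
  rewrite E, !plus_INR, !mult_INR. simpl (INR 2). simpl pow. field. apply pow_nonzero. lra.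
Qed.

Lemma cbin_0_pos (m : nat) : 0 < cbin m 0.
Proof.
  induction m as [|m IH]; [unfold cbin; simpl; lra|].
  rewrite cbin_rec0.
  assert (H := cbin_ratio m 0 ltac:(lia)).
  assert (0 <= cbin m 1).
  { unfold cbin. apply Rmult_le_pos; [apply pos_INR|]. left. apply Rinv_0_lt_compat, pow_lt. lra. }
  lra.
Qed.

Definition csum2 (g : nat -> R) (a : R) (n : nat) : R :=
  g O + 2 * sum1 (fun r => g r * cos (2 * INR r * a)) n.

(** Multiplication by [cos a ^ 2 = (1 + cos (2 a)) / 2] averages neighbouring coefficients. The two
    last terms come from truncation at [n]; they vanish once [g] is zero from [n] on. *)
Lemma csum2_step (g g' : nat -> R) (a : R) (n : nat) :
  g' O = / 2 * (g O + g 1%nat) ->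
  (forall r, g' (S r) = / 4 * (g r + 2 * g (S r) + g (S (S r)))) ->
  cos a ^ 2 * csum2 g a n =
  csum2 g' a n + / 2 * g n * cos (2 * INR (S n) * a) - / 2 * g (S n) * cos (2 * INR n * a).
Proof.
  intros H0 HS.
  assert (Hc2 : cos a ^ 2 = / 2 * (1 + cos (2 * a))) by (rewrite cos_2a_cos; field).
  rewrite Hc2.
  induction n as [|n IH].
  - unfold csum2. simpl sum1. rewrite H0. simpl INR.
    replace (2 * 0 * a) with 0 by ring. replace (2 * 1 * a) with (2 * a) by ring.
    rewrite cos_0. field.
  - assert (E : forall h, csum2 h a (S n) = csum2 h a n + 2 * (h (S n) * cos (2 * INR (S n) * a))).
    { intros h. unfold csum2. rewrite sum1_S. ring. }
    rewrite !E, Rmult_plus_distr_l, IH, HS.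
    assert (Hp : 2 * cos (2 * a) * cos (2 * INR (S n) * a)
      = cos (2 * INR (S (S n)) * a) + cos (2 * INR n * a)).
    { rewrite (S_INR (S n)).
      replace (2 * (INR (S n) + 1) * a) with (2 * INR (S n) * a + 2 * a) by ring.
      replace (2 * INR n * a) with (2 * INR (S n) * a - 2 * a) by (rewrite S_INR; ring).
      rewrite cos_plus, cos_minus. ring. }
    replace (/ 2 * (1 + cos (2 * a)) * (2 * (g (S n) * cos (2 * INR (S n) * a))))
      with (g (S n) * cos (2 * INR (S n) * a) + / 2 * g (S n) * (2 * cos (2 * a) * cos (2 * INR (S n) * a))) by field.
    rewrite Hp. field.
Qed.

Lemma cos_pow_expansion (m : nat) (a : R) (n : nat) : (m <= n)%nat ->
  cos a ^ (2 * m) = csum2 (cbin m) a n.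
Proof.
  revert n. induction m as [|m IH]; intros n Hn.
  - unfold csum2. rewrite (sum1_ext _ (fun _ => 0)).
    + rewrite sum1_const. unfold cbin. simpl. field.
    + intros k Hk. rewrite cbin_large by lia. ring.
  - replace (2 * S m)%nat with (2 + 2 * m)%nat by lia. rewrite pow_add, (IH n ltac:(lia)).
    rewrite (csum2_step (cbin m) (cbin (S m)) a n (cbin_rec0 m) (cbin_rec m)).
    rewrite (cbin_large m n), (cbin_large m (S n)) by lia. ring.
Qed.

Lemma dirichlet_kernel (t : R) (h : nat) :
  sin (t / 2) * (1 + 2 * sum1 (fun j => cos (INR j * t)) h) = sin ((2 * INR h + 1) * (t / 2)).
Proof.
  induction h as [|h IH].
  - simpl. f_equal. replace ((2 * 0 + 1) * (t / 2)) with (t / 2) by ring. ring.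
  - rewrite sum1_S.
    replace (sin (t / 2) * (1 + 2 * (sum1 (fun j => cos (INR j * t)) h + cos (INR (S h) * t))))
      with (sin (t / 2) * (1 + 2 * sum1 (fun j => cos (INR j * t)) h) + 2 * sin (t / 2) * cos (INR (S h) * t)) by ring.
    rewrite IH.
    replace ((2 * INR (S h) + 1) * (t / 2)) with (INR (S h) * t + t / 2) by field.
    replace ((2 * INR h + 1) * (t / 2)) with (INR (S h) * t - t / 2) by (rewrite S_INR; field).
    rewrite sin_plus, sin_minus. ring.
Qed.

Lemma cos_INR_2PI (n : nat) : cos (INR n * (2 * PI)) = 1.
Proof.
  induction n as [|n IH]; [simpl; rewrite Rmult_0_l; apply cos_0|].
  rewrite S_INR, Rmult_plus_distr_r, Rmult_1_l, cos_plus, IH, cos_2PI, sin_2PI. ring.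
Qed.

Lemma sin_INR_PI (n : nat) : sin (INR n * PI) = 0.
Proof.
  induction n as [|n IH]; [simpl; rewrite Rmult_0_l; apply sin_0|].
  rewrite S_INR, Rmult_plus_distr_r, Rmult_1_l, sin_plus, IH, sin_PI. ring.
Qed.

(* Orthogonality of the characters of [Z/l] for odd [l = 2 h + 1]; [r = q l + d]. *)
Lemma character_sum (h q d : nat) : let l := (2 * h + 1)%nat in (d < l)%nat ->
  1 + 2 * sum1 (fun j => cos (INR j * (2 * PI * INR (q * l + d) / INR l))) h =
  match d with O => INR l | S _ => 0 end.
Proof.
  intros l Hd.
  assert (Hl : 0 < INR l) by (apply lt_0_INR; unfold l; lia).
  assert (HlE : 2 * INR h + 1 = INR l) by (unfold l; rewrite plus_INR, mult_INR; simpl; ring).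
  destruct d as [|d].
  - rewrite (sum1_ext _ (fun _ => 1)).
    + rewrite sum1_const, <- HlE. ring.
    + intros j _. rewrite Nat.add_0_r, mult_INR.
      replace (INR j * (2 * PI * (INR q * INR l) / INR l)) with (INR (j * q) * (2 * PI))
        by (rewrite mult_INR; field; lra).
      apply cos_INR_2PI.
  - set (t := 2 * PI * INR (q * l + S d) / INR l).
    assert (H := dirichlet_kernel t h). rewrite HlE in H.
    replace (INR l * (t / 2)) with (INR (q * l + S d) * PI) in H by (unfold t; field; lra).
    rewrite sin_INR_PI in H.
    apply Rmult_integral in H. destruct H as [H|H]; [|exact H]. exfalso.
    assert (Et : t / 2 = INR (S d) / INR l * PI + INR q * PI).
    { unfold t. rewrite plus_INR, mult_INR. field. lra. }
    rewrite Et, sin_plus, sin_INR_PI, Rmult_0_r, Rplus_0_r in H.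
    assert (Hr : 0 < INR (S d) / INR l * PI < PI).
    { assert (HPI := PI_RGT_0). assert (H1 : 0 < INR (S d)) by (apply lt_0_INR; lia).
      assert (H2 : INR (S d) < INR l) by now apply lt_INR.
      assert (H3 : 0 < INR (S d) / INR l) by now apply Rdiv_lt_0_compat.
      assert (H4 : INR (S d) / INR l < 1).
      { apply Rmult_lt_reg_r with (INR l); [lra|]. unfold Rdiv. rewrite Rmult_assoc, Rinv_l by lra. lra. }
      nra. }
    assert (Hs := sin_gt_0 _ (proj1 Hr) (proj2 Hr)).
    assert (Hc : cos (INR q * PI) <> 0).
    { intros Hc. assert (H1 := sin2_cos2 (INR q * PI)). rewrite sin_INR_PI, Hc in H1.
      unfold Rsqr in H1. lra. }
    apply Rmult_integral in H. destruct H; lra.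
Qed.

Lemma sum1_multiples (g : nat -> R) (w : nat -> R) (l K : nat) (L : R) :
  (0 < l)%nat ->
  (forall q d, (d < l)%nat -> w (q * l + d)%nat = match d with O => L | S _ => 0 end) ->
  sum1 (fun r => g r * w r) (K * l) = L * sum1 (fun k => g (k * l)%nat) K.
Proof.
  intros Hl Hw. induction K as [|K IH]; [simpl; ring|].
  assert (Hb : forall d, (d < l)%nat -> sum1 (fun r => g r * w r) (K * l + d) = sum1 (fun r => g r * w r) (K * l)).
  { induction d as [|d IHd]; intros Hd; [now rewrite Nat.add_0_r|].
    rewrite Nat.add_succ_r. rewrite sum1_S. rewrite IHd by lia.
    replace (S (K * l + d)) with (K * l + S d)%nat by lia. rewrite Hw by exact Hd. ring. }
  replace (S K * l)%nat with (S (K * l + (l - 1)))%nat by lia.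
  rewrite !sum1_S. rewrite Hb, IH by lia.
  replace (S (K * l + (l - 1))) with (S K * l + 0)%nat by lia. rewrite Hw by lia.
  rewrite Nat.add_0_r. ring.
Qed.

(** A finite Poisson summation: summing [cos ^ (2 m)] over the points [PI * j / l] with
    [-h <= j <= h], paired by evenness, retains only the frequencies divisible by [l]. As [m <= K],
    all nonzero coefficients among these are present. *)
Theorem finite_theta_identity (h m K : nat) : let l := (2 * h + 1)%nat in (m <= K)%nat ->
  1 + 2 * sum1 (fun j => cos (PI * INR j / INR l) ^ (2 * m)) h =
  INR l * (cbin m 0 + 2 * sum1 (fun k => cbin m (k * l)) K).
Proof.
  intros l HmK.
  assert (Hl : 0 < INR l) by (apply lt_0_INR; unfold l; lia).
  set (n := (K * l)%nat).
  assert (Hn : (m <= n)%nat) by (unfold n, l; nia).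
  rewrite (sum1_ext _ (fun j => cbin m 0 + 2 * sum1 (fun r => cbin m r * cos (2 * INR r * (PI * INR j / INR l))) n)).
  2:{ intros j _. now apply cos_pow_expansion. }
  assert (E1 : 1 = csum2 (cbin m) 0 n).
  { rewrite <- (cos_pow_expansion m 0 n Hn), cos_0, pow1. reflexivity. }
  rewrite E1 at 1. unfold csum2.
  rewrite sum1_plus, sum1_const, sum1_scal, sum1_exchange.
  replace (cbin m 0 + 2 * sum1 (fun r => cbin m r * cos (2 * INR r * 0)) n +
    2 * (INR h * cbin m 0 + 2 * sum1 (fun j => sum1 (fun i => cbin m j * cos (2 * INR j * (PI * INR i / INR l))) h) n))
    with ((2 * INR h + 1) * cbin m 0 + 2 * (sum1 (fun r => cbin m r * cos (2 * INR r * 0)) n +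
      2 * sum1 (fun j => sum1 (fun i => cbin m j * cos (2 * INR j * (PI * INR i / INR l))) h) n)) by ring.
  replace (2 * INR h + 1) with (INR l) by (unfold l; rewrite plus_INR, mult_INR; simpl; ring).
  rewrite <- (sum1_scal 2), <- sum1_plus.
  rewrite (sum1_ext _ (fun r => cbin m r *
    (1 + 2 * sum1 (fun j => cos (INR j * (2 * PI * INR r / INR l))) h))).
  - unfold n. rewrite (sum1_multiples (cbin m) _ l K (INR l)); [ring|unfold l; lia|].
    intros q d Hd. now apply character_sum.
  - intros r _. rewrite Rmult_0_r, cos_0, sum1_scal.
    rewrite (sum1_ext (fun i => cos (2 * INR r * (PI * INR i / INR l)))
      (fun j => cos (INR j * (2 * PI * INR r / INR l)))); [ring|].
    intros j _. f_equal. field. lra.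
Qed.

(** Successive ratios are [1 - (2 r + 1) / (m + r + 1)], hence at most
    [exp (- (2 r + 1) / (m + n))], and the first [r] odd numbers add up to [r^2]. The bound [n] on
    [r] makes the denominators uniform. *)
Lemma cbin_upper (m n r : nat) : (r <= n)%nat -> (1 <= n)%nat ->
  cbin m r <= cbin m 0 * exp (- (INR r ^ 2 / INR (m + n))).
Proof.
  intros Hr Hn.
  assert (Hmn : 0 < INR (m + n)) by (apply lt_0_INR; lia).
  induction r as [|r IH].
  - simpl. replace (- (0 * (0 * 1) / INR (m + n))) with 0 by (field; lra). rewrite exp_0. lra.
  - specialize (IH ltac:(lia)).
    assert (Hc0 := cbin_0_pos m).
    destruct (Nat.le_gt_cases r m) as [Hrm|Hrm].
    + assert (H := cbin_ratio m r Hrm).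
      assert (H1 : 0 < INR (m + r + 1)) by (apply lt_0_INR; lia).
      assert (E : cbin m (S r) = (1 + - ((2 * INR r + 1) / INR (m + r + 1))) * cbin m r).
      { apply Rmult_eq_reg_l with (INR (m + r + 1)); [|lra]. rewrite H.
        rewrite minus_INR, !plus_INR by exact Hrm. simpl (INR 1). field.
        rewrite !plus_INR in H1. simpl (INR 1) in H1. lra. }
      rewrite E.
      assert (Hge0 : 0 <= 1 + - ((2 * INR r + 1) / INR (m + r + 1))).
      { replace (1 + - ((2 * INR r + 1) / INR (m + r + 1))) with (INR (m - r) / INR (m + r + 1)).
        - apply Rmult_le_pos; [apply pos_INR|left; now apply Rinv_0_lt_compat].
        - rewrite minus_INR, !plus_INR by exact Hrm. simpl (INR 1). field.
          rewrite !plus_INR in H1. simpl (INR 1) in H1. lra. }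
      assert (He : 1 + - ((2 * INR r + 1) / INR (m + r + 1)) <= exp (- ((2 * INR r + 1) / INR (m + n)))).
      { assert (Hr0 := pos_INR r).
        apply Rle_trans with (1 + - ((2 * INR r + 1) / INR (m + n))).
        - apply Rplus_le_compat_l, Ropp_le_contravar. apply Rmult_le_compat_l; [lra|].
          apply Rinv_le_contravar; [exact H1|]. apply le_INR. lia.
        - left. apply exp_ineq1. assert (H2 : 0 < (2 * INR r + 1) / INR (m + n)) by (apply Rdiv_lt_0_compat; lra). lra. }
      replace (- (INR (S r) ^ 2 / INR (m + n)))
        with (- ((2 * INR r + 1) / INR (m + n)) + - (INR r ^ 2 / INR (m + n)))
        by (rewrite S_INR; field; lra).
      rewrite exp_plus.
      apply Rle_trans with (exp (- ((2 * INR r + 1) / INR (m + n))) * (cbin m 0 * exp (- (INR r ^ 2 / INR (m + n))))).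
      * apply Rmult_le_compat; [exact Hge0| |exact He|exact IH].
        unfold cbin. apply Rmult_le_pos; [apply pos_INR|]. left. apply Rinv_0_lt_compat, pow_lt. lra.
      * right; ring.
    + rewrite cbin_large by lia.
      apply Rmult_le_pos; [lra|left; apply exp_pos].
Qed.

(** The ratios are now written [1 / (1 + z)] with [z = (2 r + 1) / (m - r)] and bounded below by
    [1 + z <= exp z]; for [r < n] the denominator is at least [m - n + 1]. *)
Lemma cbin_lower (m n r : nat) : (r <= n)%nat -> (n <= m)%nat ->
  cbin m 0 * exp (- (INR r ^ 2 / INR (m - n + 1))) <= cbin m r.
Proof.
  intros Hr Hn.
  assert (Hmn : 0 < INR (m - n + 1)) by (apply lt_0_INR; lia).
  induction r as [|r IH].
  - simpl. replace (- (0 * (0 * 1) / INR (m - n + 1))) with 0 by (field; lra). rewrite exp_0. lra.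
  - specialize (IH ltac:(lia)).
    assert (Hc0 := cbin_0_pos m). assert (Hr0 := pos_INR r).
    assert (H := cbin_ratio m r ltac:(lia)).
    assert (H1 : 0 < INR (m - r)) by (apply lt_0_INR; lia).
    assert (H1' : 0 < INR (m + r + 1)) by (apply lt_0_INR; lia).
    set (z := (2 * INR r + 1) / INR (m - r)).
    assert (Hz : 0 < z) by (apply Rdiv_lt_0_compat; lra).
    assert (E : cbin m (S r) = / (1 + z) * cbin m r).
    { apply Rmult_eq_reg_l with (INR (m + r + 1)); [|lra]. rewrite H.
      unfold z. rewrite minus_INR, !plus_INR in * by lia. simpl (INR 1) in *. field. lra. }
    assert (He : exp (- ((2 * INR r + 1) / INR (m - n + 1))) <= / (1 + z)).
    { rewrite exp_Ropp. apply Rinv_le_contravar; [lra|].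
      apply Rle_trans with (exp z); [left; apply exp_ineq1; lra|]. apply exp_le.
      apply Rmult_le_compat_l; [lra|]. apply Rinv_le_contravar; [exact Hmn|]. apply le_INR. lia. }
    rewrite E.
    replace (- (INR (S r) ^ 2 / INR (m - n + 1)))
      with (- ((2 * INR r + 1) / INR (m - n + 1)) + - (INR r ^ 2 / INR (m - n + 1)))
      by (rewrite S_INR; field; lra).
    rewrite exp_plus.
    apply Rle_trans with (exp (- ((2 * INR r + 1) / INR (m - n + 1))) * (cbin m 0 * exp (- (INR r ^ 2 / INR (m - n + 1))))).
    + right; ring.
    + apply Rmult_le_compat; [left; apply exp_pos| |exact He|exact IH].
      apply Rmult_le_pos; [lra|left; apply exp_pos].
Qed.

(* [m c_m(0)^2] increases and [(m + 1/2) c_m(0)^2] decreases. *)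
Lemma cbin_0_asymptotic : exists kappa, 0 < kappa /\
  is_lim_seq (fun m => INR m * cbin m 0 ^ 2) kappa.
Proof.
  assert (Hrec : forall m, cbin (S m) 0 = (2 * INR m + 1) / (2 * INR m + 2) * cbin m 0).
  { intros m. rewrite cbin_rec0. assert (H := cbin_ratio m 0 ltac:(lia)).
    rewrite Nat.add_0_r, Nat.sub_0_r, plus_INR in H. simpl (INR 1) in H.
    assert (Hm := pos_INR m).
    replace (cbin m 1) with (INR m / (INR m + 1) * cbin m 0).
    - field. lra.
    - apply Rmult_eq_reg_l with (INR m + 1); [|lra]. rewrite H. field. lra. }
  assert (Hinc : forall m, INR m * cbin m 0 ^ 2 <= INR (S m) * cbin (S m) 0 ^ 2).
  { intros m. rewrite Hrec, S_INR. assert (Hm := pos_INR m).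
    replace ((INR m + 1) * ((2 * INR m + 1) / (2 * INR m + 2) * cbin m 0) ^ 2)
      with ((2 * INR m + 1) ^ 2 / (4 * (INR m + 1)) * cbin m 0 ^ 2) by (field; lra).
    apply Rmult_le_compat_r; [apply pow2_ge_0|].
    apply Rmult_le_reg_r with (4 * (INR m + 1)); [lra|].
    unfold Rdiv. rewrite Rmult_assoc, Rinv_l by lra. nra. }
  assert (Hbd : forall m, (INR m + / 2) * cbin m 0 ^ 2 <= / 2).
  { induction m as [|m IH]; [unfold cbin; simpl; lra|].
    rewrite Hrec, S_INR. assert (Hm := pos_INR m). eapply Rle_trans; [|exact IH].
    replace ((INR m + 1 + / 2) * ((2 * INR m + 1) / (2 * INR m + 2) * cbin m 0) ^ 2)
      with ((INR m + 1 + / 2) * (2 * INR m + 1) ^ 2 / (2 * INR m + 2) ^ 2 * cbin m 0 ^ 2) by (field; lra).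
    apply Rmult_le_compat_r; [apply pow2_ge_0|].
    apply Rmult_le_reg_r with ((2 * INR m + 2) ^ 2); [apply pow_lt; lra|].
    unfold Rdiv. rewrite Rmult_assoc, Rinv_l by (apply pow_nonzero; lra). nra. }
  destruct (ex_finite_lim_seq_incr (fun m => INR m * cbin m 0 ^ 2) (/ 2) Hinc) as [kappa Hk].
  { intros m. assert (H := Hbd m). assert (H1 := pow2_ge_0 (cbin m 0)). lra. }
  exists kappa. split; [|exact Hk].
  assert (H1 : INR 1 * cbin 1 0 ^ 2 <= kappa) by exact (is_lim_seq_incr_compare _ _ Hk Hinc 1%nat).
  assert (H2 := cbin_0_pos 1). assert (H3 : 0 < cbin 1 0 ^ 2) by now apply pow_lt.
  simpl (INR 1) in H1. lra.
Qed.

(** * Interchange of limits and series, and Gaussian bounds for the cosine *)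

Lemma is_lim_seq_sum_n (f : nat -> nat -> R) (g : nat -> R) (n : nat) :
  (forall j, is_lim_seq (fun h => f h j) (g j)) ->
  is_lim_seq (fun h => sum_n (f h) n) (sum_n g n).
Proof.
  intros H. induction n as [|n IH].
  - rewrite sum_O. apply is_lim_seq_ext with (fun h => f h O); [intros h; now rewrite sum_O|apply H].
  - rewrite sum_Sn. apply is_lim_seq_ext with (fun h => sum_n (f h) n + f h (S n));
      [intros h; now rewrite sum_Sn|]. apply is_lim_seq_plus'; auto.
Qed.

Lemma Series_tail_le (f d : nat -> R) (n : nat) :
  (forall j, Rabs (f j) <= d j) -> ex_series d ->
  Rabs (Series f - sum_n f n) <= Series d - sum_n d n.
Proof.
  intros H Hd.
  assert (Hf : ex_series f).
  { apply (ex_series_le (K := R_AbsRing) (V := R_CompleteNormedModule) f d); auto. }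
  assert (E : forall u, ex_series u -> Series u - sum_n u n = Series (fun k => u (S n + k)%nat)).
  { intros u Hu. rewrite (Series_incr_n u (S n)) by (auto; lia).
    rewrite sum_n_Reals. simpl pred. ring. }
  rewrite !E by assumption.
  assert (Hd' : ex_series (fun k => d (S n + k)%nat)) by now apply ex_series_incr_n with (a := d).
  eapply Rle_trans; [apply Series_Rabs|].
  - apply (ex_series_le (K := R_AbsRing) (V := R_CompleteNormedModule) _ (fun k => d (S n + k)%nat)); auto.
    intros k. change (Rabs (Rabs (f (S n + k)%nat)) <= d (S n + k)%nat). rewrite Rabs_Rabsolu. apply H.
  - apply Series_le; auto. intros k. split; [apply Rabs_pos|apply H].
Qed.

Lemma tannery (f : nat -> nat -> R) (g d : nat -> R) :
  (forall j, is_lim_seq (fun h => f h j) (g j)) ->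
  (exists H0, forall h, (H0 <= h)%nat -> forall j, Rabs (f h j) <= d j) -> ex_series d ->
  is_lim_seq (fun h => Series (f h)) (Series g).
Proof.
  intros Hlim [H0 Hdom] Hd.
  assert (Hg : forall j, Rabs (g j) <= d j).
  { intros j. apply (is_lim_seq_le (fun h => Rabs (f (h + H0)%nat j)) (fun _ => d j) (Rabs (g j)) (d j)).
    - intros h. apply Hdom. lia.
    - apply (is_lim_seq_abs (fun h => f (h + H0)%nat j) (g j)).
      apply (is_lim_seq_incr_n (fun h => f h j) H0). apply Hlim.
    - apply is_lim_seq_const. }
  apply is_lim_seq_spec. intros eps.
  assert (Hs := Series_correct d Hd). change (is_lim_seq (sum_n d) (Series d)) in Hs.
  apply is_lim_seq_spec in Hs.
  assert (He : 0 < eps / 4) by (assert (H := cond_pos eps); lra).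
  destruct (Hs (mkposreal _ He)) as [N HN]. specialize (HN N (Nat.le_refl N)). simpl in HN.
  apply Rabs_def2 in HN.
  assert (Hfin := is_lim_seq_sum_n f g N Hlim). apply is_lim_seq_spec in Hfin.
  destruct (Hfin (mkposreal _ He)) as [M HM]. exists (M + H0)%nat. intros h Hh.
  specialize (HM h ltac:(lia)). simpl in HM.
  assert (T1 := Series_tail_le (f h) d N (Hdom h ltac:(lia)) Hd).
  assert (T2 := Series_tail_le g d N Hg Hd).
  replace (Series (f h) - Series g)
    with ((Series (f h) - sum_n (f h) N) + (sum_n (f h) N - sum_n g N) - (Series g - sum_n g N)) by ring.
  eapply Rle_lt_trans; [apply Rabs_triang|]. rewrite Rabs_Ropp.
  assert (H1 := Rabs_triang (Series (f h) - sum_n (f h) N) (sum_n (f h) N - sum_n g N)).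
  lra.
Qed.

Lemma Series_finite (a : nat -> R) (n : nat) :
  Series (fun k => if lt_dec k n then a (S k) else 0) = sum1 a n.
Proof.
  apply is_series_unique.
  assert (E : forall N, (n <= S N)%nat -> sum_n (fun k => if lt_dec k n then a (S k) else 0) N = sum1 a n).
  { assert (E1 : forall N, (S N <= n)%nat -> sum_n (fun k => if lt_dec k n then a (S k) else 0) N = sum1 a (S N)).
    { induction N as [|N IH]; intros HN.
      - rewrite sum_O. destruct (lt_dec 0 n); [simpl; ring|lia].
      - rewrite sum_Sn, IH by lia. destruct (lt_dec (S N) n); [reflexivity|lia]. }
    induction N as [|N IH]; intros HN.
    - destruct n as [|[|n]]; [|now apply E1|lia].
      rewrite sum_O. reflexivity.
    - destruct (Nat.eq_dec n (S (S N))) as [->|Hne]; [now apply E1|].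
      rewrite sum_Sn, IH by lia. destruct (lt_dec (S N) n); [lia|].
      change (sum1 a n + 0 = sum1 a n). ring. }
  change (is_lim_seq (sum_n (fun k => if lt_dec k n then a (S k) else 0)) (sum1 a n)).
  apply is_lim_seq_ext_loc with (fun _ => sum1 a n); [|apply is_lim_seq_const].
  exists n. intros N HN. symmetry. apply E. lia.
Qed.

Lemma ex_series_exp_lin (c : R) : 0 < c -> ex_series (fun k => exp (- c * INR (S k))).
Proof.
  intros Hc.
  apply (ex_series_ext (fun k => scal (exp (- c)) (exp (- c) ^ k))).
  - intros k. rewrite S_INR. change (exp (- c) * exp (- c) ^ k = exp (- c * (INR k + 1))).
    replace (- c * (INR k + 1)) with (- c + - c * INR k) by ring. rewrite exp_plus. f_equal.
    clear. induction k as [|k IH]; [simpl; rewrite Rmult_0_r, exp_0; reflexivity|].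
    rewrite S_INR. simpl pow. rewrite IH, <- exp_plus. f_equal. ring.
  - apply (ex_series_scal (K := R_AbsRing) (V := R_NormedModule)). apply ex_series_geom.
    rewrite Rabs_pos_eq by (left; apply exp_pos). rewrite <- exp_0. apply exp_increasing. lra.
Qed.

Lemma cos_le_exp (y : R) : 0 <= y <= PI / 2 -> cos y <= exp (- (y ^ 2 / 2)).
Proof.
  intros [Hy0 Hy].
  assert (HPI := PI_RGT_0).
  (* [y cos y <= sin y], so that [exp (y^2/2) cos y] is decreasing. *)
  assert (Hts : forall z, 0 <= z <= PI / 2 -> z * cos z - sin z <= 0).
  { intros z Hz.
    destruct (MVT_gen (fun u => u * cos u - sin u) 0 z (fun u => - (u * sin u))) as [c [Hc E]].
    - intros u _. auto_derive; [trivial|ring].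
    - intros u _. apply continuity_pt_filterlim.
      apply (ex_derive_continuous (K := R_AbsRing) (V := R_NormedModule) (fun u => u * cos u - sin u)).
      auto_derive. trivial.
    - rewrite Rmin_left, Rmax_right in Hc by lra.
      rewrite sin_0 in E.
      assert (0 <= sin c) by (apply sin_ge_0; lra).
      assert (0 <= c * sin c * z) by (repeat apply Rmult_le_pos; lra). lra. }
  destruct (MVT_gen (fun u => exp (u ^ 2 / 2) * cos u) 0 y (fun u => exp (u ^ 2 / 2) * (u * cos u - sin u))) as [c [Hc E]].
  - intros u _. auto_derive; [trivial|]. simpl. unfold Rdiv. field.
  - intros u _. apply continuity_pt_filterlim.
    apply (ex_derive_continuous (K := R_AbsRing) (V := R_NormedModule) (fun u => exp (u ^ 2 / 2) * cos u)).
    auto_derive. trivial.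
  - rewrite Rmin_left, Rmax_right in Hc by lra.
    cbv beta in E. rewrite cos_0 in E. replace (0 ^ 2 / 2) with 0 in E by (simpl; field). rewrite exp_0 in E.
    assert (H1 := Hts c ltac:(lra)). assert (H2 := exp_pos (c ^ 2 / 2)).
    assert (H3 : exp (c ^ 2 / 2) * (c * cos c - sin c) * (y - 0) <= 0).
    { assert (0 <= exp (c ^ 2 / 2) * (sin c - c * cos c) * (y - 0)) by (repeat apply Rmult_le_pos; lra). lra. }
    assert (H4 := exp_pos (y ^ 2 / 2)).
    rewrite exp_Ropp. apply Rmult_le_reg_l with (exp (y ^ 2 / 2)); [exact H4|].
    rewrite Rinv_r by lra. lra.
Qed.

(** With [z = y^2 / 2], [cos y >= 1 - z], and [1 / (1 - z) = 1 + z / (1 - z) <= exp (z / (1 - z))].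
    To leading order the exponent agrees with that of [cos_le_exp]. *)
Lemma cos_ge_exp (y : R) : 0 <= y <= 1 -> exp (- (y ^ 2 / 2 / (1 - y ^ 2 / 2))) <= cos y.
Proof.
  intros Hy.
  assert (Hc : 1 - y ^ 2 / 2 <= cos y).
  { destruct (MVT_gen (fun u => cos u + u ^ 2 / 2) 0 y (fun u => u - sin u)) as [c [Hc E]].
    - intros u _. auto_derive; [trivial|]. simpl. field.
    - intros u _. apply continuity_pt_filterlim.
      apply (ex_derive_continuous (K := R_AbsRing) (V := R_NormedModule) (fun u => cos u + u ^ 2 / 2)).
      auto_derive. trivial.
    - rewrite Rmin_left, Rmax_right in Hc by lra. cbv beta in E. rewrite cos_0 in E.
      replace (0 ^ 2 / 2) with 0 in E by (simpl; field).
      assert (sin c <= c).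
      { destruct (Req_dec c 0) as [->|Hc0]; [rewrite sin_0; lra|]. left. apply sin_lt_x. lra. }
      assert (0 <= (c - sin c) * (y - 0)) by (apply Rmult_le_pos; lra). lra. }
  assert (Hy2 : 0 <= y ^ 2 <= 1) by (split; [apply pow2_ge_0|simpl; nra]).
  eapply Rle_trans; [|exact Hc].
  set (z := y ^ 2 / 2) in *. assert (Hz : 0 <= z <= / 2) by (unfold z; lra).
  rewrite exp_Ropp. apply Rle_trans with (/ / (1 - z)); [|rewrite Rinv_inv; lra].
  apply Rinv_le_contravar; [apply Rinv_0_lt_compat; lra|].
  replace (/ (1 - z)) with (1 + z / (1 - z)) by (field; lra).
  destruct (Req_dec z 0) as [E0|Hz0].
  - assert (E : z / (1 - z) = 0) by (rewrite E0; field). rewrite E, exp_0. lra.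
  - left. apply exp_ineq1. assert (0 < z / (1 - z)) by (apply Rdiv_lt_0_compat; lra). lra.
Qed.

(* The theta function is [1 + 2 * theta0 x]. *)
Definition theta0 (x : R) : R := Series (fun k => exp (- (PI * x * INR (S k) ^ 2))).

Lemma exp_pow (a : R) (n : nat) : exp a ^ n = exp (INR n * a).
Proof.
  induction n as [|n IH]; [simpl; rewrite Rmult_0_l, exp_0; reflexivity|].
  simpl pow. rewrite IH, <- exp_plus, S_INR. f_equal. ring.
Qed.

Lemma continuity_pt_exp (x : R) : continuity_pt exp x.
Proof. apply derivable_continuous_pt, derivable_pt_exp. Qed.

(* Polya's proof: in the finite identity take [l = od h] and [m = mfloor x h ~ l^2 / (pi x)],
   so that [rho h -> 1 / (pi x)], and let [h] tend to infinity. *)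
Section ThetaLimit.
Variable x : R.
Hypothesis Hx : 0 < x.

Definition od (h : nat) : nat := (2 * h + 1)%nat.
(** The absolute value only makes the definition total; for [x > 0] its argument is already
    nonnegative. *)
Definition mfloor (x : R) (h : nat) : nat :=
  proj1_sig (nfloor_ex (Rabs (INR (od h) ^ 2 / (PI * x))) (Rabs_pos _)).

Lemma od_pos (h : nat) : 1 <= INR (od h).
Proof. unfold od. rewrite plus_INR, mult_INR. assert (H := pos_INR h). simpl. lra. Qed.

Lemma mfloor_spec (h : nat) :
  INR (mfloor x h) <= INR (od h) ^ 2 / (PI * x) < INR (mfloor x h) + 1.
Proof.
  unfold mfloor. destruct nfloor_ex as [m Hm]. simpl proj1_sig.
  assert (HPI := PI_RGT_0). assert (H := od_pos h).
  rewrite Rabs_pos_eq in Hm; [exact Hm|].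
  apply Rmult_le_pos; [apply pow2_ge_0|]. left. apply Rinv_0_lt_compat. nra.
Qed.

Definition rho (h : nat) : R := INR (mfloor x h) / INR (od h) ^ 2.

Lemma lim_inv_od : is_lim_seq (fun h => / INR (od h)) 0.
Proof.
  apply (is_lim_seq_le_le (fun _ => 0) _ (fun h => / INR (S h))).
  - intros h. assert (H := od_pos h). split; [left; apply Rinv_0_lt_compat; lra|].
    apply Rinv_le_contravar; [apply lt_0_INR; lia|]. apply le_INR. unfold od. lia.
  - apply is_lim_seq_const.
  - apply (is_lim_seq_incr_1 (fun n => / INR n)).
    replace (Finite 0) with (Rbar_inv p_infty) by reflexivity.
    apply is_lim_seq_inv; [apply is_lim_seq_INR|discriminate].
Qed.

Lemma lim_rho : is_lim_seq rho (/ (PI * x)).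
Proof.
  assert (HPI := PI_RGT_0). assert (Hpx : 0 < PI * x) by nra.
  apply (is_lim_seq_le_le (fun h => / (PI * x) - / INR (od h)) _ (fun _ => / (PI * x))).
  - intros h. destruct (mfloor_spec h) as [H1 H2]. assert (H := od_pos h). unfold rho.
    assert (Hsq : 0 < INR (od h) ^ 2) by (apply pow_lt; lra).
    split.
    + apply Rle_trans with (/ (PI * x) - / INR (od h) ^ 2).
      * apply Rplus_le_compat_l, Ropp_le_contravar. apply Rinv_le_contravar; [lra|]. simpl. nra.
      * apply Rmult_le_reg_r with (INR (od h) ^ 2); [exact Hsq|].
        unfold Rdiv in *. rewrite Rmult_minus_distr_r, Rmult_assoc, !Rinv_l by lra. lra.
    + apply Rmult_le_reg_r with (INR (od h) ^ 2); [exact Hsq|].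
      unfold Rdiv in *. rewrite Rmult_assoc, Rinv_l by lra. lra.
  - replace (Finite (/ (PI * x))) with (Finite (/ (PI * x) - 0)) by (f_equal; ring).
    apply is_lim_seq_minus'; [apply is_lim_seq_const|apply lim_inv_od].
  - apply is_lim_seq_const.
Qed.

Lemma rho_le (h : nat) : rho h <= / (PI * x).
Proof.
  assert (HPI := PI_RGT_0).
  destruct (mfloor_spec h) as [H1 _]. assert (H := od_pos h). unfold rho.
  apply Rmult_le_reg_r with (INR (od h) ^ 2); [apply pow_lt; lra|].
  assert (Hsq : INR (od h) ^ 2 <> 0) by (apply pow_nonzero; lra).
  unfold Rdiv in *. rewrite Rmult_assoc, Rinv_l by lra. lra.
Qed.

Lemma rho_pos_eventually : exists H0, forall h, (H0 <= h)%nat -> / (2 * PI * x) < rho h.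
Proof.
  assert (HPI := PI_RGT_0). assert (Hpx : 0 < PI * x) by nra.
  assert (H := lim_rho). apply is_lim_seq_spec in H.
  assert (He : 0 < / (2 * PI * x)) by (apply Rinv_0_lt_compat; nra).
  destruct (H (mkposreal _ He)) as [H0 HH0]. exists H0. intros h Hh. specialize (HH0 h Hh). simpl in HH0.
  apply Rabs_def2 in HH0.
  replace (/ (PI * x)) with (2 * / (2 * PI * x)) in HH0 by (field; lra). lra.
Qed.

Lemma mfloor_eq (h : nat) : INR (mfloor x h) = rho h * INR (od h) ^ 2.
Proof. unfold rho. field. assert (H := od_pos h). lra. Qed.

Lemma lim_exp (u : nat -> R) (l : R) : is_lim_seq u l -> is_lim_seq (fun n => exp (u n)) (exp l).
Proof. apply is_lim_seq_continuous, continuity_pt_exp. Qed.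

Lemma eventually_od_large (B : R) : exists H0, forall h, (H0 <= h)%nat -> B <= INR (od h).
Proof.
  destruct (nfloor_ex (Rabs B) (Rabs_pos B)) as [N HN]. exists (S N). intros h Hh.
  apply Rle_trans with (INR (S N)).
  - rewrite S_INR. assert (H := Rle_abs B). lra.
  - apply le_INR. unfold od. lia.
Qed.

(** The finite sums on both sides are continued by zeros to series, so that their limits fall under
    Tannery's theorem. *)
Definition lhs_term (h k : nat) : R :=
  if lt_dec k h then cos (PI * INR (S k) / INR (od h)) ^ (2 * mfloor x h) else 0.

Lemma lhs_angle (h k : nat) : (k < h)%nat -> 0 <= PI * INR (S k) / INR (od h) <= PI / 2.
Proof.
  intros H. assert (HPI := PI_RGT_0). assert (Ho := od_pos h).
  assert (H1 : 2 * INR (S k) <= INR (od h)).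
  { apply Rle_trans with (INR (2 * S k)); [rewrite mult_INR; simpl; lra|].
    apply le_INR. unfold od. lia. }
  assert (H2 := pos_INR (S k)).
  split.
  - apply Rmult_le_pos; [nra|left; apply Rinv_0_lt_compat; lra].
  - apply Rmult_le_reg_r with (INR (od h)); [lra|].
    unfold Rdiv. rewrite Rmult_assoc, Rinv_l by lra. nra.
Qed.

Lemma lhs_upper (h k : nat) : (k < h)%nat ->
  0 <= lhs_term h k <= exp (- (PI ^ 2 * INR (S k) ^ 2 * rho h)).
Proof.
  intros H. unfold lhs_term. destruct (lt_dec k h) as [_|Hn]; [|lia].
  assert (Ho := od_pos h). assert (Ha := lhs_angle h k H).
  set (y := PI * INR (S k) / INR (od h)) in *.
  assert (Hc0 : 0 <= cos y) by (apply cos_ge_0; lra).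
  split; [now apply pow_le|].
  eapply Rle_trans; [apply pow_incr; split; [exact Hc0|now apply cos_le_exp]|].
  rewrite exp_pow, mult_INR, mfloor_eq. right. f_equal. unfold y. simpl (INR 2). field. lra.
Qed.

(** With [y = PI * J / l] and [m = rho * l^2], the two bounds for the cosine give [cos y ^ (2 m)]
    the exponent [- m y^2 = - PI^2 J^2 rho] up to a factor tending to 1, and [rho] tends to
    [1 / (PI * x)]. *)
Lemma lhs_limit (k : nat) : is_lim_seq (fun h => lhs_term h k) (exp (- (PI * / x * INR (S k) ^ 2))).
Proof.
  assert (HPI := PI_RGT_0). set (J := INR (S k)).
  destruct (eventually_od_large (PI * J)) as [H0 HH0].
  apply is_lim_seq_le_le_loc with
    (u := fun h => exp (- (PI ^ 2 * J ^ 2 * rho h / (1 - PI ^ 2 * J ^ 2 / 2 * (/ INR (od h) * / INR (od h))))))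
    (w := fun h => exp (- (PI ^ 2 * J ^ 2 * rho h))).
  - exists (S k + H0)%nat. intros h Hh. split; [|apply lhs_upper; lia].
    unfold lhs_term. destruct (lt_dec k h) as [_|Hn]; [|lia].
    assert (Ha := lhs_angle h k ltac:(lia)). fold J in Ha |- *.
    specialize (HH0 h ltac:(lia)). assert (Ho := od_pos h).
    set (y := PI * J / INR (od h)) in *.
    assert (Hy1 : y <= 1).
    { unfold y. apply Rmult_le_reg_r with (INR (od h)); [lra|].
      unfold Rdiv. rewrite Rmult_assoc, Rinv_l by lra. lra. }
    apply Rle_trans with (exp (- (y ^ 2 / 2 / (1 - y ^ 2 / 2))) ^ (2 * mfloor x h)).
    + rewrite exp_pow, mult_INR, mfloor_eq. right. f_equal.
      assert (Hy2 : y ^ 2 <= 1) by (simpl; nra).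
      replace (PI ^ 2 * J ^ 2 / 2 * (/ INR (od h) * / INR (od h))) with (y ^ 2 / 2) by (unfold y; field; lra).
      replace (PI ^ 2 * J ^ 2 * rho h) with (y ^ 2 * (rho h * INR (od h) ^ 2)) by (unfold y; field; lra).
      simpl (INR 2). field. lra.
    + apply pow_incr. split; [left; apply exp_pos|]. apply cos_ge_exp. lra.
  - apply lim_exp.
    replace (- (PI * / x * J ^ 2)) with (- (PI ^ 2 * J ^ 2 * / (PI * x) / (1 - PI ^ 2 * J ^ 2 / 2 * (0 * 0)))) by (field; lra).
    apply (is_lim_seq_opp _ (Finite (PI ^ 2 * J ^ 2 * / (PI * x) / (1 - PI ^ 2 * J ^ 2 / 2 * (0 * 0))))).
    apply is_lim_seq_div'.
    + apply (is_lim_seq_scal_l rho _ (Finite (/ (PI * x)))). apply lim_rho.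
    + apply is_lim_seq_minus'; [apply is_lim_seq_const|].
      apply (is_lim_seq_scal_l (fun h => / INR (od h) * / INR (od h)) _ (Finite (0 * 0))).
      apply is_lim_seq_mult'; apply lim_inv_od.
    + lra.
  - apply lim_exp.
    replace (- (PI * / x * J ^ 2)) with (- (PI ^ 2 * J ^ 2 * / (PI * x))) by (field; lra).
    apply (is_lim_seq_opp _ (Finite (PI ^ 2 * J ^ 2 * / (PI * x)))).
    apply (is_lim_seq_scal_l rho _ (Finite (/ (PI * x)))). apply lim_rho.
Qed.

Lemma lhs_dominated : exists H0, forall h, (H0 <= h)%nat -> forall k,
  Rabs (lhs_term h k) <= exp (- (PI / (2 * x)) * INR (S k)).
Proof.
  assert (HPI := PI_RGT_0).
  destruct rho_pos_eventually as [H0 HH0]. exists H0. intros h Hh k. specialize (HH0 h Hh).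
  destruct (lt_dec k h) as [Hk|Hk].
  - destruct (lhs_upper h k Hk) as [Hl Hu]. rewrite Rabs_pos_eq by exact Hl.
    eapply Rle_trans; [exact Hu|]. apply exp_le.
    assert (HJ : 1 <= INR (S k)) by (rewrite S_INR; assert (H := pos_INR k); lra).
    set (J := INR (S k)) in *.
    replace (- (PI / (2 * x)) * J) with (- (PI ^ 2 * J * / (2 * PI * x))) by (field; lra).
    apply Ropp_le_contravar.
    assert (HP2 : 0 < PI ^ 2) by (apply pow_lt; lra).
    assert (Hi : 0 < / (2 * PI * x)) by (apply Rinv_0_lt_compat; nra).
    apply Rmult_le_compat; [nra|lra| |lra]. apply Rmult_le_compat_l; [lra|]. simpl. nra.
  - unfold lhs_term. destruct (lt_dec k h) as [Hk'|_]; [lia|].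
    rewrite Rabs_R0. left; apply exp_pos.
Qed.

(** Division by the central coefficient isolates the Gaussian shape; the growth of that coefficient
    enters separately, as a factor in [polya_identity]. *)
Definition rhs_term (h k : nat) : R :=
  if lt_dec k (mfloor x h) then cbin (mfloor x h) (S k * od h) / cbin (mfloor x h) 0 else 0.

Lemma cbin_nonneg (m r : nat) : 0 <= cbin m r.
Proof.
  unfold cbin. apply Rmult_le_pos; [apply pos_INR|]. left. apply Rinv_0_lt_compat, pow_lt. lra.
Qed.

Lemma rhs_nonneg (h k : nat) : 0 <= rhs_term h k.
Proof.
  unfold rhs_term. destruct lt_dec; [|lra].
  apply Rmult_le_pos; [apply cbin_nonneg|]. left. apply Rinv_0_lt_compat, cbin_0_pos.
Qed.

Lemma rhs_upper (h k : nat) : 0 < rho h ->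
  rhs_term h k <= exp (- (INR (S k) ^ 2 / (rho h + INR (S k) * / INR (od h)))).
Proof.
  intros Hr. unfold rhs_term. destruct lt_dec as [H|H]; [|left; apply exp_pos].
  assert (Ho := od_pos h). assert (Hc := cbin_0_pos (mfloor x h)).
  assert (Hod1 : (1 <= od h)%nat) by (unfold od; lia).
  assert (HU := cbin_upper (mfloor x h) (S k * od h) (S k * od h) ltac:(lia) ltac:(nia)).
  apply Rmult_le_reg_r with (cbin (mfloor x h) 0); [exact Hc|].
  unfold Rdiv at 1. rewrite Rmult_assoc, Rinv_l, Rmult_1_r, Rmult_comm by lra.
  eapply Rle_trans; [exact HU|]. right. f_equal. f_equal. f_equal.
  assert (HJ : 0 < INR (S k)) by (apply lt_0_INR; lia).
  rewrite plus_INR, mult_INR, mfloor_eq. field. split; [|split]; try lra.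
  - assert (0 < rho h * INR (od h) + INR (S k)) by nra. lra.
  - assert (0 < rho h * INR (od h) ^ 2 + INR (S k) * INR (od h)); [|lra].
    apply Rplus_lt_0_compat; [apply Rmult_lt_0_compat; [lra|apply pow_lt; lra]|nra].
Qed.

Lemma rhs_limit (k : nat) : is_lim_seq (fun h => rhs_term h k) (exp (- (PI * x * INR (S k) ^ 2))).
Proof.
  assert (HPI := PI_RGT_0). assert (Hpx : 0 < PI * x) by nra. set (J := INR (S k)).
  assert (HJ : 1 <= J) by (unfold J; rewrite S_INR; assert (H := pos_INR k); lra).
  destruct rho_pos_eventually as [H1 HH1].
  destruct (eventually_od_large (4 * PI * x * J)) as [H0 HH0].
  apply is_lim_seq_le_le_loc with
    (u := fun h => exp (- (J ^ 2 / (rho h - J * / INR (od h) + / INR (od h) * / INR (od h)))))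
    (w := fun h => exp (- (J ^ 2 / (rho h + J * / INR (od h))))).
  - exists (H0 + H1)%nat. intros h Hh. specialize (HH1 h ltac:(lia)). specialize (HH0 h ltac:(lia)).
    assert (Hi : 0 < / (2 * PI * x)) by (apply Rinv_0_lt_compat; nra).
    assert (Ho := od_pos h).
    assert (HJm : J * INR (od h) < INR (mfloor x h)).
    { rewrite mfloor_eq. apply Rlt_le_trans with (/ (2 * PI * x) * INR (od h) ^ 2).
      - apply Rmult_lt_reg_l with (2 * PI * x); [nra|].
        rewrite <- (Rmult_assoc (2 * PI * x) (/ _)), Rinv_r by nra. simpl.
        assert (2 * PI * x * J < INR (od h)) by nra. nra.
      - apply Rmult_le_compat_r; [apply pow2_ge_0|lra]. }
    assert (HJn : (S k * od h <= mfloor x h)%nat).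
    { apply INR_le. rewrite mult_INR. fold J. lra. }
    split; [|apply rhs_upper; lra].
    assert (Hod1 : (1 <= od h)%nat) by (unfold od; lia).
    unfold rhs_term. destruct lt_dec as [_|Hn].
    2:{ exfalso. apply Hn. nia. }
    assert (Hc := cbin_0_pos (mfloor x h)).
    assert (HL := cbin_lower (mfloor x h) (S k * od h) (S k * od h) ltac:(lia) HJn).
    apply Rmult_le_reg_r with (cbin (mfloor x h) 0); [exact Hc|].
    unfold Rdiv at 2. rewrite Rmult_assoc, Rinv_l, Rmult_1_r, Rmult_comm by lra.
    eapply Rle_trans; [|exact HL]. right. f_equal. f_equal. f_equal.
    rewrite plus_INR, minus_INR, mult_INR by exact HJn. fold J. simpl (INR 1).
    rewrite mfloor_eq in *.
    assert (Hpos : 0 < rho h * INR (od h) ^ 2 - J * INR (od h) + 1) by lra.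
    field. split; lra.
  - apply lim_exp.
    replace (- (PI * x * J ^ 2)) with (- (J ^ 2 / (/ (PI * x) - J * 0 + 0 * 0))) by (field; lra).
    apply (is_lim_seq_opp _ (Finite (J ^ 2 / (/ (PI * x) - J * 0 + 0 * 0)))).
    apply is_lim_seq_div'; [apply is_lim_seq_const| |].
    + apply is_lim_seq_plus'; [apply is_lim_seq_minus'; [apply lim_rho|]|].
      * apply (is_lim_seq_scal_l (fun h => / INR (od h)) _ (Finite 0)). apply lim_inv_od.
      * apply is_lim_seq_mult'; apply lim_inv_od.
    + assert (0 < / (PI * x)) by now apply Rinv_0_lt_compat. lra.
  - apply lim_exp.
    replace (- (PI * x * J ^ 2)) with (- (J ^ 2 / (/ (PI * x) + J * 0))) by (field; lra).
    apply (is_lim_seq_opp _ (Finite (J ^ 2 / (/ (PI * x) + J * 0)))).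
    apply is_lim_seq_div'; [apply is_lim_seq_const| |].
    + apply is_lim_seq_plus'; [apply lim_rho|].
      apply (is_lim_seq_scal_l (fun h => / INR (od h)) _ (Finite 0)). apply lim_inv_od.
    + assert (0 < / (PI * x)) by now apply Rinv_0_lt_compat. lra.
Qed.

Lemma rhs_dominated : exists H0, forall h, (H0 <= h)%nat -> forall k,
  Rabs (rhs_term h k) <= exp (- (PI * x / 2) * INR (S k)).
Proof.
  assert (HPI := PI_RGT_0). assert (Hpx : 0 < PI * x) by nra.
  destruct rho_pos_eventually as [H0 HH0]. exists H0. intros h Hh k. specialize (HH0 h Hh).
  assert (Hi : 0 < / (2 * PI * x)) by (apply Rinv_0_lt_compat; nra).
  rewrite Rabs_pos_eq by apply rhs_nonneg.
  assert (HJ : 1 <= INR (S k)) by (rewrite S_INR; assert (H := pos_INR k); lra).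
  assert (Ho := od_pos h).
  (* If [J l <= m], then [J / l <= rho] and the Gaussian bound has a denominator of at most
     [2 rho <= 2 / (PI * x)]; otherwise the coefficient is zero. *)
  destruct (Nat.le_gt_cases (S k * od h) (mfloor x h)) as [Hle|Hgt].
  - eapply Rle_trans; [apply rhs_upper; lra|]. apply exp_le.
    apply le_INR in Hle. rewrite mult_INR, mfloor_eq in Hle.
    set (J := INR (S k)) in *.
    assert (HJr : J * / INR (od h) <= rho h).
    { apply Rmult_le_reg_r with (INR (od h) ^ 2); [apply pow_lt; lra|].
      replace (J * / INR (od h) * INR (od h) ^ 2) with (J * INR (od h)) by (field; lra). lra. }
    assert (Hr := rho_le h).
    assert (HJ0 : 0 < J * / INR (od h)).
    { apply Rmult_lt_0_compat; [lra|]. apply Rinv_0_lt_compat. lra. }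
    replace (- (PI * x / 2) * J) with (- (J * / (2 * / (PI * x)))) by (field; lra).
    apply Ropp_le_contravar. unfold Rdiv.
    apply Rmult_le_compat; [lra| |simpl; nra|].
    + left; apply Rinv_0_lt_compat. assert (0 < / (PI * x)) by now apply Rinv_0_lt_compat. lra.
    + apply Rinv_le_contravar; lra.
  - unfold rhs_term. destruct lt_dec; [|left; apply exp_pos].
    rewrite cbin_large by lia. unfold Rdiv. rewrite Rmult_0_l. left; apply exp_pos.
Qed.

Lemma polya_identity (h : nat) :
  1 + 2 * Series (lhs_term h) =
  INR (od h) * cbin (mfloor x h) 0 * (1 + 2 * Series (rhs_term h)).
Proof.
  unfold lhs_term, rhs_term.
  rewrite (Series_finite (fun j => cos (PI * INR j / INR (od h)) ^ (2 * mfloor x h)) h).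
  rewrite (Series_finite (fun k => cbin (mfloor x h) (k * od h) / cbin (mfloor x h) 0) (mfloor x h)).
  assert (Hc := cbin_0_pos (mfloor x h)).
  assert (F := finite_theta_identity h (mfloor x h) (mfloor x h) ltac:(lia)).
  cbv zeta in F. fold (od h) in F. rewrite F.
  rewrite (sum1_ext (fun k => cbin (mfloor x h) (k * od h) / cbin (mfloor x h) 0)
    (fun k => / cbin (mfloor x h) 0 * cbin (mfloor x h) (k * od h)))
    by (intros; unfold Rdiv; ring).
  rewrite sum1_scal. field. lra.
Qed.

Lemma mfloor_subseq : filterlim (mfloor x) eventually eventually.
Proof.
  assert (HPI := PI_RGT_0).
  intros P [N HN]. destruct rho_pos_eventually as [H1 HH1].
  destruct (eventually_od_large (2 * PI * x * (INR N + 1))) as [H0 HH0].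
  exists (H0 + H1)%nat. intros h Hh. apply HN.
  specialize (HH1 h ltac:(lia)). specialize (HH0 h ltac:(lia)).
  apply INR_le. rewrite mfloor_eq. assert (Ho := od_pos h). assert (HN0 := pos_INR N).
  assert (Hi : 0 < / (2 * PI * x)) by (apply Rinv_0_lt_compat; nra).
  apply Rle_trans with (/ (2 * PI * x) * INR (od h) ^ 2).
  - apply Rmult_le_reg_l with (2 * PI * x); [nra|].
    rewrite <- Rmult_assoc, Rinv_r by nra.
    assert (Hpx : 0 < PI * x) by nra.
    apply Rle_trans with (INR (od h)); [lra|]. simpl. nra.
  - apply Rmult_le_compat_r; [apply pow2_ge_0|lra].
Qed.

Lemma theta_limit (kappa : R) : 0 < kappa ->
  is_lim_seq (fun m => INR m * cbin m 0 ^ 2) kappa ->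
  1 + 2 * theta0 (/ x) = sqrt (PI * x * kappa) * (1 + 2 * theta0 x).
Proof.
  intros Hk Hlim.
  assert (HPI := PI_RGT_0). assert (Hpx : 0 < PI * x) by nra.
  assert (L1 : is_lim_seq (fun h => 1 + 2 * Series (lhs_term h)) (1 + 2 * theta0 (/ x))).
  { apply is_lim_seq_plus'; [apply is_lim_seq_const|].
    apply (is_lim_seq_scal_l _ _ (Finite (theta0 (/ x)))).
    apply (tannery _ _ (fun k => exp (- (PI / (2 * x)) * INR (S k))) lhs_limit lhs_dominated).
    apply ex_series_exp_lin. apply Rdiv_lt_0_compat; lra. }
  assert (L2 : is_lim_seq (fun h => 1 + 2 * Series (rhs_term h)) (1 + 2 * theta0 x)).
  { apply is_lim_seq_plus'; [apply is_lim_seq_const|].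
    apply (is_lim_seq_scal_l _ _ (Finite (theta0 x))).
    apply (tannery _ _ (fun k => exp (- (PI * x / 2) * INR (S k))) rhs_limit rhs_dominated).
    apply ex_series_exp_lin. lra. }
  (* Since [l^2 = m / rho], the square of [l * cbin m 0] is [m * cbin m 0 ^ 2 / rho], whose limit is
     [PI * x * kappa]. *)
  assert (L3 : is_lim_seq (fun h => INR (od h) * cbin (mfloor x h) 0) (sqrt (PI * x * kappa))).
  { destruct rho_pos_eventually as [H0 HH0].
    apply is_lim_seq_ext_loc with (fun h => sqrt (1 / rho h * (INR (mfloor x h) * cbin (mfloor x h) 0 ^ 2))).
    - exists H0. intros h Hh. specialize (HH0 h Hh).
      assert (Hi : 0 < / (2 * PI * x)) by (apply Rinv_0_lt_compat; nra).
      assert (Ho := od_pos h). assert (Hc := cbin_0_pos (mfloor x h)).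
      rewrite mfloor_eq.
      replace (1 / rho h * (rho h * INR (od h) ^ 2 * cbin (mfloor x h) 0 ^ 2))
        with ((INR (od h) * cbin (mfloor x h) 0) * (INR (od h) * cbin (mfloor x h) 0)) by (field; lra).
      apply sqrt_square. apply Rmult_le_pos; lra.
    - apply is_lim_seq_continuous; [apply continuity_pt_sqrt; nra|].
      replace (PI * x * kappa) with (1 / / (PI * x) * kappa) by (field; lra).
      apply is_lim_seq_mult'.
      + apply is_lim_seq_div'; [apply is_lim_seq_const|apply lim_rho|].
        apply Rinv_neq_0_compat. lra.
      + apply (is_lim_seq_subseq (fun m => INR m * cbin m 0 ^ 2) kappa (mfloor x) mfloor_subseq Hlim). }
  assert (L4 := is_lim_seq_mult' _ _ _ _ L3 L2).
  assert (L5 : is_lim_seq (fun h => 1 + 2 * Series (lhs_term h)) (sqrt (PI * x * kappa) * (1 + 2 * theta0 x))).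
  { apply is_lim_seq_ext with (2 := L4). intros h. symmetry. apply polya_identity. }
  apply is_lim_seq_unique in L1. apply is_lim_seq_unique in L5. rewrite L1 in L5. now injection L5.
Qed.

End ThetaLimit.

Lemma theta0_nonneg (x : R) : 0 < x -> 0 <= theta0 x.
Proof.
  intros Hx. assert (HPI := PI_RGT_0).
  rewrite <- (Rmult_0_l (Series (fun _ : nat => 0))), <- Series_scal_l.
  apply Series_le.
  - intros k. split; [lra|]. rewrite Rmult_0_l. left; apply exp_pos.
  - apply (ex_series_le (K := R_AbsRing) (V := R_CompleteNormedModule) _ (fun k => exp (- (PI * x) * INR (S k)))).
    + intros k. change (Rabs (exp (- (PI * x * INR (S k) ^ 2))) <= exp (- (PI * x) * INR (S k))).
      rewrite Rabs_pos_eq by (left; apply exp_pos). apply exp_le.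
      assert (HJ : 1 <= INR (S k)) by (rewrite S_INR; assert (H := pos_INR k); lra).
      set (J := INR (S k)) in *. assert (Hpx : 0 < PI * x) by nra.
      assert (0 <= PI * x * (J * (J - 1))) by (apply Rmult_le_pos; nra). lra.
    + apply ex_series_exp_lin. nra.
Qed.

Theorem theta_functional_equation (x : R) : 0 < x ->
  1 + 2 * theta0 (/ x) = sqrt x * (1 + 2 * theta0 x).
Proof.
  intros Hx. assert (HPI := PI_RGT_0).
  destruct cbin_0_asymptotic as [kappa [Hk Hlim]].
  (* The case [x = 1] determines the constant [kappa]. *)
  assert (H1 := theta_limit 1 Rlt_0_1 kappa Hk Hlim). rewrite Rinv_1 in H1.
  assert (Hn := theta0_nonneg 1 Rlt_0_1).
  assert (Hs : sqrt (PI * 1 * kappa) = 1).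
  { apply Rmult_eq_reg_r with (1 + 2 * theta0 1); lra. }
  rewrite (theta_limit x Hx kappa Hk Hlim).
  replace (PI * x * kappa) with (x * (PI * 1 * kappa)) by ring.
  assert (Hpk : 0 < PI * kappa) by (apply Rmult_lt_0_compat; lra).
  rewrite sqrt_mult by lra. rewrite Hs. ring.
Qed.

(** * Continuity rules and substitutions for integrals along the real line *)

Lemma pcont_mult (f g : R -> C) (t : R) : pcont f t -> pcont g t -> pcont (fun u => f u * g u)%C t.
Proof.
  intros Hf Hg. apply pcont_eps. intros eps Heps.
  assert (Pf := Cmod_ge_0 (f t)). assert (Pg := Cmod_ge_0 (g t)).
  set (e := Rmin 1 (eps / (2 + Cmod (f t) + Cmod (g t)))).
  assert (He : 0 < e) by (apply Rmin_pos; [lra|apply Rdiv_lt_0_compat; lra]).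
  assert (He1 : e <= 1) by apply Rmin_l.
  assert (He2 : e * (2 + Cmod (f t) + Cmod (g t)) <= eps).
  { apply Rle_trans with (eps / (2 + Cmod (f t) + Cmod (g t)) * (2 + Cmod (f t) + Cmod (g t))).
    - apply Rmult_le_compat_r; [lra|apply Rmin_r].
    - right; field; lra. }
  destruct (pcont_eps_inv f t Hf e He) as [d1 [Hd1 H1]].
  destruct (pcont_eps_inv g t Hg e He) as [d2 [Hd2 H2]].
  exists (Rmin d1 d2); split; [now apply Rmin_pos|]. intros u Hu.
  specialize (H1 u (Rlt_le_trans _ _ _ Hu (Rmin_l _ _))).
  specialize (H2 u (Rlt_le_trans _ _ _ Hu (Rmin_r _ _))).
  replace (f u * g u - f t * g t)%C
    with ((f u - f t) * (g u - g t) + ((f u - f t) * g t + f t * (g u - g t)))%C by ring.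
  eapply Rle_lt_trans; [apply Cmod_triangle|].
  eapply Rle_lt_trans; [apply Rplus_le_compat_l, Cmod_triangle|].
  rewrite !Cmod_mult.
  assert (H3 := Cmod_ge_0 (f u - f t)). assert (H4 := Cmod_ge_0 (g u - g t)). nra.
Qed.

Lemma pcont_plus (f g : R -> C) (t : R) : pcont f t -> pcont g t -> pcont (fun u => f u + g u)%C t.
Proof. exact (continuous_plus (K := R_AbsRing) (V := C_R_NormedModule) f g t). Qed.

Lemma pcont_minus (f g : R -> C) (t : R) : pcont f t -> pcont g t -> pcont (fun u => f u - g u)%C t.
Proof. exact (continuous_minus (K := R_AbsRing) (V := C_R_NormedModule) f g t). Qed.

Lemma pcont_const (c : C) (t : R) : pcont (fun _ => c) t.
Proof. exact (continuous_const (U := R_UniformSpace) (V := C_UniformSpace) c t). Qed.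

Lemma pcont_Cexp_line (s : C) (t : R) : pcont (fun u => Cexp (RtoC u * s)) t.
Proof. eapply pderiv_continuous. apply pderiv_Cexp_line. Qed.

Lemma pcont_RtoC (h : R -> R) (t : R) : ex_derive h t -> pcont (fun u => RtoC (h u)) t.
Proof. intros [d Hd]. eapply pderiv_continuous. apply pderiv_RtoC. exact Hd. Qed.

Lemma pcont_affine (f : R -> C) (k c t : R) :
  pcont f (k * t + c) -> pcont (fun u => f (k * u + c)) t.
Proof.
  intros H. apply (continuous_comp (fun u => k * u + c) f); [|exact H].
  apply (ex_derive_continuous (K := R_AbsRing) (V := R_NormedModule) (fun u => k * u + c)). auto_derive. trivial.
Qed.

Lemma pcont_opp_arg (f : R -> C) (t : R) : pcont f (- t) -> pcont (fun u => f (- u)) t.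
Proof.
  intros H. apply (continuous_comp (fun u => - u) f); [|exact H].
  apply (ex_derive_continuous (K := R_AbsRing) (V := R_NormedModule) (fun u => - u)). auto_derive. trivial.
Qed.

Lemma CInt_opp_arg (f : R -> C) (b : R) : 0 <= b -> (forall t, pcont f t) ->
  CInt (fun u => f (- u)) 0 b = CInt f (- b) 0.
Proof.
  intros Hb Hf.
  assert (H := RInt_comp_lin (V := C_R_CompleteNormedModule) f (-1) 0 0 b).
  replace (-1 * 0 + 0) with 0 in H by ring. replace (-1 * b + 0) with (- b) in H by ring.
  assert (Hex : ex_RInt (V := C_R_NormedModule) f 0 (- b)).
  { apply (ex_RInt_continuous (V := C_R_CompleteNormedModule)). auto. }
  specialize (H Hex).
  rewrite <- (opp_RInt_swap (V := C_R_CompleteNormedModule) f 0 (- b) Hex).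
  rewrite <- H. rewrite <- (RInt_opp (V := C_R_CompleteNormedModule)).
  - apply CInt_ext; [exact Hb|]. intros t _. rewrite scal_R_Cmult.
    replace (-1 * t + 0) with (- t) by ring.
    change (f (- t)%R = - (RtoC (-1) * f (- t)%R))%C.
    replace (RtoC (-1)) with (- (1))%C by (unfold RtoC, Copp; simpl; f_equal; ring). ring.
  - apply (ex_RInt_continuous (V := C_R_CompleteNormedModule)).
    intros t _. apply (continuous_ext (fun u => RtoC (-1) * f (-1 * u + 0)%R)%C).
    + intros u. now rewrite scal_R_Cmult.
    + apply pcont_mult; [apply pcont_const|]. apply pcont_affine. apply Hf.
Qed.

Lemma CInt_shift (f : R -> C) (c a b : R) : (forall t, pcont f t) -> a <= b ->
  CInt (fun u => f (u + c)) a b = CInt f (a + c) (b + c).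
Proof.
  intros Hf Hab.
  assert (H := RInt_comp_lin (V := C_R_CompleteNormedModule) f 1 c a b).
  replace (1 * a + c) with (a + c) in H by ring. replace (1 * b + c) with (b + c) in H by ring.
  rewrite <- H.
  - apply CInt_ext; [exact Hab|]. intros t _. rewrite scal_R_Cmult.
    replace (1 * t + c) with (t + c) by ring. to_C. ring.
  - apply (ex_RInt_continuous (V := C_R_CompleteNormedModule)). auto.
Qed.

(** * Improper integrals of exponentially decaying functions *)

Lemma RInt_exp_decay (K a b c : R) : 0 < a -> b <= c ->
  ex_RInt (fun u => K * exp (- a * u)) b c /\
  RInt (fun u => K * exp (- a * u)) b c = K / a * exp (- a * b) - K / a * exp (- a * c).
Proof.
  intros Ha Hbc.
  assert (H : is_RInt (fun u => K * exp (- a * u)) b c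
     (minus (- (K / a) * exp (- a * c)) (- (K / a) * exp (- a * b)))).
  { apply (is_RInt_derive (V := R_CompleteNormedModule) (fun u => - (K / a) * exp (- a * u))).
    - intros u _. auto_derive; [trivial|]. field. lra.
    - intros u _. apply (ex_derive_continuous (K := R_AbsRing) (V := R_NormedModule) (fun u => K * exp (- a * u))).
      auto_derive. trivial. }
  split; [eexists; exact H|]. rewrite (is_RInt_unique _ _ _ _ H). unfold minus, plus, opp; simpl. ring.
Qed.

Lemma CInt_decay (f : R -> C) (K a b c : R) : 0 < a -> b <= c -> pcont_on f b c ->
  (forall u, b <= u <= c -> Cmod (f u) <= K * exp (- a * u)) ->
  Cmod (CInt f b c) <= K / a * exp (- a * b) - K / a * exp (- a * c).
Proof.
  intros Ha Hbc Hf HK. destruct (RInt_exp_decay K a b c Ha Hbc) as [Hex E]. rewrite <- E.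
  now apply CInt_norm_le_RInt.
Qed.

(** The integral over the positive half-line, cut at the integers: as a series it inherits
    holomorphy in a parameter from [holo_cseries]. *)
Definition pint (f : R -> C) : C := cseries (fun k => CInt f (INR k) (INR (S k))).

Definition pdecay (f : R -> C) (K a : R) : Prop :=
  0 < a /\ (forall u, 0 <= u -> pcont f u) /\ (forall u, 0 <= u -> Cmod (f u) <= K * exp (- a * u)).

Lemma pdecay_term (f : R -> C) (K a : R) (k : nat) : pdecay f K a ->
  Cmod (CInt f (INR k) (INR (S k))) <= K / a * exp (- a * INR k) - K / a * exp (- a * INR (S k)).
Proof.
  intros [Ha [Hc HK]]. assert (Hk := pos_INR k).
  apply CInt_decay; [exact Ha|rewrite S_INR; lra| |];
  intros u Hu; [apply Hc|apply HK]; lra.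
Qed.

Lemma lim_exp_neg_INR (c a : R) : 0 < a -> is_lim_seq (fun k => c * exp (- a * INR k)) 0.
Proof.
  intros Ha. replace (Finite 0) with (Rbar_mult c (Finite 0)) by (simpl; f_equal; ring).
  apply is_lim_seq_scal_l.
  apply is_lim_seq_ext with (fun k => exp (- a) ^ k).
  - intros k. clear. induction k as [|k IH]; [simpl; rewrite Rmult_0_r, exp_0; reflexivity|].
    rewrite S_INR. simpl pow. rewrite IH, <- exp_plus. f_equal. ring.
  - apply is_lim_seq_geom. rewrite Rabs_pos_eq by (left; apply exp_pos).
    rewrite <- exp_0. apply exp_increasing. lra.
Qed.

Lemma pdecay_K (f : R -> C) (K a : R) : pdecay f K a -> 0 <= K.
Proof.
  intros [Ha [Hc HK]]. specialize (HK 0 (Rle_refl 0)).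
  replace (- a * 0) with 0 in HK by ring. rewrite exp_0 in HK.
  assert (H := Cmod_ge_0 (f 0)). lra.
Qed.

Lemma pint_series (f : R -> C) (K a : R) : pdecay f K a ->
  is_cseries (fun k => CInt f (INR k) (INR (S k))) (pint f).
Proof.
  intros H. apply cseries_correct with (fun k => K / a * exp (- a * INR k)).
  - intros k. now apply pdecay_term.
  - apply lim_exp_neg_INR, H.
Qed.

Lemma csum_CInt (f : R -> C) (n : nat) : (forall u, 0 <= u -> pcont f u) ->
  csum (fun k => CInt f (INR k) (INR (S k))) n = CInt f 0 (INR (S n)).
Proof.
  intros Hf. induction n as [|n IH]; [now rewrite csum_0|].
  rewrite csum_S, IH. apply CInt_Chasles.
  - rewrite (S_INR (S n)). assert (H := pos_INR (S n)). lra.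
  - intros t Ht. apply Hf. lra.
Qed.

Lemma pint_approx (f : R -> C) (K a b : R) : pdecay f K a -> 0 <= b ->
  Cmod (CInt f 0 b - pint f) <= K / a * exp (- a * b).
Proof.
  intros Hd Hb. assert (HK0 := pdecay_K f K a Hd). assert (Hs := pint_series f K a Hd).
  destruct Hd as [Ha [Hc HK]].
  rewrite is_cseries_eps in Hs. apply Rnot_lt_le. intros Hlt.
  destruct (Hs (Cmod (CInt f 0 b - pint f) - K / a * exp (- a * b)) ltac:(lra)) as [N HN].
  destruct (nfloor_ex b Hb) as [n [_ Hn]].
  specialize (HN (N + n)%nat ltac:(lia)). rewrite csum_CInt in HN by exact Hc.
  set (m := INR (S (N + n))) in *.
  assert (Hm : b <= m).
  { unfold m. rewrite S_INR, plus_INR. assert (H := pos_INR N). lra. }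
  assert (H1 := CInt_decay f K a b m Ha Hm (fun t Ht => Hc t ltac:(lra)) (fun t Ht => HK t ltac:(lra))).
  assert (H2 := CInt_Chasles f 0 b m ltac:(lra) (fun t Ht => Hc t ltac:(lra))).
  assert (H3 : 0 <= K / a * exp (- a * m)).
  { apply Rmult_le_pos; [|left; apply exp_pos]. apply Rmult_le_pos; [lra|left; now apply Rinv_0_lt_compat]. }
  rewrite <- H2 in HN.
  assert (H4 := Cmod_triangle (CInt f 0 b + CInt f b m - pint f) (- CInt f b m)).
  replace (CInt f 0 b + CInt f b m - pint f + - CInt f b m)%C with (CInt f 0 b - pint f)%C in H4 by ring.
  rewrite Cmod_opp in H4. lra.
Qed.

Lemma pint_unique (f : R -> C) (l : C) : (forall u, 0 <= u -> pcont f u) ->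
  (forall eps, 0 < eps -> exists N, forall n, (N <= n)%nat -> Cmod (CInt f 0 (INR (S n)) - l) < eps) ->
  pint f = l.
Proof.
  intros Hf H. apply cseries_unique. rewrite is_cseries_eps. intros eps Heps.
  destruct (H eps Heps) as [N HN]. exists N. intros n Hn. rewrite csum_CInt by exact Hf. now apply HN.
Qed.

Lemma pint_ext (f g : R -> C) : (forall u, 0 <= u -> f u = g u) -> pint f = pint g.
Proof.
  intros H. unfold pint. f_equal. apply FunctionalExtensionality.functional_extensionality.
  intros k. apply CInt_ext; [rewrite S_INR; lra|]. intros t Ht. apply H. assert (Hk := pos_INR k). lra.
Qed.

Lemma is_cseries_plus (a b : nat -> C) (la lb : C) :
  is_cseries a la -> is_cseries b lb -> is_cseries (fun k => a k + b k)%C (la + lb)%C.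
Proof. exact (is_series_plus (K := C_AbsRing) (V := C_NormedModule) a b la lb). Qed.

Lemma pint_plus (f g : R -> C) (K a K' a' : R) : pdecay f K a -> pdecay g K' a' ->
  pint (fun u => f u + g u)%C = (pint f + pint g)%C.
Proof.
  intros Hf Hg. apply cseries_unique.
  assert (H := is_cseries_plus _ _ _ _ (pint_series f K a Hf) (pint_series g K' a' Hg)).
  destruct Hf as [_ [Hf _]]. destruct Hg as [_ [Hg _]].
  refine (eq_ind _ (fun u => is_cseries u _) H _ _).
  apply FunctionalExtensionality.functional_extensionality. intros k.
  symmetry. assert (Hk := pos_INR k).
  apply CInt_plus; [rewrite S_INR; lra| |]; intros t Ht; [apply Hf|apply Hg]; lra.
Qed.

Lemma is_cseries_scal (a : nat -> C) (c la : C) :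
  is_cseries a la -> is_cseries (fun k => c * a k)%C (c * la)%C.
Proof. exact (is_series_scal (K := C_AbsRing) (V := C_NormedModule) c a la). Qed.

Lemma pint_scal (f : R -> C) (c : C) (K a : R) : pdecay f K a ->
  pint (fun u => c * f u)%C = (c * pint f)%C.
Proof.
  intros Hf. apply cseries_unique.
  assert (H := is_cseries_scal _ c _ (pint_series f K a Hf)).
  destruct Hf as [_ [Hf _]].
  refine (eq_ind _ (fun u => is_cseries u _) H _ _).
  apply FunctionalExtensionality.functional_extensionality. intros k.
  symmetry. assert (Hk := pos_INR k).
  apply CInt_scal; [rewrite S_INR; lra|]; intros t Ht; apply Hf; lra.
Qed.

Lemma pdecay_Cexp (z : C) : 0 < Re z -> pdecay (fun u => Cexp (RtoC u * - z)) 1 (Re z).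
Proof.
  intros Hz. split; [exact Hz|]. split.
  - intros u _. apply pcont_Cexp_line.
  - intros u _. rewrite Cmod_Cexp, re_scal_l, re_opp. right.
    rewrite Rmult_1_l. f_equal. ring.
Qed.

Lemma pint_Cexp (z : C) : 0 < Re z -> pint (fun u => Cexp (RtoC u * - z)) = (/ z)%C.
Proof.
  intros Hz.
  assert (Hz0 : z <> 0) by (intros E; rewrite E, re_RtoC in Hz; lra).
  apply pint_unique; [intros u _; apply pcont_Cexp_line|]. intros eps Heps.
  assert (Hl := lim_exp_neg_INR (/ Cmod z) (Re z) Hz). apply is_lim_seq_spec in Hl.
  destruct (Hl (mkposreal eps Heps)) as [N HN]. exists N. intros n Hn.
  specialize (HN (S n) ltac:(lia)). simpl pos in HN. rewrite Rminus_0_r in HN. apply Rabs_def2 in HN.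
  rewrite (CInt_primitive (fun u => - / z * Cexp (RtoC u * - z))%C).
  - rewrite Cmult_0_l, Cexp_0.
    replace (- / z * Cexp (RtoC (INR (S n)) * - z) - - / z * 1 - / z)%C
      with (- (/ z * Cexp (RtoC (INR (S n)) * - z)))%C by ring.
    rewrite Cmod_opp, Cmod_mult, Cmod_inv, Cmod_Cexp, re_scal_l, re_opp by exact Hz0.
    replace (INR (S n) * - Re z) with (- Re z * INR (S n)) by ring. lra.
  - apply pos_INR.
  - intros t _.
    apply (pderiv_val _ _ (0 * Cexp (RtoC t * - z) + - / z * (- z * Cexp (RtoC t * - z)))%C).
    + field. exact Hz0.
    + apply (pderiv_mult (fun _ => - / z)%C (fun u => Cexp (RtoC u * - z))); [apply pderiv_const|].
      apply pderiv_Cexp_line.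
  - intros t _. apply pcont_Cexp_line.
Qed.

(** * Holomorphy of Laplace-type integrals *)

(** Differentiation under the integral: the remainder of [Cexp (u * h)] beyond its linear part is
    quadratic in [h], uniformly for [u] in the compact interval. *)
Lemma holo_CInt_exp (f : R -> C) (a b : R) (s0 : C) : a <= b -> pcont_on f a b ->
  holo (fun s => CInt (fun u => f u * Cexp (RtoC u * s))%C a b) s0.
Proof.
  intros Hab Hf.
  destruct (pcont_on_bounded f a b Hf) as [M0 HM0].
  set (M := Rabs M0 + 1).
  assert (HM : 0 < M) by (unfold M; assert (H := Rabs_pos M0); lra).
  assert (HfM : forall u, a <= u <= b -> Cmod (f u) <= M).
  { intros u Hu. unfold M. assert (H := HM0 u Hu). assert (H1 := Rle_abs M0). lra. }
  set (U := Rabs a + Rabs b + 1).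
  assert (HU1 : 1 <= U) by (unfold U; assert (H := Rabs_pos a); assert (H1 := Rabs_pos b); lra).
  assert (HU : forall u, a <= u <= b -> Rabs u <= U).
  { intros u Hu. unfold U. apply Rabs_le. assert (H := Rle_abs a). assert (H1 := Rle_abs b).
    assert (H2 := Rle_abs (- a)). rewrite Rabs_Ropp in H2. assert (H3 := Rle_abs (- b)). rewrite Rabs_Ropp in H3.
    assert (H4 := Rabs_pos a). assert (H5 := Rabs_pos b). lra. }
  assert (Hc : forall s, pcont_on (fun u => f u * Cexp (RtoC u * s))%C a b).
  { intros s u Hu. apply pcont_mult; [now apply Hf|apply pcont_Cexp_line]. }
  assert (Hid : forall u, pcont (fun u => RtoC u) u).
  { intros u. apply (pcont_RtoC (fun u => u)). auto_derive. trivial. }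
  assert (Hcd : pcont_on (fun u => f u * Cexp (RtoC u * s0) * RtoC u)%C a b).
  { intros u Hu. apply (pcont_mult (fun u => f u * Cexp (RtoC u * s0))%C (fun u => RtoC u)); [now apply Hc|apply Hid]. }
  exists (CInt (fun u => f u * Cexp (RtoC u * s0) * RtoC u)%C a b).
  apply cderiv_eps. intros eps Heps.
  set (K := (b - a) * (M * exp (U * Cmod s0) * (U ^ 2 * exp U)) + 1).
  assert (HK0 : 0 <= (b - a) * (M * exp (U * Cmod s0) * (U ^ 2 * exp U))).
  { apply Rmult_le_pos; [lra|]. apply Rmult_le_pos.
    - apply Rmult_le_pos; [lra|left; apply exp_pos].
    - apply Rmult_le_pos; [apply pow2_ge_0|left; apply exp_pos]. }
  exists (Rmin 1 (eps / K)). split; [apply Rmin_pos; [lra|apply Rdiv_lt_0_compat; unfold K; lra]|].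
  intros s Hs.
  assert (Hs1 := Rlt_le_trans _ _ _ Hs (Rmin_l _ _)).
  assert (Hs2 := Rlt_le_trans _ _ _ Hs (Rmin_r _ _)).
  assert (Hh0 := Cmod_ge_0 (s - s0)). set (h := (s - s0)%C) in *.
  assert (E : (CInt (fun u => f u * Cexp (RtoC u * s)) a b - CInt (fun u => f u * Cexp (RtoC u * s0)) a b
     - h * CInt (fun u => f u * Cexp (RtoC u * s0) * RtoC u) a b)%C =
     CInt (fun u => f u * Cexp (RtoC u * s) - f u * Cexp (RtoC u * s0) - h * (f u * Cexp (RtoC u * s0) * RtoC u))%C a b).
  { rewrite (CInt_minus (fun u => f u * Cexp (RtoC u * s) - f u * Cexp (RtoC u * s0))%C
      (fun u => h * (f u * Cexp (RtoC u * s0) * RtoC u))%C); [|exact Hab| |].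
    - rewrite (CInt_minus (fun u => f u * Cexp (RtoC u * s))%C (fun u => f u * Cexp (RtoC u * s0))%C); auto.
      rewrite CInt_scal by auto. reflexivity.
    - intros u Hu. apply pcont_minus; now apply Hc.
    - intros u Hu. apply pcont_mult; [apply pcont_const|now apply Hcd]. }
  rewrite E.
  apply Rle_trans with ((b - a) * (M * exp (U * Cmod s0) * (U ^ 2 * exp U) * (Cmod h * Cmod h))).
  - apply CInt_norm_le; [exact Hab| |].
    + intros u Hu. apply pcont_minus; [apply pcont_minus; now apply Hc|].
      apply pcont_mult; [apply pcont_const|now apply Hcd].
    + intros u Hu.
      replace (f u * Cexp (RtoC u * s) - f u * Cexp (RtoC u * s0) - h * (f u * Cexp (RtoC u * s0) * RtoC u))%C
        with (f u * Cexp (RtoC u * s0) * (Cexp (RtoC u * h) - 1 - RtoC u * h))%C.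
      2:{ replace (RtoC u * s)%C with (RtoC u * s0 + RtoC u * h)%C by (unfold h; ring).
          rewrite Cexp_plus. ring. }
      rewrite !Cmod_mult. assert (HuU := HU u Hu).
      assert (Hu0 := Rabs_pos u).
      assert (Hexp0 : Cmod (Cexp (RtoC u * s0)) <= exp (U * Cmod s0)).
      { rewrite Cmod_Cexp. apply exp_le. eapply Rle_trans; [apply Rle_abs|].
        eapply Rle_trans; [apply re_le_Cmod|]. rewrite Cmod_mult, Cmod_R.
        apply Rmult_le_compat_r; [apply Cmod_ge_0|exact HuU]. }
      assert (Hrem := Cexp_sub_1_sub_id (RtoC u * h)). rewrite Cmod_mult, Cmod_R in Hrem.
      assert (Hrem2 : Cmod (Cexp (RtoC u * h) - 1 - RtoC u * h) <= U ^ 2 * exp U * (Cmod h * Cmod h)).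
      { eapply Rle_trans; [exact Hrem|].
        replace (U ^ 2 * exp U * (Cmod h * Cmod h)) with ((U * Cmod h) ^ 2 * exp U) by ring.
        apply Rmult_le_compat; [apply pow2_ge_0|left; apply exp_pos| |].
        - apply pow_incr. split; [apply Rmult_le_pos; lra|apply Rmult_le_compat_r; lra].
        - apply exp_le. nra. }
      rewrite (Rmult_assoc (M * exp (U * Cmod s0))).
      apply Rmult_le_compat; [apply Rmult_le_pos; apply Cmod_ge_0|apply Cmod_ge_0| |exact Hrem2].
      apply Rmult_le_compat; try apply Cmod_ge_0; [now apply HfM|exact Hexp0].
  - apply Rle_trans with (K * Cmod h * Cmod h); [unfold K; nra|].
    apply Rmult_le_compat_r; [exact Hh0|].
    apply Rlt_le, Rmult_lt_reg_l with (/ K); [apply Rinv_0_lt_compat; unfold K; lra|].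
    rewrite <- Rmult_assoc, Rinv_l by (unfold K; lra). unfold Rdiv in Hs2. lra.
Qed.

Lemma holo_pint (f : R -> C) (s0 : C) (r K a : R) : 0 < r ->
  (forall s, Cmod (s - s0) < r -> pdecay (fun u => f u * Cexp (RtoC u * s))%C K a) ->
  (forall u, 0 <= u -> pcont f u) ->
  holo (fun s => pint (fun u => f u * Cexp (RtoC u * s))%C) s0.
Proof.
  intros Hr H Hf. unfold pint.
  assert (Ha : 0 < a).
  { assert (H0 := H s0). replace (s0 - s0)%C with (RtoC 0) in H0 by ring. rewrite Cmod_0 in H0. now apply H0. }
  apply (holo_cseries (fun k s => CInt (fun u => f u * Cexp (RtoC u * s))%C (INR k) (INR (S k))) s0 r
    (fun k => K / a * exp (- a * INR k))); auto.
  - now apply lim_exp_neg_INR.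
  - intros k s Hs. apply pdecay_term. now apply H.
  - intros k s Hs. assert (Hk := pos_INR k). apply holo_CInt_exp; [rewrite S_INR; lra|].
    intros u Hu. apply Hf. lra.
Qed.

(** * Integrals over the real line *)

Definition rint (f : R -> C) : C := (pint f + pint (fun u => f (- u)%R))%C.

Definition rdecay (f : R -> C) (K a : R) : Prop :=
  0 < a /\ (forall u, pcont f u) /\ (forall u, Cmod (f u) <= K * exp (- a * Rabs u)).

Lemma rdecay_pdecay (f : R -> C) (K a : R) : rdecay f K a ->
  pdecay f K a /\ pdecay (fun u => f (- u)) K a.
Proof.
  intros [Ha [Hc HK]]. split; split; auto; split.
  - intros u _. apply Hc.
  - intros u Hu. specialize (HK u). now rewrite Rabs_pos_eq in HK.
  - intros u _. apply pcont_opp_arg, Hc.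
  - intros u Hu. specialize (HK (- u)). now rewrite Rabs_Ropp, Rabs_pos_eq in HK.
Qed.

Lemma rint_approx (f : R -> C) (K a A B : R) : rdecay f K a -> 0 <= A -> 0 <= B ->
  Cmod (CInt f (- A) B - rint f) <= K / a * (exp (- a * A) + exp (- a * B)).
Proof.
  intros Hd HA HB. destruct (rdecay_pdecay f K a Hd) as [H1 H2].
  assert (P1 := pint_approx f K a B H1 HB). assert (P2 := pint_approx _ K a A H2 HA).
  destruct Hd as [_ [Hc _]].
  rewrite CInt_opp_arg in P2 by auto.
  assert (Hch := CInt_Chasles f (- A)%R 0 B ltac:(lra) (fun t _ => Hc t)).
  rewrite <- Hch. unfold rint.
  replace (CInt f (- A)%R 0 + CInt f 0 B - (pint f + pint (fun u => f (- u)%R)))%C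
    with ((CInt f 0 B - pint f) + (CInt f (- A)%R 0 - pint (fun u => f (- u)%R)))%C by ring.
  eapply Rle_trans; [apply Cmod_triangle|]. lra.
Qed.

Lemma rint_norm_le (f : R -> C) (K a : R) : rdecay f K a -> Cmod (rint f) <= 2 * K / a.
Proof.
  intros Hd. assert (H := rint_approx f K a 0 0 Hd (Rle_refl 0) (Rle_refl 0)).
  assert (Ha : 0 < a) by apply Hd.
  replace (- 0) with 0 in H by ring.
  rewrite (RInt_point (V := C_R_CompleteNormedModule)) in H.
  change (zero : C_R_NormedModule) with (RtoC 0) in H.
  replace (0 - rint f)%C with (- rint f)%C in H by ring.
  rewrite Cmod_opp, Rmult_0_r, exp_0 in H.
  replace (2 * K / a) with (K / a * (1 + 1)) by (field; lra). exact H.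
Qed.

(** The two ends tend to infinity independently, so the notion is stable under translation; sums and
    shifts can be formed without carrying decay constants along. *)
Definition has_int (f : R -> C) (l : C) : Prop :=
  (forall u, pcont f u) /\
  forall eps, 0 < eps -> exists N, 0 <= N /\ forall a b, a <= - N -> N <= b -> Cmod (CInt f a b - l) < eps.

Lemma rint_has_int (f : R -> C) (K a : R) : rdecay f K a -> has_int f (rint f).
Proof.
  intros Hd. split; [apply Hd|]. intros eps Heps.
  assert (Ha : 0 < a) by apply Hd. assert (HK := pdecay_K f K a (proj1 (rdecay_pdecay f K a Hd))).
  assert (Hl := lim_exp_neg_INR (2 * (K / a)) a Ha). apply is_lim_seq_spec in Hl.
  destruct (Hl (mkposreal eps Heps)) as [N HN]. specialize (HN N (Nat.le_refl N)). simpl pos in HN.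
  rewrite Rminus_0_r in HN. apply Rabs_def2 in HN.
  exists (INR N). split; [apply pos_INR|]. intros A B HA HB. assert (HN0 := pos_INR N).
  assert (H := rint_approx f K a (- A) B Hd ltac:(lra) ltac:(lra)). rewrite Ropp_involutive in H.
  eapply Rle_lt_trans; [exact H|].
  assert (HKa : 0 <= K / a) by (apply Rmult_le_pos; [lra|left; now apply Rinv_0_lt_compat]).
  assert (E1 : exp (- a * - A) <= exp (- a * INR N)) by (apply exp_le; nra).
  assert (E2 : exp (- a * B) <= exp (- a * INR N)) by (apply exp_le; nra).
  apply Rle_lt_trans with (K / a * (exp (- a * INR N) + exp (- a * INR N))); [|lra].
  apply Rmult_le_compat_l; lra.
Qed.

Lemma has_int_unique (f : R -> C) (l1 l2 : C) : has_int f l1 -> has_int f l2 -> l1 = l2.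
Proof.
  intros [_ H1] [_ H2]. apply Ceq_minus, Cmod_eq_0, Rle_antisym; [|apply Cmod_ge_0].
  apply Rnot_lt_le. intros Hlt.
  destruct (H1 _ (Rdiv_lt_0_compat _ 2 Hlt ltac:(lra))) as [N1 [P1 HN1]].
  destruct (H2 _ (Rdiv_lt_0_compat _ 2 Hlt ltac:(lra))) as [N2 [P2 HN2]].
  specialize (HN1 (- (N1 + N2)) (N1 + N2) ltac:(lra) ltac:(lra)).
  specialize (HN2 (- (N1 + N2)) (N1 + N2) ltac:(lra) ltac:(lra)).
  rewrite Cmod_minus_sym in HN1.
  assert (H := Cmod_minus_triangle l1 (CInt f (- (N1 + N2)) (N1 + N2)) l2). lra.
Qed.

Lemma has_int_plus (f g : R -> C) (l m : C) : has_int f l -> has_int g m ->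
  has_int (fun u => f u + g u)%C (l + m)%C.
Proof.
  intros [C1 H1] [C2 H2]. split; [intros u; now apply pcont_plus|]. intros eps Heps.
  destruct (H1 (eps / 2) ltac:(lra)) as [N1 [P1 HN1]].
  destruct (H2 (eps / 2) ltac:(lra)) as [N2 [P2 HN2]].
  exists (N1 + N2). split; [lra|]. intros a b Ha Hb.
  specialize (HN1 a b ltac:(lra) ltac:(lra)). specialize (HN2 a b ltac:(lra) ltac:(lra)).
  rewrite CInt_plus by (try lra; intros t _; auto).
  replace (CInt f a b + CInt g a b - (l + m))%C with ((CInt f a b - l) + (CInt g a b - m))%C by ring.
  eapply Rle_lt_trans; [apply Cmod_triangle|]. lra.
Qed.

Lemma has_int_scal (f : R -> C) (c l : C) : has_int f l -> has_int (fun u => c * f u)%C (c * l)%C.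
Proof.
  intros [C1 H1]. split; [intros u; apply pcont_mult; [apply pcont_const|auto]|]. intros eps Heps.
  assert (Hc := Cmod_ge_0 c).
  destruct (H1 (eps / (1 + Cmod c)) ltac:(apply Rdiv_lt_0_compat; lra)) as [N1 [P1 HN1]].
  exists N1. split; [exact P1|]. intros a b Ha Hb. specialize (HN1 a b Ha Hb).
  rewrite CInt_scal by (try lra; intros t _; auto).
  replace (c * CInt f a b - c * l)%C with (c * (CInt f a b - l))%C by ring.
  rewrite Cmod_mult. assert (H0 := Cmod_ge_0 (CInt f a b - l)).
  apply Rle_lt_trans with ((1 + Cmod c) * Cmod (CInt f a b - l)); [nra|].
  apply (Rmult_lt_compat_l (1 + Cmod c)) in HN1; [|lra].
  replace ((1 + Cmod c) * (eps / (1 + Cmod c))) with eps in HN1 by (field; lra). exact HN1.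
Qed.

Lemma has_int_shift (f : R -> C) (l : C) (c : R) : has_int f l -> has_int (fun u => f (u + c)) l.
Proof.
  intros [C1 H1]. split.
  - intros u. apply (continuous_ext (fun u => f (1 * u + c))); [intros v; f_equal; ring|].
    apply pcont_affine, C1.
  - intros eps Heps. destruct (H1 eps Heps) as [N [P HN]].
    exists (N + Rabs c). assert (Hc := Rabs_pos c). split; [lra|]. intros a b Ha Hb.
    assert (H2 := Rle_abs c). assert (H3 := Rle_abs (- c)). rewrite Rabs_Ropp in H3.
    rewrite CInt_shift by (auto; lra). apply HN; lra.
Qed.

Lemma has_int_ext (f g : R -> C) (l : C) : (forall u, f u = g u) -> has_int f l -> has_int g l.
Proof.
  intros E H. replace g with f; [exact H|]. now apply FunctionalExtensionality.functional_extensionality.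
Qed.

Lemma has_int_dominated (f : R -> C) (h : R -> R) (l lh : C) :
  has_int f l -> has_int (fun u => RtoC (h u)) lh -> (forall u, Cmod (f u) <= h u) ->
  Cmod l <= Re lh.
Proof.
  intros [C1 H1] [C2 H2] Hfh. apply Rnot_lt_le. intros Hlt.
  set (e := (Cmod l - Re lh) / 3). assert (He : 0 < e) by (unfold e; lra).
  destruct (H1 e He) as [N1 [P1 HN1]]. destruct (H2 e He) as [N2 [P2 HN2]].
  specialize (HN1 (- (N1 + N2)) (N1 + N2) ltac:(lra) ltac:(lra)).
  specialize (HN2 (- (N1 + N2)) (N1 + N2) ltac:(lra) ltac:(lra)).
  set (a := - (N1 + N2)) in *. set (b := N1 + N2) in *.
  assert (Hab : a <= b) by (unfold a, b; lra).
  assert (HR := is_CInt_Re _ _ _ _ (CInt_correct _ a b Hab (fun t _ => C2 t))).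
  assert (H3 : Cmod (CInt f a b) <= Re (CInt (fun u => RtoC (h u)) a b)).
  { rewrite Cmod_norm.
    apply (norm_RInt_le (V := C_R_NormedModule) f h a b (CInt f a b) _ Hab).
    - intros t Ht. rewrite <- Cmod_norm. apply Hfh.
    - apply CInt_correct; auto. intros t _. apply C1.
    - exact HR. }
  assert (H4 : Re (CInt (fun u => RtoC (h u)) a b) - Re lh < e).
  { eapply Rle_lt_trans; [|exact HN2]. eapply Rle_trans; [apply Rle_abs|].
    unfold Rminus, Cminus. rewrite <- re_opp, <- re_plus. apply re_le_Cmod. }
  assert (H5 := Cmod_triangle_inv l (CInt f a b)). rewrite Cmod_minus_sym in H5.
  unfold e in *. lra.
Qed.

(** * The gamma factor *)

(* Mellin integrals are written additively, in the logarithm [u] of the variable. *)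
Definition qexp (u : R) : R := exp (- (PI * exp (2 * u))).

Definition mel (s : C) (u : R) : C := (RtoC (qexp u) * Cexp (RtoC u * s))%C.

(* [gam s = (1/2) pi^(-s/2) Gamma(s/2)]. *)
Definition gam (s : C) : C := rint (mel s).

Lemma PI_ge_2 : 2 <= PI.
Proof. assert (H := PI2_3_2). lra. Qed.

Lemma exp_ge_1_plus (x : R) : 1 + x <= exp x.
Proof.
  destruct (Req_dec x 0) as [->|H]; [rewrite exp_0; lra|]. left. now apply exp_ineq1.
Qed.

Lemma qexp_pos (u : R) : 0 < qexp u.
Proof. apply exp_pos. Qed.

Lemma qexp_le_1 (u : R) : qexp u <= 1.
Proof.
  unfold qexp. rewrite <- exp_0. apply exp_le.
  assert (H := PI_ge_2). assert (H1 := exp_pos (2 * u)). nra.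
Qed.

(** [PI * exp (2 u)] exceeds [u^2], which by completing the square is at least [b u - b^2 / 4]. *)
Lemma qexp_decay (b u : R) : 0 <= u -> qexp u <= exp (b ^ 2 / 4) * exp (- b * u).
Proof.
  intros Hu. unfold qexp. rewrite <- exp_plus. apply exp_le.
  assert (H := PI_ge_2). assert (H1 := exp_ge_1_plus u).
  replace (2 * u) with (u + u) by ring. rewrite exp_plus.
  assert (H2 : u ^ 2 <= PI * (exp u * exp u)) by (simpl; nra).
  assert (H3 := pow2_ge_0 (u - b / 2)). simpl in *. nra.
Qed.

Lemma pcont_qexp (u : R) : pcont (fun u => RtoC (qexp u)) u.
Proof. apply (pcont_RtoC qexp). unfold qexp. auto_derive. trivial. Qed.

Lemma pcont_mel (s : C) (u : R) : pcont (mel s) u.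
Proof. apply (pcont_mult (fun u => RtoC (qexp u))); [apply pcont_qexp|apply pcont_Cexp_line]. Qed.

Lemma Cmod_mel (s : C) (u : R) : Cmod (mel s u) = qexp u * exp (Re s * u).
Proof.
  unfold mel. rewrite Cmod_mult, Cmod_R, Rabs_pos_eq by (left; apply qexp_pos).
  rewrite Cmod_Cexp, re_scal_l. f_equal. f_equal. ring.
Qed.

Lemma mel_rdecay (s : C) (S' a : R) : 0 < a -> a <= Re s <= S' ->
  rdecay (mel s) (exp ((S' + a) ^ 2 / 4)) a.
Proof.
  intros Ha Hs. split; [exact Ha|]. split; [apply pcont_mel|]. intros u. rewrite Cmod_mel.
  assert (HK : 1 <= exp ((S' + a) ^ 2 / 4)).
  { rewrite <- exp_0. apply exp_le. assert (H := pow2_ge_0 (S' + a)). lra. }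
  destruct (Rle_or_lt 0 u) as [Hu|Hu].
  - rewrite Rabs_pos_eq by exact Hu. assert (H := qexp_decay (S' + a) u Hu).
    apply Rle_trans with (exp ((S' + a) ^ 2 / 4) * exp (- (S' + a) * u) * exp (Re s * u)).
    + apply Rmult_le_compat_r; [left; apply exp_pos|exact H].
    + rewrite Rmult_assoc, <- exp_plus. apply Rmult_le_compat_l; [lra|]. apply exp_le. nra.
  - rewrite Rabs_left by exact Hu. assert (H := qexp_le_1 u). assert (H0 := qexp_pos u).
    apply Rle_trans with (1 * exp (- a * - u)).
    + apply Rmult_le_compat; [lra|left; apply exp_pos|exact H|]. apply exp_le. nra.
    + apply Rmult_le_compat_r; [left; apply exp_pos|exact HK].
Qed.

Lemma gam_has_int (s : C) : 0 < Re s -> has_int (mel s) (gam s).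
Proof. intros Hs. eapply rint_has_int. apply (mel_rdecay s (Re s) (Re s)); lra. Qed.

Lemma holo_gam (s0 : C) : 0 < Re s0 -> holo gam s0.
Proof.
  intros Hs0. unfold gam, rint.
  set (a := Re s0 / 2). assert (Ha : 0 < a) by (unfold a; lra).
  assert (HD : forall s, Cmod (s - s0) < a -> rdecay (mel s) (exp ((Re s0 + a + a) ^ 2 / 4)) a).
  { intros s Hs. apply Re_near in Hs. apply mel_rdecay; unfold a in *; lra. }
  apply (holo_plus (fun s => pint (mel s)) (fun s => pint (fun u => mel s (- u)))).
  - apply (holo_pint (fun u => RtoC (qexp u)) s0 a (exp ((Re s0 + a + a) ^ 2 / 4)) a Ha).
    + intros s Hs. apply (rdecay_pdecay (mel s)). now apply HD.
    + intros u _. apply pcont_qexp.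
  - apply holo_ext with (fun s => pint (fun u => RtoC (qexp (- u)) * Cexp (RtoC u * - s))%C).
    + intros s. f_equal. apply FunctionalExtensionality.functional_extensionality. intros u.
      unfold mel. rewrite RtoC_opp. f_equal. f_equal. ring.
    + apply (holo_comp (fun s => pint (fun u => RtoC (qexp (- u)) * Cexp (RtoC u * s))%C) (fun s => - s)%C).
      * apply (holo_pint (fun u => RtoC (qexp (- u))) (- s0) a (exp ((Re s0 + a + a) ^ 2 / 4)) a Ha).
        -- intros s Hs.
           assert (Hs' : Cmod (- s - s0) < a).
           { replace (- s - s0)%C with (- (s - - s0))%C by ring. now rewrite Cmod_opp. }
           destruct (rdecay_pdecay _ _ _ (HD _ Hs')) as [_ H].
           refine (eq_ind _ (fun f => pdecay f _ _) H _ _).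
           apply FunctionalExtensionality.functional_extensionality. intros u.
           unfold mel. rewrite RtoC_opp. f_equal. f_equal. ring.
        -- intros u _. apply (pcont_opp_arg (fun u => RtoC (qexp u))), pcont_qexp.
      * apply (holo_opp (fun s => s)), holo_id.
Qed.

(* Integration by parts: [(q e^(su))' = (s - 2 pi e^(2u)) q e^(su)]. *)
Lemma gam_rec (s : C) : 0 < Re s -> (s * gam s = 2 * PI * gam (s + 2))%C.
Proof.
  intros Hs.
  assert (H0 := gam_has_int s Hs).
  assert (H2 := gam_has_int (s + 2) ltac:(rewrite re_plus, re_RtoC; lra)).
  assert (HI := has_int_plus _ _ _ _ (has_int_scal _ s _ H0) (has_int_scal _ (- (2 * PI))%C _ H2)).
  assert (HD : forall t, pderiv (mel s) t (s * mel s t + - (2 * PI) * mel (s + 2) t)%C).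
  { intros t. unfold mel.
    assert (Hq : is_derive qexp t (- (2 * PI * exp (2 * t)) * qexp t)).
    { unfold qexp. auto_derive; [trivial|]. ring. }
    apply (pderiv_val _ _ (RtoC (- (2 * PI * exp (2 * t)) * qexp t) * Cexp (RtoC t * s) +
       RtoC (qexp t) * (s * Cexp (RtoC t * s)))%C).
    - replace (RtoC t * (s + 2))%C with (RtoC t * s + RtoC (2 * t))%C by (rewrite RtoC_mult; ring).
      rewrite Cexp_plus, Cexp_R, RtoC_mult, RtoC_opp, !RtoC_mult. ring.
    - apply (pderiv_mult (fun u => RtoC (qexp u)) (fun u => Cexp (RtoC u * s)));
      [apply pderiv_RtoC, Hq|apply pderiv_Cexp_line]. }
  assert (H : has_int (fun u => s * mel s u + - (2 * PI) * mel (s + 2) u)%C (RtoC 0)).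
  { split; [apply HI|]. intros eps Heps.
    assert (Hd := mel_rdecay s (Re s) (Re s) Hs (conj (Rle_refl _) (Rle_refl _))).
    destruct Hd as [_ [_ Hd]]. set (K := exp ((Re s + Re s) ^ 2 / 4)) in *.
    assert (Hl := lim_exp_neg_INR (2 * K) (Re s) Hs). apply is_lim_seq_spec in Hl.
    destruct (Hl (mkposreal eps Heps)) as [N HN]. specialize (HN N (Nat.le_refl N)). simpl pos in HN.
    rewrite Rminus_0_r in HN. apply Rabs_def2 in HN. assert (HN0 := pos_INR N).
    exists (INR N). split; [exact HN0|]. intros a b Ha Hb.
    rewrite (CInt_primitive (mel s)); [|lra|intros t _; apply HD|intros t _; apply HI].
    replace (mel s b - mel s a - 0)%C with (mel s b + - mel s a)%C by ring.
    eapply Rle_lt_trans; [apply Cmod_triangle|]. rewrite Cmod_opp.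
    assert (HK : 0 < K) by apply exp_pos.
    assert (E1 := Hd a). assert (E2 := Hd b). rewrite Rabs_left1 in E1 by lra. rewrite Rabs_pos_eq in E2 by lra.
    assert (E3 : exp (- Re s * - a) <= exp (- Re s * INR N)) by (apply exp_le; nra).
    assert (E4 : exp (- Re s * b) <= exp (- Re s * INR N)) by (apply exp_le; nra).
    apply (Rmult_le_compat_l K) in E3; [|lra]. apply (Rmult_le_compat_l K) in E4; [|lra]. lra. }
  assert (E := has_int_unique _ _ _ HI H).
  apply Ceq_minus. rewrite <- E. ring.
Qed.

Lemma mel_real (x u : R) : mel (RtoC x) u = RtoC (qexp u * exp (x * u)).
Proof.
  unfold mel. rewrite <- RtoC_mult, Cexp_R, <- RtoC_mult. f_equal. f_equal. f_equal. ring.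
Qed.

Lemma has_int_Re_nonneg_lower (h : R -> R) (l : C) (m : R) :
  has_int (fun u => RtoC (h u)) l -> (forall u, 0 <= h u) -> (forall u, 0 <= u <= 1 -> m <= h u) ->
  m <= Re l.
Proof.
  intros [Hc H] Hh Hm. apply Rnot_lt_le. intros Hlt.
  destruct (H (m - Re l) ltac:(lra)) as [N [HN0 HN]].
  specialize (HN (- N) (N + 1) (Rle_refl _) ltac:(lra)).
  assert (Hex : forall a b, a <= b -> ex_RInt h a b).
  { intros a b Hab. eexists.
    exact (is_CInt_Re _ _ _ _ (CInt_correct (fun u => RtoC (h u)) a b Hab (fun t _ => Hc t))). }
  assert (E : Re (CInt (fun u => RtoC (h u)) (- N) (N + 1)) = RInt h (- N) (N + 1)).
  { symmetry. apply is_RInt_unique.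
    exact (is_CInt_Re _ _ _ _ (CInt_correct (fun u => RtoC (h u)) (- N) (N + 1) ltac:(lra) (fun t _ => Hc t))). }
  assert (H1 : RInt h (- N) (N + 1) = RInt h (- N) 0 + (RInt h 0 1 + RInt h 1 (N + 1))).
  { rewrite <- (RInt_Chasles (V := R_CompleteNormedModule) h (- N) 0 (N + 1)) by (apply Hex; lra).
    rewrite <- (RInt_Chasles (V := R_CompleteNormedModule) h 0 1 (N + 1)) by (apply Hex; lra). reflexivity. }
  assert (H2 : 0 <= RInt h (- N) 0) by (apply RInt_ge_0; auto; [lra|apply Hex; lra]).
  assert (H3 : 0 <= RInt h 1 (N + 1)) by (apply RInt_ge_0; auto; [lra|apply Hex; lra]).
  assert (H4 : m <= RInt h 0 1).
  { apply Rle_trans with (RInt (fun _ => m) 0 1).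
    - rewrite RInt_const. change (m <= (1 - 0) * m). lra.
    - apply RInt_le; [lra|apply ex_RInt_const|apply Hex; lra|]. intros u Hu. apply Hm. lra. }
  assert (H5 := Rle_trans _ _ _ (Rle_abs _) (re_le_Cmod (CInt (fun u => RtoC (h u)) (- N) (N + 1) - l))).
  unfold Cminus in H5, HN. rewrite re_plus, re_opp, E in H5. lra.
Qed.

Lemma gam_real_pos (x : R) : 0 < x -> 0 < Re (gam (RtoC x)).
Proof.
  intros Hx. apply Rlt_le_trans with (qexp 1); [apply qexp_pos|].
  apply (has_int_Re_nonneg_lower (fun u => qexp u * exp (x * u))).
  - apply has_int_ext with (mel (RtoC x)); [apply mel_real|]. apply gam_has_int. now rewrite re_RtoC.
  - intros u. apply Rmult_le_pos; left; [apply qexp_pos|apply exp_pos].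
  - intros u Hu. rewrite <- (Rmult_1_r (qexp 1)).
    assert (H1 : 1 <= exp (x * u)) by (rewrite <- exp_0; apply exp_le; nra).
    apply Rmult_le_compat; [left; apply qexp_pos|lra| |exact H1].
    unfold qexp. apply exp_le. assert (H := PI_ge_2).
    assert (exp (2 * u) <= exp (2 * 1)) by (apply exp_le; lra). nra.
Qed.

(** [|exp (i t v) - 1| <= |t v|], and [2 |v|] is at most [|exp v - exp (-v)|]. The bound is made
    quadratic in the latter because squares of exponentials integrate against [mel] to values of
    [gam] at points two apart. *)
Lemma Cexp_imag_sub_1 (t v d : R) : 0 < d ->
  Cmod (Cexp (RtoC v * (Ci * RtoC t)) - 1) <=
  Rabs t * (d + / (16 * d) * (exp v - exp (- v)) ^ 2).
Proof.
  intros Hd.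
  assert (H1 : forall v, 0 <= v -> Cmod (Cexp (RtoC v * (Ci * RtoC t)) - 1) <= Rabs t * v).
  { intros w Hw.
    assert (H := mean_value_ineq (fun u => Cexp (RtoC u * (Ci * RtoC t)))
      (fun u => Ci * RtoC t * Cexp (RtoC u * (Ci * RtoC t)))%C 0 w (Rabs t) Hw
      (fun u _ => pderiv_Cexp_line (Ci * RtoC t) u)).
    cbv beta in H. rewrite Cmult_0_l, Cexp_0, Rminus_0_r in H. apply H.
    intros u _. rewrite !Cmod_mult, Cmod_Ci, Cmod_R, Cmod_Cexp.
    replace (Re (RtoC u * (Ci * RtoC t))) with 0 by (unfold Re, Ci, Cmult, RtoC; simpl; ring).
    rewrite exp_0. lra. }
  assert (H2 : Cmod (Cexp (RtoC v * (Ci * RtoC t)) - 1) <= Rabs t * Rabs v).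
  { destruct (Rle_or_lt 0 v) as [Hv|Hv]; [rewrite (Rabs_pos_eq v) by exact Hv; now apply H1|].
    rewrite (Rabs_left v) by exact Hv.
    replace (Cexp (RtoC v * (Ci * RtoC t)) - 1)%C
      with (- (Cexp (RtoC v * (Ci * RtoC t)) * (Cexp (RtoC (- v) * (Ci * RtoC t)) - 1)))%C.
    - rewrite Cmod_opp, Cmod_mult, Cmod_Cexp.
      replace (Re (RtoC v * (Ci * RtoC t))) with 0 by (unfold Re, Ci, Cmult, RtoC; simpl; ring).
      rewrite exp_0, Rmult_1_l. apply H1. lra.
    - assert (E : (Cexp (RtoC v * (Ci * RtoC t)) * Cexp (RtoC (- v) * (Ci * RtoC t)) = 1)%C).
      { rewrite <- Cexp_plus. replace (RtoC v * (Ci * RtoC t) + RtoC (- v) * (Ci * RtoC t))%C with (RtoC 0)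
          by (rewrite RtoC_opp; ring). apply Cexp_0. }
      replace (- (Cexp (RtoC v * (Ci * RtoC t)) * (Cexp (RtoC (- v) * (Ci * RtoC t)) - 1)))%C
        with (Cexp (RtoC v * (Ci * RtoC t)) - Cexp (RtoC v * (Ci * RtoC t)) * Cexp (RtoC (- v) * (Ci * RtoC t)))%C
        by ring. rewrite E. ring. }
  eapply Rle_trans; [exact H2|]. apply Rmult_le_compat_l; [apply Rabs_pos|].
  set (w := exp v - exp (- v)).
  assert (Hw : 2 * Rabs v <= Rabs w).
  { assert (Hs : forall y, 0 <= y -> 2 * y <= exp y - exp (- y)).
    { intros y Hy.
      destruct (MVT_gen (fun u => exp u - exp (- u) - 2 * u) 0 y (fun u => exp u + exp (- u) - 2)) as [c [Hc E]].
      - intros u _. auto_derive; [trivial|ring].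
      - intros u _. apply continuity_pt_filterlim.
        apply (ex_derive_continuous (K := R_AbsRing) (V := R_NormedModule) (fun u => exp u - exp (- u) - 2 * u)).
        auto_derive. trivial.
      - cbv beta in E. rewrite Ropp_0, exp_0 in E.
        assert (H3 : 2 <= exp c + exp (- c)).
        { rewrite exp_Ropp. assert (H4 := exp_pos c).
          apply Rmult_le_reg_l with (exp c); [exact H4|]. rewrite Rmult_plus_distr_l, Rinv_r by lra.
          assert (H5 := pow2_ge_0 (exp c - 1)). nra. }
        nra. }
    unfold w. destruct (Rle_or_lt 0 v) as [Hv|Hv].
    - rewrite (Rabs_pos_eq v) by exact Hv. eapply Rle_trans; [now apply Hs|apply Rle_abs].
    - rewrite (Rabs_left v) by exact Hv. rewrite Rabs_minus_sym. eapply Rle_trans; [apply Hs; lra|].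
      rewrite Ropp_involutive. apply Rle_abs. }
  assert (H3 : w ^ 2 = Rabs w ^ 2) by (rewrite pow2_abs; reflexivity).
  rewrite H3. set (z := Rabs w) in *.
  (* AM-GM: [z / 2 <= d + z^2 / (16 d)] *)
  assert (H4 : z / 2 <= d + / (16 * d) * z ^ 2).
  { apply Rmult_le_reg_l with (16 * d); [lra|].
    replace (16 * d * (d + / (16 * d) * z ^ 2)) with (16 * d ^ 2 + z ^ 2) by (field; lra).
    assert (H5 := pow2_ge_0 (4 * d - z)). nra. }
  lra.
Qed.

(* For large [x] the weight [q(u) e^(xu)] concentrates where the phase
   [e^(i t (u - c))], [e^(2c) = x / 2 pi], is nearly constant. *)
Lemma gam_neq_0_large (x t d : R) : 2 < x -> 0 < d ->
  Rabs t * (d + / (8 * d * (x - 2))) < 1 -> gam (RtoC x + Ci * RtoC t) <> 0.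
Proof.
  intros Hx Hd Hsmall E0.
  assert (HPI := PI_RGT_0).
  set (c := ln (x / (2 * PI)) / 2).
  assert (Hxp : 0 < x / (2 * PI)) by (apply Rdiv_lt_0_compat; lra).
  assert (Hc2 : exp (2 * c) = x / (2 * PI)).
  { unfold c. replace (2 * (ln (x / (2 * PI)) / 2)) with (ln (x / (2 * PI))) by field. now apply exp_ln. }
  assert (Hx0 := gam_real_pos x ltac:(lra)).
  set (G := gam (RtoC x)) in *.
  assert (Hg0 : has_int (mel (RtoC x)) G) by (apply gam_has_int; rewrite re_RtoC; lra).
  assert (Hgt := gam_has_int (RtoC x + Ci * RtoC t)
    ltac:(rewrite re_plus, re_RtoC; unfold Re at 1, Ci, Cmult, RtoC; simpl; lra)).
  rewrite E0 in Hgt.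
  assert (Hgp : has_int (mel (RtoC (x + 2))) (RtoC (x / (2 * PI)) * G)%C).
  { replace (RtoC (x / (2 * PI)) * G)%C with (gam (RtoC (x + 2))).
    - apply gam_has_int. rewrite re_RtoC. lra.
    - assert (H := gam_rec (RtoC x) ltac:(rewrite re_RtoC; lra)). fold G in H.
      rewrite <- RtoC_plus in H. rewrite RtoC_div, RtoC_mult by lra.
      assert (HP : RtoC PI <> 0) by (apply RtoC_neq_0; lra).
      replace (RtoC x / (2 * PI) * G)%C with (RtoC x * G / (2 * PI))%C by (field; exact HP).
      rewrite H. field. exact HP. }
  assert (Hgm : has_int (mel (RtoC (x - 2))) (RtoC (2 * PI / (x - 2)) * G)%C).
  { replace (RtoC (2 * PI / (x - 2)) * G)%C with (gam (RtoC (x - 2))).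
    - apply gam_has_int. rewrite re_RtoC. lra.
    - assert (H := gam_rec (RtoC (x - 2)) ltac:(rewrite re_RtoC; lra)).
      rewrite <- RtoC_plus in H. replace (x - 2 + 2) with x in H by ring. fold G in H.
      assert (HP : RtoC (x - 2) <> 0) by (apply RtoC_neq_0; lra).
      rewrite RtoC_div, RtoC_mult by lra.
      replace (2 * PI / RtoC (x - 2) * G)%C with (2 * PI * G / RtoC (x - 2))%C by (field; exact HP).
      rewrite <- H. field. exact HP. }
  (* Expanding the square yields the integrals of [mel] at [x + 2], [x] and [x - 2]. With this [c]
     the recursion makes their ratios to [G] equal to [1], [-2] and [x / (x - 2)], so the mean of
     the square is [2 / (x - 2)]. *)
  set (h := fun u => qexp u * exp (x * u) * (Rabs t * (d + / (16 * d) * (exp (u - c) - exp (- (u - c))) ^ 2))).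
  assert (Hh : has_int (fun u => RtoC (h u))
    (RtoC (Rabs t * (d - / (8 * d))) * G +
      (RtoC (Rabs t * / (16 * d) * exp (- (2 * c))) * (RtoC (x / (2 * PI)) * G) +
       RtoC (Rabs t * / (16 * d) * exp (2 * c)) * (RtoC (2 * PI / (x - 2)) * G)))%C).
  { apply (has_int_ext (fun u => RtoC (Rabs t * (d - / (8 * d))) * mel (RtoC x) u +
      (RtoC (Rabs t * / (16 * d) * exp (- (2 * c))) * mel (RtoC (x + 2)) u +
       RtoC (Rabs t * / (16 * d) * exp (2 * c)) * mel (RtoC (x - 2)) u))%C).
    - intros u. rewrite !mel_real, <- !RtoC_mult, <- !RtoC_plus. f_equal. unfold h.
      replace ((exp (u - c) - exp (- (u - c))) ^ 2)
        with (exp (u - c) * exp (u - c) - 2 * (exp (u - c) * exp (- (u - c))) + exp (- (u - c)) * exp (- (u - c))) by ring.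
      rewrite <- !exp_plus.
      replace (u - c + - (u - c)) with 0 by ring. rewrite exp_0.
      replace ((x + 2) * u) with (x * u + 2 * u) by ring. replace ((x - 2) * u) with (x * u + - (2 * u)) by ring.
      replace (u - c + (u - c)) with (- (2 * c) + 2 * u) by ring.
      replace (- (u - c) + - (u - c)) with (2 * c + - (2 * u)) by ring.
      rewrite !exp_plus. field. lra.
    - repeat apply has_int_plus; apply has_int_scal; assumption. }
  assert (Hf := has_int_plus _ _ _ _ (has_int_scal _ (Cexp (RtoC (- c) * (Ci * RtoC t))) _ Hgt)
    (has_int_scal _ (- (1))%C _ Hg0)).
  assert (Hdom := has_int_dominated _ h _ _ Hf Hh).
  assert (Hle : Cmod (Cexp (RtoC (- c) * (Ci * RtoC t)) * 0 + - (1) * G) <=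
     Re (RtoC (Rabs t * (d - / (8 * d))) * G +
      (RtoC (Rabs t * / (16 * d) * exp (- (2 * c))) * (RtoC (x / (2 * PI)) * G) +
       RtoC (Rabs t * / (16 * d) * exp (2 * c)) * (RtoC (2 * PI / (x - 2)) * G)))).
  { apply Hdom. intros u.
    replace (Cexp (RtoC (- c) * (Ci * RtoC t)) * mel (RtoC x + Ci * RtoC t) u + - (1) * mel (RtoC x) u)%C
      with (mel (RtoC x) u * (Cexp (RtoC (u - c) * (Ci * RtoC t)) - 1))%C.
    - rewrite Cmod_mult, Cmod_mel, re_RtoC. unfold h.
      apply Rmult_le_compat_l; [apply Rmult_le_pos; left; [apply qexp_pos|apply exp_pos]|].
      now apply Cexp_imag_sub_1.
    - unfold mel.
      replace (RtoC u * (RtoC x + Ci * RtoC t))%C with (RtoC u * RtoC x + RtoC u * (Ci * RtoC t))%C by ring.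
      replace (RtoC (u - c) * (Ci * RtoC t))%C with (RtoC u * (Ci * RtoC t) + RtoC (- c) * (Ci * RtoC t))%C
        by (rewrite RtoC_minus, RtoC_opp; ring).
      rewrite !Cexp_plus. ring. }
  replace (Cexp (RtoC (- c) * (Ci * RtoC t)) * 0 + - (1) * G)%C with (- G)%C in Hle by ring.
  rewrite Cmod_opp in Hle.
  assert (HGm := Rle_trans _ _ _ (Rle_abs _) (re_le_Cmod G)).
  rewrite !re_plus, !re_scal_l in Hle.
  rewrite exp_Ropp, Hc2 in Hle.
  replace (Rabs t * (d - / (8 * d)) * Re G +
    (Rabs t * / (16 * d) * / (x / (2 * PI)) * (x / (2 * PI) * Re G) +
     Rabs t * / (16 * d) * (x / (2 * PI)) * (2 * PI / (x - 2) * Re G)))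
    with (Rabs t * (d + / (8 * d * (x - 2))) * Re G) in Hle by (field; lra).
  nra.
Qed.

(** The recursion carries a zero at [s] to all [s + 2 k], with fixed imaginary part and growing real
    part, until it contradicts [gam_neq_0_large]. *)
Theorem gam_neq_0 (s : C) : 0 < Re s -> gam s <> 0.
Proof.
  intros Hs E.
  assert (Hk : forall k : nat, gam (s + RtoC (2 * INR k)) = RtoC 0).
  { induction k as [|k IH].
    - rewrite <- E. f_equal. simpl INR. replace (2 * 0) with 0 by ring. ring.
    - assert (Hk0 := pos_INR k).
      assert (H := gam_rec (s + RtoC (2 * INR k)) ltac:(rewrite re_plus, re_RtoC; lra)).
      rewrite IH in H.
      replace (s + RtoC (2 * INR k) + 2)%C with (s + RtoC (2 * INR (S k)))%C in H
        by (rewrite S_INR, !RtoC_mult, RtoC_plus; ring).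
      assert (HP : (2 * RtoC PI)%C <> 0).
      { rewrite <- RtoC_mult. apply RtoC_neq_0. assert (H1 := PI_RGT_0). lra. }
      replace (gam (s + RtoC (2 * INR (S k))))
        with (2 * PI * gam (s + RtoC (2 * INR (S k))) / (2 * PI))%C by (field; apply RtoC_neq_0, PI_neq0).
      rewrite <- H. unfold Cdiv. ring. }
  destruct s as [x t]. unfold Re in Hs; simpl in Hs.
  (* With [w = 1 + |t|] and [X - 2 > w^2], [d = 1 / (2 w)] gives [d + 1 / (8 d (X - 2)) <= 1 / (2 w)
     + 1 / (4 w) < 1 / w], and [|t| / w < 1]. *)
  set (d := / (2 * (1 + Rabs t))). assert (Ht := Rabs_pos t).
  assert (Hd : 0 < d) by (apply Rinv_0_lt_compat; lra).
  destruct (nfloor_ex (1 + (1 + Rabs t) ^ 2)) as [k [_ Hk2]]; [assert (H := pow2_ge_0 (1 + Rabs t)); lra|].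
  assert (Hsq := pow2_ge_0 (1 + Rabs t)).
  set (X := x + 2 * INR (S k)).
  assert (HX : 2 + (1 + Rabs t) ^ 2 < X) by (unfold X; rewrite S_INR; lra).
  apply (gam_neq_0_large X t d); [lra|exact Hd| |].
  - set (w := 1 + Rabs t) in *. assert (Hw : 1 <= w) by (unfold w; lra).
    replace (Rabs t) with (w - 1) by (unfold w; ring).
    assert (E1 : / (8 * d * (X - 2)) = w / (4 * (X - 2))) by (unfold d; field; lra).
    rewrite E1.
    assert (H1 : w / (4 * (X - 2)) <= / (4 * w)).
    { apply Rle_trans with (w / (4 * w ^ 2)); [|right; field; lra].
      apply Rmult_le_compat_l; [lra|]. apply Rinv_le_contravar; [|lra].
      assert (0 < w ^ 2) by (apply pow_lt; lra). lra. }
    assert (H2 : d + / (4 * w) <= / w).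
    { unfold d. apply Rmult_le_reg_r with w; [lra|]. rewrite Rinv_l by lra.
      replace ((/ (2 * w) + / (4 * w)) * w) with (3 / 4) by (field; lra). lra. }
    apply Rle_lt_trans with ((w - 1) * / w).
    + apply Rmult_le_compat_l; lra.
    + apply Rmult_lt_reg_r with w; [lra|]. rewrite Rmult_assoc, Rinv_l by lra. lra.
  - rewrite <- (Hk (S k)). f_equal. unfold X.
    unfold Cplus, Cmult, RtoC, Ci; simpl. f_equal; ring.
Qed.

(** * The functional equation of zeta *)

Definition psi_term (k : nat) (u : R) : R := exp (- (PI * exp (2 * u) * INR (S k) ^ 2)).
Definition psi (u : R) : R := theta0 (exp (2 * u)).
Definition psi_sum (n : nat) (u : R) : R := sum_n (fun k => psi_term k u) n.
(** The majorant [psi_weight u * inv_gap k] of [psi_term k u] separates the variables: [inv_gap]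
    telescopes to total sum 1, and the weight combines [exp (-y) <= 1 / y] on the left with
    superexponential decay on the right. *)
Definition psi_weight (u : R) : R := if Rle_dec u 0 then exp (- (2 * u)) else exp PI * qexp u.
Definition inv_gap (k : nat) : R := / INR (S k) - / INR (S (S k)).

Lemma inv_gap_sum (n : nat) : sum_n inv_gap n = 1 - / INR (S (S n)).
Proof.
  induction n as [|n IH].
  - rewrite sum_O. unfold inv_gap. simpl (INR 1). rewrite Rinv_1. reflexivity.
  - rewrite sum_Sn, IH. unfold inv_gap. change (1 - / INR (S (S n)) + (/ INR (S (S n)) - / INR (S (S (S n)))) = 1 - / INR (S (S (S n)))).
    ring.
Qed.

Lemma is_series_inv_gap : is_series inv_gap 1.
Proof.
  change (is_lim_seq (sum_n inv_gap) 1).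
  apply is_lim_seq_ext with (fun n => 1 - / INR (S (S n))); [intros n; symmetry; apply inv_gap_sum|].
  replace (Finite 1) with (Finite (1 - 0)) by (f_equal; ring).
  apply is_lim_seq_minus'; [apply is_lim_seq_const|].
  apply (is_lim_seq_ext (fun n => / INR (n + 2))); [intros n; f_equal; f_equal; lia|].
  apply (is_lim_seq_incr_n (fun n => / INR n) 2).
  replace (Finite 0) with (Rbar_inv p_infty) by reflexivity.
  apply is_lim_seq_inv; [apply is_lim_seq_INR|discriminate].
Qed.

Lemma inv_gap_ge (k : nat) : / (PI * INR (S k) ^ 2) <= inv_gap k.
Proof.
  assert (HJ : 1 <= INR (S k)) by (rewrite S_INR; assert (H := pos_INR k); lra).
  unfold inv_gap. rewrite (S_INR (S k)). set (J := INR (S k)) in *.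
  replace (/ J - / (J + 1)) with (/ (J * (J + 1))) by (field; lra).
  apply Rinv_le_contravar; [nra|]. assert (H := PI_ge_2). simpl. nra.
Qed.

Lemma exp_neg_le_inv (y : R) : 0 < y -> exp (- y) <= / y.
Proof.
  intros Hy. rewrite exp_Ropp. apply Rinv_le_contravar; [exact Hy|].
  assert (H := exp_ge_1_plus y). lra.
Qed.

Lemma psi_term_le (k : nat) (u : R) : 0 <= psi_term k u <= psi_weight u * inv_gap k.
Proof.
  split; [left; apply exp_pos|].
  assert (HJ : 1 <= INR (S k)) by (rewrite S_INR; assert (H := pos_INR k); lra).
  assert (HPI := PI_ge_2). assert (Hg := inv_gap_ge k).
  unfold psi_term, psi_weight. set (J := INR (S k)) in *.
  assert (HJ2 : 1 <= J ^ 2) by (simpl; nra).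
  assert (He := exp_pos (2 * u)).
  destruct (Rle_dec u 0) as [Hu|Hu].
  - apply Rle_trans with (/ (PI * exp (2 * u) * J ^ 2)).
    + apply exp_neg_le_inv. apply Rmult_lt_0_compat; [nra|lra].
    + rewrite exp_Ropp.
      replace (/ (PI * exp (2 * u) * J ^ 2)) with (/ exp (2 * u) * / (PI * J ^ 2)) by (field; lra).
      apply Rmult_le_compat_l; [left; now apply Rinv_0_lt_compat|exact Hg].
  - assert (He1 : 1 <= exp (2 * u)) by (rewrite <- exp_0; apply exp_le; lra).
    unfold qexp.
    apply Rle_trans with (exp PI * exp (- (PI * exp (2 * u))) * exp (- (PI * J ^ 2))).
    + rewrite <- !exp_plus. apply exp_le.
      (* The product of the two nonnegative differences gives
         [exp (2 u) J^2 >= exp (2 u) + J^2 - 1], which splits the exponent into a part in [u] and a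
         part in [J]. *)
      assert (0 <= PI * ((exp (2 * u) - 1) * (J ^ 2 - 1))) by (apply Rmult_le_pos; [lra|nra]). lra.
    + apply Rmult_le_compat_l; [apply Rmult_le_pos; left; apply exp_pos|].
      eapply Rle_trans; [apply exp_neg_le_inv; nra|exact Hg].
Qed.

Lemma psi_weight_pos (u : R) : 0 < psi_weight u.
Proof.
  unfold psi_weight. destruct Rle_dec; [apply exp_pos|].
  apply Rmult_lt_0_compat; [apply exp_pos|apply qexp_pos].
Qed.

Lemma psi_approx (n : nat) (u : R) : Rabs (psi u - psi_sum n u) <= psi_weight u * / INR (S (S n)).
Proof.
  unfold psi, theta0, psi_sum.
  assert (Hs : is_series (fun k => psi_weight u * inv_gap k) (psi_weight u * 1))
    by (apply (is_series_scal (K := R_AbsRing) (V := R_NormedModule)); apply is_series_inv_gap).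
  assert (H := Series_tail_le (fun k => psi_term k u) (fun k => psi_weight u * inv_gap k) n).
  eapply Rle_trans; [apply H|].
  - intros j. assert (H1 := psi_term_le j u). rewrite Rabs_pos_eq; lra.
  - eexists; exact Hs.
  - rewrite (is_series_unique _ _ Hs).
    assert (E : sum_n (fun k => psi_weight u * inv_gap k) n = psi_weight u * sum_n inv_gap n)
      by apply (sum_n_mult_l (K := R_Ring)).
    rewrite E, inv_gap_sum. right. ring.
Qed.

Lemma psi_bounds (u : R) : 0 <= psi u <= psi_weight u.
Proof.
  split; [apply theta0_nonneg, exp_pos|].
  rewrite <- (Rmult_1_r (psi_weight u)).
  assert (Hs : is_series (fun k => psi_weight u * inv_gap k) (psi_weight u * 1))
    by (apply (is_series_scal (K := R_AbsRing) (V := R_NormedModule)); apply is_series_inv_gap).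
  rewrite <- (is_series_unique _ _ Hs). apply Series_le; [intros k; apply psi_term_le|].
  eexists; exact Hs.
Qed.

Lemma pcont_psi_sum (n : nat) (u : R) : pcont (fun u => RtoC (psi_sum n u)) u.
Proof.
  apply (pcont_RtoC (psi_sum n)). unfold psi_sum.
  assert (Ht : forall k, ex_derive (psi_term k) u).
  { intros k. unfold psi_term. set (J := INR (S k)). auto_derive. trivial. }
  induction n as [|n IH].
  - apply (ex_derive_ext (psi_term 0)); [intros v; now rewrite sum_O|apply Ht].
  - apply (ex_derive_ext (fun v => sum_n (fun k => psi_term k v) n + psi_term (S n) v));
      [intros v; now rewrite sum_Sn|].
    apply (ex_derive_plus (fun v => sum_n (fun k => psi_term k v) n) (psi_term (S n))); [exact IH|apply Ht].
Qed.

Lemma pcont_psi (u0 : R) : pcont (fun u => RtoC (psi u)) u0.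
Proof.
  apply pcont_eps. intros eps Heps.
  set (W := exp (2 * (Rabs u0 + 1)) + exp PI).
  assert (HW0 : 0 < W) by (assert (H1 := exp_pos (2 * (Rabs u0 + 1))); assert (H2 := exp_pos PI); unfold W; lra).
  assert (HW : forall u, Rabs (u - u0) < 1 -> psi_weight u <= W).
  { intros u Hu. apply Rabs_def2 in Hu. unfold psi_weight, W.
    assert (H1 := exp_pos (2 * (Rabs u0 + 1))). assert (H2 := exp_pos PI).
    destruct (Rle_dec u 0).
    - assert (H3 := Rle_abs (- u0)). rewrite Rabs_Ropp in H3.
      assert (exp (- (2 * u)) <= exp (2 * (Rabs u0 + 1))) by (apply exp_le; lra). lra.
    - assert (H3 := qexp_le_1 u). assert (H4 := qexp_pos u). nra. }
  destruct (nfloor_ex (3 * W / eps)) as [n [_ Hn]]; [apply Rmult_le_pos; [lra|left; now apply Rinv_0_lt_compat]|].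
  assert (Hsmall : W * / INR (S (S n)) < eps / 3).
  { assert (Hp : 0 < INR (S (S n))) by (apply lt_0_INR; lia).
    apply Rmult_lt_reg_r with (INR (S (S n))); [exact Hp|]. rewrite Rmult_assoc, Rinv_l, Rmult_1_r by lra.
    rewrite !S_INR. apply (Rmult_lt_compat_l (eps / 3)) in Hn; [|lra].
    replace (eps / 3 * (3 * W / eps)) with W in Hn by (field; lra). lra. }
  destruct (pcont_eps_inv _ u0 (pcont_psi_sum n u0) (eps / 3) ltac:(lra)) as [d [Hd Hc]].
  exists (Rmin 1 d). split; [apply Rmin_pos; lra|]. intros u Hu.
  assert (Hu1 := Rlt_le_trans _ _ _ Hu (Rmin_l _ _)). assert (Hu2 := Rlt_le_trans _ _ _ Hu (Rmin_r _ _)).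
  specialize (Hc u Hu2). rewrite <- RtoC_minus, Cmod_R in Hc. rewrite <- RtoC_minus, Cmod_R.
  assert (Happ : forall v, Rabs (v - u0) < 1 -> Rabs (psi v - psi_sum n v) < eps / 3).
  { intros v Hv. eapply Rle_lt_trans; [apply psi_approx|]. eapply Rle_lt_trans; [|exact Hsmall].
    apply Rmult_le_compat_r; [|now apply HW]. left. apply Rinv_0_lt_compat, lt_0_INR. lia. }
  assert (H1 := Happ u Hu1). assert (H2 := Happ u0 ltac:(rewrite Rminus_diag, Rabs_R0; lra)).
  apply Rabs_def2 in H1. apply Rabs_def2 in H2. apply Rabs_def2 in Hc. apply Rabs_def1; lra.
Qed.

Lemma psi_weight_decay (x S' b u : R) : x <= S' -> 0 <= u ->
  psi_weight u * exp (x * u) <= exp PI * exp ((S' + b) ^ 2 / 4) * exp (- b * u).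
Proof.
  intros Hx Hu.
  assert (Hw : psi_weight u <= exp PI * qexp u).
  { unfold psi_weight. destruct (Rle_dec u 0) as [Hu0|]; [|lra].
    replace u with 0 by lra. unfold qexp. rewrite !Rmult_0_r, exp_0, Rmult_1_r, <- exp_plus.
    apply exp_le. lra. }
  assert (Hq := qexp_decay (S' + b) u Hu). assert (He := exp_pos PI).
  apply Rle_trans with (exp PI * (exp ((S' + b) ^ 2 / 4) * exp (- (S' + b) * u)) * exp (S' * u)).
  - apply Rmult_le_compat; [left; apply psi_weight_pos|left; apply exp_pos| |apply exp_le; nra].
    eapply Rle_trans; [exact Hw|]. apply Rmult_le_compat_l; lra.
  - right. rewrite Rmult_assoc, (Rmult_assoc (exp ((S' + b) ^ 2 / 4))), <- exp_plus, <- Rmult_assoc.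
    f_equal. f_equal. ring.
Qed.

Lemma Cmod_RtoC_Cexp (x u : R) (s : C) : Cmod (RtoC x * Cexp (RtoC u * s)) = Rabs x * exp (Re s * u).
Proof. rewrite Cmod_mult, Cmod_R, Cmod_Cexp, re_scal_l. f_equal. f_equal. ring. Qed.

Definition mpsi (s : C) (u : R) : C := (RtoC (psi u) * Cexp (RtoC u * s))%C.

Lemma pcont_mpsi (s : C) (u : R) : pcont (mpsi s) u.
Proof. apply (pcont_mult (fun u => RtoC (psi u))); [apply pcont_psi|apply pcont_Cexp_line]. Qed.

Lemma mpsi_pdecay (s : C) (S' : R) : Re s <= S' ->
  pdecay (mpsi s) (exp PI * exp ((S' + 1) ^ 2 / 4)) 1.
Proof.
  intros Hs. split; [lra|]. split; [intros u _; apply pcont_mpsi|]. intros u Hu.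
  unfold mpsi. rewrite Cmod_RtoC_Cexp. assert (Hb := psi_bounds u). rewrite Rabs_pos_eq by lra.
  eapply Rle_trans; [|apply (psi_weight_decay (Re s) S' 1 u Hs Hu)].
  apply Rmult_le_compat_r; [left; apply exp_pos|lra].
Qed.

(** In the variable [x = exp u] this is the part of the Mellin integral over [x >= 1]; it is entire
    because [psi] decays superexponentially there. *)
Definition Epsi (s : C) : C := pint (mpsi s).

Lemma holo_Epsi (s : C) : holo Epsi s.
Proof.
  unfold Epsi. apply (holo_pint (fun u => RtoC (psi u)) s 1 (exp PI * exp ((Re s + 1 + 1) ^ 2 / 4)) 1 Rlt_0_1).
  - intros z Hz. apply Re_near in Hz. apply mpsi_pdecay. lra.
  - intros u _. apply pcont_psi.
Qed.

Lemma psi_reflection (u : R) : psi (- u) = exp u * psi u + (exp u - 1) / 2.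
Proof.
  assert (H := theta_functional_equation (exp (2 * u)) (exp_pos _)).
  rewrite <- exp_Ropp in H.
  replace (sqrt (exp (2 * u))) with (exp u) in H.
  2:{ replace (2 * u) with (u + u) by ring. rewrite exp_plus, sqrt_square by (left; apply exp_pos). reflexivity. }
  unfold psi. replace (2 * - u) with (- (2 * u)) by ring. lra.
Qed.

(** The completed zeta function [(1/2) pi^(-s/2) Gamma(s/2) zeta(s)], with its poles at 0 and 1
    written out; it is not Riemann's entire function of the same letter. *)
Definition xi (s : C) : C := (Epsi s + Epsi (1 - s) + / 2 * / (s - 1) - / 2 * / s)%C.

Lemma xi_symmetric (s : C) : xi (1 - s) = xi s.
Proof.
  unfold xi. replace (1 - (1 - s))%C with s by ring. replace (1 - s - 1)%C with (- s)%C by ring.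
  assert (E : forall z, (/ - z = - / z)%C).
  { intros [a b]. unfold Cinv, Copp. simpl.
    replace (- a * (- a * 1) + - b * (- b * 1)) with (a * (a * 1) + b * (b * 1)) by ring.
    unfold Rdiv. f_equal; ring. }
  rewrite E. replace (1 - s)%C with (- (s - 1))%C at 2 by ring. rewrite E. ring.
Qed.

(** For negative [u] the weight is [exp (-2 u)], so this majorant is integrable against [exp (s u)]
    for [Re s > 2]. The factor [1 / (n + 2)] is the tail of [inv_gap]. *)
Lemma mpsi_tail_rdecay (n : nat) (s : C) : 2 < Re s ->
  rdecay (fun u => RtoC (psi u - psi_sum n u) * Cexp (RtoC u * s))%C
    (exp PI * exp ((Re s + (Re s - 2)) ^ 2 / 4) * / INR (S (S n))) (Re s - 2).
Proof.
  intros Hs. split; [lra|]. split.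
  - intros u. apply (pcont_mult (fun u => RtoC (psi u - psi_sum n u))); [|apply pcont_Cexp_line].
    apply (continuous_ext (fun u => RtoC (psi u) - RtoC (psi_sum n u))%C); [intros v; now rewrite RtoC_minus|].
    apply pcont_minus; [apply pcont_psi|apply pcont_psi_sum].
  - intros u. rewrite Cmod_RtoC_Cexp.
    assert (Hi : 0 < / INR (S (S n))) by (apply Rinv_0_lt_compat, lt_0_INR; lia).
    apply Rle_trans with (psi_weight u * / INR (S (S n)) * exp (Re s * u)).
    { apply Rmult_le_compat_r; [left; apply exp_pos|apply psi_approx]. }
    replace (psi_weight u * / INR (S (S n)) * exp (Re s * u))
      with (psi_weight u * exp (Re s * u) * / INR (S (S n))) by ring.
    replace (exp PI * exp ((Re s + (Re s - 2)) ^ 2 / 4) * / INR (S (S n)) * exp (- (Re s - 2) * Rabs u))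
      with (exp PI * exp ((Re s + (Re s - 2)) ^ 2 / 4) * exp (- (Re s - 2) * Rabs u) * / INR (S (S n))) by ring.
    apply Rmult_le_compat_r; [lra|].
    destruct (Rle_or_lt 0 u) as [Hu|Hu].
    + rewrite (Rabs_pos_eq u) by exact Hu. apply psi_weight_decay; lra.
    + rewrite (Rabs_left u) by exact Hu. unfold psi_weight. destruct (Rle_dec u 0) as [_|Hn]; [|lra].
      rewrite <- !exp_plus. apply exp_le.
      assert (H1 := pow2_ge_0 (Re s + (Re s - 2))). assert (H2 := PI_ge_2). nra.
Qed.

(** Translation of [u] by the logarithm of an integer is the substitution that turns one Gaussian
    into the corresponding term of the theta series. *)
Lemma mel_shift (s : C) (k : nat) (u : R) :
  (ncp (INR (S k)) s * mel s (u + ln (INR (S k))) = RtoC (psi_term k u) * Cexp (RtoC u * s))%C.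
Proof.
  assert (HJ : 0 < INR (S k)) by (apply lt_0_INR; lia).
  unfold mel, ncp.
  assert (Eq : qexp (u + ln (INR (S k))) = psi_term k u).
  { unfold qexp, psi_term. f_equal. f_equal. rewrite Rmult_assoc. f_equal.
    replace (2 * (u + ln (INR (S k)))) with (2 * u + (ln (INR (S k)) + ln (INR (S k)))) by ring.
    rewrite !exp_plus, exp_ln by exact HJ. ring. }
  rewrite Eq.
  replace (RtoC (u + ln (INR (S k))) * s)%C with (RtoC u * s + RtoC (ln (INR (S k))) * s)%C
    by (rewrite RtoC_plus; ring).
  rewrite Cexp_plus.
  assert (E1 : (Cexp (- s * RtoC (ln (INR (S k)))) * Cexp (RtoC (ln (INR (S k))) * s) = 1)%C).
  { rewrite <- Cexp_plus. replace (- s * RtoC (ln (INR (S k))) + RtoC (ln (INR (S k))) * s)%C with (RtoC 0) by ring.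
    apply Cexp_0. }
  replace (Cexp (- s * RtoC (ln (INR (S k)))) * (RtoC (psi_term k u) * (Cexp (RtoC u * s) * Cexp (RtoC (ln (INR (S k))) * s))))%C
    with (RtoC (psi_term k u) * Cexp (RtoC u * s) * (Cexp (- s * RtoC (ln (INR (S k)))) * Cexp (RtoC (ln (INR (S k))) * s)))%C by ring.
  rewrite E1. ring.
Qed.

Lemma psi_sum_has_int (n : nat) (s : C) : 0 < Re s ->
  has_int (fun u => RtoC (psi_sum n u) * Cexp (RtoC u * s))%C
    (csum (fun k => ncp (INR (S k)) s) n * gam s)%C.
Proof.
  intros Hs.
  assert (Ht : forall k, has_int (fun u => RtoC (psi_term k u) * Cexp (RtoC u * s))%C (ncp (INR (S k)) s * gam s)%C).
  { intros k. apply (has_int_ext (fun u => ncp (INR (S k)) s * mel s (u + ln (INR (S k))))%C).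
    - intros u. apply mel_shift.
    - apply (has_int_scal (fun u => mel s (u + ln (INR (S k))))). apply has_int_shift. now apply gam_has_int. }
  induction n as [|n IH].
  - rewrite csum_0. apply (has_int_ext (fun u => RtoC (psi_term 0 u) * Cexp (RtoC u * s))%C); [|apply Ht].
    intros u. unfold psi_sum. now rewrite sum_O.
  - rewrite csum_S.
    replace ((csum (fun k => ncp (INR (S k)) s) n + ncp (INR (S (S n))) s) * gam s)%C
      with (csum (fun k => ncp (INR (S k)) s) n * gam s + ncp (INR (S (S n))) s * gam s)%C by ring.
    apply (has_int_ext (fun u => RtoC (psi_sum n u) * Cexp (RtoC u * s) + RtoC (psi_term (S n) u) * Cexp (RtoC u * s))%C).
    + intros u. unfold psi_sum. rewrite sum_Sn.
      change (plus (sum_n (fun k => psi_term k u) n) (psi_term (S n) u)) with (sum_n (fun k => psi_term k u) n + psi_term (S n) u).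
      rewrite RtoC_plus. ring.
    + apply has_int_plus; auto.
Qed.

Lemma mpsi_rdecay (s : C) : 2 < Re s ->
  rdecay (mpsi s) (exp PI * exp ((Re s + (Re s - 2)) ^ 2 / 4)) (Re s - 2).
Proof.
  intros Hs. split; [lra|]. split; [apply pcont_mpsi|]. intros u.
  unfold mpsi. rewrite Cmod_RtoC_Cexp. assert (Hb := psi_bounds u). rewrite Rabs_pos_eq by lra.
  apply Rle_trans with (psi_weight u * exp (Re s * u)).
  { apply Rmult_le_compat_r; [left; apply exp_pos|lra]. }
  destruct (Rle_or_lt 0 u) as [Hu|Hu].
  - rewrite (Rabs_pos_eq u) by exact Hu. apply psi_weight_decay; lra.
  - rewrite (Rabs_left u) by exact Hu. unfold psi_weight. destruct (Rle_dec u 0) as [_|Hn]; [|lra].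
    rewrite <- !exp_plus. apply exp_le.
    assert (H1 := pow2_ge_0 (Re s + (Re s - 2))). assert (H2 := PI_ge_2). nra.
Qed.

(** Summation and integration are exchanged: the integral of the tail of [psi] is [O(1 / n)], while
    the Dirichlet sums tend to [zeta_em s]. *)
Lemma zeta_mellin (s : C) : 2 < Re s -> (zeta_em s * gam s)%C = rint (mpsi s).
Proof.
  intros Hs. set (K := exp PI * exp ((Re s + (Re s - 2)) ^ 2 / 4)).
  assert (HR := rint_has_int _ _ _ (mpsi_rdecay s Hs)).
  set (P := fun n => csum (fun k => ncp (INR (S k)) s) n).
  assert (Hn : forall n, Cmod (rint (mpsi s) - P n * gam s) <= 2 * (K * / INR (S (S n))) / (Re s - 2)).
  { intros n.
    assert (H1 := has_int_plus _ _ _ _ HR (has_int_scal _ (- (1))%C _ (psi_sum_has_int n s ltac:(lra)))).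
    assert (Hd := mpsi_tail_rdecay n s Hs).
    assert (H2 := rint_has_int _ _ _ Hd).
    assert (H3 : has_int (fun u => RtoC (psi u - psi_sum n u) * Cexp (RtoC u * s))%C
      (rint (mpsi s) + - (1) * (P n * gam s))%C).
    { refine (has_int_ext _ _ _ _ H1). intros u. unfold mpsi. rewrite RtoC_minus. ring. }
    replace (rint (mpsi s) - P n * gam s)%C with (rint (mpsi s) + - (1) * (P n * gam s))%C by ring.
    rewrite (has_int_unique _ _ _ H3 H2). exact (rint_norm_le _ _ _ Hd). }
  apply Ceq_minus, Cmod_eq_0, Rle_antisym; [|apply Cmod_ge_0].
  apply Rnot_lt_le. intros Hlt. set (eta := Cmod (zeta_em s * gam s - rint (mpsi s))) in *.
  assert (Hz := zeta_em_dirichlet s ltac:(lra)). rewrite is_cseries_eps in Hz.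
  assert (Hg := Cmod_ge_0 (gam s)).
  destruct (Hz (eta / 2 / (1 + Cmod (gam s)))) as [N HN].
  { apply Rdiv_lt_0_compat; lra. }
  assert (HK : 0 < K) by (apply Rmult_lt_0_compat; apply exp_pos).
  set (c := 2 * K / (Re s - 2)). assert (Hc : 0 < c) by (apply Rdiv_lt_0_compat; lra).
  destruct (nfloor_ex (2 * c / eta)) as [M [_ HM]].
  { apply Rmult_le_pos; [lra|left; now apply Rinv_0_lt_compat]. }
  specialize (HN (N + M)%nat ltac:(lia)). specialize (Hn (N + M)%nat).
  change (csum (fun k => ncp (INR (S k)) s) (N + M)) with (P (N + M)%nat) in HN.
  set (p := P (N + M)%nat) in *.
  assert (HJ : 0 < INR (S (S (N + M)))) by (apply lt_0_INR; lia).
  assert (Hn2 : 2 * (K * / INR (S (S (N + M)))) / (Re s - 2) < eta / 2).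
  { replace (2 * (K * / INR (S (S (N + M)))) / (Re s - 2)) with (c * / INR (S (S (N + M)))) by (unfold c; field; lra).
    apply Rmult_lt_reg_r with (INR (S (S (N + M)))); [exact HJ|]. rewrite Rmult_assoc, Rinv_l, Rmult_1_r by lra.
    apply (Rmult_lt_compat_l (eta / 2)) in HM; [|lra].
    replace (eta / 2 * (2 * c / eta)) with c in HM by (field; lra).
    apply Rlt_le_trans with (1 := HM). apply Rmult_le_compat_l; [lra|].
    rewrite !S_INR, plus_INR. assert (H := pos_INR N). lra. }
  assert (H1 : eta <= Cmod (p - zeta_em s) * Cmod (gam s) + Cmod (rint (mpsi s) - p * gam s)).
  { unfold eta.
    replace (zeta_em s * gam s - rint (mpsi s))%C
      with (- ((p - zeta_em s) * gam s) + - (rint (mpsi s) - p * gam s))%C by ring.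
    eapply Rle_trans; [apply Cmod_triangle|]. rewrite !Cmod_opp, Cmod_mult. lra. }
  assert (H2 : Cmod (p - zeta_em s) * Cmod (gam s) <= eta / 2).
  { apply Rle_trans with (eta / 2 / (1 + Cmod (gam s)) * (1 + Cmod (gam s))).
    - apply Rmult_le_compat; try apply Cmod_ge_0; lra.
    - right. field. lra. }
  lra.
Qed.

(** The half-line [u < 0] is folded onto [u > 0] by [psi_reflection]; the elementary terms of the
    reflection integrate to the two polar terms of [xi]. *)
Lemma rint_mpsi (s : C) : 2 < Re s -> rint (mpsi s) = xi s.
Proof.
  intros Hs. unfold rint.
  assert (Hs0 : s <> 0) by (intros E; rewrite E, re_RtoC in Hs; lra).
  assert (Hre1 : Re (s - 1) = Re s - 1) by (unfold Cminus; rewrite re_plus, re_opp, re_RtoC; ring).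
  assert (Hre2 : Re (1 - s) = 1 - Re s) by (unfold Cminus; rewrite re_plus, re_opp, re_RtoC; ring).
  assert (E : pint (fun u => mpsi s (- u)) =
    pint (fun u => mpsi (1 - s) u + (/ 2 * Cexp (RtoC u * - (s - 1)) + - / 2 * Cexp (RtoC u * - s)))%C).
  { apply pint_ext. intros u _. unfold mpsi. rewrite psi_reflection.
    replace (RtoC (- u) * s)%C with (RtoC u * - s)%C by (rewrite RtoC_opp; ring).
    replace (RtoC u * (1 - s))%C with (RtoC u + RtoC u * - s)%C by ring.
    replace (RtoC u * - (s - 1))%C with (RtoC u + RtoC u * - s)%C by ring.
    rewrite Cexp_plus, Cexp_R, RtoC_plus, RtoC_mult, RtoC_div, RtoC_minus by lra. field. }
  assert (D1 := mpsi_pdecay (1 - s) (1 - Re s) ltac:(lra)).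
  assert (D2 := pdecay_Cexp (s - 1) ltac:(lra)).
  assert (D3 := pdecay_Cexp s ltac:(lra)).
  assert (Hh : forall z c, 0 < Re z -> pdecay (fun u => c * Cexp (RtoC u * - z))%C (Cmod c) (Re z)).
  { intros z c Hz. split; [exact Hz|]. split.
    - intros u _. apply pcont_mult; [apply pcont_const|apply pcont_Cexp_line].
    - intros u Hu. rewrite Cmod_mult, Cmod_Cexp, re_scal_l, re_opp. right. f_equal. f_equal. ring. }
  assert (D4 := Hh (s - 1)%C (/ 2)%C ltac:(lra)). assert (D5 := Hh s (- / 2)%C ltac:(lra)).
  assert (D6 : pdecay (fun u => / 2 * Cexp (RtoC u * - (s - 1)) + - / 2 * Cexp (RtoC u * - s))%C
    (Cmod (/ 2) + Cmod (- / 2)) (Re s - 1)).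
  { destruct D4 as [P1 [P2 P3]]. destruct D5 as [Q1 [Q2 Q3]]. split; [lra|]. split.
    - intros u Hu. apply pcont_plus; auto.
    - intros u Hu. eapply Rle_trans; [apply Cmod_triangle|].
      specialize (P3 u Hu). specialize (Q3 u Hu). rewrite Hre1 in P3.
      assert (exp (- Re s * u) <= exp (- (Re s - 1) * u)) by (apply exp_le; nra).
      assert (H1 := Cmod_ge_0 (- / 2)). nra. }
  rewrite E, (pint_plus (mpsi (1 - s)) _ _ _ _ _ D1 D6).
  rewrite (pint_plus _ _ _ _ _ _ D4 D5).
  rewrite (pint_scal _ _ _ _ D2), (pint_scal _ _ _ _ D3), !pint_Cexp by lra.
  unfold xi, Epsi. ring.
Qed.

Lemma holo_refl (f : C -> C) (s : C) : holo f (1 - s)%C -> holo (fun z => f (1 - z)%C) s.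
Proof.
  intros H. apply (holo_comp f (fun z : C => 1 - z)%C); [exact H|].
  apply (holo_minus (fun _ => RtoC 1) (fun z => z)); [apply holo_const|apply holo_id].
Qed.

Lemma zeta_em_xi (s : C) : 0 < Re s -> s <> RtoC 1 -> (zeta_em s * gam s)%C = xi s.
Proof.
  intros Hs Hs1. apply Ceq_minus.
  apply (identity_half_plane (fun s => zeta_em s * gam s - xi s)%C 0 2); auto.
  - intros z Hz Hz1.
    assert (Hz0 : z <> 0) by (intros E; rewrite E, re_RtoC in Hz; lra).
    apply (holo_minus (fun z => zeta_em z * gam z)%C xi).
    + apply holo_mult; [apply zeta_em_holo; auto; lra|now apply holo_gam].
    + unfold xi. apply (holo_minus (fun z => Epsi z + Epsi (1 - z) + / 2 * / (z - 1))%C (fun z => / 2 * / z)%C).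
      * apply (holo_plus (fun z => Epsi z + Epsi (1 - z))%C (fun z => / 2 * / (z - 1))%C).
        -- apply (holo_plus Epsi (fun z => Epsi (1 - z)%C)); [apply holo_Epsi|apply holo_refl, holo_Epsi].
        -- apply (holo_mult (fun _ => / 2)%C (fun z => / (z - 1))%C); [apply holo_const|].
           apply holo_inv; [now apply Cminus_eq_contra|apply holo_minus; [apply holo_id|apply holo_const]].
      * apply (holo_mult (fun _ => / 2)%C (fun z => / z)%C); [apply holo_const|].
        apply (holo_inv (fun z => z)); [exact Hz0|apply holo_id].
  - intros z Hz. rewrite zeta_mellin, rint_mpsi by exact Hz. ring.
Qed.

(** * Existence and uniqueness of zeta on the plane minus [1] *)

(** This is [s * xi s] with the pole at 0 cancelled by hand, so that it is holomorphic there, with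
    value [- 1 / 2]. *)
Definition xi_num (s : C) : C := (s * (Epsi s + Epsi (1 - s) + / 2 * / (s - 1)) - / 2)%C.

Lemma xi_num_eq (s : C) : s <> 0 -> xi_num s = (s * xi s)%C.
Proof. intros Hs. unfold xi_num, xi.
  generalize (Epsi s + Epsi (1 - s) + / 2 * / (s - 1))%C. intros y. field. exact Hs.
Qed.

Lemma holo_xi_num (s : C) : s <> RtoC 1 -> holo xi_num s.
Proof.
  intros Hs1. unfold xi_num.
  apply (holo_minus (fun s => s * (Epsi s + Epsi (1 - s) + / 2 * / (s - 1)))%C (fun _ => / 2)%C); [|apply holo_const].
  apply (holo_mult (fun s => s) (fun s => Epsi s + Epsi (1 - s) + / 2 * / (s - 1))%C); [apply holo_id|].
  apply (holo_plus (fun z => Epsi z + Epsi (1 - z))%C (fun z => / 2 * / (z - 1))%C).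
  - apply (holo_plus Epsi (fun z => Epsi (1 - z)%C)); [apply holo_Epsi|apply holo_refl, holo_Epsi].
  - apply (holo_mult (fun _ => / 2)%C (fun z => / (z - 1))%C); [apply holo_const|].
    apply holo_inv; [now apply Cminus_eq_contra|apply holo_minus; [apply holo_id|apply holo_const]].
Qed.

Fixpoint even_prod (n : nat) (s : C) : C :=
  match n with O => RtoC 1 | S m => (even_prod m s * (s + RtoC (2 * INR (S m))))%C end.

(** For [Re s > 0] this is [s (s + 2) ... (s + 2 n) gam s], by [n + 1] steps of the recursion. It
    has no zeros for [Re s > - 2 (n + 1)], and in [zeta_branch] the product in the numerator
    restores the quotient [xi / gam]. *)
Definition gam_denom (n : nat) (s : C) : C := ((2 * PI) ^ S n * gam (s + RtoC (2 * INR (S n))))%C.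

(* The values agree for all [n] with [-2 (n + 1) < Re s], by the recursion for [gam]. *)
Definition zeta_branch (n : nat) (s : C) : C := (xi_num s * even_prod n s / gam_denom n s)%C.

Lemma twoPI_neq_0 : (2 * RtoC PI)%C <> 0.
Proof. rewrite <- RtoC_mult. apply RtoC_neq_0. assert (H := PI_RGT_0). lra. Qed.

Lemma gam_denom_neq_0 (n : nat) (s : C) : - (2 * INR (S n)) < Re s -> gam_denom n s <> 0.
Proof.
  intros Hs. apply Cmult_neq_0; [apply Cpow_nz, twoPI_neq_0|].
  apply gam_neq_0. rewrite re_plus, re_RtoC. lra.
Qed.

Lemma zeta_branch_S (n : nat) (s : C) : - (2 * INR (S n)) < Re s ->
  zeta_branch (S n) s = zeta_branch n s.
Proof.
  intros Hs. unfold zeta_branch.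
  set (w := (s + RtoC (2 * INR (S n)))%C).
  assert (Hw : 0 < Re w) by (unfold w; rewrite re_plus, re_RtoC; lra).
  assert (Hw0 : w <> 0) by (intros E; rewrite E, re_RtoC in Hw; lra).
  assert (Hg := gam_neq_0 w Hw). assert (HP := twoPI_neq_0).
  assert (E : gam_denom (S n) s = (w * gam_denom n s)%C).
  { unfold gam_denom. fold w.
    replace (s + RtoC (2 * INR (S (S n))))%C with (w + 2)%C
      by (unfold w; rewrite (S_INR (S n)), Rmult_plus_distr_l, Rmult_1_r, RtoC_plus; ring).
    rewrite (Cpow_S _ (S n)).
    replace (2 * PI * (2 * PI) ^ S n * gam (w + 2))%C with ((2 * PI) ^ S n * (2 * PI * gam (w + 2)))%C by ring.
    rewrite <- gam_rec by exact Hw. ring. }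
  rewrite E. change (even_prod (S n) s) with (even_prod n s * w)%C.
  assert (Hd := gam_denom_neq_0 n s Hs). field. split; assumption.
Qed.

Lemma zeta_branch_eq (n m : nat) (s : C) : - (2 * INR (S n)) < Re s -> - (2 * INR (S m)) < Re s ->
  zeta_branch n s = zeta_branch m s.
Proof.
  assert (H : forall n k, - (2 * INR (S n)) < Re s -> zeta_branch (n + k) s = zeta_branch n s).
  { intros p k Hp. induction k as [|k IH]; [now rewrite Nat.add_0_r|].
    rewrite Nat.add_succ_r, zeta_branch_S; [exact IH|].
    assert (INR (S p) <= INR (S (p + k))) by (apply le_INR; lia). lra. }
  intros Hn Hm. rewrite <- (H n m Hn), <- (H m n Hm). f_equal. lia.
Qed.

Definition zeta_ext (s : C) : C :=
  zeta_branch (proj1_sig (nfloor_ex (Rabs (Re s)) (Rabs_pos _))) s.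

Lemma zeta_ext_branch (n : nat) (s : C) : - (2 * INR (S n)) < Re s -> zeta_ext s = zeta_branch n s.
Proof.
  intros Hs. unfold zeta_ext. apply zeta_branch_eq; [|exact Hs].
  destruct nfloor_ex as [m Hm]. simpl proj1_sig. rewrite S_INR.
  assert (H := Rle_abs (- Re s)). rewrite Rabs_Ropp in H. assert (H1 := Rabs_pos (Re s)). lra.
Qed.

Lemma holo_even_prod (n : nat) (s : C) : holo (even_prod n) s.
Proof.
  induction n as [|n IH]; [apply (holo_const 1)|].
  apply (holo_mult (even_prod n) (fun s => s + RtoC (2 * INR (S n)))%C); [exact IH|].
  apply holo_plus; [apply holo_id|apply holo_const].
Qed.

Lemma holo_zeta_ext (s : C) : s <> RtoC 1 -> holo zeta_ext s.
Proof.
  intros Hs1.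
  destruct (nfloor_ex (Rabs (Re s)) (Rabs_pos _)) as [n [_ Hn]].
  assert (Hlow : forall z, Cmod (z - s) < 1 -> - (2 * INR (S n)) < Re z).
  { intros z Hz. apply Re_near in Hz. rewrite S_INR. assert (Hn0 := pos_INR n).
    assert (H := Rle_abs (- Re s)). rewrite Rabs_Ropp in H. lra. }
  assert (Hss : Cmod (s - s) < 1).
  { replace (s - s)%C with (RtoC 0) by ring. rewrite Cmod_0. lra. }
  apply holo_ext_loc with (zeta_branch n).
  - exists 1. split; [lra|]. intros z Hz. symmetry. apply zeta_ext_branch. now apply Hlow.
  - unfold zeta_branch. apply (holo_div (fun s => xi_num s * even_prod n s)%C (gam_denom n)).
    + apply gam_denom_neq_0. now apply Hlow.
    + apply holo_mult; [now apply holo_xi_num|apply holo_even_prod].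
    + unfold gam_denom. apply (holo_mult (fun _ => (2 * PI) ^ S n)%C (fun s => gam (s + RtoC (2 * INR (S n)))%C));
        [apply holo_const|].
      apply (holo_comp gam (fun s => s + RtoC (2 * INR (S n)))%C).
      * apply holo_gam. rewrite re_plus, re_RtoC. specialize (Hlow s Hss). lra.
      * apply holo_plus; [apply holo_id|apply holo_const].
Qed.

Lemma zeta_ext_em (s : C) : 0 < Re s -> s <> RtoC 1 -> zeta_ext s = zeta_em s.
Proof.
  intros Hs Hs1.
  assert (Hs0 : s <> 0) by (intros E; rewrite E, re_RtoC in Hs; lra).
  rewrite (zeta_ext_branch 0) by (simpl; lra).
  unfold zeta_branch, gam_denom. simpl even_prod.
  rewrite xi_num_eq, <- zeta_em_xi by assumption.
  replace (RtoC (2 * INR 1)) with (RtoC 2) by (simpl INR; f_equal; ring).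
  rewrite Cpow_1_r, <- gam_rec by exact Hs.
  assert (Hg := gam_neq_0 s Hs). field. split; assumption.
Qed.

Lemma is_riemann_zeta_ext : is_riemann_zeta zeta_ext.
Proof.
  split; [|exact holo_zeta_ext].
  intros s Hs.
  assert (Hs1 : s <> RtoC 1) by (intros ->; rewrite re_RtoC in Hs; lra).
  rewrite zeta_ext_em by (auto; lra).
  refine (is_series_ext (K := C_AbsRing) (V := C_NormedModule) _ _ _ _ (zeta_em_dirichlet s Hs)).
  intros k. rewrite <- nat_cpow_inv. unfold Cdiv. symmetry. apply Cmult_1_l.
Qed.

Lemma is_riemann_zeta_unique (f g : C -> C) (s : C) :
  is_riemann_zeta f -> is_riemann_zeta g -> s <> RtoC 1 -> f s = g s.
Proof.
  intros [Hf1 Hf2] [Hg1 Hg2] Hs1. apply Ceq_minus.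
  apply (identity_half_plane (fun s => f s - g s)%C (Re s - 1) 1); [| |lra|exact Hs1].
  - intros z _ Hz. apply holo_minus; auto.
  - intros z Hz. rewrite (is_cseries_unique _ _ _ (Hf1 z Hz) (Hg1 z Hz)). ring.
Qed.

(** [zeta] is known only through its specification: the constructed [zeta_ext] shows that the
    specification can be met, and uniqueness then identifies the chosen function away from 1. *)
Lemma zeta_eq_ext (s : C) : s <> RtoC 1 -> zeta s = zeta_ext s.
Proof.
  apply is_riemann_zeta_unique; [|exact is_riemann_zeta_ext].
  unfold zeta. apply epsilon_spec. exists zeta_ext. exact is_riemann_zeta_ext.
Qed.

Lemma zeta_eq_em (s : C) : s <> RtoC 1 -> 0 < Re s -> zeta s = zeta_em s.
Proof. intros Hs1 Hs. rewrite zeta_eq_ext by exact Hs1. now apply zeta_ext_em. Qed.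

Lemma even_prod_zero (n : nat) (s : C) : even_prod n s = RtoC 0 -> trivial_zero s.
Proof.
  induction n as [|n IH]; intros H.
  - simpl in H. now apply C1_nz in H.
  - destruct (Ceq_dec (even_prod n s) 0) as [E|E]; [now apply IH|].
    destruct (Ceq_dec (s + RtoC (2 * INR (S n)))%C 0) as [E'|E'].
    + exists n. replace (RtoC (-2 * INR (S n))) with (- RtoC (2 * INR (S n)))%C
        by (rewrite <- RtoC_opp; f_equal; ring).
      replace s with ((s + RtoC (2 * INR (S n))) - RtoC (2 * INR (S n)))%C by ring. rewrite E'. ring.
    + now elim (Cmult_neq_0 _ _ E E').
Qed.

(** In a branch a zero comes from [xi_num] or from [even_prod], and zeros of the latter are trivial
    ones. Since [xi_num 0] is not zero, it follows that [xi s = 0]; by symmetry [xi (1 - s) = 0],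
    and on the right half-plane [xi] is zeta times a nonvanishing factor. *)
Theorem zeta_zero_reflection (s : C) : s <> RtoC 1 -> Re s < 1 -> zeta s = RtoC 0 ->
  ~ trivial_zero s -> (1 - s)%C <> RtoC 1 /\ zeta (1 - s) = RtoC 0.
Proof.
  intros Hs1 Hs Hz Ht.
  rewrite zeta_eq_ext in Hz by exact Hs1.
  destruct (nfloor_ex (Rabs (Re s)) (Rabs_pos _)) as [n [_ Hn]].
  assert (Hlow : - (2 * INR (S n)) < Re s).
  { rewrite S_INR. assert (H := Rle_abs (- Re s)). rewrite Rabs_Ropp in H. assert (Hn0 := pos_INR n). lra. }
  rewrite (zeta_ext_branch n s Hlow) in Hz. unfold zeta_branch in Hz.
  assert (Hd := gam_denom_neq_0 n s Hlow).
  assert (Hnum : xi_num s = RtoC 0).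
  { destruct (Ceq_dec (xi_num s) 0) as [E|E]; [exact E|].
    destruct (Ceq_dec (even_prod n s) 0) as [E'|E']; [elim Ht; now apply (even_prod_zero n)|].
    assert (H := Cmult_neq_0 _ _ E E').
    elim (Cmult_neq_0 _ (/ gam_denom n s)%C H); [|exact Hz].
    intros E2. apply C1_nz. rewrite <- (Cinv_r _ Hd), E2. ring. }
  assert (Hs0 : s <> 0).
  { intros E. rewrite E in Hnum. unfold xi_num in Hnum.
    replace (0 * (Epsi 0 + Epsi (1 - 0) + / 2 * / (0 - 1)) - / 2)%C with (- / 2)%C in Hnum by ring.
    apply (f_equal Re) in Hnum. rewrite re_opp, <- RtoC_inv, !re_RtoC in Hnum by lra. lra. }
  rewrite xi_num_eq in Hnum by exact Hs0.
  assert (Hxi : xi s = RtoC 0).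
  { destruct (Ceq_dec (xi s) 0) as [E|E]; [exact E|]. now elim (Cmult_neq_0 _ _ Hs0 E). }
  assert (Hre : Re (1 - s) = 1 - Re s) by (unfold Cminus; rewrite re_plus, re_opp, re_RtoC; ring).
  assert (Hne : (1 - s)%C <> RtoC 1).
  { intros E. apply Hs0. replace s with (1 - (1 - s))%C by ring. rewrite E. ring. }
  split; [exact Hne|].
  rewrite <- xi_symmetric, <- zeta_em_xi in Hxi by (auto; lra).
  rewrite zeta_eq_em by (auto; lra).
  assert (Hg := gam_neq_0 (1 - s)%C ltac:(lra)).
  destruct (Ceq_dec (zeta_em (1 - s)) 0) as [E|E]; [exact E|]. now elim (Cmult_neq_0 _ _ E Hg).
Qed.

(** * Divided differences of complex-valued functions *)

Lemma slope_near_deriv (f df ddf : R -> C) (a b e B : R) :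
  a < b -> a <= e <= b ->
  (forall u, a <= u <= b -> pderiv f u (df u)) ->
  (forall u, a <= u <= b -> pderiv df u (ddf u)) ->
  (forall u, a <= u <= b -> Cmod (ddf u) <= B) ->
  Cmod ((f b - f a) / RtoC (b - a) - df e) <= B * (b - a).
Proof.
  intros Hab He Hf Hdf HB.
  assert (Hba : RtoC (b - a) <> 0) by (apply RtoC_neq_0; lra).
  assert (H1 : forall u, a <= u <= b -> Cmod (df u - df e) <= B * (b - a)).
  { intros u Hu.
    assert (HB0 : 0 <= B) by (apply Rle_trans with (Cmod (ddf a)); [apply Cmod_ge_0|apply HB; lra]).
    destruct (Rle_or_lt e u) as [Hue|Hue].
    - apply Rle_trans with (B * (u - e)); [|nra].
      apply mean_value_ineq with ddf; [exact Hue| |]; intros v Hv; [apply Hdf|apply HB]; lra.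
    - rewrite Cmod_minus_sym. apply Rle_trans with (B * (e - u)); [|nra].
      apply mean_value_ineq with ddf; [lra| |]; intros v Hv; [apply Hdf|apply HB]; lra. }
  assert (H2 := mean_value_ineq (fun u => f u - RtoC u * df e)%C (fun u => df u - df e)%C a b
    (B * (b - a)) ltac:(lra)).
  replace ((f b - f a) / RtoC (b - a) - df e)%C
    with ((f b - RtoC b * df e - (f a - RtoC a * df e)) / RtoC (b - a))%C.
  2:{ rewrite RtoC_minus in *. field. exact Hba. }
  rewrite Cmod_div by exact Hba. rewrite Cmod_R, Rabs_pos_eq by lra.
  apply Rmult_le_reg_r with (b - a); [lra|].
  unfold Rdiv. rewrite Rmult_assoc, Rinv_l, Rmult_1_r by lra.
  apply H2; [|exact H1].
  intros u Hu. apply pderiv_minus; [now apply Hf|].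
  apply (pderiv_val _ _ (1 * df e + RtoC u * 0)%C); [ring|].
  apply (pderiv_mult (fun v => RtoC v) (fun _ => df e)); [|apply pderiv_const].
  apply pderiv_RtoC. apply (is_derive_id (K := R_AbsRing)).
Qed.

(** Both slopes are compared with the derivative at the common node [b], each up to [B] times the
    length of its interval. *)
Lemma slope_diff (f df ddf : R -> C) (a b c B : R) :
  a < b < c ->
  (forall u, a <= u <= c -> pderiv f u (df u)) ->
  (forall u, a <= u <= c -> pderiv df u (ddf u)) ->
  (forall u, a <= u <= c -> Cmod (ddf u) <= B) ->
  Cmod ((f b - f c) / RtoC (c - b) - (f a - f b) / RtoC (b - a)) <= B * (c - a).
Proof.
  intros Habc Hf Hdf HB.
  assert (H1 := slope_near_deriv f df ddf a b b B ltac:(lra) ltac:(lra)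
    (fun u Hu => Hf u ltac:(lra)) (fun u Hu => Hdf u ltac:(lra)) (fun u Hu => HB u ltac:(lra))).
  assert (H2 := slope_near_deriv f df ddf b c b B ltac:(lra) ltac:(lra)
    (fun u Hu => Hf u ltac:(lra)) (fun u Hu => Hdf u ltac:(lra)) (fun u Hu => HB u ltac:(lra))).
  replace ((f b - f c) / RtoC (c - b) - (f a - f b) / RtoC (b - a))%C
    with (((f b - f a) / RtoC (b - a) - df b) - ((f c - f b) / RtoC (c - b) - df b))%C
    by (unfold Cdiv; ring).
  unfold Cminus at 1. eapply Rle_trans; [apply Cmod_triangle|]. rewrite Cmod_opp. lra.
Qed.

Lemma slope_bound (f df : R -> C) (a b B : R) :
  a < b -> (forall u, a <= u <= b -> pderiv f u (df u)) ->
  (forall u, a <= u <= b -> Cmod (df u) <= B) ->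
  Cmod ((f a - f b) / RtoC (b - a)) <= B.
Proof.
  intros Hab Hf HB.
  assert (Hba : RtoC (b - a) <> 0) by (apply RtoC_neq_0; lra).
  rewrite Cmod_div by exact Hba. rewrite Cmod_R, Rabs_pos_eq, Cmod_minus_sym by lra.
  apply Rmult_le_reg_r with (b - a); [lra|].
  unfold Rdiv. rewrite Rmult_assoc, Rinv_l, Rmult_1_r by lra.
  apply mean_value_ineq with df; auto; lra.
Qed.

(** * Double summation by parts against [log(N/n)] *)

(* From here on the index [k] of a sequence stands for the integer [k + 1]. *)
Definition lnS (k : nat) : R := ln (INR (S k)).

Lemma INR_S_ge1 (k : nat) : 1 <= INR (S k).
Proof. rewrite S_INR. assert (H := pos_INR k). lra. Qed.

Lemma lnS_0 : lnS 0 = 0.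
Proof. apply ln_1. Qed.

Lemma lnS_lt (k : nat) : lnS k < lnS (S k).
Proof.
  apply ln_increasing; [assert (H := INR_S_ge1 k); lra|]. rewrite (S_INR (S k)). lra.
Qed.

Lemma lnS_le (k n : nat) : (k <= n)%nat -> lnS k <= lnS n.
Proof.
  intros H. apply ln_le_le; [assert (H1 := INR_S_ge1 k); lra|]. apply le_INR. lia.
Qed.

Lemma lnS_pos (k : nat) : 0 <= lnS k.
Proof. rewrite <- lnS_0. apply lnS_le. lia. Qed.

Lemma exp_lnS (k : nat) : exp (lnS k) = INR (S k).
Proof. apply exp_ln. assert (H := INR_S_ge1 k). lra. Qed.

Lemma lnS_step (k : nat) : lnS (S k) - lnS k <= ln 2 /\ ln 2 <= 1.
Proof.
  assert (H1 := INR_S_ge1 k). split.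
  - unfold lnS. assert (H : ln (INR (S (S k))) <= ln 2 + ln (INR (S k))); [|lra].
    rewrite <- ln_mult by lra. apply ln_le_le; rewrite (S_INR (S k)); lra.
  - rewrite <- (ln_exp 1). apply ln_le_le; [lra|]. assert (H := exp_ineq1 1 ltac:(lra)). lra.
Qed.

Lemma lnS_gap2 (k : nat) : lnS (S (S k)) - lnS k <= 4 / INR (S (S k)).
Proof.
  assert (H1 := INR_S_ge1 k).
  assert (E : lnS (S (S k)) - lnS k = ln (1 + 2 / INR (S k))).
  { unfold lnS. rewrite <- ln_div by (try lra; rewrite (S_INR (S (S k))), (S_INR (S k)); lra).
    f_equal. rewrite (S_INR (S (S k))), (S_INR (S k)). field. lra. }
  rewrite E.
  assert (H2 : 0 < 2 / INR (S k)) by (apply Rdiv_lt_0_compat; lra).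
  apply Rle_trans with (2 / INR (S k)).
  - rewrite <- (ln_exp (2 / INR (S k))) at 2. apply ln_le_le; [lra|].
    left. apply exp_ineq1. lra.
  - rewrite (S_INR (S k)). apply Rmult_le_reg_r with (INR (S k) * (INR (S k) + 1)); [nra|].
    field_simplify; lra.
Qed.

(** An unnormalised Riesz mean with logarithmic weights; its last term has weight zero. *)
Definition riesz_sum (alpha : nat -> C) (n : nat) : C :=
  csum (fun k => alpha k * RtoC (lnS n - lnS k))%C n.

Lemma riesz_sum_0 (alpha : nat -> C) : riesz_sum alpha 0 = RtoC 0.
Proof. unfold riesz_sum. rewrite csum_0. replace (lnS 0 - lnS 0) with 0 by ring. to_C. ring. Qed.

(** Partial sums are thus difference quotients of the Riesz sums in the variable [log n], which is
    what a second summation by parts exploits. *)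
Lemma riesz_sum_S (alpha : nat -> C) (n : nat) :
  riesz_sum alpha (S n) = (riesz_sum alpha n + csum alpha n * RtoC (lnS (S n) - lnS n))%C.
Proof.
  unfold riesz_sum. rewrite csum_S. replace (lnS (S n) - lnS (S n)) with 0 by ring.
  rewrite (csum_ext _ (fun k => alpha k * RtoC (lnS n - lnS k) + RtoC (lnS (S n) - lnS n) * alpha k)%C).
  - rewrite csum_plus, csum_scal. to_C. ring.
  - intros k _. rewrite !RtoC_minus. ring.
Qed.

(** Minus a divided difference, taken at the nodes [lnS k] rather than at the integers; for smooth
    [p] in [log k] it is about minus the derivative. *)
Definition slope (p : nat -> C) (k : nat) : C :=
  ((p k - p (S k)) / RtoC (lnS (S k) - lnS k))%C.

(* At [k = 0], where [pred 0 = 0], the last summand vanishes. *)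
Lemma double_abel (alpha p : nat -> C) (n : nat) :
  csum (fun k => alpha k * p k)%C n =
  (csum alpha n * p n + riesz_sum alpha n * slope p n
   - csum (fun k => riesz_sum alpha k * (slope p k - slope p (pred k))) n)%C.
Proof.
  induction n as [|n IH].
  - rewrite !csum_0, riesz_sum_0. to_C. ring.
  - rewrite !csum_S, IH, riesz_sum_S. simpl pred.
    assert (E : (slope p n * RtoC (lnS (S n) - lnS n) = p n - p (S n))%C).
    { unfold slope. field. apply RtoC_neq_0. assert (H := lnS_lt n). lra. }
    set (A0 := csum alpha n) in *. set (R0 := riesz_sum alpha n) in *.
    set (S0 := csum _ n) in *. clearbody A0 R0 S0.
    set (d := RtoC (lnS (S n) - lnS n)) in *.
    replace (p n) with (slope p n * d + p (S n))%C by (rewrite E; ring).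
    clear E. to_C. ring.
Qed.

(** * Transfer from height [T] to the real point [1/2] *)

Definition mu_coef (s : C) (k : nat) : C := (muC (S k) * ncp (INR (S k)) s)%C.

Lemma riesz_mollifier (s : C) (k : nat) : (1 <= k)%nat ->
  riesz_sum (mu_coef s) k = (RtoC (lnS k) * mollifier (S k) s)%C.
Proof.
  intros Hk.
  assert (Hl : 0 < lnS k).
  { rewrite <- lnS_0. eapply Rlt_le_trans; [apply lnS_lt|now apply lnS_le]. }
  unfold mollifier, riesz_sum.
  rewrite <- (sum_n_m_S (G := C_AbelianMonoid)).
  change (sum_n_m (G := C_AbelianMonoid) ?f 0 k) with (csum f k).
  rewrite <- csum_scal. apply csum_ext. intros j _.
  unfold mu_coef, Cdiv. rewrite nat_cpow_inv. unfold lnS in *.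
  replace (ln (INR (S k)) - ln (INR (S j))) with (ln (INR (S k)) * (1 - ln (INR (S j)) / ln (INR (S k))))
    by (field; lra).
  rewrite RtoC_mult. ring.
Qed.

(** One smooth function of [u = log k] that both moves the coefficients from [1/2 + it] to [1/2] and
    supplies the Riesz weight. It vanishes at [u = X]. *)
Definition twist (t X u : R) : C := (Cexp (RtoC u * (Ci * RtoC t)) * RtoC (X - u))%C.

Lemma Cmod_Cexp_imag (u t : R) : Cmod (Cexp (RtoC u * (Ci * RtoC t))) = 1.
Proof.
  rewrite Cmod_Cexp, re_scal_l. replace (Re (Ci * RtoC t)) with 0.
  - rewrite Rmult_0_r. apply exp_0.
  - unfold Re, Ci, Cmult, RtoC; simpl; ring.
Qed.

Lemma mu_coef_twist (t X : R) (k : nat) :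
  (mu_coef (critical_point t) k * twist t X (lnS k) = mu_coef (critical_point 0) k * RtoC (X - lnS k))%C.
Proof.
  unfold mu_coef, twist.
  replace (ncp (INR (S k)) (critical_point 0))
    with (ncp (INR (S k)) (critical_point t) * Cexp (RtoC (lnS k) * (Ci * RtoC t)))%C; [ring|].
  unfold ncp. rewrite <- Cexp_plus. f_equal. unfold lnS.
  unfold critical_point, RtoC, Ci, Cplus, Cmult, Copp; simpl. f_equal; ring.
Qed.

Definition dtwist (t X u : R) : C :=
  (Cexp (RtoC u * (Ci * RtoC t)) * (Ci * RtoC t * RtoC (X - u) - 1))%C.
Definition ddtwist (t X u : R) : C :=
  (Cexp (RtoC u * (Ci * RtoC t)) * (Ci * RtoC t * (Ci * RtoC t * RtoC (X - u) - 2)))%C.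

Lemma pderiv_sub (X u : R) : pderiv (fun v => RtoC (X - v)) u (- (1))%C.
Proof.
  apply (pderiv_val _ _ (RtoC (-1))); [unfold RtoC, Copp; simpl; f_equal; ring|].
  apply pderiv_RtoC. auto_derive; [trivial|ring].
Qed.

Lemma pderiv_twist (t X u : R) : pderiv (twist t X) u (dtwist t X u).
Proof.
  unfold twist, dtwist.
  apply (pderiv_val _ _ (Ci * RtoC t * Cexp (RtoC u * (Ci * RtoC t)) * RtoC (X - u) +
    Cexp (RtoC u * (Ci * RtoC t)) * - (1))%C); [ring|].
  apply (pderiv_mult (fun v => Cexp (RtoC v * (Ci * RtoC t))%C) (fun v => RtoC (X - v)));
  [apply pderiv_Cexp_line|apply pderiv_sub].
Qed.

Lemma pderiv_dtwist (t X u : R) : pderiv (dtwist t X) u (ddtwist t X u).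
Proof.
  unfold dtwist, ddtwist.
  apply (pderiv_val _ _ (Ci * RtoC t * Cexp (RtoC u * (Ci * RtoC t)) * (Ci * RtoC t * RtoC (X - u) - 1) +
    Cexp (RtoC u * (Ci * RtoC t)) * ((0 * RtoC (X - u) + Ci * RtoC t * - (1)) - 0))%C); [ring|].
  apply (pderiv_mult (fun v => Cexp (RtoC v * (Ci * RtoC t))%C) (fun v => Ci * RtoC t * RtoC (X - v) - 1)%C);
  [apply pderiv_Cexp_line|].
  apply pderiv_minus; [|apply pderiv_const].
  apply (pderiv_mult (fun _ => Ci * RtoC t)%C (fun v => RtoC (X - v))); [apply pderiv_const|apply pderiv_sub].
Qed.

Lemma dtwist_bound (t X u : R) : 0 <= t -> Cmod (dtwist t X u) <= t * Rabs (X - u) + 1.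
Proof.
  intros Ht. unfold dtwist. rewrite Cmod_mult, Cmod_Cexp_imag, Rmult_1_l.
  unfold Cminus. eapply Rle_trans; [apply Cmod_triangle|].
  rewrite Cmod_opp, Cmod_1, !Cmod_mult, Cmod_Ci, !Cmod_R, (Rabs_pos_eq t) by lra. lra.
Qed.

Lemma ddtwist_bound (t X u : R) : 0 <= t -> Cmod (ddtwist t X u) <= t * (t * Rabs (X - u) + 2).
Proof.
  intros Ht. unfold ddtwist. rewrite Cmod_mult, Cmod_Cexp_imag, Rmult_1_l.
  rewrite !Cmod_mult, Cmod_Ci, Cmod_R, Rabs_pos_eq, Rmult_1_l by lra.
  apply Rmult_le_compat_l; [lra|].
  unfold Cminus. eapply Rle_trans; [apply Cmod_triangle|].
  rewrite Cmod_opp, !Cmod_mult, Cmod_Ci, !Cmod_R, (Rabs_pos_eq t), (Rabs_pos_eq 2) by lra. lra.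
Qed.

(** In [double_abel] the boundary term with the unweighted sum drops out, because [twist] vanishes
    at its end point. What remains are Riesz sums at height [t], weighted by first and second
    differences of [twist], of sizes [T] and [T^2 / k] up to a logarithm. *)
Lemma riesz_transfer (T t : R) (n : nat) :
  2 <= T -> T <= t <= 2 * T ->
  Cmod (riesz_sum (mu_coef (critical_point 0)) n) <=
  19 * T ^ 2 * (lnS n + 2) *
   (Cmod (riesz_sum (mu_coef (critical_point t)) n) +
    sum_n (fun k => / INR (S k) * Cmod (riesz_sum (mu_coef (critical_point t)) k)) n).
Proof.
  intros HT Ht.
  set (X := lnS n). assert (HX : 0 <= X) by apply lnS_pos.
  set (F := riesz_sum (mu_coef (critical_point t))).
  set (p := fun k => twist t X (lnS k)).
  assert (E : riesz_sum (mu_coef (critical_point 0)) n =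
    (F n * slope p n - csum (fun k => F k * (slope p k - slope p (pred k))) n)%C).
  { assert (H := double_abel (mu_coef (critical_point t)) p n). fold F in H.
    assert (Hp : p n = RtoC 0).
    { unfold p, twist, X. replace (lnS n - lnS n) with 0 by ring. ring. }
    rewrite Hp in H.
    unfold riesz_sum at 1. rewrite (csum_ext _ (fun k => mu_coef (critical_point t) k * p k)%C).
    - rewrite H. to_C. ring.
    - intros k _. unfold p. symmetry. apply mu_coef_twist. }
  rewrite E. unfold Cminus. eapply Rle_trans; [apply Cmod_triangle|].
  rewrite Cmod_opp, Cmod_mult.
  (* On the last interval [|X - u| <= 1], so the derivative is at most [2 T + 1]. *)
  assert (Hrn : Cmod (slope p n) <= 3 * T).
  { apply (slope_bound (twist t X) (dtwist t X)); [apply lnS_lt|intros u _; apply pderiv_twist|].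
    intros u Hu. eapply Rle_trans; [apply dtwist_bound; lra|].
    assert (H1 := lnS_step n). fold X in H1, Hu.
    rewrite Rabs_left1 by lra. nra. }
  assert (Hd : forall k, (k <= n)%nat ->
     Cmod (F k * (slope p k - slope p (pred k))) <=
     16 * T ^ 2 * (X + 2) * (/ INR (S k) * Cmod (F k))).
  { intros k Hk. rewrite Cmod_mult.
    assert (HF := Cmod_ge_0 (F k)).
    destruct k as [|k].
    - simpl pred. replace (slope p 0 - slope p 0)%C with (RtoC 0) by ring. rewrite Cmod_0.
      rewrite Rmult_0_r. apply Rmult_le_pos; [nra|].
      apply Rmult_le_pos; [|exact HF]. left; apply Rinv_0_lt_compat.
      assert (H := INR_S_ge1 0). lra.
    - simpl pred.
      assert (H1 := lnS_lt k). assert (H2 := lnS_lt (S k)).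
      assert (H3 := slope_diff (twist t X) (dtwist t X) (ddtwist t X) (lnS k) (lnS (S k)) (lnS (S (S k)))
        (4 * T ^ 2 * (X + 2)) ltac:(lra) (fun u _ => pderiv_twist t X u) (fun u _ => pderiv_dtwist t X u)).
      (* On the two adjacent intervals [u <= X + 1], so the second derivative is at most
         [4 T^2 (X + 2)]; their joint length is at most [4 / (k + 2)]. *)
      assert (H4 : Cmod (slope p (S k) - slope p k) <= 16 * T ^ 2 * (X + 2) * / INR (S (S k))).
      { eapply Rle_trans; [apply H3|].
        - intros u Hu. eapply Rle_trans; [apply ddtwist_bound; lra|].
          assert (H5 := lnS_step (S k)). assert (H6 := lnS_le (S k) n Hk). fold X in H6.
          assert (H7 := lnS_pos k).
          assert (H8 : Rabs (X - u) <= X + 1) by (apply Rabs_le; lra).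
          assert (H9 := Rabs_pos (X - u)).
          apply Rle_trans with (2 * T * (2 * T * (X + 1) + 2)); [|nra].
          apply Rmult_le_compat; nra.
        - assert (H5 := lnS_gap2 k).
          apply Rle_trans with (4 * T ^ 2 * (X + 2) * (4 / INR (S (S k)))).
          + apply Rmult_le_compat_l; [nra|exact H5].
          + unfold Rdiv. right; ring. }
      rewrite Rmult_comm, <- Rmult_assoc. apply Rmult_le_compat_r; [exact HF|exact H4]. }
  assert (Hs := csum_norm_le _ _ n Hd).
  assert (Hsc : sum_n (fun k => 16 * T ^ 2 * (X + 2) * (/ INR (S k) * Cmod (F k))) n =
     16 * T ^ 2 * (X + 2) * sum_n (fun k => / INR (S k) * Cmod (F k)) n).
  { apply (sum_n_mult_l (K := R_Ring)). }
  rewrite Hsc in Hs.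
  assert (Hpos : 0 <= sum_n (fun k => / INR (S k) * Cmod (F k)) n).
  { clear. induction n as [|n IH]; [rewrite sum_O|rewrite sum_Sn].
    - apply Rmult_le_pos; [|apply Cmod_ge_0]. left; apply Rinv_0_lt_compat.
      assert (H := INR_S_ge1 0). lra.
    - apply Rplus_le_le_0_compat; [exact IH|].
      apply Rmult_le_pos; [|apply Cmod_ge_0]. left; apply Rinv_0_lt_compat.
      assert (H := INR_S_ge1 (S n)). lra. }
  assert (HF := Cmod_ge_0 (F n)).
  assert (H1 : Cmod (F n) * Cmod (slope p n) <= 19 * T ^ 2 * (X + 2) * Cmod (F n)).
  { rewrite Rmult_comm. apply Rmult_le_compat_r; [exact HF|]. eapply Rle_trans; [exact Hrn|]. nra. }
  assert (H2 : 16 * T ^ 2 * (X + 2) * sum_n (fun k => / INR (S k) * Cmod (F k)) n <=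
    19 * T ^ 2 * (X + 2) * sum_n (fun k => / INR (S k) * Cmod (F k)) n).
  { apply Rmult_le_compat_r; [exact Hpos|]. nra. }
  rewrite Rmult_plus_distr_l. apply Rplus_le_compat; [exact H1|].
  eapply Rle_trans; [exact Hs|exact H2].
Qed.

(** * First moments against zeta and the bound for the Riesz sums at 1/2 *)

Lemma critical_point_neq_1 (t : R) : critical_point t <> RtoC 1.
Proof.
  intros E. apply (f_equal Re) in E. rewrite re_RtoC in E.
  unfold critical_point, Re in E; simpl in E. lra.
Qed.

Lemma zeta_critical (t : R) : zeta (critical_point t) = zeta_em (critical_point t).
Proof.
  apply zeta_eq_em; [apply critical_point_neq_1|]. unfold critical_point, Re; simpl; lra.
Qed.

Definition zeta_abs (t : R) : R := Cmod (zeta_em (critical_point t)).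

Definition riesz_abs (k : nat) (t : R) : R := Cmod (riesz_sum (mu_coef (critical_point t)) k).

Lemma continuous_zeta_abs (t : R) : continuous zeta_abs t.
Proof. apply continuous_Cmod, zeta_em_critical_ccont. Qed.

Lemma continuous_riesz_abs (k : nat) (t : R) : continuous (riesz_abs k) t.
Proof.
  apply (continuous_Cmod (fun t => riesz_sum (mu_coef (critical_point t)) k)).
  apply (pcont_critical (fun s => riesz_sum (mu_coef s) k)). apply holo_ccont.
  unfold riesz_sum, mu_coef.
  apply (csum_holo (fun j s => muC (S j) * ncp (INR (S j)) s * RtoC (lnS k - lnS j))%C).
  intros j. apply holo_mult; [|apply holo_const].
  apply (holo_mult (fun _ => muC (S j)) (ncp (INR (S j)))); [apply holo_const|apply holo_ncp].
Qed.

Lemma ex_RInt_cont (f : R -> R) (a b : R) : (forall t, continuous f t) -> ex_RInt f a b.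
Proof. intros H. apply (ex_RInt_continuous (V := R_CompleteNormedModule)). auto. Qed.

Lemma continuous_Rmult (f g : R -> R) (t : R) :
  continuous f t -> continuous g t -> continuous (fun u => f u * g u) t.
Proof. apply (continuous_mult (K := R_AbsRing)). Qed.

Lemma RInt_sum_n (u : nat -> R -> R) (a b : R) (n : nat) :
  (forall k t, continuous (u k) t) ->
  (forall t, continuous (fun t => sum_n (fun k => u k t) n) t) /\
  RInt (fun t => sum_n (fun k => u k t) n) a b = sum_n (fun k => RInt (u k) a b) n.
Proof.
  intros Hu. induction n as [|n [IH1 IH2]].
  - split.
    + intros t. apply (continuous_ext (u O)); [|apply Hu]. intros v. now rewrite sum_O.
    + rewrite sum_O. apply RInt_ext. intros t _. now rewrite sum_O.
  - assert (HE : forall t, sum_n (fun k => u k t) n + u (S n) t = sum_n (fun k => u k t) (S n))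
      by (intros t; now rewrite sum_Sn).
    split.
    + intros t. apply (continuous_ext (fun v => sum_n (fun k => u k v) n + u (S n) v)); [exact HE|].
      apply (continuous_plus (V := R_NormedModule) (fun v => sum_n (fun k => u k v) n)); auto.
    + rewrite sum_Sn, <- IH2.
      rewrite <- (RInt_plus (V := R_CompleteNormedModule) (fun t => sum_n (fun k => u k t) n) (u (S n)))
        by (apply ex_RInt_cont; auto).
      apply RInt_ext. intros t _. symmetry. apply HE.
Qed.

(** A first moment of the product suffices, as the transfer inequality is linear in the Riesz sums.
    The moment bound is asked for [k >= 1] only: at [k = 0] the Riesz sum is zero, and a mollifier
    of length 1 would divide by [log 1]. *)
Lemma first_moment_riesz (T K eps : R) (k : nat) :
  2 <= T -> 0 < eps -> 0 < K ->
  ((1 <= k)%nat -> mollified_moment (S k) T (2 * T) <= K * Rpower T (1 + eps)) ->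
  RInt (fun t => riesz_abs k t * zeta_abs t) T (2 * T) <= lnS k * ((1 + K) * Rpower T (1 + eps)).
Proof.
  intros HT Heps HK H.
  destruct k as [|k].
  - rewrite lnS_0, Rmult_0_l. rewrite (RInt_ext _ (fun _ => 0)).
    + rewrite RInt_const. change ((2 * T - T) * 0 <= 0). lra.
    + intros t _. unfold riesz_abs. rewrite riesz_sum_0, Cmod_0. apply Rmult_0_l.
  - specialize (H ltac:(lia)). unfold mollified_moment in H.
    set (g := fun t => (Cmod (mollifier (S (S k)) (critical_point t))) ^ 2 * (Cmod (zeta (critical_point t))) ^ 2) in *.
    set (L := lnS (S k)). assert (HL : 0 < L).
    { unfold L. rewrite <- lnS_0. eapply Rlt_le_trans; [apply (lnS_lt 0)|apply lnS_le; lia]. }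
    assert (Hm : forall t, Cmod (mollifier (S (S k)) (critical_point t)) = / L * riesz_abs (S k) t).
    { intros t. unfold riesz_abs. rewrite riesz_mollifier by lia. fold L.
      rewrite Cmod_mult, Cmod_R, Rabs_pos_eq by lra. field. lra. }
    assert (Hg : forall t, g t = / L * riesz_abs (S k) t * (/ L * riesz_abs (S k) t) * (zeta_abs t * zeta_abs t)).
    { intros t. unfold g. rewrite Hm, zeta_critical. fold (zeta_abs t). ring. }
    assert (Hgc : forall t, continuous g t).
    { intros t. apply (continuous_ext (fun t => / L * riesz_abs (S k) t * (/ L * riesz_abs (S k) t) * (zeta_abs t * zeta_abs t)));
      [intros v; symmetry; apply Hg|].
      apply continuous_Rmult; apply continuous_Rmult;
      try apply continuous_zeta_abs; apply continuous_Rmult;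
      try apply continuous_riesz_abs; apply continuous_const. }
    apply Rle_trans with (RInt (fun t => L * (1 + g t)) T (2 * T)).
    + apply RInt_le; [lra| | |].
      * apply ex_RInt_cont. intros t. apply continuous_Rmult; [apply continuous_riesz_abs|apply continuous_zeta_abs].
      * apply ex_RInt_cont. intros t. apply continuous_Rmult; [apply continuous_const|].
        apply (continuous_plus (V := R_NormedModule) (fun _ => 1) g); [apply continuous_const|apply Hgc].
      * (* AM-GM: [a z <= 1 + (a z)^2] *)
        intros t _. rewrite Hg. set (a := / L * riesz_abs (S k) t).
        replace (riesz_abs (S k) t) with (L * a) by (unfold a; field; lra).
        assert (Hsq := pow2_ge_0 (a * zeta_abs t - 1)). rewrite Rmult_assoc.
        apply Rmult_le_compat_l; [lra|]. assert (Hsq2 := pow2_ge_0 (a * zeta_abs t)). nra.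
    + assert (E : RInt (fun t => L * (1 + g t)) T (2 * T) = L * (T + RInt g T (2 * T))).
      { rewrite (RInt_scal (V := R_CompleteNormedModule) (fun t => 1 + g t)).
        - rewrite (RInt_plus (V := R_CompleteNormedModule) (fun _ => 1) g).
          + rewrite RInt_const. change (L * ((2 * T - T) * 1 + RInt g T (2 * T)) = L * (T + RInt g T (2 * T))).
            ring.
          + apply ex_RInt_cont. intros t. apply continuous_const.
          + now apply ex_RInt_cont.
        - apply ex_RInt_cont. intros t.
          apply (continuous_plus (V := R_NormedModule) (fun _ => 1) g); [apply continuous_const|apply Hgc]. }
      rewrite E. apply Rmult_le_compat_l; [lra|].
      assert (HTp : T <= Rpower T (1 + eps)).
      { rewrite <- (Rpower_1 T) at 1 by lra. apply Rle_Rpower; lra. }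
      lra.
Qed.

Lemma harmonic_le (n : nat) : sum_n (fun k => / INR (S k)) n <= 1 + lnS n.
Proof.
  induction n as [|n IH].
  - rewrite sum_O, lnS_0. simpl. lra.
  - rewrite sum_Sn.
    change (sum_n (fun k => / INR (S k)) n + / INR (S (S n)) <= 1 + lnS (S n)).
    assert (H1 := INR_S_ge1 n). assert (H2 := INR_S_ge1 (S n)).
    assert (H : lnS n - lnS (S n) <= - / INR (S (S n))).
    { unfold lnS. rewrite <- ln_div by lra.
      assert (H3 : INR (S n) / INR (S (S n)) = 1 + - / INR (S (S n))).
      { rewrite (S_INR (S n)). field. lra. }
      rewrite H3. rewrite <- (ln_exp (- / INR (S (S n)))) at 2.
      apply ln_le_le.
      - rewrite <- H3. apply Rdiv_lt_0_compat; lra.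
      - left. apply exp_ineq1. assert (H4 := Rinv_0_lt_compat (INR (S (S n))) ltac:(lra)). lra. }
    lra.
Qed.

(** The transfer inequality is multiplied by [zeta_abs t] and integrated over [t]; the left side
    then gains a factor of at least [T / 2], which doubles the constant 19. Of the three logarithms
    one comes from the transfer, one from passing from the mollifier to the Riesz sum, and one from
    the harmonic sum. *)
Lemma riesz_bound_at (T K eps : R) (n : nat) :
  100 ^ 4 <= T -> 0 < eps -> 0 < K ->
  (forall k, (1 <= k <= n)%nat -> mollified_moment (S k) T (2 * T) <= K * Rpower T (1 + eps)) ->
  riesz_abs n 0 <= 38 * (1 + K) * Rpower T (2 + eps) * (lnS n + 2) ^ 3.
Proof.
  intros HT Heps HK H.
  assert (H100 : 2 <= 100 ^ 4) by (simpl; lra).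
  assert (HT0 : 0 < T) by lra.
  (* The fourth root of [T], to which the lower bound for the mean of zeta applies. *)
  set (y := exp (ln T / 4)).
  assert (HyT : y ^ 4 = T).
  { unfold y. simpl. rewrite Rmult_1_r, <- !exp_plus.
    replace (ln T / 4 + (ln T / 4 + (ln T / 4 + ln T / 4))) with (ln T) by field. now apply exp_ln. }
  assert (Hy : 100 <= y).
  { apply Rnot_lt_le. intros Hy. assert (Hy0 : 0 < y) by apply exp_pos.
    assert (y ^ 4 < 100 ^ 4); [|lra].
    apply Rlt_trans with (y ^ 3 * 100).
    - replace (y ^ 4) with (y ^ 3 * y) by ring. apply Rmult_lt_compat_l; [apply pow_lt|]; lra.
    - replace (100 ^ 4) with (100 ^ 3 * 100) by ring. apply Rmult_lt_compat_r; [lra|].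
      assert (y ^ 2 < 100 ^ 2) by (simpl; nra). simpl. simpl in H0. nra. }
  assert (Hlow := zeta_em_first_moment y Hy). rewrite HyT in Hlow. fold zeta_abs in Hlow.
  set (X := lnS n) in *. assert (HX : 0 <= X) by apply lnS_pos.
  set (Q := (1 + K) * Rpower T (1 + eps)).
  assert (HQ : 0 < Q) by (apply Rmult_lt_0_compat; [lra|apply exp_pos]).
  assert (Hk : forall k, (k <= n)%nat -> RInt (fun t => riesz_abs k t * zeta_abs t) T (2 * T) <= X * Q).
  { intros k Hkn.
    apply Rle_trans with (lnS k * Q).
    - apply (first_moment_riesz T K eps k); [lra|exact Heps|exact HK|]. intros Hk1. apply H. lia.
    - apply Rmult_le_compat_r; [lra|]. now apply lnS_le. }
  set (c := 19 * T ^ 2 * (X + 2)). assert (Hc : 0 <= c) by (unfold c; nra).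
  set (u := fun k t => / INR (S k) * (riesz_abs k t * zeta_abs t)).
  assert (Hpc : forall k t, continuous (fun t => riesz_abs k t * zeta_abs t) t).
  { intros k t. apply continuous_Rmult; [apply continuous_riesz_abs|apply continuous_zeta_abs]. }
  assert (Huc : forall k t, continuous (u k) t).
  { intros k t. apply (continuous_Rmult (fun _ => / INR (S k))); [apply continuous_const|apply Hpc]. }
  destruct (RInt_sum_n u T (2 * T) n Huc) as [Hsc Hs].
  assert (Hmain : riesz_abs n 0 * RInt zeta_abs T (2 * T) <=
    c * (RInt (fun t => riesz_abs n t * zeta_abs t) T (2 * T)
        + RInt (fun t => sum_n (fun k => u k t) n) T (2 * T))).
  { assert (E1 : riesz_abs n 0 * RInt zeta_abs T (2 * T) = RInt (fun t => riesz_abs n 0 * zeta_abs t) T (2 * T)).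
    { symmetry. apply (RInt_scal (V := R_CompleteNormedModule)). apply ex_RInt_cont, continuous_zeta_abs. }
    assert (E2 : c * (RInt (fun t => riesz_abs n t * zeta_abs t) T (2 * T)
        + RInt (fun t => sum_n (fun k => u k t) n) T (2 * T)) =
      RInt (fun t => c * (riesz_abs n t * zeta_abs t + sum_n (fun k => u k t) n)) T (2 * T)).
    { rewrite (RInt_scal (V := R_CompleteNormedModule)
        (fun t => riesz_abs n t * zeta_abs t + sum_n (fun k => u k t) n)).
      - rewrite (RInt_plus (V := R_CompleteNormedModule)
          (fun t => riesz_abs n t * zeta_abs t) (fun t => sum_n (fun k => u k t) n)); [reflexivity| |];
        apply ex_RInt_cont; auto.
      - apply ex_RInt_cont. intros t.
        apply (continuous_plus (V := R_NormedModule) (fun t => riesz_abs n t * zeta_abs t)); auto. }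
    rewrite E1, E2. apply RInt_le; [lra| | |].
    - apply ex_RInt_cont. intros t.
      apply (continuous_Rmult (fun _ => riesz_abs n 0)); [apply continuous_const|apply continuous_zeta_abs].
    - apply ex_RInt_cont. intros t.
      apply (continuous_Rmult (fun _ => c)); [apply continuous_const|].
      apply (continuous_plus (V := R_NormedModule) (fun t => riesz_abs n t * zeta_abs t)); auto.
    - intros t Ht.
      assert (Htr := riesz_transfer T t n ltac:(lra) ltac:(lra)).
      fold (riesz_abs n 0) (riesz_abs n t) in Htr. fold X in Htr. fold c in Htr.
      assert (Hz : 0 <= zeta_abs t) by apply Cmod_ge_0.
      apply (Rmult_le_compat_r (zeta_abs t)) in Htr; [|exact Hz].
      eapply Rle_trans; [exact Htr|]. right.
      rewrite Rmult_assoc, Rmult_plus_distr_r. f_equal. f_equal.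
      rewrite Rmult_comm, <- (sum_n_mult_l (K := R_Ring)). apply sum_n_ext. intros k.
      unfold u, riesz_abs. change (zeta_abs t * (/ INR (S k) * Cmod (riesz_sum (mu_coef (critical_point t)) k)) =
        / INR (S k) * (Cmod (riesz_sum (mu_coef (critical_point t)) k) * zeta_abs t)). ring. }
  assert (Hs2 : RInt (fun t => sum_n (fun k => u k t) n) T (2 * T) <= X * Q * (1 + X)).
  { rewrite Hs. apply Rle_trans with (sum_n (fun k => X * Q * / INR (S k)) n).
    - assert (Hle : forall m, (m <= n)%nat -> sum_n (fun k => RInt (u k) T (2 * T)) m
        <= sum_n (fun k => X * Q * / INR (S k)) m).
      { induction m as [|m IH]; intros Hm.
        - rewrite !sum_O. unfold u. rewrite (RInt_scal (V := R_CompleteNormedModule)).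
          + change (/ INR 1 * RInt (fun t => riesz_abs 0 t * zeta_abs t) T (2 * T) <= X * Q * / INR 1).
            rewrite Rmult_comm. apply Rmult_le_compat_r; [simpl; lra|]. apply Hk. lia.
          + apply ex_RInt_cont. apply Hpc.
        - rewrite !sum_Sn. apply Rplus_le_compat; [apply IH; lia|].
          unfold u. rewrite (RInt_scal (V := R_CompleteNormedModule)).
          + change (/ INR (S (S m)) * RInt (fun t => riesz_abs (S m) t * zeta_abs t) T (2 * T) <= X * Q * / INR (S (S m))).
            rewrite Rmult_comm. apply Rmult_le_compat_r; [|apply Hk; lia].
            left. apply Rinv_0_lt_compat. assert (Hi := INR_S_ge1 (S m)). lra.
          + apply ex_RInt_cont. apply Hpc. }
      now apply Hle.
    - assert (E : sum_n (fun k => X * Q * / INR (S k)) n = X * Q * sum_n (fun k => / INR (S k)) n)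
        by apply (sum_n_mult_l (K := R_Ring)).
      rewrite E. apply Rmult_le_compat_l; [nra|]. apply harmonic_le. }
  assert (Hk1 := Hk n (Nat.le_refl n)).
  assert (HF : 0 <= riesz_abs n 0) by apply Cmod_ge_0.
  assert (Hfin : riesz_abs n 0 * (T / 2) <= c * (X * Q * (2 + X))).
  { eapply Rle_trans; [apply Rmult_le_compat_l; [exact HF|exact Hlow]|].
    eapply Rle_trans; [exact Hmain|]. apply Rmult_le_compat_l; [exact Hc|]. lra. }
  assert (HQT : T ^ 2 * Q = (1 + K) * Rpower T (2 + eps) * T).
  { unfold Q. replace (2 + eps) with (1 + (1 + eps)) by ring. rewrite (Rpower_plus 1 (1 + eps)), Rpower_1 by lra.
    ring. }
  assert (HR : 0 < (1 + K) * Rpower T (2 + eps)) by (apply Rmult_lt_0_compat; [lra|apply exp_pos]).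
  apply Rmult_le_reg_r with (T / 2); [lra|].
  eapply Rle_trans; [exact Hfin|].
  unfold c. replace (19 * T ^ 2 * (X + 2) * (X * Q * (2 + X))) with
    (19 * (T ^ 2 * Q) * ((X + 2) * X * (X + 2))) by ring.
  rewrite HQT.
  replace (38 * (1 + K) * Rpower T (2 + eps) * (X + 2) ^ 3 * (T / 2))
    with (19 * ((1 + K) * Rpower T (2 + eps) * T) * ((X + 2) * (X + 2) * (X + 2))) by field.
  apply Rmult_le_compat_l.
  - apply Rmult_le_pos; [lra|]. apply Rmult_le_pos; lra.
  - apply Rmult_le_compat_r; [lra|]. apply Rmult_le_compat_l; lra.
Qed.

(** This covers the small [n], for which the height attached to [n] is below the range of the lower
    bound for zeta. *)
Lemma riesz_abs_trivial (n : nat) : riesz_abs n 0 <= exp (2 * lnS n).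
Proof.
  unfold riesz_abs, riesz_sum.
  assert (HX := lnS_pos n).
  eapply Rle_trans; [apply (csum_norm_le _ (fun _ => lnS n))|].
  - intros k Hk. unfold mu_coef. rewrite !Cmod_mult, (Cmod_R (lnS n - lnS k)), Cmod_ncp.
    assert (H1 := muC_le1 (S k)). assert (H2 := lnS_le k n Hk). assert (H3 := lnS_pos k).
    rewrite Rabs_pos_eq by lra.
    assert (H4 : exp (- Re (critical_point 0) * ln (INR (S k))) <= 1).
    { rewrite <- exp_0. apply exp_le. unfold critical_point, Re; simpl fst. fold (lnS k). lra. }
    assert (H5 := exp_pos (- Re (critical_point 0) * ln (INR (S k)))).
    assert (H6 := Cmod_ge_0 (muC (S k))).
    apply Rle_trans with (1 * (lnS n - lnS k)); [|lra].
    apply Rmult_le_compat_r; [lra|]. nra.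
  - rewrite sum_n_const.
    replace (2 * lnS n) with (lnS n + lnS n) by ring. rewrite exp_plus, exp_lnS.
    apply Rmult_le_compat_l; [apply pos_INR|].
    rewrite <- exp_lnS. destruct HX as [HX|HX]; [left; assert (H := exp_ineq1 (lnS n) ltac:(lra)); lra|].
    rewrite <- HX. left; apply exp_pos.
Qed.

Theorem riesz_bound (theta delta : R) : 0 < theta -> moment_bound theta -> 2 / theta < delta ->
  exists K, 0 < K /\ forall n, riesz_abs n 0 <= K * exp (delta * lnS n).
Proof.
  intros Hth Hmb Hdelta.
  assert (H2 : 2 < delta * theta).
  { apply (Rmult_lt_compat_r theta) in Hdelta; [|exact Hth].
    unfold Rdiv in Hdelta. rewrite Rmult_assoc, Rinv_l in Hdelta by lra. lra. }
  assert (Hd0 : 0 < delta) by (assert (0 < 2 / theta) by (apply Rdiv_lt_0_compat; lra); lra).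
  (* Half of the available slack, so that [(2 + eps) / theta] is still less than [delta]; the
     remaining gap [rho] has to absorb the cube of the logarithm. *)
  set (eps := (delta * theta - 2) / 2). assert (Heps : 0 < eps) by (unfold eps; lra).
  destruct (Hmb eps Heps) as [K [HK HM]].
  set (rho := delta - (2 + eps) / theta).
  assert (Hrho : 0 < rho).
  { unfold rho, eps. replace (delta - (2 + (delta * theta - 2) / 2) / theta)
      with ((delta * theta - 2) / (2 * theta)) by (field; lra). apply Rdiv_lt_0_compat; lra. }
  (* From [y <= exp y] at [y = rho / 3 * (X + 2)], cubed. *)
  set (C3 := (3 / rho) ^ 3 * exp (2 * rho)).
  assert (HC3 : 0 < C3).
  { apply Rmult_lt_0_compat; [apply pow_lt, Rdiv_lt_0_compat; lra|apply exp_pos]. }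
  (* The trivial bound [exp (2 X)] in the range [X < 4 theta ln 100], where the height
     [exp (X / theta)] is below [100 ^ 4]. *)
  set (B := exp (8 * theta * ln 100)).
  assert (HB := exp_pos (8 * theta * ln 100)). fold B in HB.
  exists (B + 38 * (1 + K) * C3). split; [nra|]. intros n.
  set (X := lnS n). assert (HX : 0 <= X) by apply lnS_pos.
  assert (HeX : 1 <= exp (delta * X)) by (rewrite <- exp_0; apply exp_le; nra).
  assert (HP : 0 <= 38 * (1 + K) * C3) by nra.
  destruct (Rlt_or_le X (4 * theta * ln 100)) as [Hsmall|Hlarge].
  - apply Rle_trans with B.
    + eapply Rle_trans; [apply riesz_abs_trivial|]. fold X. apply exp_le. lra.
    + nra.
  (* Then [T^theta = n + 1]: the smallest height at which all mollifier lengths up to [n + 1] are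
     admissible. *)
  - set (T := exp (X / theta)).
    assert (HlT : ln T = X / theta) by apply ln_exp.
    assert (HT : 100 ^ 4 <= T).
    { unfold T. replace (100 ^ 4) with (exp (4 * ln 100)).
      - apply exp_le. apply Rmult_le_reg_r with theta; [lra|].
        replace (X / theta * theta) with X by (field; lra). lra.
      - replace (4 * ln 100) with (ln 100 + ln 100 + ln 100 + ln 100) by ring.
        rewrite !exp_plus, exp_ln by lra. ring. }
    assert (H100 : 2 <= 100 ^ 4) by (simpl; lra).
    assert (Hb := riesz_bound_at T K eps n HT Heps HK). fold X in Hb.
    eapply Rle_trans; [apply Hb|].
    + intros k Hk. apply HM; [lra| |].
      * apply (ssrbool.introT ssrnat.leP). lia.
      * unfold Rpower. rewrite HlT. replace (theta * (X / theta)) with X by (field; lra).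
        unfold X. rewrite exp_lnS. apply le_INR. lia.
    + assert (H3 : (X + 2) ^ 3 <= C3 * exp (rho * X)).
      { assert (Hle : rho / 3 * (X + 2) <= exp (rho / 3 * (X + 2))).
        { assert (H := exp_ineq1 (rho / 3 * (X + 2)) ltac:(nra)). lra. }
        assert (Hpos : 0 <= rho / 3 * (X + 2)) by nra.
        assert (Hp := pow_incr _ _ 3 (conj Hpos Hle)).
        replace (exp (rho / 3 * (X + 2)) ^ 3) with (exp (2 * rho) * exp (rho * X)) in Hp.
        2:{ simpl. rewrite Rmult_1_r, <- !exp_plus. f_equal. field. }
        rewrite Rpow_mult_distr in Hp.
        apply Rmult_le_reg_l with ((rho / 3) ^ 3); [apply pow_lt; lra|].
        eapply Rle_trans; [exact Hp|]. unfold C3. right. field. lra. }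
      assert (HTp : Rpower T (2 + eps) = exp ((2 + eps) / theta * X)).
      { unfold Rpower. rewrite HlT. f_equal. field. lra. }
      rewrite HTp.
      replace (exp (delta * X)) with (exp ((2 + eps) / theta * X) * exp (rho * X)).
      2:{ rewrite <- exp_plus. f_equal. unfold rho. field. lra. }
      assert (HE1 := exp_pos ((2 + eps) / theta * X)). assert (HE2 := exp_pos (rho * X)).
      set (E1 := exp ((2 + eps) / theta * X)) in *. set (E2 := exp (rho * X)) in *.
      apply Rle_trans with (38 * (1 + K) * E1 * (C3 * E2)).
      * apply Rmult_le_compat_l; [nra|exact H3].
      * assert (0 <= B * (E1 * E2)) by (apply Rmult_le_pos; nra). nra.
Qed.

(** * The zero-free half-plane *)

Lemma ncp_lnS (k : nat) (w : C) : ncp (INR (S k)) w = Cexp (RtoC (lnS k) * - w).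
Proof. unfold ncp, lnS. f_equal. ring. Qed.

Definition npow (w : C) (k : nat) : C := ncp (INR (S k)) w.

Lemma pderiv_Cexp_neg (w : C) (u : R) :
  pderiv (fun v => Cexp (RtoC v * - w)) u (- w * Cexp (RtoC u * - w))%C.
Proof. apply pderiv_Cexp_line. Qed.

Lemma pderiv_Cexp_neg2 (w : C) (u : R) :
  pderiv (fun v => - w * Cexp (RtoC v * - w))%C u (w * w * Cexp (RtoC u * - w))%C.
Proof.
  apply (pderiv_val _ _ (0 * Cexp (RtoC u * - w) + - w * (- w * Cexp (RtoC u * - w)))%C); [ring|].
  apply (pderiv_mult (fun _ => - w)%C (fun v => Cexp (RtoC v * - w))); [apply pderiv_const|].
  apply pderiv_Cexp_line.
Qed.

Lemma Cmod_Cexp_neg (w : C) (u : R) : Cmod (Cexp (RtoC u * - w)) = exp (- Re w * u).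
Proof. rewrite Cmod_Cexp, re_scal_l, re_opp. f_equal. ring. Qed.

Lemma slope_npow_bound (w : C) (k : nat) : 0 <= Re w ->
  Cmod (slope (npow w) k) <= Cmod w * exp (- Re w * lnS k).
Proof.
  intros Hw. unfold slope, npow. rewrite !ncp_lnS.
  apply (slope_bound (fun v => Cexp (RtoC v * - w)) (fun v => - w * Cexp (RtoC v * - w))%C);
  [apply lnS_lt|intros u _; apply pderiv_Cexp_neg|].
  intros u Hu. rewrite Cmod_mult, Cmod_opp, Cmod_Cexp_neg.
  apply Rmult_le_compat_l; [apply Cmod_ge_0|]. apply exp_le. nra.
Qed.

(** In [u = log k] the second derivative of the power is [w^2 exp (- w u)], largest at the left
    node; the factor [exp (Re w * ln 2)] moves this value to the middle node. *)
Lemma slope_npow_diff (w : C) (k : nat) : 0 <= Re w ->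
  Cmod (slope (npow w) (S k) - slope (npow w) k) <=
  Cmod w ^ 2 * exp (Re w * ln 2) * (4 * exp (- (Re w + 1) * lnS (S k))).
Proof.
  intros Hw. unfold slope, npow. rewrite !ncp_lnS.
  assert (H := slope_diff (fun v => Cexp (RtoC v * - w)) (fun v => - w * Cexp (RtoC v * - w))%C
    (fun u => w * w * Cexp (RtoC u * - w))%C (lnS k) (lnS (S k)) (lnS (S (S k)))
    (Cmod w ^ 2 * exp (- Re w * lnS k)) (conj (lnS_lt k) (lnS_lt (S k)))
    (fun u _ => pderiv_Cexp_neg w u) (fun u _ => pderiv_Cexp_neg2 w u)).
  eapply Rle_trans; [apply H|].
  - intros u Hu. rewrite !Cmod_mult, Cmod_Cexp_neg.
    replace (Cmod w * Cmod w) with (Cmod w ^ 2) by ring.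
    apply Rmult_le_compat_l; [apply pow2_ge_0|]. apply exp_le. nra.
  - assert (Hgap := lnS_gap2 k). destruct (lnS_step k) as [Hst _].
    assert (Hc := pow2_ge_0 (Cmod w)).
    assert (He : exp (- Re w * lnS k) <= exp (Re w * ln 2) * exp (- Re w * lnS (S k))).
    { rewrite <- exp_plus. apply exp_le. nra. }
    assert (Hi : / INR (S (S k)) = exp (- lnS (S k))) by (rewrite exp_Ropp, exp_lnS; reflexivity).
    unfold Rdiv in Hgap. rewrite Hi in Hgap.
    replace (exp (- (Re w + 1) * lnS (S k))) with (exp (- Re w * lnS (S k)) * exp (- lnS (S k)))
      by (rewrite <- exp_plus; f_equal; ring).
    assert (E1 := exp_pos (- Re w * lnS k)). assert (E2 := exp_pos (- lnS (S k))).
    assert (Hlt := lnS_lt k). assert (Hlt2 := lnS_lt (S k)).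
    apply Rle_trans with (Cmod w ^ 2 * (exp (Re w * ln 2) * exp (- Re w * lnS (S k))) * (4 * exp (- lnS (S k)))).
    + apply Rmult_le_compat; [nra|lra| |exact Hgap]. apply Rmult_le_compat_l; lra.
    + right; ring.
Qed.

(* These are the terms of a series for [- 1 / zeta (1/2 + w)]. *)
Definition inv_zeta_term (k : nat) (w : C) : C :=
  (riesz_sum (mu_coef (critical_point 0)) k * (slope (npow w) k - slope (npow w) (pred k)))%C.

(** The Riesz sum grows like [k^delta] and the second difference decays like [k^(- Re w - 1)], so
    the terms are [O(k^(-1-a))]. The parameters [a], [W], [S'] make the majorant uniform on a
    disc. *)
Lemma inv_zeta_term_bound (K delta a W S' : R) (w : C) (k : nat) :
  (forall n, riesz_abs n 0 <= K * exp (delta * lnS n)) -> 0 <= K -> 0 <= delta -> 0 < a ->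
  delta + a <= Re w <= S' -> Cmod w <= W ->
  let g := fun j => 4 * K * W ^ 2 * exp (S' * ln 2) * (exp ((a + 1) * ln 2) / a) * exp (- a * lnS j) in
  Cmod (inv_zeta_term k w) <= g k - g (S k).
Proof.
  intros HF HK Hd Ha Hw HW g.
  assert (HW0 : 0 <= W) by (assert (H := Cmod_ge_0 w); lra).
  assert (HWw : Cmod w ^ 2 <= W ^ 2) by (apply pow_incr; split; [apply Cmod_ge_0|exact HW]).
  assert (Hln2 : 0 < ln 2) by (assert (H := ln_lt_2); lra).
  assert (HS : exp (Re w * ln 2) <= exp (S' * ln 2)) by (apply exp_le; nra).
  assert (Htel := telescope_power a (INR (S k)) Ha (INR_S_ge1 k)).
  rewrite <- S_INR in Htel. fold (lnS k) (lnS (S k)) in Htel.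
  assert (Hc0 : 0 <= 4 * K * W ^ 2 * exp (S' * ln 2)).
  { repeat apply Rmult_le_pos; try lra. left; apply exp_pos. }
  assert (Hg : 4 * K * W ^ 2 * exp (S' * ln 2) * exp (- (a + 1) * lnS k) <= g k - g (S k)).
  { unfold g. apply (Rmult_le_compat_l _ _ _ Hc0) in Htel. lra. }
  assert (He := exp_pos (- (a + 1) * lnS k)).
  eapply Rle_trans; [|exact Hg].
  unfold inv_zeta_term. rewrite Cmod_mult.
  destruct k as [|k].
  - simpl pred. replace (slope (npow w) 0 - slope (npow w) 0)%C with (RtoC 0) by ring.
    rewrite Cmod_0, Rmult_0_r. apply Rmult_le_pos; lra.
  - simpl pred. assert (H1 := slope_npow_diff w k ltac:(lra)).
    assert (H2 := HF (S k)). unfold riesz_abs in H2.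
    apply Rle_trans with (K * exp (delta * lnS (S k)) *
      (W ^ 2 * exp (S' * ln 2) * (4 * exp (- (Re w + 1) * lnS (S k))))).
    + apply Rmult_le_compat; try apply Cmod_ge_0; [exact H2|].
      eapply Rle_trans; [exact H1|]. apply Rmult_le_compat_r.
      * assert (H3 := exp_pos (- (Re w + 1) * lnS (S k))). lra.
      * apply Rmult_le_compat; [apply pow2_ge_0|left; apply exp_pos|exact HWw|exact HS].
    + replace (K * exp (delta * lnS (S k)) * (W ^ 2 * exp (S' * ln 2) * (4 * exp (- (Re w + 1) * lnS (S k)))))
        with (4 * K * W ^ 2 * exp (S' * ln 2) * (exp (delta * lnS (S k)) * exp (- (Re w + 1) * lnS (S k)))) by ring.
      apply Rmult_le_compat_l; [exact Hc0|]. rewrite <- exp_plus. apply exp_le.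
      assert (H3 := lnS_pos (S k)). nra.
Qed.

Lemma is_lim_exp_neg_lnS (c a : R) : 0 < a -> is_lim_seq (fun n => c * exp (- a * lnS n)) 0.
Proof.
  intros Ha. replace (Finite 0) with (Rbar_mult c (Finite 0)) by (simpl; f_equal; ring).
  apply is_lim_seq_scal_l. now apply is_lim_exp_neg_ln.
Qed.

Lemma holo_inv_zeta_term (k : nat) (w : C) : holo (inv_zeta_term k) w.
Proof.
  unfold inv_zeta_term, slope, npow.
  assert (Hs : forall j, holo (fun w => (ncp (INR (S j)) w - ncp (INR (S (S j))) w) / RtoC (lnS (S j) - lnS j))%C w).
  { intros j. apply (holo_mult (fun w => ncp (INR (S j)) w - ncp (INR (S (S j))) w)%C
      (fun _ => / RtoC (lnS (S j) - lnS j))%C); [|apply holo_const].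
    apply holo_minus; apply holo_ncp. }
  apply (holo_mult (fun _ => riesz_sum (mu_coef (critical_point 0)) k)); [apply holo_const|].
  apply (holo_minus _ _ w (Hs k) (Hs (pred k))).
Qed.

(** The product of zeta with [G] is shown to be 1 far to the right, where [double_abel] can be let
    tend to its limit; by the identity theorem it is 1 throughout the half-plane in which [G]
    converges. The sign in [G] is that of the last sum in [double_abel]. *)
Theorem zeta_em_neq_0_of_riesz (K delta : R) : 0 < K -> 0 < delta ->
  (forall n, riesz_abs n 0 <= K * exp (delta * lnS n)) ->
  forall s, s <> RtoC 1 -> 1 / 2 + delta < Re s -> zeta_em s <> 0.
Proof.
  intros HK Hd HF s Hs1 Hs.
  set (G := fun w => (- cseries (fun k => inv_zeta_term k w))%C).
  set (half := RtoC (1 / 2)).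
  assert (Hhalf : forall z, Re (z - half)%C = Re z - 1 / 2).
  { intros z. unfold Cminus. rewrite re_plus, re_opp. unfold half. now rewrite re_RtoC. }
  assert (Hid : forall z : C, 1 / 2 + delta < Re z -> z <> RtoC 1 -> (G (z - half) * zeta_em z - 1)%C = RtoC 0).
  2:{ intros E. specialize (Hid s Hs Hs1). rewrite E in Hid.
      replace (G (s - half) * 0 - 1)%C with (- (1))%C in Hid by ring.
      apply (f_equal Re) in Hid. rewrite re_opp, !re_RtoC in Hid. lra. }
  (* Beyond [delta + 3] the shifted variable satisfies [Re w > delta + 2]: both boundary terms are
     then [O(1 / n)], even with trivial bounds for the partial sums, and [Re z > 2] admits the
     Moebius inversion. *)
  apply (identity_half_plane _ (1 / 2 + delta) (delta + 3)).
  - intros z Hz Hz1. apply (holo_minus (fun z : C => G (z - half) * zeta_em z)%C (fun _ => RtoC 1)); [|apply holo_const].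
    apply (holo_mult (fun z : C => G (z - half)%C) zeta_em).
    + apply (holo_comp G (fun z : C => z - half)%C); [|apply holo_minus; [apply holo_id|apply holo_const]].
      set (w0 := (z - half)%C). assert (Hw0 : delta < Re w0) by (unfold w0; rewrite Hhalf; lra).
      apply (holo_opp (fun w => cseries (fun k => inv_zeta_term k w))).
      set (a := (Re w0 - delta) / 2). assert (Ha : 0 < a) by (unfold a; lra).
      apply (holo_cseries inv_zeta_term w0 a
        (fun j => 4 * K * (Cmod w0 + a) ^ 2 * exp ((Re w0 + a) * ln 2) * (exp ((a + 1) * ln 2) / a) * exp (- a * lnS j))).
      * exact Ha.
      * now apply is_lim_exp_neg_lnS.
      * intros j w Hw. apply (inv_zeta_term_bound K delta a); auto; try lra.
        -- apply Re_near in Hw. unfold a in *. lra.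
        -- apply Cmod_near in Hw. lra.
      * intros j w _. apply holo_inv_zeta_term.
    + apply zeta_em_holo; [exact Hz1|lra].
  - intros z Hz. set (w := (z - half)%C).
    assert (Hw : delta + 2 < Re w) by (unfold w; rewrite Hhalf; lra).
    set (al := mu_coef (critical_point 0)).
    assert (Hprod : forall n, csum (fun k => al k * npow w k)%C n = csum (mu_coef z) n).
    { intros n. apply csum_ext. intros k _. unfold al, mu_coef, npow.
      replace (ncp (INR (S k)) z) with (ncp (INR (S k)) (critical_point 0) * ncp (INR (S k)) w)%C; [ring|].
      rewrite <- ncp_plus. f_equal. unfold w, half, critical_point.
      destruct z; unfold Cplus, Cminus, Copp, RtoC; simpl. f_equal; ring. }
    assert (HA : forall n, Cmod (csum al n) <= exp (lnS n)).
    { intros n. eapply Rle_trans; [apply (csum_norm_le _ (fun _ => 1))|].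
      - intros k _. unfold al, mu_coef. rewrite Cmod_mult, Cmod_ncp.
        assert (H1 := muC_le1 (S k)). assert (H3 := lnS_pos k).
        assert (H4 : exp (- Re (critical_point 0) * ln (INR (S k))) <= 1).
        { rewrite <- exp_0. apply exp_le. unfold critical_point, Re; simpl fst. fold (lnS k). lra. }
        assert (H5 := exp_pos (- Re (critical_point 0) * ln (INR (S k)))).
        assert (H6 := Cmod_ge_0 (muC (S k))). nra.
      - rewrite sum_n_const, exp_lnS. lra. }
    assert (Hser : is_cseries (fun k => inv_zeta_term k w) (cseries (fun k => inv_zeta_term k w))).
    { apply cseries_correct with
        (fun j => 4 * K * (Cmod w) ^ 2 * exp (Re w * ln 2) * (exp ((1 + 1) * ln 2) / 1) * exp (- (1) * lnS j)).
      - intros j. apply (inv_zeta_term_bound K delta 1); auto; lra.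
      - apply is_lim_exp_neg_lnS. lra. }
    assert (Hlim : forall eps, 0 < eps -> exists N, forall n, (N <= n)%nat ->
       Cmod (csum (mu_coef z) n - G w) < eps).
    { intros eps Heps.
      rewrite is_cseries_eps in Hser. destruct (Hser (eps / 2) ltac:(lra)) as [N1 HN1].
      assert (Hl := is_lim_exp_neg_lnS (1 + K * Cmod w) 1 ltac:(lra)). apply is_lim_seq_spec in Hl.
      destruct (Hl (mkposreal (eps / 2) ltac:(lra))) as [N2 HN2].
      exists (N1 + N2)%nat. intros n Hn.
      specialize (HN1 n ltac:(lia)). specialize (HN2 n ltac:(lia)). simpl in HN2.
      rewrite Rminus_0_r in HN2. apply Rabs_def2 in HN2.
      rewrite <- Hprod, double_abel.
      change (csum (fun k => riesz_sum al k * (slope (npow w) k - slope (npow w) (pred k)))%C n)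
        with (csum (fun k => inv_zeta_term k w) n).
      set (D := csum (fun k => inv_zeta_term k w) n) in *. unfold G.
      replace (csum al n * npow w n + riesz_sum al n * slope (npow w) n - D - - cseries (fun k => inv_zeta_term k w))%C
        with (csum al n * npow w n + riesz_sum al n * slope (npow w) n
          + - (D - cseries (fun k => inv_zeta_term k w)))%C by (to_C; ring).
      eapply Rle_lt_trans; [apply Cmod_triangle|]. rewrite Cmod_opp.
      assert (Hx := lnS_pos n).
      assert (H1 : Cmod (csum al n * npow w n) <= exp (- (1) * lnS n)).
      { rewrite Cmod_mult. unfold npow. rewrite Cmod_ncp. fold (lnS n).
        apply Rle_trans with (exp (lnS n) * exp (- Re w * lnS n)).
        - apply Rmult_le_compat_r; [left; apply exp_pos|apply HA].
        - rewrite <- exp_plus. apply exp_le. nra. }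
      assert (H2 : Cmod (riesz_sum al n * slope (npow w) n) <= K * Cmod w * exp (- (1) * lnS n)).
      { rewrite Cmod_mult. assert (H3 := HF n). unfold riesz_abs in H3. fold al in H3.
        assert (H4 := slope_npow_bound w n ltac:(lra)).
        apply Rle_trans with (K * exp (delta * lnS n) * (Cmod w * exp (- Re w * lnS n))).
        - apply Rmult_le_compat; try apply Cmod_ge_0; assumption.
        - replace (K * exp (delta * lnS n) * (Cmod w * exp (- Re w * lnS n)))
            with (K * Cmod w * (exp (delta * lnS n) * exp (- Re w * lnS n))) by ring.
          apply Rmult_le_compat_l.
          + apply Rmult_le_pos; [lra|apply Cmod_ge_0].
          + rewrite <- exp_plus. apply exp_le. nra. }
      assert (H5 := Cmod_triangle (csum al n * npow w n) (riesz_sum al n * slope (npow w) n)).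
      lra. }
    assert (Hz2 : 2 < Re z) by lra.
    apply Cmod_eq_0, Rle_antisym; [|apply Cmod_ge_0]. apply Rnot_lt_le. intros Hlt.
    set (eta := Cmod (G w * zeta_em z - 1)) in *.
    assert (Hz0 := Cmod_ge_0 (zeta_em z)).
    destruct (Hlim (eta / 2 / (1 + Cmod (zeta_em z)))) as [N1 HN1].
    { apply Rdiv_lt_0_compat; lra. }
    destruct (moebius_dirichlet_inverse z Hz2 (eta / 2) ltac:(lra)) as [N2 HN2].
    specialize (HN1 (N1 + N2)%nat ltac:(lia)). specialize (HN2 (N1 + N2)%nat ltac:(lia)).
    change (csum (fun n => muC (S n) * ncp (INR (S n)) z)%C (N1 + N2)) with (csum (mu_coef z) (N1 + N2)) in HN2.
    set (P := csum (mu_coef z) (N1 + N2)) in *.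
    assert (H1 : eta <= Cmod (P - G w) * Cmod (zeta_em z) + Cmod (P * zeta_em z - 1)).
    { unfold eta. replace (G w * zeta_em z - 1)%C with (- ((P - G w) * zeta_em z) + (P * zeta_em z - 1))%C by ring.
      eapply Rle_trans; [apply Cmod_triangle|]. rewrite Cmod_opp, Cmod_mult. lra. }
    assert (H2 : Cmod (P - G w) * Cmod (zeta_em z) <= eta / 2).
    { apply Rle_trans with (eta / 2 / (1 + Cmod (zeta_em z)) * (1 + Cmod (zeta_em z))).
      - apply Rmult_le_compat; try apply Cmod_ge_0; lra.
      - right. field. lra. }
    lra.
Qed.

Theorem zeta_zero_free (theta : R) : 0 < theta -> moment_bound theta ->
  forall s, s <> RtoC 1 -> 1 / 2 + 2 / theta < Re s -> zeta s <> RtoC 0.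
Proof.
  intros Hth Hmb s Hs1 Hs.
  assert (H2 : 0 < 2 / theta) by (apply Rdiv_lt_0_compat; lra).
  (* The midpoint between [2 / theta] and [Re s - 1 / 2], so that both strict inequalities required
     of [delta] hold. *)
  set (delta := (2 / theta + (Re s - 1 / 2)) / 2).
  destruct (riesz_bound theta delta Hth Hmb ltac:(unfold delta; lra)) as [K [HK HF]].
  rewrite zeta_eq_em by (auto; lra).
  apply (zeta_em_neq_0_of_riesz K delta); auto; unfold delta; lra.
Qed.

Lemma no_zero_right_of_critical_line (s : C) :
  (forall B : R, exists theta : R, B < theta /\ moment_bound theta) ->
  s <> RtoC 1 -> 1 / 2 < Re s -> zeta s <> RtoC 0.
Proof.
  (* The second bound amounts to [2 / theta < Re s - 1 / 2]; the first keeps [theta] positive. *)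
  intros H Hs1 Hs. destruct (H (Rmax 1 (2 / (Re s - 1 / 2)))) as [theta [Ht Hm]].
  assert (H1 := Rle_lt_trans _ _ _ (Rmax_l _ _) Ht). assert (H2 := Rle_lt_trans _ _ _ (Rmax_r _ _) Ht).
  apply (zeta_zero_free theta); [lra|exact Hm|exact Hs1|].
  apply (Rmult_lt_compat_r (Re s - 1 / 2)) in H2; [|lra].
  unfold Rdiv at 1 in H2. rewrite Rmult_assoc, Rinv_l, Rmult_1_r in H2 by lra.
  apply Rplus_lt_reg_l with (- (1 / 2)). apply Rmult_lt_reg_l with theta; [lra|].
  replace (theta * (- (1 / 2) + (1 / 2 + 2 / theta))) with 2 by (field; lra). lra.
Qed.

Theorem theorem2 :
  (forall theta : R, 0 < theta -> moment_bound theta ->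
     forall s : C, s <> RtoC 1 -> 1 / 2 + 2 / theta < Re s ->
       zeta s <> RtoC 0) /\
  ((forall B : R, exists theta : R, B < theta /\ moment_bound theta) ->
   riemann_hypothesis).
Proof.
  split; [exact zeta_zero_free|].
  intros H s Hs1 Hz Ht.
  destruct (Rtotal_order (Re s) (1 / 2)) as [Hs|[Hs|Hs]]; [|exact Hs|].
  - destruct (zeta_zero_reflection s Hs1 ltac:(lra) Hz Ht) as [H1 H2].
    elim (no_zero_right_of_critical_line (1 - s)%C H H1); [|exact H2].
    unfold Cminus. rewrite re_plus, re_opp, re_RtoC. lra.
  - now elim (no_zero_right_of_critical_line s H Hs1 Hs).
Qed.
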